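(* Let $Z$ be a compact 6-manifold with an $\mathrm{SU}(3)$-structure $(\omega,\Omega)$ satisfying $d^*\omega=0$ and $d\Omega=w_1\omega^2$ with $w_1\in\mathbb{C}$. Let $S\subset Z$ be finite, $P\to Z\setminus S$ a principal $G$-bundle, $A\in\mathcal{A}_\mu(P,\{P_s,A_s\})$ a conically singular connection, and define $\Omega^\ell_\mu(Z\setminus S,\mathfrak{g}_P)$ with respect to any set of framings $\{(\Upsilon_s,\tilde\Upsilon_s)\}_{s\in S}$ of $A$. Then for $a\in\Omega^1_\mu(Z\setminus S,\mathfrak{g}_P)$ the connection $A+a$ is a conically singular $\mathrm{SU}(3)$-instanton in Coulomb gauge relative to $A$ (that is, $\Lambda_\omega F_{A+a}=0$, $F_{A+a}\wedge\mathrm{Im}\,\Omega=0$ and $d_A^*a=0$) if and only if there are $\xi_1,\xi_2\in\Omega^0_\mu(Z\setminus S,\mathfrak{g}_P)$ such that $$\Lambda_\omega F_{A+a}=0,\qquad *(F_{A+a}\wedge\mathrm{Im}\,\Omega)+d_{A+a}\xi_1+J^*(d_{A+a}\xi_2)=0,\qquad d_A^*a=0.$$ Moreover, in the latter case the two sections satisfy $d_{A+a}\xi_1=d_{A+a}\xi_2=0$.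
   Context: On $\mathbb{C}^3\cong\mathbb{R}^6$ let $\omega_0=\frac i2\sum_j dz_j\wedge d\bar z_j$, $\Omega_0=dz_1\wedge dz_2\wedge dz_3$. An $\mathrm{SU}(3)$-structure on a 6-manifold $Z$ is a pair $(\omega,\Omega)\in\Omega^2(Z)\times\Omega^3(Z,\mathbb{C})$ such that for every $z\in Z$ there is a real-linear isomorphism $f:\mathbb{C}^3\to T_zZ$ with $f^*(\omega_z,\Omega_z)=(\omega_0,\Omega_0)$. It induces a metric $g$, an orientation and an almost complex structure $J$ with $\omega=g(J\cdot,\cdot)$; $*$ is the Hodge star, $\Lambda_\omega$ the adjoint of $\omega\wedge\cdot$, $(J^*\alpha)(X)=\alpha(JX)$. An $\mathrm{SU}(3)$-coordinate system centred at $z$ is a diffeomorphism $\Upsilon:B_R(0)\subset\mathbb{C}^3\to U\subset Z$ onto an open set with $\Upsilon(0)=z$, $(\Upsilon^*(\omega,\Omega))_0=(\omega_0,\Omega_0)$. $G$ is a compact Lie group whose Lie algebra carries an $\mathrm{Ad}$-invariant inner product; $\mathfrak{g}_P$ is the adjoint bundle. $\mathrm{pr}_{S^5}:\mathbb{C}^3\setminus\{0\}\to S^5$ is radial projection. Forms $\theta,\omega_1,\omega_2,\omega_3$ on $S^5$ are determined by $\omega_0=r\,dr\wedge\theta+r^2\omega_1$, $\Omega_0=r^2(dr+ir\theta)\wedge(\omega_2+i\omega_3)$. For each $s\in S$ we fix a rate $\mu_s\in(-1,0)$, a principal $G$-bundle $P_s\to S^5$ and a connection $A_s$ on $P_s$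 with $F_{A_s}\wedge\omega_j=0$, $j=1,2,3$. A connection $A$ on $P$ is conically singular, $A\in\mathcal{A}_\mu(P,\{P_s,A_s\})$, if for every $s\in S$ there are an $\mathrm{SU}(3)$-coordinate system $\Upsilon_s$ centred at $s$ and a bundle isomorphism $\tilde\Upsilon_s:\mathrm{pr}_{S^5}^*P_s\to P$ covering $\Upsilon_s$ (over the punctured ball) with $|\nabla^k_{\mathrm{pr}_{S^5}^*A_s}(\tilde\Upsilon_s^*A-\mathrm{pr}_{S^5}^*A_s)|=\mathcal{O}(r^{\mu_s-k})$ as $r\to0$ for all $k\in\mathbb{N}_0$. Such $\{(\Upsilon_s,\tilde\Upsilon_s)\}$ are called framings of $A$. $\Omega^\ell_\mu(Z\setminus S,\mathfrak{g}_P)$ is the space of smooth $\mathfrak{g}_P$-valued $\ell$-forms $\eta$ on $Z\setminus S$ with $|\nabla^k_{\mathrm{pr}_{S^5}^*A_s}(\tilde\Upsilon_s^*\eta)|=\mathcal{O}(r^{\mu_s-k})$ for all $k\in\mathbb{N}_0$ and $s\in S$ (norms and Levi-Civita connection of the flat metric on $\mathbb{C}^3$); it does not depend on the choice of framings of $A$. *)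

(* Defs.v *)
From HB Require Import structures.
From mathcomp Require Import all_boot all_order all_algebra all_fingroup.
From mathcomp Require Import all_classical all_reals all_analysis.
From mathcomp Require Import complex.
Import numFieldNormedType.Exports.
Set Implicit Arguments.
Unset Strict Implicit.
Unset Printing Implicit Defensive.
Import Order.TTheory GRing.Theory Num.Theory.
Local Open Scope classical_set_scope.
Local Open Scope ring_scope.

(* U is always open and E finite dimensional below, so that continuity of all
   iterated directional derivatives is the usual C^k. *)
Fixpoint Ck (R : realType) (E F : normedModType R) (k : nat) (U : set E)
    (f : E -> F) : Prop :=
  (forall x, U x -> {for x, continuous f}) /\
  match k with
  | 0 => True
  | k'.+1 => forall v : E,
      (forall x, U x -> derivable f x v) /\ Ck k' U ('D_v f)
  end.

Definition smooth_on (R : realType) (E F : normedModType R) (U : set E)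
  (f : E -> F) : Prop := forall k, Ck k U f.

Definition kform (k : nat) (E V : Type) := ('I_k -> E) -> V.

Section Forms.
Context {R : realType} {n : nat}.
Local Notation E := 'rV[R]_n.

Definition is_form (V : lmodType R) k (al : kform k E V) : Prop :=
  (forall (v : 'I_k -> E) (i : 'I_k) (a : R) (u w : E),
     al [eta v with i |-> a *: u + w] =
     a *: al [eta v with i |-> u] + al [eta v with i |-> w]) /\
  (forall (v : 'I_k -> E) (i j : 'I_k), i != j -> v i = v j -> al v = 0).

(* Normalized so that (al /\ be)(u, v) = al(u) be(v) - al(v) be(u) in degrees
   1, 1; op multiplies the values. *)
Definition wedgef (V1 V2 : Type) (V3 : lmodType R) (op : V1 -> V2 -> V3) k l
    (al : kform k E V1) (be : kform l E V2) : kform (k + l) E V3 := fun v =>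
  ((k`! * l`!)%:R : R)^-1 *: \sum_(s : 'S_(k + l)) ((-1) ^+ s : R) *:
    op (al (fun i => v (s (lshift l i)))) (be (fun j => v (s (rshift k j)))).

Definition dext (V : normedModType R) l (al : E -> kform l E V) :
    E -> kform l.+1 E V := fun x v =>
  \sum_(i < l.+1) ((-1) ^+ i : R) *:
    'D_(v i) (fun y => al y (fun j => v (lift i j))) x.

Definition evec (i : 'I_n) : E := delta_mx 0 i.

Definition dotv (x y : E) : R := \sum_(i < n) x 0 i * y 0 i.
(* The Euclidean norm; the library norm of 'rV[R]_n is the sup norm. *)
Definition enorm (x : E) : R := Num.sqrt (dotv x x).
Definition radproj (x : E) : E := (enorm x)^-1 *: x.

End Forms.

Definition pullf (R : realType) (n p : nat) (V : Type) k
    (f : 'rV[R]_n -> 'rV[R]_p) (al : 'rV[R]_p -> kform k 'rV[R]_p V) :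
    'rV[R]_n -> kform k 'rV[R]_n V := fun x v =>
  al (f x) (fun i => 'D_(v i) f x).

Section Star.
Context {R : realType} {k l : nat}.
Local Notation E := 'rV[R]_(k + l).

Definition cat_vec (u : 'I_k -> E) (v : 'I_l -> E) : 'I_(k + l) -> E :=
  fun a => match fintype.split a with inl i => u i | inr j => v j end.

(* Hodge star of the standard metric and orientation of R^(k+l): contraction of
   al with the first k slots of the volume form. *)
Definition star0 (V : lmodType R) (al : kform k E V) : kform l E V := fun v =>
  (k`!%:R : R)^-1 *: \sum_(I : {ffun 'I_k -> 'I_(k + l)})
    \det (\matrix_(a, b) cat_vec (fun i => evec (I i)) v a 0 b) *:
    al (fun i => evec (I i)).

(* Hodge star of the metric and orientation transported by the linear
   isomorphism f, which acts as v |-> v *m f. *)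
Definition starf (f : 'M[R]_(k + l)) (V : lmodType R) (al : kform k E V) :
    kform l E V := fun v =>
  star0 (fun w => al (fun i => w i *m f)) (fun j => v j *m invmx f).

End Star.

Section Manifolds.
Context {R : realType}.

Record chart (n : nat) (T : Type) := Chart {
  cdom : set 'rV[R]_n;
  cpar : 'rV[R]_n -> T;
  ccoo : T -> 'rV[R]_n }.

Section OneManifold.
Context {n : nat} {T : Type}.
Implicit Types (c d : chart n T) (A : set (chart n T)).

Definition cimg c : set T := cpar c @` cdom c.
Definition overlap c d : set 'rV[R]_n :=
  [set x | cdom c x /\ cimg d (cpar c x)].
Definition ctrans c d : 'rV[R]_n -> 'rV[R]_n := fun x => ccoo d (cpar c x).

Definition compatible c d : Prop :=
  open (overlap c d) /\ smooth_on (overlap c d) (ctrans c d).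

(* The charts of the maximal atlas generated by A on the union of its images. *)
Definition admissible A c : Prop :=
  [/\ open (cdom c),
      forall x, cdom c x -> ccoo c (cpar c x) = x,
      cimg c `<=` \bigcup_(d in A) cimg d &
      forall d, A d -> compatible c d /\ compatible d c].

Definition is_atlas A : Prop := forall c, A c -> admissible A c.

Definition smooth_to A (E : normedModType R) (U : set E) (f : E -> T) : Prop :=
  forall c, A c -> open (U `&` f @^-1` cimg c) /\
    smooth_on (U `&` f @^-1` cimg c) (fun x => ccoo c (f x)).

(* A differential form is given by its expressions in all charts of the maximal
   atlas; the values outside of the domains are irrelevant. *)
Definition is_dform A (V : normedModType R) k
    (al : chart n T -> 'rV[R]_n -> kform k 'rV[R]_n V) : Prop :=
  [/\ forall c x, admissible A c -> cdom c x -> is_form (al c x),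
      forall c v, admissible A c -> smooth_on (cdom c) (fun x => al c x v) &
      forall c d x v, admissible A c -> admissible A d -> overlap c d x ->
        al c x v = pullf (ctrans c d) (al d) x v].

End OneManifold.

Definition is_manifold n (T : topologicalType) (A : set (chart n T)) : Prop :=
  [/\ is_atlas A, \bigcup_(c in A) cimg c = setT,
      (forall U : set T,
         open U <-> forall c, A c -> open (cdom c `&` cpar c @^-1` U)),
      hausdorff_space T & @second_countable T].

End Manifolds.
Arguments chart : clear implicits.

(* Stereographic projection of S^5 from the pole (0, ..., 0, e), e = 1 or -1. *)
Definition stereo (R : realType) (e : R) : chart R 5 'rV[R]_6 := {|
  cdom := setT;
  cpar := fun u : 'rV[R]_5 => row_mx ((2 / (dotv u u + 1)) *: u)
            (const_mx (e * (dotv u u - 1) / (dotv u u + 1)) : 'rV[R]_1);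
  ccoo := fun x : 'rV[R]_(5 + 1) => (1 - e * x 0 ord_max)^-1 *: lsubmx x |}.

Definition S5_atlas (R : realType) : set (chart R 5 'rV[R]_6) :=
  [set stereo 1; stereo (-1)].
Definition S5 (R : realType) : set 'rV[R]_6 := [set x | enorm x = 1].
Arguments S5_atlas : clear implicits.
Arguments S5 : clear implicits.

Record lieGroup (R : realType) (m : nat) := LieGroup {
  lg :> topologicalType;
  lmul : lg -> lg -> lg;
  lone : lg;
  linv : lg -> lg;
  latlas : set (chart R m lg);
  lchart : chart R m lg;
  lg_manifold : is_manifold latlas;
  lg_chart : latlas lchart /\ cimg lchart lone;
  lmulA : associative lmul;
  lmul1 : left_id lone lmul;
  lmulV : left_inverse lone linv lmul;
  lmul_smooth : forall c d, latlas c -> latlas d ->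
    smooth_to latlas ([set z | cdom c z.1 /\ cdom d z.2] :
                        set ('rV[R]_m * 'rV[R]_m)%type)
      (fun z => lmul (cpar c z.1) (cpar d z.2));
  linv_smooth : forall c, latlas c ->
    smooth_to latlas (cdom c) (fun x => linv (cpar c x)) }.

Arguments latlas {R m} l _.
Arguments lchart {R m} l.
Arguments lone {R m} l.

Section LieAlgebra.
Context {R : realType} {m : nat} (G : lieGroup R m).

(* The Lie algebra T_1 G is identified with R^m by the chart lchart around 1. *)
Definition lie (_ : lieGroup R m) := 'rV[R]_m.
Local Notation g := (lie G).
Let e := lchart G.
Let u1 := ccoo e (lone G).

Definition Ad (h : G) (X : g) : g :=
  'D_X (fun u => ccoo e (lmul (lmul h (cpar e u)) (linv h))) u1.

(* ad_X Y, the derivative of Ad; it is the bracket of left-invariant fields. *)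
Definition brk (X Y : g) : g := 'D_X (fun u => Ad (cpar e u) Y) u1.

(* The pullback h^{-1} dh of the left Maurer-Cartan form. *)
Definition mc n (h : 'rV[R]_n -> G) (x v : 'rV[R]_n) : g :=
  'D_v (fun y => ccoo e (lmul (linv (h x)) (h y))) x.

Definition Ad_inner_product (ip : g -> g -> R) : Prop :=
  [/\ forall a X X' Y, ip (a *: X + X') Y = a * ip X Y + ip X' Y,
      forall X Y, ip X Y = ip Y X,
      forall X, X != 0 -> 0 < ip X X &
      forall h X Y, ip (Ad h X) (Ad h Y) = ip X Y].

End LieAlgebra.
Arguments brk {R m} G X Y.

(* A gauge is a local section along a chart: gsec x lies over cpar gch x. *)
Record gauge (R : realType) (n : nat) (T P : Type) := Gauge {
  gch : chart R n T;
  gsec : 'rV[R]_n -> P }.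

Section GaugeTransition.
Context {R : realType} {n m : nat} {T P : Type} (G : lieGroup R m).
Variable act : P -> G -> P.

Definition pdiv (p q : P) : G := xget (lone G) [set g | q = act p g].

(* gsec b' x = gsec b (ctrans (gch b') (gch b) x) . gtrans b b' x *)
Definition gtrans (b b' : gauge R n T P) (x : 'rV[R]_n) : G :=
  pdiv (gsec b (ctrans (gch b') (gch b) x)) (gsec b' x).

Definition gcompatible (b b' : gauge R n T P) : Prop :=
  smooth_to (latlas G) (overlap (gch b') (gch b)) (gtrans b b').

End GaugeTransition.

(* Principal G-bundles over the open part X of the manifold T with atlas A; the
   smooth structure of the total space is given by an atlas of local sections
   with smooth transition functions. *)
Record pbundle (R : realType) (m : nat) (G : lieGroup R m) (n : nat) (T : Type)
    (A : set (chart R n T)) (X : set T) := PBundle {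
  ptot :> Type;
  pproj : ptot -> T;
  pact : ptot -> G -> ptot;
  pgauges : set (gauge R n T ptot);
  pproj_in : forall p, X (pproj p);
  pact1 : forall p, pact p (lone G) = p;
  pactM : forall p g h, pact (pact p g) h = pact p (lmul g h);
  pproj_act : forall p g, pproj (pact p g) = pproj p;
  pact_free : forall p g, pact p g = p -> g = lone G;
  pact_trans : forall p q, pproj p = pproj q -> exists g, q = pact p g;
  pgauges_cover : X `<=` \bigcup_(b in pgauges) cimg (gch b);
  pgauges_adm : forall b, pgauges b -> admissible A (gch b);
  pgauges_sec : forall b x, pgauges b -> cdom (gch b) x ->
    pproj (gsec b x) = cpar (gch b) x;
  pgauges_smooth : forall b b', pgauges b -> pgauges b' ->
    gcompatible pact b b' }.

Arguments pgauges {R m G n T A X} _ _.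
Arguments pact {R m G n T A X} _ _ _.

Section Bundles.
Context {R : realType} {m : nat} {G : lieGroup R m} {n : nat} {T : Type}.
Context {A : set (chart R n T)} {X : set T} (P : pbundle G A X).
Local Notation E := 'rV[R]_n.
Local Notation g := (lie G).

(* All smooth local sections along charts of the maximal atlas; their images lie
   in X by pproj_in. *)
Definition adm_gauge (b : gauge R n T P) : Prop :=
  [/\ admissible A (gch b),
      forall x, cdom (gch b) x -> pproj (gsec b x) = cpar (gch b) x &
      forall b', pgauges P b' ->
        gcompatible (pact P) b' b /\
        gcompatible (pact P) b b'].

(* Local expressions, in all smooth gauges, of a connection or of a form with
   values in the adjoint bundle. *)
Definition gfield (l : nat) := gauge R n T P -> E -> kform l E g.

Definition smooth_gfield l (eta : gfield l) : Prop :=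
  forall b, adm_gauge b ->
    (forall x, cdom (gch b) x -> is_form (eta b x)) /\
    (forall v, smooth_on (cdom (gch b)) (fun x => eta b x v)).

Definition adform l (eta : gfield l) : Prop :=
  smooth_gfield eta /\
  forall b b' x v, adm_gauge b -> adm_gauge b' ->
    overlap (gch b') (gch b) x ->
    eta b' x v = Ad (linv (gtrans (pact P) b b' x))
                    (pullf (ctrans (gch b') (gch b)) (eta b) x v).

Definition connection (B : gfield 1) : Prop :=
  smooth_gfield B /\
  forall b b' x v, adm_gauge b -> adm_gauge b' ->
    overlap (gch b') (gch b) x ->
    let h := gtrans (pact P) b b' in
    B b' x v = Ad (linv (h x)) (pullf (ctrans (gch b') (gch b)) (B b) x v)
               + mc h x (v ord0).

Definition addg l (B eta : gfield l) : gfield l := fun b x v =>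
  B b x v + eta b x v.

Definition curv (B : gfield 1) : gfield 2 := fun b x v =>
  dext (B b) x v + (2^-1 : R) *: wedgef (brk G) (B b x) (B b x) v.

Definition dcov (B : gfield 1) l (eta : gfield l) : gfield l.+1 := fun b x v =>
  dext (eta b) x v + wedgef (brk G) (B b x) (eta b x) v.

End Bundles.

(* The wedge product of a g-valued and a real-valued form. *)
Definition wedger (R : realType) (n : nat) (V : lmodType R) k l
    (al : kform k 'rV[R]_n V) (be : kform l 'rV[R]_n R) :
    kform (k + l) 'rV[R]_n V :=
  wedgef (fun (y : V) (r : R) => r *: y) al be.

Section SU3.
Context {R : realType}.
Local Notation E := 'rV[R]_6.

(* C^3 = R^6 with real coordinates (x_1, y_1, x_2, y_2, x_3, y_3). *)
Definition xco (j : 'I_3) (v : E) : R := v 0 (inord j.*2).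
Definition yco (j : 'I_3) (v : E) : R := v 0 (inord j.*2.+1).
Definition zco (j : 'I_3) (v : E) : R[i] := Complex (xco j v) (yco j v).

(* i/2 sum_j dz_j /\ d zbar_j = sum_j dx_j /\ dy_j *)
Definition omega0 : kform 2 E R := fun v =>
  \sum_(j < 3) (xco j (v ord0) * yco j (v ord_max)
                - xco j (v ord_max) * yco j (v ord0)).

Definition Omega0 : kform 3 E (Rcomplex R) := fun v =>
  \det (\matrix_(i < 3, j < 3) zco j (v i)).

(* Multiplication by the imaginary unit. *)
Definition J0 (v : E) : E :=
  \row_(k < 6) (if odd k then v 0 (inord k.-1) else - v 0 (inord k.+1)).

Definition reform (n k : nat) (al : 'rV[R]_n -> kform k 'rV[R]_n (Rcomplex R)) :
  'rV[R]_n -> kform k 'rV[R]_n R := fun x v => complex.Re (al x v).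
Definition imform (n k : nat) (al : 'rV[R]_n -> kform k 'rV[R]_n (Rcomplex R)) :
  'rV[R]_n -> kform k 'rV[R]_n R := fun x v => complex.Im (al x v).

Record su3 (Z : Type) := Su3 {
  om : chart R 6 Z -> E -> kform 2 E R;
  Om : chart R 6 Z -> E -> kform 3 E (Rcomplex R) }.

Section Structure.
Context {Z : Type} (sg : su3 Z).
Implicit Type c : chart R 6 Z.

Definition su3_frame c (x : E) (f : 'M[R]_6) : Prop :=
  [/\ f \in unitmx,
      forall v, om sg c x (fun i => v i *m f) = omega0 v &
      forall v, Om sg c x (fun i => v i *m f) = Omega0 v].

Definition su3_structure (A : set (chart R 6 Z)) : Prop :=
  [/\ is_dform A (om sg),
      is_dform A (fun c => reform (Om sg c)),
      is_dform A (fun c => imform (Om sg c)) &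
      forall c x, admissible A c -> cdom c x -> exists f, su3_frame c x f].

(* The metric, the orientation and J are those transported by an SU(3)-frame;
   two frames differ by an element of SU(3), so the choice is irrelevant. *)
Definition frame c (x : E) : 'M[R]_6 := xget 1%:M [set f | su3_frame c x f].

Definition Jx c (x : E) (v : E) : E :=
  J0 (v *m invmx (frame c x)) *m frame c x.

(* On 2-forms, the adjoint of (omega /\ .) : Omega^0 -> Omega^2 is the pointwise
   inner product <omega, .>, computed here in an orthonormal basis. *)
Definition Lambda (V : lmodType R) c (x : E) (al : kform 2 E V) : V :=
  (2`!%:R : R)^-1 *: \sum_(I : {ffun 'I_2 -> 'I_6})
    om sg c x (fun i => evec (I i) *m frame c x) *:
    al (fun i => evec (I i) *m frame c x).

(* In even dimension d^* = - * d * in all degrees. *)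
Definition codiff2 c (al : E -> kform 2 E R) : E -> kform 1 E R := fun x v =>
  - starf (k := 5) (l := 1) (frame c x)
      (dext (fun y => starf (k := 2) (l := 4) (frame c y) (al y)) x) v.

End Structure.
End SU3.
Arguments su3 : clear implicits.

Section Instantons.
Context {R : realType} {m : nat} {G : lieGroup R m} {Z : Type}.
Context {A : set (chart R 6 Z)} {X : set Z} (P : pbundle G A X).
Variable sg : su3 R Z.
Local Notation E := 'rV[R]_6.
Local Notation g := (lie G).

Definition Lambda_curv (B : gfield P 1) (b : gauge R 6 Z P) (x : E) : g :=
  Lambda sg (gch b) x (curv B b x).

Definition curv_ImOm (B : gfield P 1) : gfield P 5 := fun b x =>
  wedger (curv B b x) (imform (Om sg (gch b)) x).

Definition star_curv_ImOm (B : gfield P 1) : gfield P 1 := fun b x =>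
  starf (k := 5) (l := 1) (frame sg (gch b) x) (curv_ImOm B b x).

Definition Jpull (al : gfield P 1) : gfield P 1 := fun b x v =>
  al b x (fun i => Jx sg (gch b) x (v i)).

(* d_B^* = - * d_B * on g_P-valued 1-forms *)
Definition codcov (B : gfield P 1) (al : gfield P 1) : gfield P 0 :=
  fun b x v =>
  - starf (k := 6) (l := 0) (frame sg (gch b) x)
      (dcov B (fun b' y => starf (k := 1) (l := 5) (frame sg (gch b') y)
                             (al b' y)) b x) v.

Definition gzero l (eta : gfield P l) : Prop :=
  forall b x v, adm_gauge b -> cdom (gch b) x -> eta b x v = 0.

Definition Lambda_flat (B : gfield P 1) : Prop :=
  forall b x, adm_gauge b -> cdom (gch b) x -> Lambda_curv B b x = 0.

Definition su3_instanton (B : gfield P 1) : Prop :=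
  Lambda_flat B /\ gzero (curv_ImOm B).

End Instantons.

Section SphereForms.
Context {R : realType}.
Local Notation E := 'rV[R]_6.

Definition S5form (k : nat) :=
  chart R 5 'rV[R]_6 -> 'rV[R]_5 -> kform k 'rV[R]_5 R.

(* The pullback of a form on S^5 under radial projection. *)
Definition pr_S5 k (al : S5form k) (c : chart R 5 'rV[R]_6) :
    E -> kform k E R :=
  pullf (fun x => ccoo c (radproj x)) (al c).

Definition S5_forms (theta : S5form 1) (om1 om2 om3 : S5form 2) : Prop :=
  [/\ is_dform (S5_atlas R) theta, is_dform (S5_atlas R) om1,
      is_dform (S5_atlas R) om2, is_dform (S5_atlas R) om3 &
  forall c (x : E), admissible (S5_atlas R) c -> x != 0 ->
    cimg c (radproj x) ->
    let r := enorm x in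
    let dr : kform 1 E R := fun v => 'D_(v ord0) (@enorm R 6) x in
    let th := pr_S5 theta c x in
    (forall v, omega0 v = r * wedgef (V3 := R) *%R dr th v
                          + r ^+ 2 * pr_S5 om1 c x v) /\
    (forall v, Omega0 v = (r ^+ 2 : R) *:
       wedgef (V3 := Rcomplex R) (fun y z : R[i] => y * z)
         (fun u : 'I_1 -> E => Complex (dr u) (r * th u))
         (fun u : 'I_2 -> E => Complex (pr_S5 om2 c x u) (pr_S5 om3 c x u))
         v)].

End SphereForms.

Section Decay.
Context {R : realType} {m : nat} (G : lieGroup R m).
Variable ip : lie G -> lie G -> R.
Local Notation E := 'rV[R]_6.
Local Notation g := (lie G).

(* Covariant derivative of tensors, from the flat Levi-Civita connection of R^6
   and the connection with potential B. *)
Definition nabla (B : E -> kform 1 E g) l (al : E -> kform l E g) :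
    E -> kform l.+1 E g := fun x v =>
  'D_(v ord0) (fun y => al y (fun j => v (lift ord0 j))) x
  + brk G (B x (fun=> v ord0)) (al x (fun j => v (lift ord0 j))).

Fixpoint nablak (B : E -> kform 1 E g) (k l : nat) (al : E -> kform l E g) :
    E -> kform (k + l) E g :=
  match k return E -> kform (k + l) E g with
  | 0 => al
  | k'.+1 => nabla B (@nablak B k' l al)
  end.

Arguments nablak B k {l} al _ _.

Definition tnorm l (al : kform l E g) : R :=
  Num.sqrt (\sum_(I : {ffun 'I_l -> 'I_6})
    ip (al (fun i => evec (I i))) (al (fun i => evec (I i)))).

Context (Ps : pbundle G (S5_atlas R) (S5 R)).

(* pr^* As, in the gauge x |-> (x, gsec b (ccoo (gch b) (radproj x))) of
   pr^* Ps *)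
Definition pr_conn (As : gfield Ps 1) (b : gauge R 5 'rV[R]_6 Ps) :
    E -> kform 1 E g :=
  pullf (fun x => ccoo (gch b) (radproj x)) (As b).

(* |nabla^k al| = O(r^(mu-k)) for all k, for a form al over a punctured ball
   with values in the adjoint bundle of pr^* Ps, al b being its expression in
   the gauge induced by b. *)
Definition decays (As : gfield Ps 1) (mu : R) l
    (al : gauge R 5 'rV[R]_6 Ps -> E -> kform l E g) : Prop :=
  forall k : nat, exists C delta : R, 0 < delta /\
    forall b x, adm_gauge b -> 0 < enorm x < delta ->
      cimg (gch b) (radproj x) ->
      tnorm (nablak (pr_conn As b) k (al b) x) <= C * enorm x `^ (mu - k%:R).

Context {Z : Type} {A : set (chart R 6 Z)} {X : set Z} (P : pbundle G A X).
Variable sg : su3 R Z.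

(* frmap x p is the image of (x, p) in pr^* Ps, i.e. pproj p = radproj x. *)
Record framing := Framing {
  frch : chart R 6 Z;
  frmap : E -> Ps -> P }.

(* The gauge of P obtained by transporting the gauge of pr^* Ps induced by b; the
   expressions of (frmap^* B) are those of B in this gauge. *)
Definition cone_gauge (Phi : framing) (b : gauge R 5 'rV[R]_6 Ps) :
    gauge R 6 Z P := {|
  gch := {|
    cdom := [set x | [/\ cdom (frch Phi) x, x != 0
                        & cimg (gch b) (radproj x)]];
    cpar := cpar (frch Phi);
    ccoo := ccoo (frch Phi) |};
  gsec := fun x => frmap Phi x (gsec b (ccoo (gch b) (radproj x))) |}.

Definition su3_coordinates (c : chart R 6 Z) (z : Z) : Prop :=
  admissible A c /\
  (exists2 r : R, 0 < r & cdom c = [set x | enorm x < r]) /\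
  cpar c 0 = z /\
  (forall v, om sg c 0 v = omega0 v) /\ (forall v, Om sg c 0 v = Omega0 v).

Definition bundle_iso (Phi : framing) : Prop :=
  (forall x p, cdom (frch Phi) x -> x != 0 -> pproj p = radproj x ->
     pproj (frmap Phi x p) = cpar (frch Phi) x /\
     forall h, frmap Phi x (pact Ps p h) = pact P (frmap Phi x p) h) /\
  (forall b, adm_gauge b -> adm_gauge (cone_gauge Phi b)).

Definition is_framing (As : gfield Ps 1) (mu : R) (z : Z) (B : gfield P 1)
    (Phi : framing) : Prop :=
  [/\ su3_coordinates (frch Phi) z, bundle_iso Phi &
      decays As mu
        (fun b x v => B (cone_gauge Phi b) x v - pr_conn As b x v)].

End Decay.

Section ConicallySingular.
Context {R : realType} {m : nat} {G : lieGroup R m}.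
Variable ip : lie G -> lie G -> R.
Context {Z : Type} {A : set (chart R 6 Z)} {X : set Z} (P : pbundle G A X).
Variables (sg : su3 R Z) (S : set Z) (mu : Z -> R).
Variable Ps : Z -> pbundle G (S5_atlas R) (S5 R).
Variable As : forall s, gfield (Ps s) 1.

Definition conically_singular (B : gfield P 1) : Prop :=
  connection B /\
  forall s, S s -> exists Phi : framing (Ps s) P,
    is_framing ip sg (@As s) (mu s) s B Phi.

Definition Omega_mu (Phi : forall s, framing (Ps s) P) l (eta : gfield P l) :
    Prop :=
  adform eta /\
  forall s, S s ->
    decays ip (@As s) (mu s) (fun b => eta (cone_gauge (Phi s) b)).

End ConicallySingular.

(* Main.v *)
(** Write B = A + a and F for its curvature.  The vector fields dual to the
    5-forms F /\ Im Omega and F /\ Re Omega are divergence free for B: by the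
    Bianchi identity only F /\ d Omega is left, and it vanishes because d Omega
    is a multiple of omega^2 and Lambda F = 0 means F /\ omega^2 = 0.  The vector
    fields dual to omega^2 /\ d_B xi are divergence free because omega is
    coclosed and F /\ omega^2 = 0.  Since F /\ Re Omega is determined by
    F /\ Im Omega and J, the equation expresses the gradients of xi_1 and xi_2
    through these fields, so d_B^* d_B xi_1 = d_B^* d_B xi_2 = 0.  Hence
    u = |xi|^2 satisfies div grad u = 2 |d_B xi|^2 >= 0.

    Near a singular point u = O(r^(2 mu)) with 2 mu > -2, so u is dominated by
    the superharmonic barrier r^(-2) and its values in a small punctured ball
    are bounded by those on the boundary sphere.  By compactness of Z, u attains
    its supremum over every component of Z \ S.  The strong maximum principle
    makes u constant there, so d_B xi = 0 and then F /\ Im Omega = 0. *)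

Require Import Defs.
From HB Require Import structures.
From mathcomp Require Import all_boot all_order all_algebra all_fingroup.
From mathcomp Require Import all_classical all_reals all_analysis.
From mathcomp Require Import complex ring lra.
Import numFieldNormedType.Exports.
Set Implicit Arguments.
Unset Strict Implicit.
Unset Printing Implicit Defensive.
Import Order.TTheory GRing.Theory Num.Theory.
Local Open Scope classical_set_scope.
Local Open Scope ring_scope.

(** * Calculus of C^k maps *)

(** Frames are chosen pointwise by [xget], so nothing built from them can be differentiated
    directly. The differentiated coefficients are therefore expressed through omega and Omega alone:
    the bivector dual to omega, as a density, is a contraction of omega /\ omega, and J is a
    rational function of Omega; their product [Gm] is the inverse metric as a density. Densities
    also make every divergence a plain sum of coordinate derivatives, without Christoffel symbols.
    The price is a factor [\det f] of unknown sign, so inequalities for the operator [Lop] are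
    stated after multiplication by it.

    F /\ Re Omega is accessible because (l - i l o J) /\ Omega is a (4,0)-form on C^3, hence zero.

    Instead of components, the maximum argument uses quasi-components, cut out by relatively clopen
    sets. The comparison near a singular point is run on the trace of such a set, without the
    connectedness of the punctured ball. The barrier r^(-2) fits both sides: r^(-2q) is
    superharmonic on R^6 for 0 < 2q < 4, and q = 1 is enough because mu > -1. *)

Section CkBasic.
Context {R : realType} {E : normedModType R}.
Implicit Types (U V : set E) (F : normedModType R).

Lemma Ck_cont F k U (f : E -> F) x : Ck k U f -> U x -> {for x, continuous f}.
Proof. by case: k => [|k] [cf _] Ux; exact: cf. Qed.

Lemma Ck_der F k U (f : E -> F) x v : Ck k.+1 U f -> U x -> derivable f x v.
Proof. by move=> [_ /(_ v)[df _]] Ux; exact: df. Qed.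

Lemma CkD F k U (f : E -> F) v : Ck k.+1 U f -> Ck k U ('D_v f).
Proof. by move=> [_ /(_ v)[]]. Qed.

Lemma Ck_pred F k U (f : E -> F) : Ck k.+1 U f -> Ck k U f.
Proof.
elim: k f => [|k IH] f; first by case=> cf _; split.
move=> [cf df]; split => // v; have [d1 d2] := df v; split => //; exact: IH.
Qed.

Lemma Ck_leq F j k U (f : E -> F) : (j <= k)%N -> Ck k U f -> Ck j U f.
Proof.
move=> /subnK <-; elim: (k - j)%N => // d IH; rewrite addSn => /Ck_pred; exact: IH.
Qed.

Lemma Ck_subset F k U V (f : E -> F) : V `<=` U -> Ck k U f -> Ck k V f.
Proof.
move=> VU; elim: k f => [|k IH] f [cf df]; split => //.
- by move=> x /VU; exact: cf.
- by move=> x /VU; exact: cf.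
- by move=> v; have [d1 d2] := df v; split => [x /VU|]; [exact: d1|exact: IH].
Qed.

Lemma near_open U x : open U -> U x -> \forall y \near x, U y.
Proof. by move=> oU Ux; exact: open_nbhs_nbhs. Qed.

Lemma eq_near F U (f g : E -> F) x : open U -> {in U, f =1 g} -> U x ->
  {near x, f =1 g}.
Proof.
move=> oU fg Ux; near=> y; apply: fg; rewrite inE; near: y; exact: near_open.
Unshelve. all: by end_near. Qed.

Lemma eq_derive F U (f g : E -> F) x v : open U -> {in U, f =1 g} -> U x ->
  'D_v f x = 'D_v g x.
Proof. by move=> oU fg Ux; apply: near_eq_derive; apply: eq_near Ux. Qed.

Lemma Ck_eq F k U (f g : E -> F) : open U -> {in U, f =1 g} ->
  Ck k U f -> Ck k U g.
Proof.
move=> oU; elim: k f g => [|k IH] f g fg [cf df].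
  split => // x Ux; have fgx := eq_near oU fg Ux.
  rewrite /prop_for /continuous_at -(nbhs_singleton fgx).
  by apply: cvg_trans (cf _ Ux); apply: near_eq_cvg.
split.
  move=> x Ux; have fgx := eq_near oU fg Ux.
  rewrite /prop_for /continuous_at -(nbhs_singleton fgx).
  by apply: cvg_trans (cf _ Ux); apply: near_eq_cvg.
move=> v; have [d1 d2] := df v; split.
  by move=> x Ux; apply: near_eq_derivable (d1 _ Ux); apply: eq_near Ux.
apply: IH d2 => x; rewrite inE => Ux; exact: eq_derive Ux.
Qed.

Lemma Ck_cst F k U (a : F) : Ck k U (fun _ => a).
Proof.
elim: k a => [|k IH] a; split => //; first by move=> x _; exact: cst_continuous.
  by move=> x _; exact: cst_continuous.
move=> v; split; first by move=> x _; exact: derivable_cst.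
have -> : 'D_v (fun=> a : F) = (fun=> 0) by apply/funext => x; exact: derive_cst.
exact: IH.
Qed.

Lemma Ck_add F k U (f g : E -> F) : open U ->
  Ck k U f -> Ck k U g -> Ck k U (fun x => f x + g x).
Proof.
move=> oU; elim: k f g => [|k IH] f g [cf df] [cg dg].
  by split => // x Ux; apply: cvgD; [exact: cf|exact: cg].
split; first by move=> x Ux; apply: cvgD; [exact: cf|exact: cg].
move=> v; have [df1 df2] := df v; have [dg1 dg2] := dg v; split.
  by move=> x Ux; apply: derivableD; [exact: df1|exact: dg1].
apply: (@Ck_eq _ _ _ (fun x => 'D_v f x + 'D_v g x)) => //; last exact: IH.
by move=> x; rewrite inE => Ux; rewrite deriveD; [| exact: df1|exact: dg1].
Qed.

Lemma Ck_scale F k U (f : E -> F) (c : R) : open U ->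
  Ck k U f -> Ck k U (fun x => c *: f x).
Proof.
move=> oU; elim: k f => [|k IH] f [cf df].
  by split => // x Ux; apply: cvgZ; [exact: cvg_cst|exact: cf].
split; first by move=> x Ux; apply: cvgZ; [exact: cvg_cst|exact: cf].
move=> v; have [df1 df2] := df v; split.
  by move=> x Ux; apply: derivableZ; exact: df1.
apply: (@Ck_eq _ _ _ (fun x => c *: 'D_v f x)) => //; last exact: IH.
by move=> x; rewrite inE => Ux; rewrite deriveZ; [| exact: df1].
Qed.

Lemma Ck_opp F k U (f : E -> F) : open U -> Ck k U f -> Ck k U (fun x => - f x).
Proof.
move=> oU /(Ck_scale (-1) oU); apply: Ck_eq => // x _.
by rewrite scaleN1r.
Qed.

Lemma Ck_sum F k U (I : Type) (r : seq I) (P : pred I) (f : I -> E -> F) :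
  open U -> (forall i, P i -> Ck k U (f i)) ->
  Ck k U (fun x => \sum_(i <- r | P i) f i x).
Proof.
move=> oU Cf; elim: r => [|i r IH].
  by apply: Ck_eq (Ck_cst k U (0 : F)) => // x _; rewrite big_nil.
case: (boolP (P i)) => Pi.
  by apply: Ck_eq (Ck_add oU (Cf i Pi) IH) => // x _; rewrite big_cons Pi.
by apply: Ck_eq IH => // x _; rewrite big_cons (negbTE Pi).
Qed.

Lemma derivable_mulr (f g : E -> R) x v : derivable f x v -> derivable g x v ->
  derivable (fun y => f y * g y) x v.
Proof. by move=> df dg; have := derivableM df dg. Qed.

Lemma derive_mulr (f g : E -> R) x v : derivable f x v -> derivable g x v ->
  'D_v (fun y => f y * g y) x = 'D_v f x * g x + f x * 'D_v g x.
Proof.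
move=> df dg; have := deriveM df dg; rewrite /GRing.scale /= => H.
by rewrite [LHS]H addrC [_ * g x]mulrC.
Qed.

Lemma Ck_mul k U (f g : E -> R) : open U ->
  Ck k U f -> Ck k U g -> Ck k U (fun x => f x * g x).
Proof.
move=> oU; elim: k f g => [|k IH] f g Cf Cg.
  by split => // x Ux; apply: cvgM; [exact: (Ck_cont Cf)|exact: (Ck_cont Cg)].
split; first by move=> x Ux; apply: cvgM; [exact: (Ck_cont Cf)|exact: (Ck_cont Cg)].
move=> v; split.
  by move=> x Ux; exact: (derivable_mulr (Ck_der Cf Ux) (Ck_der Cg Ux)).
apply: (@Ck_eq _ _ _ (fun x => 'D_v f x * g x + f x * 'D_v g x)) => //.
  by move=> x; rewrite inE => Ux; rewrite derive_mulr //;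
    [exact: (Ck_der Cf)|exact: (Ck_der Cg)].
by apply: Ck_add => //; apply: IH => //; (try exact: CkD); exact: Ck_pred.
Qed.

Lemma Ck_prod k U (I : Type) (r : seq I) (P : pred I) (f : I -> E -> R) :
  open U -> (forall i, P i -> Ck k U (f i)) ->
  Ck k U (fun x => \prod_(i <- r | P i) f i x).
Proof.
move=> oU Cf; elim: r => [|i r IH].
  by apply: Ck_eq (Ck_cst k U (1 : R)) => // x _; rewrite big_nil.
case: (boolP (P i)) => Pi.
  by apply: Ck_eq (Ck_mul oU (Cf i Pi) IH) => // x _; rewrite big_cons Pi.
by apply: Ck_eq IH => // x _; rewrite big_cons (negbTE Pi).
Qed.

Lemma Ck_exp k U (f : E -> R) n : open U -> Ck k U f -> Ck k U (fun x => f x ^+ n).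
Proof.
move=> oU Cf; elim: n => [|n IH]; first by apply: Ck_eq (Ck_cst k U (1 : R)).
by apply: Ck_eq (Ck_mul oU Cf IH) => // x _; rewrite exprS.
Qed.

Lemma Ck_inv k U (f : E -> R) : open U -> (forall x, U x -> f x != 0) ->
  Ck k U f -> Ck k U (fun x => (f x)^-1).
Proof.
move=> oU f0; elim: k => [|k IH] Cf.
  by split => // x Ux; apply: cvgV; [exact: f0|exact: (Ck_cont Cf)].
split; first by move=> x Ux; apply: cvgV; [exact: f0|exact: (Ck_cont Cf)].
move=> v; split.
  by move=> x Ux; apply: derivableV; [exact: f0|exact: (Ck_der Cf)].
apply: (@Ck_eq _ _ _ (fun x => - ((f x)^-1 ^+ 2 * 'D_v f x))) => //.
  move=> x; rewrite inE => Ux; rewrite deriveV; [|exact: f0|exact: (Ck_der Cf)].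
  by rewrite /GRing.scale /= mulNr exprVn.
apply: Ck_opp => //; apply: Ck_mul => //; last exact: CkD.
by apply: Ck_exp => //; apply: IH; exact: Ck_pred.
Qed.

Lemma is_derive_scaler F (f : E -> R) (a : F) x v : derivable f x v ->
  is_derive x v (fun y => f y *: a) ('D_v f x *: a).
Proof.
move=> df.
have H : (fun h => h^-1 *: (((fun y => f y *: a) \o shift x) (h *: v) - f x *: a)) @ 0^'
    --> 'D_v f x *: a.
  under eq_fun do rewrite /= -scalerBl scalerA.
  by apply: cvgZ; [exact: df|exact: cvg_cst].
by split; [apply/cvg_ex; exists ('D_v f x *: a)|exact: cvg_lim].
Qed.

Lemma Ck_scaler F k U (f : E -> R) (a : F) : open U ->
  Ck k U f -> Ck k U (fun x => f x *: a).
Proof.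
move=> oU; elim: k f => [|k IH] f Cf.
  by split => // x Ux; apply: cvgZ; [exact: (Ck_cont Cf)|exact: cvg_cst].
have dS x v (Ux : U x) := is_derive_scaler a (Ck_der Cf Ux : derivable f x v).
split; first by move=> x Ux; apply: cvgZ; [exact: (Ck_cont Cf)|exact: cvg_cst].
move=> v; split; first by move=> x Ux; case: (dS x v Ux).
apply: (@Ck_eq _ _ _ (fun x => 'D_v f x *: a)) => //; last exact/IH/CkD.
by move=> x; rewrite inE => Ux; have [_ ->] := dS x v Ux.
Qed.

(** The difference quotient is constantly [L v], so no regularity of [f] enters. *)
Lemma is_derive_affine F (f L : E -> F) x v :
  (forall h y, f (h *: v + y) = h *: L v + f y) -> is_derive x v f (L v).
Proof.
move=> fL.
have H : (fun h => h^-1 *: ((f \o shift x) (h *: v) - f x)) @ 0^' --> L v.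
  apply: cvg_near_cst; near=> h; rewrite /= fL addrK scalerA mulVf ?scale1r //.
  by near: h; exact: nbhs_dnbhs_neq.
by split; [apply/cvg_ex; exists (L v)|exact: cvg_lim].
Unshelve. all: by end_near. Qed.

Lemma Ck_affine F k U (f L : E -> F) : open U -> continuous f ->
  (forall v h y, f (h *: v + y) = h *: L v + f y) -> Ck k U f.
Proof.
move=> oU cf fL; case: k => [|k]; first by split => // x _; exact: cf.
split; first by move=> x _; exact: cf.
move=> v; split; first by move=> x _; have [] := is_derive_affine x (fL v).
apply: Ck_eq (Ck_cst k U (L v)) => // x _.
by have [_ ->] := is_derive_affine x (fL v).
Qed.

End CkBasic.

Section CkMatrix.
Context {R : realType} {E : normedModType R} {m n : nat}.
Implicit Types (U : set E) (f : E -> 'M[R]_(m, n)).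

Lemma mx_cont f x :
  (forall i j, {for x, continuous (fun y => f y i j)}) -> {for x, continuous f}.
Proof.
move=> fc; apply/cvgrPdist_le => e e0; near=> y.
rewrite {1}/Num.Def.normr /= mx_normrE (bigmax_le _ (ltW e0)) //= => i _.
rewrite !mxE; move: i; near: y; apply: filter_forall => /= i.
exact: ((cvgrPdist_le _ _).1 (fc i.1 i.2)).
Unshelve. all: by end_near. Qed.

Lemma coord_cont f x i j : {for x, continuous f} ->
  {for x, continuous (fun y => f y i j)}.
Proof.
move=> cf; apply: (@continuous_comp _ _ _ f (fun M : 'M[R]_(m, n) => M i j)) => //.
exact: coord_continuous.
Qed.

Lemma Ck_mxP k U f : open U ->
  Ck k U f <-> forall i j, Ck k U (fun x => f x i j).
Proof.
move=> oU; elim: k f => [|k IH] f; split.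
- move=> [cf _] i j; split => // x Ux.
  by apply: coord_cont; exact: cf.
- by move=> cf; split => // x Ux; apply: mx_cont => i j; have [c _] := cf i j; exact: c.
- move=> Cf i j; split.
    by move=> x Ux; apply: coord_cont; exact: Ck_cont Cf Ux.
  move=> v; split; first by move=> x Ux; have /derivable_mxP H : derivable f x v := Ck_der Cf Ux; exact: H.
  apply: (@Ck_eq _ _ _ _ _ (fun x => 'D_v f x i j)) => //; last first.
    by move: i j; apply/IH; exact: CkD.
  move=> x; rewrite inE => Ux; rewrite derive_mx ?mxE //; exact: Ck_der Cf Ux.
- move=> Cf; split.
    by move=> x Ux; apply: mx_cont => i j; exact: Ck_cont (Cf i j) Ux.
  move=> v; have df x : U x -> derivable f x v.
    by move=> Ux; apply/derivable_mxP => i j; exact: Ck_der (Cf i j) Ux.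
  split => //; apply/IH => i j.
  apply: (@Ck_eq _ _ _ _ _ ('D_v (fun x => f x i j))) => //; last exact: CkD.
  by move=> x; rewrite inE => Ux; rewrite derive_mx ?mxE //; exact: df.
Qed.

Lemma Ck_coord k (U : set 'M[R]_(m, n)) i j : open U ->
  Ck k U (fun M : 'M[R]_(m, n) => M i j).
Proof.
move=> oU; have H := @Ck_affine R _ _ k U (fun M : 'M[R]_(m, n) => M i j) (fun M : 'M[R]_(m, n) => M i j). apply: H => //.
  exact: coord_continuous.
by move=> v h y; rewrite !mxE.
Qed.

End CkMatrix.

Section Lines.
Context {R : realType} {E F : normedModType R}.
Implicit Types (f : E -> F) (x v : E).

Lemma is_derive_line f x v (t : R) : derivable f (x + t *: v) v ->
  is_derive t 1 (fun s : R => f (x + s *: v)) ('D_v f (x + t *: v)).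
Proof.
move=> df.
have e : (fun h : R => h^-1 *: (((fun s => f (x + s *: v)) \o shift t) h%:A - f (x + t *: v)))
    = (fun h => h^-1 *: ((f \o shift (x + t *: v)) (h *: v) - f (x + t *: v))).
  apply/funext => h /=; congr (_ *: (f _ - _)).
  by rewrite [_%:A]mulr1 scalerDl addrCA.
by split; [rewrite /derivable /= e|rewrite /derive /= e].
Qed.

Lemma is_derive_dirZ f x v (c : R) : derivable f x v ->
  is_derive x (c *: v) f (c *: 'D_v f x).
Proof.
move=> df; have [->|c0] := eqVneq c 0.
  by rewrite !scale0r; exact: is_derive0.
have H : (fun h => h^-1 *: ((f \o shift x) (h *: (c *: v)) - f x)) @ 0^' -->
    c *: 'D_v f x.
  have -> : (fun h => h^-1 *: ((f \o shift x) (h *: (c *: v)) - f x)) =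
    (fun h => c *: ((h * c)^-1 *: ((f \o shift x) ((h * c) *: v) - f x))).
    apply/funext => h; rewrite !scalerA; congr (_ *: _).
    by rewrite invfM mulrCA mulfV // mulr1.
  apply: cvgZ; first exact: cvg_cst.
  have K : ((fun h : R => h * c) @ 0^') `=>` 0^'.
    move=> A [e /= e0 eA]; exists (e / `|c|) => /=.
      by rewrite divr_gt0 // normr_gt0.
    move=> h /=; rewrite sub0r normrN ltr_pdivlMr ?normr_gt0 // => hc h0.
    apply: eA; rewrite /= ?sub0r ?normrN ?normrM //.
    by rewrite mulf_neq0.
  apply: (@cvg_comp _ _ _ (fun h => h * c)
    (fun k => k^-1 *: ((f \o shift x) (k *: v) - f x)) _ _ _ K); exact: df.
by split; [apply/cvg_ex; exists (c *: 'D_v f x)|exact: cvg_lim].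
Qed.

End Lines.

Section C1.
Context {R : realType} {n : nat}.
Local Notation E := 'rV[R]_n.
Implicit Types (f : E -> R) (U : set E).

(** The mean value theorem on the segment from x to x + v. Here [c] is the expected increment,
    usually a derivative at a base point, so the lemma bounds Taylor remainders. *)
Lemma mvt_line (V : normedModType R) (f : V -> R) (x v : V) (c e : R) :
  (forall t : R, 0 <= t <= 1 -> derivable f (x + t *: v) v /\
     `|'D_v f (x + t *: v) - c| <= e) ->
  `|f (x + v) - f x - c| <= e.
Proof.
move=> H.
pose g (t : R) := f (x + t *: v).
have dg (t : R) : 0 <= t <= 1 -> is_derive t (1 : R) g ('D_v f (x + t *: v)).
  by move=> /H[d _]; exact: is_derive_line.
have [] := @MVT R g (fun t => 'D_v f (x + t *: v)) 0 1 ltr01.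
- by move=> t; rewrite in_itv /= => /andP[t0 t1]; apply: dg; rewrite !ltW.
- apply: derivable_within_continuous => t; rewrite in_itv /= => t01.
  by have [] := dg t t01.
move=> t; rewrite in_itv /= /g => /andP[t0 t1]; rewrite scale1r scale0r addr0 subr0 mulr1 => ->.
by have [] := H t; rewrite ?(ltW t0) ?(ltW t1).
Qed.

Lemma row_sum_evec (h : E) : h = \sum_(i < n) h 0 i *: evec i.
Proof. exact: row_sum_delta. Qed.

(* Moving along the coordinate axes one at a time. *)
Lemma C1_differentiable_scalar U f x :
  open U -> Ck 1 U f -> U x -> differentiable f x.
Proof.
move=> oU Cf Ux.
pose df (h : E) : R := \sum_(i < n) h 0 i * 'D_(evec i) f x.
have dfl : linear df.
  move=> a u v; rewrite /df scaler_sumr -big_split /=; apply: eq_bigr => i _.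
  by rewrite !mxE mulrDl /GRing.scale /= mulrA.
pose dfL : {linear E -> R} := HB.pack df (GRing.isLinear.Build _ _ _ _ _ dfl).
have dfc : continuous df.
  have [c _] : Ck 0 [set: E] df.
    apply: Ck_sum => [|i _]; first exact: openT.
    by apply: Ck_mul (Ck_cst _ _ _); [exact: openT|apply: Ck_coord; exact: openT].
  by move=> y; exact: c.
have main : f \o shift x = cst (f x) + dfL +o_ (0 : E) id.
  apply/eqaddoP => _/posnumP[e].
  (* The tolerance is divided by n + 1 rather than n, so that n = 0 needs no separate case; the n
     coordinate steps then cost less than [e%:num]. *)
  have De : forall i : 'I_n, \forall y \near x,
      `|'D_(evec i) f y - 'D_(evec i) f x| <= e%:num / n.+1%:R.
    move=> i; have /cvgrPdist_le/(_ (e%:num / n.+1%:R)) := Ck_cont (CkD (evec i) Cf) Ux.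
    rewrite divr_gt0 // => /(_ isT); apply: filterS => y; by rewrite distrC.
  have /nbhs_ballP[d /= d0 dP] : \forall y \near x, U y /\ forall i : 'I_n,
      `|'D_(evec i) f y - 'D_(evec i) f x| <= e%:num / n.+1%:R.
    near=> y; split; first by near: y; exact: (near_open oU Ux).
    by move=> i; move: i; near: y; apply: filter_forall.
  near=> h.
  (* The truncation of [h] to its first k coordinates; consecutive truncations differ by a multiple
     of one basis vector. *)
  pose hk k : E := \row_j (if (j < k)%N then h 0 j else 0).
  have hd : `|h| < d. near: h; exact: (@pseudometric_normed_Zmodule.nbhs0_lt R E d d0).
  have hin (k : nat) (i : 'I_n) (t : R) : k = i -> 0 <= t <= 1 ->
      ball x d (x + hk k + t *: (h 0 i *: evec i)).
    move=> -> /andP[t0 t1]; rewrite -ball_normE /= opprD addrA opprD addrA subrr sub0r.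
    rewrite -opprD normrN; apply: le_lt_trans hd.
    rewrite {1}/Num.Def.normr /= mx_normrE; apply: bigmax_le => // -[a b] _ /=.
    have hb : `|h 0 b| <= `|h|.
      rewrite [leRHS]/Num.Def.normr /= mx_normrE.
      exact: (le_bigmax _ (fun ij : 'I_1 * 'I_n => `|h ij.1 ij.2|) (0, b)).
    rewrite !mxE !ord1 eqxx /=; have [bi|bi] := eqVneq b i.
      rewrite bi ltnn add0r mulr1 normrM ger0_norm //; apply: le_trans hb.
      by rewrite bi ler_piMl.
    rewrite !mulr0 addr0; case: ifP => // _; by rewrite normr0.
  have step (k : nat) : (k <= n)%N ->
     `|f (x + hk k) - f x - \sum_(i < n | (i < k)%N) h 0 i * 'D_(evec i) f x|
       <= k%:R * (e%:num / n.+1%:R * `|h|).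
    elim: k => [|k IH] kn.
      rewrite big_pred0 // (_ : hk 0%N = 0) ?addr0 ?subrr ?subr0 ?normr0 ?mul0r //.
      by apply/rowP => j; rewrite !mxE.
    have {}IH := IH (ltnW kn).
    pose i := Ordinal kn.
    have hkS : hk k.+1 = hk k + h 0 i *: evec i.
      apply/rowP => j; rewrite !mxE ltnS leq_eqVlt -[_ == k :> nat]/(j == i).
      have [->|ji] := eqVneq j i; first by rewrite ?ltnn ?eqxx /= mulr1 add0r.
      by rewrite andbF mulr0 addr0.
    rewrite (bigD1 i) //= ?ltnS //.
    have -> : \sum_(j < n | (j < k.+1)%N && (j != i)) h 0 j * 'D_(evec j) f x
       = \sum_(j < n | (j < k)%N) h 0 j * 'D_(evec j) f x.
      apply: eq_bigl => j; rewrite ltnS leq_eqVlt -[_ == k :> nat]/(j == i).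
      by have [->|ji] := eqVneq j i; rewrite /= ?ltnn ?andbT.
    have := @mvt_line _ f (x + hk k) (h 0 i *: evec i) (h 0 i * 'D_(evec i) f x)
       (e%:num / n.+1%:R * `|h|).
    have hkx : x + hk k.+1 = x + hk k + h 0 i *: evec i by rewrite hkS addrA.
    rewrite -hkx => mv.
    have {}mv : `|f (x + hk k.+1) - f (x + hk k) - h 0 i * 'D_(evec i) f x| <=
         e%:num / n.+1%:R * `|h|.
      apply: mv => t t01.
      have /dP[Uy Dy] := hin k i t erefl t01.
      have [d1 ->] := is_derive_dirZ (h 0 i) (Ck_der Cf Uy : derivable f _ (evec i)).
      split => //; rewrite -mulrBr normrM mulrC; apply: ler_pM => //.
      rewrite [leRHS]/Num.Def.normr /= mx_normrE.
      exact: (le_bigmax _ (fun ij : 'I_1 * 'I_n => `|h ij.1 ij.2|) (0, i)).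
    rewrite -natr1 mulrDl mul1r [leRHS]addrC.
    apply: le_trans (lerD mv IH); apply: le_trans (ler_normD _ _).
    rewrite le_eqVlt; apply/orP; left; apply/eqP; congr `|_|.
    by ring.
  have := step n (leqnn n).
  have -> : hk n = h by apply/rowP => j; rewrite !mxE ltn_ord.
  rewrite (eq_bigl predT); last by move=> i /=; rewrite ltn_ord.
  move=> H; rewrite /= /cst /=.
  have -> : (f \o shift x - (cst (f x) + dfL : E -> R)) h = f (x + h) - f x - df h.
    by rewrite /= ![in LHS]fctE /= opprD addrA [h + x]addrC.
  apply: le_trans H _; rewrite mulrA; apply: ler_wpM2r => //.
  by rewrite mulrA ler_pdivrMr // mulrC ler_pM2l // ler_nat.
have := diff_unique (dfc : continuous dfL) main => dE.
by apply/diff_locallyP; rewrite dE.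
Unshelve. all: by end_near. Qed.

End C1.

Section Chain.
Context {R : realType}.

Lemma derive_coord (E : normedModType R) m n (f : E -> 'M[R]_(m, n)) x v i j :
  derivable f x v -> 'D_v f x i j = 'D_v (fun y => f y i j) x.
Proof. by move=> df; rewrite derive_mx // mxE. Qed.

Lemma derive_linear n m (f : 'rV[R]_n -> 'rV[R]_m) U x (a : R) u v : open U -> Ck 1 U f -> U x ->
  'D_(a *: u + v) f x = a *: 'D_u f x + 'D_v f x.
Proof.
move=> oU Cf Ux; apply/rowP => j.
have fj : Ck 1 U (fun x => f x 0 j) by move/Ck_mxP : Cf; apply.
have df : differentiable (fun x => f x 0 j) x by exact: C1_differentiable_scalar Ux.
have dfv w : derivable f x w by exact: Ck_der Cf Ux.
rewrite 2!mxE !derive_coord //.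
by rewrite !deriveE // linearP.
Qed.

Lemma derive_scalar_sum n (f : 'rV[R]_n -> R) U x v : open U -> Ck 1 U f -> U x ->
  'D_v f x = \sum_(i < n) v 0 i * 'D_(evec i) f x.
Proof.
move=> oU Cf Ux; have df := C1_differentiable_scalar oU Cf Ux.
rewrite deriveE // {1}(row_sum_evec v) linear_sum; apply: eq_bigr => i _.
by rewrite linearZ deriveE.
Qed.

(** The inner map is only known to be derivable in the direction v, so the chain rule is applied to
    its restriction to a line, where derivability and differentiability coincide. *)
Lemma is_derive_comp (E : normedModType R) n (c : E -> 'rV[R]_n) (f : 'rV[R]_n -> R) U x v :
  open U -> Ck 1 U f -> U (c x) -> derivable c x v ->
  is_derive x v (fun y => f (c y)) ('D_('D_v c x) f (c x)).
Proof.
move=> oU Cf Ucx dc.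
have df := C1_differentiable_scalar oU Cf Ucx.
have /derivable1P/derivable1_diffP dc1 := dc.
have c0 : (fun h : R => c (h *: v + x)) 0 = c x by rewrite scale0r add0r.
have df0 : differentiable f ((fun h : R => c (h *: v + x)) 0) by rewrite c0.
have e (W : normedModType R) (g : E -> W) : (fun h : R => h^-1 *: (((fun k : R => g (k *: v + x)) \o shift 0) h%:A
     - (fun k : R => g (k *: v + x)) 0)) = (fun h => h^-1 *: ((g \o shift x) (h *: v) - g x)).
  by apply/funext => h /=; rewrite addr0 scale0r add0r [_%:A]mulr1.
have dcomp : differentiable (f \o (fun h : R => c (h *: v + x))) (0 : R).
  exact: differentiable_comp.
split.
  by apply/derivable1P/derivable1_diffP.
have -> : 'D_v (fun y => f (c y)) x = 'D_1 (f \o (fun h : R => c (h *: v + x))) (0 : R).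
  by rewrite /derive -(e _ (fun y => f (c y))).
rewrite deriveE // diff_comp //= c0 deriveE //; congr ('d f _ _).
have cdiff : differentiable (fun h : R => c (h *: v + x)) (0 : R) by [].
by rewrite -(deriveE _ cdiff) /derive e.
Qed.

Lemma Ck_comp_scalar k (E : normedModType R) n (V : set E) U (c : E -> 'rV[R]_n)
    (f : 'rV[R]_n -> R) :
  open V -> open U -> (forall x, V x -> U (c x)) ->
  Ck k V c -> Ck k U f -> Ck k V (fun x => f (c x)).
Proof.
move=> oV oU VU; elim: k f => [|k IH] f Cc Cf.
  split => // x Vx; apply: (@continuous_comp _ _ _ c f).
    exact: Ck_cont Cc Vx.
  exact: Ck_cont Cf (VU _ Vx).
have C1 : Ck 1 U f by apply: Ck_leq Cf.
split.
  move=> x Vx; apply: (@continuous_comp _ _ _ c f).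
    exact: Ck_cont Cc Vx.
  exact: Ck_cont Cf (VU _ Vx).
move=> v; split.
  move=> x Vx.
  by have [] := is_derive_comp oU C1 (VU _ Vx) (Ck_der Cc Vx : derivable c x v).
apply: (@Ck_eq _ _ _ _ _ (fun x => \sum_(i < n) 'D_v c x 0 i * 'D_(evec i) f (c x))) => //.
  move=> x; rewrite inE => Vx.
  have [_ ->] := is_derive_comp oU C1 (VU _ Vx) (Ck_der Cc Vx : derivable c x v).
  by rewrite (derive_scalar_sum _ oU C1 (VU _ Vx)).
apply: Ck_sum => // i _; apply: Ck_mul => //.
  by have /(Ck_mxP _ _ oV) := CkD v Cc; apply.
exact: (IH ('D_(evec i) f) (Ck_pred Cc) (CkD _ Cf)).
Qed.

Lemma Ck_comp k (E : normedModType R) n m (V : set E) U (c : E -> 'rV[R]_n)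
    (f : 'rV[R]_n -> 'rV[R]_m) :
  open V -> open U -> (forall x, V x -> U (c x)) ->
  Ck k V c -> Ck k U f -> Ck k V (fun x => f (c x)).
Proof.
move=> oV oU VU Cc /(Ck_mxP _ _ oU) Cf; apply/Ck_mxP => // i j.
exact: (Ck_comp_scalar oV oU VU Cc (Cf i j)).
Qed.

Lemma derive_comp (E : normedModType R) n m (c : E -> 'rV[R]_n) (f : 'rV[R]_n -> 'rV[R]_m) U x v :
  open U -> Ck 1 U f -> U (c x) -> derivable c x v ->
  is_derive x v (fun y => f (c y)) ('D_('D_v c x) f (c x)).
Proof.
move=> oU Cf Ucx dc.
have Cfj i j : Ck 1 U (fun x => f x i j) by move/Ck_mxP : Cf; apply.
have dj i j := is_derive_comp oU (Cfj i j) Ucx dc.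
have dfc : derivable (fun y => f (c y)) x v.
  by apply/derivable_mxP => i j; have [] := dj i j.
split => //; apply/rowP => j; have [_ dj0] := dj 0 j.
have df : derivable f (c x) ('D_v c x) by exact: Ck_der Cf Ucx.
rewrite (derive_coord 0 j df) -dj0.
exact: (derive_coord 0 j dfc).
Qed.

End Chain.

(** * Second derivatives: symmetry and the behaviour at a maximum *)

Section SecondOrder.
Context {R : realType} {E : normedModType R}.
Implicit Types (f : E -> R) (U : set E).

Lemma near_plane (P : set E) (x u v : E) : (\forall y \near x, P y) ->
  exists2 d : R, 0 < d & forall a b : R, `|a| <= d -> `|b| <= d ->
    P (x + a *: u + b *: v).
Proof.
move=> /nbhs_ballP[e /= e0 eP].
have n0 : 0 < `|u| + `|v| + 1 by rewrite ltr_wpDl ?addr_ge0.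
exists (e / (`|u| + `|v| + 1)); first by rewrite divr_gt0.
move=> a b ad bd; apply: eP; rewrite -ball_normE /= -addrA opprD addrA subrr sub0r normrN.
apply: le_lt_trans (ler_normD _ _) _; rewrite !normrZ.
apply: (@le_lt_trans _ _ (e / (`|u| + `|v| + 1) * (`|u| + `|v|))).
  by rewrite mulrDr; apply: lerD; apply: ler_wpM2r.
by rewrite mulrAC ltr_pdivrMr // ltr_pM2l // ltrDl.
Qed.

Lemma near_line (P : set E) (x v : E) : (\forall y \near x, P y) ->
  exists2 d : R, 0 < d & forall a : R, `|a| <= d -> P (x + a *: v).
Proof.
move=> nP; have [d d0 dP] := near_plane v v nP; exists d => // a ad.
have Pa : P (x + a *: v + (0 : R) *: v) by apply: dP => //; rewrite normr0 ltW.
by rewrite scale0r addr0 in Pa.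
Qed.

Lemma near_deriv_cont k f U x (e : R) v : open U -> Ck k.+1 U f -> U x -> 0 < e ->
  \forall y \near x, U y /\ `|'D_v f y - 'D_v f x| <= e.
Proof.
move=> oU Cf Ux e0.
have /cvgrPdist_le/(_ e e0) c := Ck_cont (CkD v Cf) Ux.
near=> y; split; first by near: y; exact: (near_open oU Ux).
by rewrite distrC; near: y.
Unshelve. all: by end_near. Qed.

(** Two applications of the mean value estimate: the second difference is the increment along h u of
    g(y) = f(y + h v) - f(y), and the derivative of g along h u is itself an increment along h v of
    the derivative of f along u. *)
Lemma seconddiff f U x u v (e : R) : open U -> Ck 2 U f -> U x -> 0 < e ->
  exists2 d : R, 0 < d & forall h : R, `|h| <= d ->
    `|f (x + h *: u + h *: v) - f (x + h *: u) - (f (x + h *: v) - f x) -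
      h * (h * 'D_v ('D_u f) x)| <= e * `|h| ^+ 2.
Proof.
move=> oU Cf Ux e0.
have Cu := CkD u Cf.
have [d d0 dP] := near_plane u v (near_deriv_cont v oU Cu Ux e0).
exists d => // h hd.
have sc (t : R) : 0 <= t <= 1 -> `|t * h| <= d.
  by move=> /andP[t0 t1]; rewrite normrM ger0_norm // (le_trans _ hd) // ler_piMl.
pose g y := f (y + h *: v) - f y.
have -> : f (x + h *: u + h *: v) - f (x + h *: u) - (f (x + h *: v) - f x) =
   g (x + h *: u) - g x by [].
apply: mvt_line => t t01.
have n0d : `|0 : R| <= d by rewrite normr0 ltW.
have [Uy _] := dP (t * h) 0 (sc _ t01) n0d.
have [Uyv _] := dP (t * h) h (sc _ t01) hd.
rewrite scale0r addr0 -scalerA in Uy; rewrite -scalerA in Uyv.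
have d1 : is_derive (x + t *: (h *: u)) (h *: u) (fun y => f (y + h *: v))
    (h * 'D_u f (x + t *: (h *: u) + h *: v)).
  have [b1 b2] := is_derive_dirZ h (Ck_der Cf Uyv : derivable f _ u).
  have e1 : (fun k : R => k^-1 *: (((fun y => f (y + h *: v)) \o shift (x + t *: (h *: u))) (k *: (h *: u)) - f (x + t *: (h *: u) + h *: v))) =
    (fun k : R => k^-1 *: ((f \o shift (x + t *: (h *: u) + h *: v)) (k *: (h *: u)) - f (x + t *: (h *: u) + h *: v))).
    by apply/funext => k /=; rewrite !addrA.
  by split; rewrite -?b2 /derivable /derive e1.
have d2 : is_derive (x + t *: (h *: u)) (h *: u) f (h * 'D_u f (x + t *: (h *: u))).
  exact: is_derive_dirZ (Ck_der Cf Uy).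
have [d3 ->] := is_deriveB d1 d2.
split => //.
rewrite -!mulrBr normrM expr2 mulrCA.
apply: ler_wpM2l => //.
apply: (@mvt_line R E ('D_u f) (x + t *: (h *: u)) (h *: v) (h * 'D_v ('D_u f) x) (e * `|h|)) => s s01.
have [Uz zP] := dP (t * h) (s * h) (sc _ t01) (sc _ s01).
rewrite -!scalerA in Uz zP.
have [d4 ->] := is_derive_dirZ h (Ck_der Cu Uz : derivable ('D_u f) _ v).
by split => //; rewrite -mulrBr normrM [leRHS]mulrC; apply: ler_wpM2l.
Qed.

(** The second difference is symmetric in u and v, so by [seconddiff] both mixed derivatives are
    within e / 2 of its quotient by h^2. *)
Lemma schwarz f U x u v : open U -> Ck 2 U f -> U x ->
  'D_u ('D_v f) x = 'D_v ('D_u f) x.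
Proof.
move=> oU Cf Ux; apply/eqP; rewrite -subr_eq0 -normr_eq0 eq_le normr_ge0 andbT.
apply/ler_addgt0Pr => e e0; rewrite add0r.
have e2 : 0 < e / 2 by rewrite divr_gt0.
have [d1 d10 H1] := seconddiff u v oU Cf Ux e2.
have [d2 d20 H2] := seconddiff v u oU Cf Ux e2.
pose h := Num.min d1 d2.
have h0 : 0 < h by rewrite lt_min d10.
have {}H1 := H1 h; have {}H2 := H2 h.
rewrite gtr0_norm // in H1 H2.
have {}H1 : _ <= _ := H1 ltac:(by rewrite ge_min lexx).
have {}H2 : _ <= _ := H2 ltac:(by rewrite ge_min lexx orbT).
rewrite [_ + h *: v + h *: u]addrAC in H2.
set A := f (x + h *: u + h *: v) in H1 H2.
set B := 'D_u _ _ in H2 *; set C := 'D_v ('D_u f) x in H1 *.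
have hh : 0 < h ^+ 2 by rewrite exprn_gt0.
rewrite -(ler_pM2l hh) -[X in X * `|_|]gtr0_norm // -normrM.
have -> : h ^+ 2 * (B - C) = (A - f (x + h *: u) - (f (x + h *: v) - f x) - h * (h * C))
   - (A - f (x + h *: v) - (f (x + h *: u) - f x) - h * (h * B)) by ring.
apply: le_trans (ler_normB _ _) _; apply: le_trans (lerD H1 H2) _.
by rewrite -mulrDl -splitr mulrC.
Qed.

Lemma deriv_at_max f U x v : open U -> Ck 1 U f -> U x ->
  (forall y, U y -> f y <= f x) -> 'D_v f x = 0.
Proof.
move=> oU Cf Ux fmax; apply/eqP/negPn/negP => c0.
set c := 'D_v f x in c0.
have e0 : 0 < `|c| / 2 by rewrite divr_gt0 // normr_gt0.
have [d d0 dP] := near_line v (near_deriv_cont v oU Cf Ux e0).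
(* The sign makes the first-order increment positive, namely d |c|. *)
pose h := Num.sg c * d.
have hd : `|h| = d by rewrite normrM normr_sg c0 mul1r gtr0_norm.
have : `|f (x + h *: v) - f x - h * c| <= d * (`|c| / 2).
  apply: mvt_line => t /andP[t0 t1].
  have [Uy yP] : (U (x + t *: (h *: v)) /\ `|'D_v f (x + t *: (h *: v)) - c| <= `|c| / 2).
    rewrite scalerA; apply: dP.
    by rewrite normrM hd ger0_norm // ler_piMl // ltW.
  have [d4 ->] := is_derive_dirZ h (Ck_der Cf Uy : derivable f _ v).
  split => //; rewrite -mulrBr normrM hd; apply: ler_wpM2l => //; exact: ltW.
have -> : h * c = d * `|c| by rewrite /h mulrAC -normrEsg mulrC.
have Uh : U (x + h *: v).
  by have [] := dP h; rewrite ?hd.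
have := fmax _ Uh; rewrite -subr_le0 => fle.
rewrite distrC ler_norml => /andP[_]; apply/negP; rewrite -ltNge.
have p : 0 < d * `|c| by rewrite mulr_gt0 // normr_gt0.
by lra.
Qed.

(** If the second derivative were positive, the first derivative, which vanishes at x, would be
    positive on a segment starting at x, and f would increase along it. *)
Lemma deriv2_at_max f U x v : open U -> Ck 2 U f -> U x ->
  (forall y, U y -> f y <= f x) -> 'D_v ('D_v f) x <= 0.
Proof.
move=> oU Cf Ux fmax; rewrite leNgt; apply/negP => c0.
have z0 : 'D_v f x = 0 by apply: deriv_at_max fmax => //; exact: Ck_pred.
set c := 'D_v ('D_v f) x in c0.
have Cv := CkD v Cf.
have e0 : 0 < c / 2 by rewrite divr_gt0.
have [d d0 dP] := near_line v (near_deriv_cont v oU Cv Ux e0).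
have Uyd (t : R) : 0 <= t <= d -> U (x + t *: v) /\ `|'D_v ('D_v f) (x + t *: v) - c| <= c / 2.
  by move=> /andP[t0 t1]; apply: dP; rewrite ger0_norm.
have grow (t : R) : 0 < t <= d -> 0 < 'D_v f (x + t *: v).
  move=> /andP[t0 t1].
  have : `|'D_v f (x + t *: v) - 'D_v f x - t * c| <= t * (c / 2).
    apply: (@mvt_line R E ('D_v f) x (t *: v) (t * c) (t * (c / 2))) => s /andP[s0 s1].
    have [Uy yP] : (U (x + s *: (t *: v)) /\
         `|'D_v ('D_v f) (x + s *: (t *: v)) - c| <= c / 2).
      rewrite scalerA; apply: Uyd; rewrite mulr_ge0 ?(ltW t0) //=.
      by apply: le_trans t1; rewrite ler_piMl // ltW.
    have [d4 ->] := is_derive_dirZ t (Ck_der Cv Uy : derivable ('D_v f) _ v).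
    split => //; rewrite -mulrBr normrM (gtr0_norm t0); apply: ler_wpM2l => //; exact: ltW.
  rewrite z0 subr0 ler_norml => /andP[+ _].
  have p : 0 < t * c by rewrite mulr_gt0.
  by lra.
have [] := @MVT R (fun t => f (x + t *: v)) (fun t => 'D_v f (x + t *: v)) 0 d d0.
- move=> t; rewrite in_itv /= => /andP[t0 t1]; apply: is_derive_line.
  have [Uy _] : _ /\ _ := Uyd t ltac:(by rewrite !ltW).
  exact: Ck_der Cf Uy.
- apply: derivable_within_continuous => t; rewrite in_itv /= => t01.
  have [Uy _] := Uyd t t01.
  by have [] := is_derive_line (Ck_der Cf Uy : derivable f (x + t *: v) v).
move=> t; rewrite in_itv /= => /andP[t0 t1]; rewrite scale0r addr0 subr0 => fe.
have dd : 0 <= d <= d by rewrite lexx ltW.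
have [Ud _] := Uyd d dd.
have := fmax _ Ud; rewrite -subr_le0 fe leNgt mulr_gt0 //.
by apply: grow; rewrite t0 ltW.
Qed.

End SecondOrder.

(** * Linear algebra of the flat SU(3)-structure *)

Section Alt6.
Context {R : realType}.
Local Notation E := 'rV[R]_6.

Definition o6 (k : nat) : 'I_6 := inord k.

Lemma o6E k : (k < 6)%N -> o6 k = k :> nat.
Proof. exact: inordK. Qed.

Lemma ord6_cases (P : 'I_6 -> Prop) :
  P (o6 0) -> P (o6 1) -> P (o6 2) -> P (o6 3) -> P (o6 4) -> P (o6 5) -> forall i, P i.
Proof.
move=> P0 P1 P2 P3 P4 P5 i; have -> : i = o6 i by apply/val_inj; rewrite /= o6E.
by case: i => -[|[|[|[|[|[|]]]]]].
Qed.

Lemma big_ord6 (T : Type) (idx : T) (op : Monoid.com_law idx) (F : 'I_6 -> T) :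
  \big[op/idx]_(i < 6) F i =
  op (F (o6 0)) (op (F (o6 1)) (op (F (o6 2)) (op (F (o6 3)) (op (F (o6 4)) (F (o6 5)))))).
Proof.
rewrite !big_ord_recl big_ord0 Monoid.mulm1.
by do 5!(congr (op _ _); first by congr F; apply/val_inj; rewrite /= o6E);
  congr F; apply/val_inj; rewrite /= o6E.
Qed.

(** Contraction of a six-index array with the Levi-Civita symbol, without factorials. Products of
    forms of total degree six are written this way, so that reordering factors amounts to the swap
    lemmas below. *)
Definition alt6 (V : lmodType R) (T : 'I_6 -> 'I_6 -> 'I_6 -> 'I_6 -> 'I_6 -> 'I_6 -> V) : V :=
  \sum_(s : 'S_6) ((-1) ^+ s : R) *:
    T (s (o6 0)) (s (o6 1)) (s (o6 2)) (s (o6 3)) (s (o6 4)) (s (o6 5)).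

Section Basic.
Variable V : lmodType R.
Implicit Types T : 'I_6 -> 'I_6 -> 'I_6 -> 'I_6 -> 'I_6 -> 'I_6 -> V.

Lemma eq_alt6 T T' : (forall a b c d e g, T a b c d e g = T' a b c d e g) ->
  alt6 T = alt6 T'.
Proof. by move=> TT'; apply: eq_bigr => s _; rewrite TT'. Qed.

Lemma alt6_add T T' : alt6 (fun a b c d e g => T a b c d e g + T' a b c d e g) =
  alt6 T + alt6 T'.
Proof. by rewrite -big_split /=; apply: eq_bigr => s _; rewrite scalerDr. Qed.

Lemma alt6_scale (k : R) T : alt6 (fun a b c d e g => k *: T a b c d e g) = k *: alt6 T.
Proof. by rewrite scaler_sumr; apply: eq_bigr => s _; rewrite !scalerA mulrC. Qed.

Lemma alt6_opp T : alt6 (fun a b c d e g => - T a b c d e g) = - alt6 T.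
Proof. by rewrite -scaleN1r -alt6_scale; apply: eq_alt6 => *; rewrite scaleN1r. Qed.

Lemma alt6_sum (I : finType) (T : I -> 'I_6 -> 'I_6 -> 'I_6 -> 'I_6 -> 'I_6 -> 'I_6 -> V) :
  alt6 (fun a b c d e g => \sum_i T i a b c d e g) = \sum_i alt6 (T i).
Proof. by rewrite exchange_big; apply: eq_bigr => s _; rewrite scaler_sumr. Qed.

Lemma alt6_perm T (t : 'S_6) :
  \sum_(s : 'S_6) ((-1) ^+ s : R) *: T (s (t (o6 0))) (s (t (o6 1))) (s (t (o6 2)))
     (s (t (o6 3))) (s (t (o6 4))) (s (t (o6 5))) = ((-1) ^+ t : R) *: alt6 T.
Proof.
rewrite /alt6 [in RHS](reindex_inj (mulgI t)) /= scaler_sumr; apply: eq_bigr => s _.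
by rewrite scalerA odd_permM signr_addb mulrA -signr_addb addbb mul1r !permM.
Qed.

Lemma alt6_swap01 T : alt6 (fun a b c d e g => T b a c d e g) = - alt6 T.
Proof.
have := alt6_perm T (tperm (o6 0) (o6 1)).
rewrite odd_tperm -val_eqE /= !o6E // scaleN1r => <-.
by apply: eq_bigr => s _; rewrite tpermL tpermR !tpermD // -val_eqE /= !o6E.
Qed.

Lemma alt6_swap12 T : alt6 (fun a b c d e g => T a c b d e g) = - alt6 T.
Proof.
have := alt6_perm T (tperm (o6 1) (o6 2)).
rewrite odd_tperm -val_eqE /= !o6E // scaleN1r => <-.
by apply: eq_bigr => s _; rewrite tpermL tpermR !tpermD // -val_eqE /= !o6E.
Qed.

Lemma alt6_swap23 T : alt6 (fun a b c d e g => T a b d c e g) = - alt6 T.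
Proof.
have := alt6_perm T (tperm (o6 2) (o6 3)).
rewrite odd_tperm -val_eqE /= !o6E // scaleN1r => <-.
by apply: eq_bigr => s _; rewrite tpermL tpermR !tpermD // -val_eqE /= !o6E.
Qed.

Lemma alt6_swap34 T : alt6 (fun a b c d e g => T a b c e d g) = - alt6 T.
Proof.
have := alt6_perm T (tperm (o6 3) (o6 4)).
rewrite odd_tperm -val_eqE /= !o6E // scaleN1r => <-.
by apply: eq_bigr => s _; rewrite tpermL tpermR !tpermD // -val_eqE /= !o6E.
Qed.

Lemma alt6_swap45 T : alt6 (fun a b c d e g => T a b c d g e) = - alt6 T.
Proof.
have := alt6_perm T (tperm (o6 4) (o6 5)).
rewrite odd_tperm -val_eqE /= !o6E // scaleN1r => <-.
by apply: eq_bigr => s _; rewrite tpermL tpermR !tpermD // -val_eqE /= !o6E.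
Qed.

Definition lin_exp (h : E -> V) := forall u, h u = \sum_(j < 6) u 0 j *: h (evec j).

Definition multilin6 (M : E -> E -> E -> E -> E -> E -> V) :=
  [/\ forall b c d e g, lin_exp (fun a => M a b c d e g),
      forall a c d e g, lin_exp (fun b => M a b c d e g),
      forall a b d e g, lin_exp (fun c => M a b c d e g) &
     [/\ forall a b c e g, lin_exp (fun d => M a b c d e g),
      forall a b c d g, lin_exp (fun e => M a b c d e g) &
      forall a b c d e, lin_exp (fun g => M a b c d e g)]].

Definition alt6_at (M : E -> E -> E -> E -> E -> E -> V) (p : 'I_6 -> E) : V :=
  \sum_(s : 'S_6) ((-1) ^+ s : R) *: M (p (s (o6 0))) (p (s (o6 1))) (p (s (o6 2)))
    (p (s (o6 3))) (p (s (o6 4))) (p (s (o6 5))).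

Lemma scale_sum_exchange (I J : finType) (a : I -> R) (b : I -> J -> R) (X : I -> J -> V) :
  \sum_i a i *: \sum_j b i j *: X i j = \sum_j \sum_i (a i * b i j) *: X i j.
Proof.
rewrite exchange_big /=; apply: eq_bigr => i _; rewrite scaler_sumr.
by apply: eq_bigr => j _; rewrite scalerA.
Qed.

Lemma alt6_at_expand M p : multilin6 M ->
  alt6_at M p = \sum_a \sum_b \sum_c \sum_d \sum_e \sum_g
    (\sum_(s : 'S_6) ((-1) ^+ s : R) * p (s (o6 0)) 0 a * p (s (o6 1)) 0 b * p (s (o6 2)) 0 c
      * p (s (o6 3)) 0 d * p (s (o6 4)) 0 e * p (s (o6 5)) 0 g) *:
    M (evec a) (evec b) (evec c) (evec d) (evec e) (evec g).
Proof.
move=> [M0 M1 M2 [M3 M4 M5]]; rewrite /alt6_at.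
under eq_bigr do rewrite M0.
rewrite scale_sum_exchange; apply: eq_bigr => a _.
under eq_bigr do rewrite M1.
rewrite scale_sum_exchange; apply: eq_bigr => b _.
under eq_bigr do rewrite M2.
rewrite scale_sum_exchange; apply: eq_bigr => c _.
under eq_bigr do rewrite M3.
rewrite scale_sum_exchange; apply: eq_bigr => d _.
under eq_bigr do rewrite M4.
rewrite scale_sum_exchange; apply: eq_bigr => e _.
under eq_bigr do rewrite M5.
rewrite scale_sum_exchange; apply: eq_bigr => g _.
by rewrite scaler_suml.
Qed.

(** The second matrix has basis vectors as columns, so multiplying by it selects columns of [f]; the
    left side is the determinant of the product. *)
Lemma alt_coef_det (f : 'M[R]_6) (a b c d e g : 'I_6) :
  \sum_(s : 'S_6) ((-1) ^+ s : R) * row (s (o6 0)) f 0 a * row (s (o6 1)) f 0 b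
      * row (s (o6 2)) f 0 c * row (s (o6 3)) f 0 d * row (s (o6 4)) f 0 e
      * row (s (o6 5)) f 0 g =
  \det f * \det (\matrix_(i, k) (i == nth a [:: a; b; c; d; e; g] k)%:R).
Proof.
rewrite -det_mulmx -det_tr; apply: eq_bigr => s _.
rewrite big_ord6 /= -!mulrA; congr (_ * _).
have sel k l : (f *m \matrix_(i, k) (i == nth a [:: a; b; c; d; e; g] k)%:R) k l =
    f k (nth a [:: a; b; c; d; e; g] l).
  rewrite !mxE (bigD1 (nth a [:: a; b; c; d; e; g] l)) //= !mxE eqxx mulr1.
  by rewrite big1 ?addr0 // => i /negbTE il; rewrite !mxE il mulr0.
by rewrite ![_^T _ _]mxE !sel !o6E // !mxE.
Qed.

(** Antisymmetrizing a multilinear function of six vectors gives a top-degree form, which scales by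
    [\det f]. This is the passage between frame expressions and coordinate expressions. *)
Lemma alt6_at_mx M (f : 'M[R]_6) : multilin6 M ->
  alt6_at M (fun i => row i f) =
  \det f *: alt6 (fun a b c d e g => M (evec a) (evec b) (evec c) (evec d) (evec e) (evec g)).
Proof.
move=> mM.
have -> : alt6 (fun a b c d e g => M (evec a) (evec b) (evec c) (evec d) (evec e) (evec g)) =
    alt6_at M (fun i => row i 1%:M).
  by apply: eq_bigr => s _; rewrite !row1.
rewrite !alt6_at_expand // scaler_sumr.
do 5!(apply: eq_bigr => ? _; rewrite scaler_sumr); apply: eq_bigr => ? _.
by rewrite !alt_coef_det det1 mul1r scalerA.
Qed.

End Basic.

Lemma lin_exp_linear (V : lmodType R) (h : E -> V) :
  (forall a u v, h (a *: u + v) = a *: h u + h v) -> lin_exp h.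
Proof.
move=> hl u; pose hL : {linear E -> V} := HB.pack h (GRing.isLinear.Build _ _ _ _ _ hl).
rewrite {1}(row_sum_evec u) -[h]/(hL : E -> V) linear_sum; apply: eq_bigr => i _.
by rewrite linearZ.
Qed.

End Alt6.

Section StarAlt.
Context {R : realType}.

(** In the determinant of [star0] the first k rows are basis vectors. Expanding it over permutations
    s therefore forces the multi-index to agree with s on the first k slots, and the sum over
    multi-indices disappears. *)
Lemma star0E k l (V : lmodType R) (al : kform k 'rV[R]_(k + l) V) v :
  star0 al v = (k`!%:R : R)^-1 *: \sum_(s : 'S_(k + l)) ((-1) ^+ s : R) *:
    ((\prod_(j < l) v j 0 (s (rshift k j))) *: al (fun i => evec (s (lshift l i)))).
Proof.
rewrite /star0; congr (_ *: _).
transitivity (\sum_(I : {ffun 'I_k -> 'I_(k + l)}) \sum_(s : 'S_(k + l))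
  ((-1) ^+ s * ((\prod_(i < k) (I i == s (lshift l i))%:R) *
     \prod_(j < l) v j 0 (s (rshift k j)))) *: al (fun i => evec (I i))).
  apply: eq_bigr => I _; rewrite -scaler_suml; congr (_ *: _).
  apply: eq_bigr => s _; congr (_ * _); rewrite big_split_ord /=; congr (_ * _).
    apply: eq_bigr => i _; rewrite mxE /cat_vec.
    by rewrite (unsplitK (inl i)) /evec mxE eqxx /= eq_sym.
  by apply: eq_bigr => j _; rewrite mxE /cat_vec (unsplitK (inr j)).
rewrite exchange_big /=; apply: eq_bigr => s _.
rewrite (bigD1 [ffun i => s (lshift l i)]) //= [X in _ + X]big1 ?addr0.
  rewrite big1 ?mul1r; last by move=> i _; rewrite ffunE eqxx.
  by rewrite scalerA; congr (_ *: al _); apply/funext => i; rewrite ffunE.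
move=> I /eqP In; have [i Ii] : exists i, I i != s (lshift l i).
  apply/existsP; rewrite -negb_forall; apply/negP => /forallP H; apply: In.
  by apply/ffunP => i; rewrite ffunE; apply/eqP.
by rewrite (bigD1 i) //= (negbTE Ii) !(mul0r, mulr0) scale0r.
Qed.

End StarAlt.

(** * Small determinants that reduce by computation *)

Section Laplace.
Variable K : comPzRingType.
Implicit Types F : nat -> nat -> K.

Fixpoint nsum (m : nat) (g : nat -> K) : K :=
  match m with 0 => 0 | m'.+1 => nsum m' g + g m' end.

(** [Nat.leb] makes it reduce on numerals; it is [bump] by [nbumpE]. *)
Definition nbump (j k : nat) : nat := if Nat.leb j k then k.+1 else k.

(* Determinants over nat indices, which reduce to polynomials that [ring] decides. *)
Fixpoint ndet (n : nat) F : K :=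
  match n with
  | 0 => 1
  | n'.+1 => nsum n (fun j => (-1) ^+ j * F 0%N j * ndet n' (fun i k => F i.+1 (nbump j k)))
  end.

Lemma nbumpE j k : nbump j k = bump j k.
Proof.
rewrite /nbump /bump; case: (PeanoNat.Nat.leb_spec j k) => [/ssrnat.leP -> //|/ssrnat.ltP].
by rewrite ltnNge => /negbTE ->.
Qed.

Lemma nsumE m g : nsum m g = \sum_(i < m) g i.
Proof. by elim: m => [|m IH]; rewrite ?big_ord0 // big_ord_recr /= IH. Qed.

Lemma det_ndet n F : \det (\matrix_(i < n, j < n) F i j) = ndet n F.
Proof.
elim: n F => [|n IH] F; first by rewrite det_mx00.
rewrite (expand_det_row _ ord0) -[RHS]/(nsum n.+1 (fun j => (-1) ^+ j * F 0%N j *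
  ndet n (fun i k => F i.+1 (nbump j k)))) nsumE; apply: eq_bigr => j _.
rewrite mxE /cofactor add0n -IH mulrA [_ * (-1) ^+ _]mulrC; congr (_ * \det _).
by apply/matrixP => i k; rewrite !mxE nbumpE.
Qed.

Lemma ndet_ext n F F' : (forall i j, (i < n)%N -> (j < n)%N -> F i j = F' i j) ->
  ndet n F = ndet n F'.
Proof.
move=> FF; rewrite -!det_ndet; congr (\det _); apply/matrixP => i j.
by rewrite !mxE FF.
Qed.
End Laplace.

(** * The model forms [omega0] and [Omega0] in coordinates *)

Section Flat.
Context {R : realType}.
Local Notation E := 'rV[R]_6.

Definition tup (n : nat) (s : seq E) : 'I_n -> E := fun i => nth 0 s i.
Arguments tup : clear implicits.

Lemma tup2E (v : 'I_2 -> E) : v = tup 2 [:: v ord0; v ord_max].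
Proof. by apply/funext => -[[|[|//]] p]; rewrite /tup /=; congr v; apply/val_inj. Qed.

Lemma tup3E (v : 'I_3 -> E) :
  v = tup 3 [:: v (inord 0); v (inord 1); v (inord 2)].
Proof.
by apply/funext => -[[|[|[|//]]] p]; rewrite /tup /=; congr v; apply/val_inj; rewrite /= inordK.
Qed.

Lemma alt6_det (A : nat -> 'I_6 -> R) :
  alt6 (V := R) (fun a b c d e g => A 0%N a * A 1%N b * A 2%N c * A 3%N d * A 4%N e * A 5%N g) =
  ndet 6 (fun i j => A i (o6 j)).
Proof.
rewrite -det_ndet; apply: eq_bigr => s _; rewrite /GRing.scale /= !mulrA.
rewrite big_ord6 !mxE !o6E // !mulrA.
have oK (i : 'I_6) : o6 i = i by apply/val_inj; rewrite /= o6E.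
by rewrite !oK.
Qed.

Definition om0 (u v : E) : R :=
  u 0 (o6 0) * v 0 (o6 1) - u 0 (o6 1) * v 0 (o6 0)
  + (u 0 (o6 2) * v 0 (o6 3) - u 0 (o6 3) * v 0 (o6 2))
  + (u 0 (o6 4) * v 0 (o6 5) - u 0 (o6 5) * v 0 (o6 4)).

Lemma omega0E v : omega0 v = om0 (v ord0) (v ord_max).
Proof.
rewrite /omega0 /om0 /xco /yco !big_ord_recl big_ord0 /= addr0 addrA.
by rewrite ![v ord_max 0 _ * _]mulrC.
Qed.

Lemma J0E (v : E) k : J0 v 0 (o6 k) =
  (if odd (o6 k) then v 0 (inord (o6 k).-1) else - v 0 (inord (o6 k).+1)).
Proof. by rewrite mxE. Qed.

Lemma J0_coords (v : E) :
  [/\ J0 v 0 (o6 0) = - v 0 (o6 1), J0 v 0 (o6 1) = v 0 (o6 0),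
      J0 v 0 (o6 2) = - v 0 (o6 3), J0 v 0 (o6 3) = v 0 (o6 2) &
      J0 v 0 (o6 4) = - v 0 (o6 5) /\ J0 v 0 (o6 5) = v 0 (o6 4)].
Proof. by rewrite !J0E !o6E. Qed.

(** Real and, below, imaginary part of (a + i a')(b + i b')(c + i c'). *)
Definition re3 (a b c a' b' c' : R) := a * b * c - a * b' * c' - a' * b * c' - a' * b' * c.
Definition im3 (a b c a' b' c' : R) := a * b * c' + a * b' * c + a' * b * c - a' * b' * c'.

(** Leibniz expansion of the complex 3 by 3 determinant with rows u, v, w; [h] takes the real or
    imaginary part of each product. *)
Definition alt3 (h : R -> R -> R -> R -> R -> R -> R) (u v w : E) : R :=
  let z1 (i j : nat) := u 0 (o6 i) in
  h (u 0 (o6 0)) (v 0 (o6 2)) (w 0 (o6 4)) (u 0 (o6 1)) (v 0 (o6 3)) (w 0 (o6 5))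
  - h (u 0 (o6 0)) (v 0 (o6 4)) (w 0 (o6 2)) (u 0 (o6 1)) (v 0 (o6 5)) (w 0 (o6 3))
  - h (u 0 (o6 2)) (v 0 (o6 0)) (w 0 (o6 4)) (u 0 (o6 3)) (v 0 (o6 1)) (w 0 (o6 5))
  + h (u 0 (o6 2)) (v 0 (o6 4)) (w 0 (o6 0)) (u 0 (o6 3)) (v 0 (o6 5)) (w 0 (o6 1))
  + h (u 0 (o6 4)) (v 0 (o6 0)) (w 0 (o6 2)) (u 0 (o6 5)) (v 0 (o6 1)) (w 0 (o6 3))
  - h (u 0 (o6 4)) (v 0 (o6 2)) (w 0 (o6 0)) (u 0 (o6 5)) (v 0 (o6 3)) (w 0 (o6 1)).

Lemma Omega0E u v w : Omega0 (tup 3 [:: u; v; w]) = Complex (alt3 re3 u v w) (alt3 im3 u v w).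
Proof.
pose F (i j : nat) : R[i] := let p := nth 0 [:: u; v; w] i in
   Complex (p 0 (o6 j.*2)) (p 0 (o6 j.*2.+1)).
rewrite /Omega0.
have -> : \matrix_(i < 3, j < 3) zco j (tup 3 [:: u; v; w] i) = \matrix_(i < 3, j < 3) F i j.
  by apply/matrixP => i j; rewrite !mxE.
rewrite det_ndet /= /nbump /= /F /= !expr0 expr1 sqrrN expr1n.
rewrite !(add0r, mul1r, mulr1, expr0, expr1).
set a0 := u 0 _; set a1 := u 0 (o6 1); set a2 := u 0 (o6 2).
set a3 := u 0 (o6 3); set a4 := u 0 (o6 4); set a5 := u 0 (o6 5).
set b0 := v 0 (o6 0); set b1 := v 0 (o6 1); set b2 := v 0 (o6 2).
set b3 := v 0 (o6 3); set b4 := v 0 (o6 4); set b5 := v 0 (o6 5).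
set c0 := w 0 (o6 0); set c1 := w 0 (o6 1); set c2 := w 0 (o6 2).
set c3 := w 0 (o6 3); set c4 := w 0 (o6 4); set c5 := w 0 (o6 5).
rewrite !mulN1r /alt3 /re3 /im3 -/a0 -/a1 -/a2 -/a3 -/a4 -/a5 -/b0 -/b1 -/b2 -/b3 -/b4 -/b5.
rewrite -/c0 -/c1 -/c2 -/c3 -/c4 -/c5.
simpc.
by congr Complex; ring.
Qed.

End Flat.
Arguments tup {R} n s _.

Section FlatIdentities.
Context {R : realType}.
Local Notation E := 'rV[R]_6.

Definition kd (k : nat) (c : 'I_6) : R := (c == o6 k)%:R.
Definition nkd (k j : nat) : R := if Nat.eqb j k then 1 else 0.

Lemma kd_o6 k j : (k < 6)%N -> (j < 6)%N -> kd k (o6 j) = nkd k j.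
Proof.
move=> k6 j6; rewrite /kd /nkd -val_eqE /= !o6E //.
by case: (PeanoNat.Nat.eqb_spec j k) => [->|/eqP/negbTE ->]; rewrite ?eqxx.
Qed.

Lemma evec_kd c k : evec c 0 (o6 k) = kd k c :> R.
Proof. by rewrite /evec mxE eqxx eq_sym. Qed.

Lemma om0_evec c d : om0 (evec c) (evec d) =
  \sum_(k < 3) (kd k.*2 c * kd k.*2.+1 d - kd k.*2 d * kd k.*2.+1 c).
Proof.
rewrite /om0 !evec_kd !big_ord_recl big_ord0 /= /bump -!/(addn 1 _) !add1n /=; ring.
Qed.

(** Both terms of each dx_k /\ dy_k have the same alternating sum, whence the 2. *)
Lemma alt6_om01 (X : 'I_6 -> 'I_6 -> 'I_6 -> 'I_6 -> R) :
  alt6 (V := R) (fun a b c d e g => om0 (evec a) (evec b) * X c d e g) =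
  2 * \sum_(k < 3) alt6 (V := R) (fun a b c d e g => kd k.*2 a * kd k.*2.+1 b * X c d e g).
Proof.
transitivity (alt6 (V := R) (fun a b c d e g => \sum_(k < 3)
   (kd k.*2 a * kd k.*2.+1 b * X c d e g - kd k.*2 b * kd k.*2.+1 a * X c d e g))).
  by apply: eq_alt6 => *; rewrite om0_evec mulr_suml; apply: eq_bigr => k _; rewrite mulrBl.
rewrite alt6_sum mulr_sumr; apply: eq_bigr => k _.
rewrite alt6_add alt6_opp.
rewrite (alt6_swap01 (fun a b c d e g => kd k.*2 a * kd k.*2.+1 b * X c d e g)).
by rewrite opprK mulrDl mul1r.
Qed.

Lemma ndet_nkd n k (F : nat -> nat -> R) : (k <= n)%N -> (forall j, F 0%N j = nkd k j) ->
  ndet n.+1 F = (-1) ^+ k * ndet n (fun i l => F i.+1 (nbump k l)).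
Proof.
move=> kn F0; rewrite -[LHS]/(nsum n.+1 (fun j => (-1) ^+ j * F 0%N j *
  ndet n (fun i k => F i.+1 (nbump j k)))) nsumE.
have kn' : (k < n.+1)%N by [].
rewrite (bigD1 (Ordinal kn')) //= F0 /nkd PeanoNat.Nat.eqb_refl mulr1 big1 ?addr0 // => j jk.
rewrite F0 /nkd; case: (PeanoNat.Nat.eqb_spec j k) => [e|]; last by rewrite mulr0 mul0r.
by move/negP: jk; case; apply/eqP/val_inj.
Qed.

(** Laplace expansion along two rows that are basis vectors. Deleting column 2j moves column 2j + 1
    to place 2j, so both expansions bump at [j.*2], and their equal signs cancel. *)
Lemma alt6_kd2 (j : nat) (X : nat -> 'I_6 -> R) : (j < 3)%N ->
  alt6 (V := R) (fun a b c d e g =>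
     kd j.*2 a * kd j.*2.+1 b * (X 0%N c * X 1%N d * X 2%N e * X 3%N g)) =
  ndet 4 (fun i p => X i (o6 (nbump j.*2 (nbump j.*2 p)))).
Proof.
move=> j3.
have [j1 j2] : (j.*2 < 6)%N /\ (j.*2.+1 < 6)%N by case: j j3 => [|[|[|]]].
pose A i := if i is i'.+1 then if i' is i''.+1 then X i'' else kd j.*2.+1 else kd j.*2.
transitivity (ndet 6 (fun i p => A i (o6 p))).
  by rewrite -alt6_det; apply: eq_alt6 => *; rewrite !mulrA.
transitivity (ndet 6 (fun i p => if i is i'.+1 then if i' is i''.+1 then X i'' (o6 p)
   else nkd j.*2.+1 p else nkd j.*2 p)).
  by apply: ndet_ext; move=> [|[|i]] p // _ p6; rewrite /A kd_o6.
rewrite (@ndet_nkd 5 j.*2) // (@ndet_nkd 4 j.*2).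
- by rewrite mulrA -expr2 sqrr_sign mul1r.
- by case: j j3 {A j1 j2} => [|[|[|]]].
move=> p /=; rewrite /nkd /nbump; case: PeanoNat.Nat.leb_spec => pj.
  case: (PeanoNat.Nat.eqb_spec p.+1 j.*2.+1) => [[e]|e]; last first.
    by case: (PeanoNat.Nat.eqb_spec p j.*2) => // e'; case: e; rewrite e'.
  by rewrite e PeanoNat.Nat.eqb_refl.
case: (PeanoNat.Nat.eqb_spec p j.*2.+1) => [e|_]; last first.
  by case: (PeanoNat.Nat.eqb_spec p j.*2) => // e; move/ssrnat.ltP: pj; rewrite e ltnn.
by move/ssrnat.ltP: pj; rewrite e ltnNge leqnSn.
Qed.

(** The constant is 2 * 2 for the slots of the two copies of omega, times 2 for the order of the two
    coordinate planes complementary to the one that l and m fill. *)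
Lemma alt6_om0_om0 (l m : E) :
  alt6 (V := R) (fun a b c d e g =>
    om0 (evec a) (evec b) * (om0 (evec c) (evec d) * (l 0 e * m 0 g))) = 8 * om0 l m.
Proof.
have swap (T : 'I_6 -> 'I_6 -> 'I_6 -> 'I_6 -> 'I_6 -> 'I_6 -> R) :
    alt6 T = alt6 (fun a b c d e g => T c d a b e g).
  have e4 := alt6_swap12 (fun a b c d e g => T b d a c e g).
  have e3 := alt6_swap23 (fun a b c d e g => T b c a d e g).
  have e2 := alt6_swap01 (fun a b c d e g => T a c b d e g).
  by rewrite e4 e3 e2 (alt6_swap12 T) !opprK.
rewrite alt6_om01; under eq_bigr => k _.
  rewrite swap (_ : alt6 _ = alt6 (fun a b c d e g =>
    om0 (evec a) (evec b) * (kd k.*2 c * kd k.*2.+1 d * (l 0 e * m 0 g)))); last first.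
    by apply: eq_alt6 => *; rewrite mulrCA.
  rewrite alt6_om01; over.
rewrite -mulr_sumr mulrA.
rewrite !big_ord_recl !big_ord0.
have main (k j : nat) : (k < 3)%N -> (j < 3)%N ->
   alt6 (V := R) (fun a b c d e g =>
     kd j.*2 a * kd j.*2.+1 b * (kd k.*2 c * kd k.*2.+1 d * (l 0 e * m 0 g))) =
   ndet 4 (fun i p => nth (fun=> 0) [:: nkd k.*2; nkd k.*2.+1;
     (fun q => l 0 (o6 q)); (fun q => m 0 (o6 q))] i (nbump j.*2 (nbump j.*2 p))).
  move=> k3 j3.
  have lt2 i : (i < 3)%N -> (i.*2 < 6)%N /\ (i.*2.+1 < 6)%N by case: i => [|[|[|]]].
  have [k1 k2] := lt2 k k3; have [j1 j2] := lt2 j j3.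
  pose X i := nth (fun=> 0) [:: kd k.*2; kd k.*2.+1; (fun q => l 0 q); (fun q => m 0 q)] i.
  transitivity (ndet 4 (fun i p => X i (o6 (nbump j.*2 (nbump j.*2 p))))).
    by rewrite -alt6_kd2 //; apply: eq_alt6 => *; rewrite !mulrA.
  apply: ndet_ext => i p i4 p4.
  have bS x : (nbump j.*2 x <= x.+1)%N.
    by rewrite nbumpE /bump -[x.+1]add1n leq_add2r leq_b1.
  have p6 : (nbump j.*2 (nbump j.*2 p) < 6)%N.
    by apply: leq_ltn_trans (bS _) _; rewrite ltnS; apply: leq_ltn_trans (bS _) _.
  by case: i i4 => [|[|[|[|//]]]] _; rewrite /X /= ?kd_o6.
rewrite !main // /= /nbump /nkd /= /om0; ring.
Qed.

(** Half of omega0 /\ omega0 in the normalization of [wedgef]; compare [wedge22E]. *)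
Definition om0_sq (u v w x : E) : R :=
  om0 u v * om0 w x - om0 u w * om0 v x + om0 u x * om0 v w.

Lemma alt6_om0_star (u v w x : E) :
  alt6 (V := R) (fun a b c d e g =>
    om0 (evec a) (evec b) * (u 0 c * v 0 d * w 0 e * x 0 g)) = 2 * om0_sq u v w x.
Proof.
pose X i (q : 'I_6) := nth 0 [:: u; v; w; x] i 0 q.
rewrite (alt6_om01 (fun c d e g => X 0%N c * X 1%N d * X 2%N e * X 3%N g)).
rewrite !big_ord_recl !big_ord0 !alt6_kd2 //; congr (_ * _).
rewrite /= /X /nbump /= /om0_sq /om0; ring.
Qed.

(** In dimension six the star of omega is omega^2 / 2. This turns coclosedness of omega into
    closedness of omega^2. *)
Lemma star0_omega0 (v : 'I_4 -> E) : star0 (k := 2) (l := 4) omega0 v =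
  om0_sq (v (inord 0)) (v (inord 1)) (v (inord 2)) (v (inord 3)).
Proof.
rewrite star0E; apply: (@mulfI R 2) => //; rewrite -alt6_om0_star.
set S := (X in _ *: X).
have -> : 2 * (2`!%:R^-1 *: S) = S by rewrite -[_ *: S]/(_ * S) mulrA mulfV // mul1r.
apply: eq_bigr => s _.
rewrite omega0E; congr (_ *: _); rewrite /GRing.scale /= mulrC; congr (om0 _ _ * _).
- by congr (evec (s _)); apply/val_inj; rewrite /= o6E.
- by congr (evec (s _)); apply/val_inj; rewrite /= o6E.
rewrite !big_ord_recl big_ord0 mulr1 !mulrA.
congr (_ * _ * _ * _); congr (v _ 0 (s _)); apply/val_inj; by rewrite /= ?o6E ?inordK.
Qed.

(** Omega has type (3,0): inserting J in a slot multiplies it by i. *)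
Lemma alt3_J (u v w : E) :
  alt3 re3 (J0 u) v w = - alt3 im3 u v w /\ alt3 im3 (J0 u) v w = alt3 re3 u v w.
Proof.
have [e0 e1 e2 e3 [e4 e5]] := J0_coords u.
by rewrite /alt3 /re3 /im3 e0 e1 e2 e3 e4 e5; split; ring.
Qed.

(* The real form of (l - i l o J) /\ Omega = 0, a (4,0)-form on C^3. *)
Lemma wedge_J_Omega (l : E) (p q r t : E) :
  dotv l p * alt3 im3 q r t - dotv l q * alt3 im3 p r t
  + dotv l r * alt3 im3 p q t - dotv l t * alt3 im3 p q r =
  dotv l (J0 p) * alt3 re3 q r t - dotv l (J0 q) * alt3 re3 p r t
  + dotv l (J0 r) * alt3 re3 p q t - dotv l (J0 t) * alt3 re3 p q r.
Proof.
rewrite /dotv !big_ord6 /=.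
have [p0 p1 p2 p3 [p4 p5]] := J0_coords p; rewrite p0 p1 p2 p3 p4 p5 {p0 p1 p2 p3 p4 p5}.
have [p0 p1 p2 p3 [p4 p5]] := J0_coords q; rewrite p0 p1 p2 p3 p4 p5 {p0 p1 p2 p3 p4 p5}.
have [p0 p1 p2 p3 [p4 p5]] := J0_coords r; rewrite p0 p1 p2 p3 p4 p5 {p0 p1 p2 p3 p4 p5}.
have [p0 p1 p2 p3 [p4 p5]] := J0_coords t; rewrite p0 p1 p2 p3 p4 p5 {p0 p1 p2 p3 p4 p5}.
rewrite /alt3 /re3 /im3; ring.
Qed.

Lemma alt3_nondeg (u : E) : (forall v w, alt3 re3 u v w = 0) -> u = 0.
Proof.
move=> H; have V k j : evec j 0 (o6 k) = kd k j :> R by exact: evec_kd.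
have h a b := H (evec (o6 a)) (evec (o6 b)).
(* Each of these six pairs of basis vectors isolates one coordinate of [u], up to sign. *)
have := (h 2 4, h 3 4, h 0 4, h 1 4, h 0 2, h 1 2).
rewrite /h /alt3 /re3 !V !kd_o6 // /nkd /= => -[[[[[]]]]].
rewrite !(mulr0, mulr1, subr0, sub0r, add0r, addr0, oppr0).
by move=> *; apply/rowP; apply: ord6_cases; rewrite mxE; lra.
Qed.

End FlatIdentities.

(** * The vector dual to the 5-form F /\ P *)

Section Embedding.
Context {R : realType} (V : lmodType R).
Local Notation E := 'rV[R]_6.

Definition emb5 (t : 'S_5) : 'S_6 := lift_perm ord_max ord_max t.

Lemma odd_emb5 t : odd_perm (emb5 t) = odd_perm t.
Proof. by rewrite odd_lift_perm addbb. Qed.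

Lemma emb5_lshift t (i : 'I_5) : emb5 t (lshift 1 i) = lshift 1 (t i).
Proof.
have e (j : 'I_5) : lshift 1 j = lift ord_max j.
  by apply/val_inj; rewrite /= /bump leqNgt ltn_ord.
by rewrite !e /emb5 lift_perm_lift.
Qed.

Lemma emb5_last t : emb5 t (rshift 5 ord0) = rshift 5 ord0.
Proof.
have -> : rshift 5 (ord0 : 'I_1) = ord_max by apply/val_inj.
by rewrite /emb5 lift_perm_id.
Qed.

Lemma o6_lshift k (H : (k < 5)%N) : o6 k = lshift 1 (inord k : 'I_5).
Proof. by apply/val_inj; rewrite /= o6E ?inordK // ltnW. Qed.

Lemma o6_last : o6 5 = rshift 5 (ord0 : 'I_1).
Proof. by apply/val_inj; rewrite /= o6E. Qed.

(** Permuting the first five slots by t reindexes the outer sum by [emb5 t], whose sign cancels that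
    of t. All 5! inner terms therefore contribute equally. *)
Lemma sum_emb5 (T : 'I_6 -> 'I_6 -> 'I_6 -> 'I_6 -> 'I_6 -> 'I_6 -> V) :
  \sum_(s : 'S_6) ((-1) ^+ s : R) *: \sum_(t : 'S_5) ((-1) ^+ t : R) *:
    T (s (lshift 1 (t (inord 0)))) (s (lshift 1 (t (inord 1)))) (s (lshift 1 (t (inord 2))))
      (s (lshift 1 (t (inord 3)))) (s (lshift 1 (t (inord 4)))) (s (rshift 5 ord0))
  = (5`!)%:R *: alt6 T.
Proof.
under eq_bigr do rewrite scaler_sumr.
rewrite exchange_big /=.
transitivity (\sum_(t : 'S_5) alt6 T); last by rewrite sumr_const card_Sn scaler_nat.
apply: eq_bigr => t _.
transitivity (((-1) ^+ t : R) *: (((-1) ^+ (emb5 t) : R) *: alt6 T)); last first.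
  by rewrite odd_emb5 scalerA -signr_addb addbb scale1r.
rewrite -(alt6_perm T (emb5 t)) scaler_sumr; apply: eq_bigr => s _.
rewrite scalerA mulrC -scalerA.
by rewrite o6_last !o6_lshift // !emb5_lshift emb5_last.
Qed.

Lemma sum_fix5 (a : 'S_6 -> V) : (forall s : 'S_6, s ord_max != ord_max -> a s = 0) ->
  \sum_(s : 'S_6) a s = \sum_(t : 'S_5) a (emb5 t).
Proof.
move=> a0; rewrite (bigID (fun s : 'S_6 => s ord_max == ord_max)) /=.
rewrite [X in _ + X]big1 ?addr0; last by move=> s /a0.
(* The inverse of [emb5], written for every s by removing the value [s ord_max]. The other indices
   never take that value, so the default of [odflt] is never reached. *)
have cp (s : 'S_6) : injective (fun k : 'I_5 => odflt k (unlift (s ord_max) (s (lift ord_max k)))).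
  move=> k1 k2 eqf; apply: (@lift_inj _ ord_max); apply: (@perm_inj _ s).
  have nfp k : s ord_max != s (lift ord_max k).
    by rewrite (inj_eq perm_inj) neq_lift.
  have [/unlift_some[k1' ek1 rk1]] := (nfp k1); have [/unlift_some[k2' ek2 rk2]] := nfp k2.
  by move: eqf; rewrite rk1 rk2 /= ek1 ek2 => ->.
rewrite (reindex emb5); last first.
  exists (fun s => perm (cp s)) => /= [t _|s].
    apply/permP => i; rewrite permE /emb5 lift_perm_id lift_perm_lift liftK //.
  rewrite inE => /eqP sm; apply/permP => i; rewrite /emb5.
  case: (unliftP ord_max i) => [k|] ->; last by rewrite lift_perm_id.
  rewrite lift_perm_lift permE sm.
  have nfp : ord_max != s (lift ord_max k) by rewrite -{1}sm (inj_eq perm_inj) neq_lift.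
  by have [/unlift_some[k' ek rk]] := nfp; rewrite rk /= -ek.
by apply: eq_bigl => t; rewrite /emb5 lift_perm_id eqxx.
Qed.

End Embedding.

Section Wedge23.
Context {R : realType} {V : lmodType R}.
Local Notation E := 'rV[R]_6.

Lemma scaleCA (a b : R) (x : V) : a *: (b *: x) = b *: (a *: x).
Proof. by rewrite !scalerA mulrC. Qed.

Lemma lin_expZ (h : E -> V) (c : R) : lin_exp h -> lin_exp (fun u => c *: h u).
Proof.
move=> hl u; rewrite hl scaler_sumr; apply: eq_bigr => j _.
by rewrite !scalerA mulrC.
Qed.

Lemma lin_expZl (h : E -> R) (x : V) : lin_exp (V := R) h -> lin_exp (fun u => h u *: x).
Proof.
move=> hl u; rewrite hl scaler_suml; apply: eq_bigr => j _.
by rewrite scalerA.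
Qed.

Lemma lin_exp_dot (l : E) : lin_exp (V := R) (fun u => dotv u l).
Proof.
move=> u; rewrite /dotv; apply: eq_bigr => j _; congr (_ * _).
rewrite (bigD1 j) //= mxE !eqxx mul1r big1 ?addr0 // => i /negbTE ij.
by rewrite mxE ij andbF mul0r.
Qed.

Lemma dotv_evec (l : E) a : dotv (evec a) l = l 0 a.
Proof.
rewrite /dotv (bigD1 a) //= mxE !eqxx mul1r big1 ?addr0 // => i /negbTE ij.
by rewrite mxE ij andbF mul0r.
Qed.

Lemma dotv_ge0 n (p : 'rV[R]_n) : 0 <= dotv p p.
Proof. by apply: sumr_ge0 => i _; rewrite -expr2 sqr_ge0. Qed.

Lemma dotv_eq0 n (p : 'rV[R]_n) : (dotv p p == 0) = (p == 0).
Proof.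
apply/eqP/eqP => [p0|->]; last by rewrite /dotv big1 // => i _; rewrite mxE mul0r.
apply/rowP => j; rewrite mxE; have pp (i : 'I_n) : true -> 0 <= p 0 i * p 0 i.
  by rewrite -expr2 sqr_ge0.
by have /eqP := psumr_eq0P pp p0 (isT : true) (i := j); rewrite mulf_eq0 orbb => /eqP.
Qed.

Lemma dotv_mulmx (u l : E) (f : 'M[R]_6) : dotv (u *m f) l = dotv u (l *m f^T).
Proof.
rewrite /dotv; under eq_bigr do rewrite mxE mulr_suml.
rewrite exchange_big /=; apply: eq_bigr => j _; rewrite mxE mulr_sumr.
by apply: eq_bigr => i _; rewrite mxE -mulrA [l 0 i * _]mulrC.
Qed.

Definition bilin (F : E -> E -> V) :=
  (forall b, lin_exp (fun a => F a b)) /\ (forall a, lin_exp (F a)).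

Definition trilin (P : E -> E -> E -> R) :=
  [/\ forall b c, lin_exp (V := R) (fun a => P a b c),
      forall a c, lin_exp (V := R) (fun b => P a b c) &
      forall a b, lin_exp (V := R) (fun c => P a b c)].

Lemma multilin_F_P_dot F P l : bilin F -> trilin P ->
  multilin6 (fun a b c d e g => dotv g l *: (P c d e *: F a b)).
Proof.
move=> [F1 F2] [P1 P2 P3]; split => [b c d e g|a c d e g|a b d e g|].
- by do 2!apply: lin_expZ; exact: F1.
- by do 2!apply: lin_expZ; exact: F2.
- by apply: lin_expZ; apply: lin_expZl; exact: P1.
split => [a b c e g|a b c d g|a b c d e].
- by apply: lin_expZ; apply: lin_expZl; exact: P2.
- by apply: lin_expZ; apply: lin_expZl; exact: P3.
- by apply: lin_expZl; exact: lin_exp_dot.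
Qed.

Definition kf2 (al : kform 2 E V) (u v : E) : V := al (tup 2 [:: u; v]).
Definition kf3 (al : kform 3 E R) (u v w : E) : R := al (tup 3 [:: u; v; w]).

Lemma wedger23E (F : kform 2 E V) (P : kform 3 E R) (v : 'I_5 -> E) :
  wedger F P v = (12%:R : R)^-1 *: \sum_(t : 'S_5) ((-1) ^+ t : R) *:
    (kf3 P (v (t (inord 2))) (v (t (inord 3))) (v (t (inord 4)))
      *: kf2 F (v (t (inord 0))) (v (t (inord 1)))).
Proof.
rewrite /wedger /wedgef; congr (_ *: _); apply: eq_bigr => t _; congr (_ *: _).
rewrite /kf2 /kf3; congr (_ *: _).
  congr (P _); rewrite [LHS]tup3E; congr (tup 3 [:: _; _; _]);
  by congr (v (t _)); apply/val_inj; rewrite /= !inordK.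
congr (F _); rewrite [LHS]tup2E; congr (tup 2 [:: _; _]);
by congr (v (t _)); apply/val_inj; rewrite /= !inordK.
Qed.

(* The vector dual to the 5-form F /\ P, paired with a covector l. *)
Definition Yvec (F : E -> E -> V) (P : E -> E -> E -> R) (l : E) : V :=
  (12%:R : R)^-1 *: alt6 (fun a b c d e g =>
     l 0 g *: (P (evec c) (evec d) (evec e) *: F (evec a) (evec b))).

(** The 1/5! of the star cancels the 5! of [sum_emb5], and the frame vectors are removed by
    [alt6_at_mx] at the cost of [\det f]. The matrix applied to [v ord0] is that of the metric,
    which turns the vector into a covector. *)
Lemma starf_wedger23 (f : 'M[R]_6) (F : kform 2 E V) (P : kform 3 E R) (v : 'I_1 -> E) :
  f \in unitmx -> bilin (kf2 F) -> trilin (kf3 P) ->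
  starf (k := 5) (l := 1) f (wedger F P) v =
  \det f *: Yvec (kf2 F) (kf3 P) (v ord0 *m (invmx f *m (invmx f)^T)).
Proof.
move=> fU bF tP; rewrite /starf star0E.
pose T a b c d e g := (v ord0 *m invmx f) 0 g *:
   (kf3 P (evec c *m f) (evec d *m f) (evec e *m f) *: kf2 F (evec a *m f) (evec b *m f)).
transitivity ((5`!%:R : R)^-1 *: ((12%:R : R)^-1 *: ((5`!)%:R *: alt6 T))).
  congr (_ *: _); rewrite -sum_emb5 scaler_sumr; apply: eq_bigr => s _.
  rewrite wedger23E [RHS]scaleCA; congr (_ *: _).
  rewrite scaleCA scaler_sumr; congr (_ *: _); apply: eq_bigr => t _.
  by rewrite scaleCA big_ord_recl big_ord0 mulr1.
rewrite /Yvec [LHS]scaleCA [RHS]scaleCA; congr (_ *: _).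
rewrite scalerA mulVf ?pnatr_eq0 // scale1r.
set l := v ord0 *m _.
apply: etrans (etrans _ (alt6_at_mx f (multilin_F_P_dot l bF tP))) _.
  apply: eq_bigr => s _; rewrite /T !rowE /=; congr (_ *: (_ *: _)).
  by rewrite dotv_mulmx dotv_evec /l -!mulmxA -trmx_mul mulmxV // trmx1 mulmx1.
by congr (_ *: _); apply: eq_alt6 => *; rewrite dotv_evec.
Qed.

(** A 5-form in six dimensions is determined by its dual vector. The five arguments are completed by
    a nonzero vector [p] orthogonal to them, and the vanishing of [Yvec] on [p] is read off on the
    resulting six rows. *)
Lemma Yvec_eq0_wedger23 (F : kform 2 E V) (P : kform 3 E R) :
  bilin (kf2 F) -> trilin (kf3 P) -> (forall l, Yvec (kf2 F) (kf3 P) l = 0) ->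
  forall v, wedger F P v = 0.
Proof.
move=> bF tP Y0 v.
pose B := \matrix_(i < 5) v i.
have [p pn pB] : exists2 p : E, p != 0 & forall i, dotv (v i) p = 0.
  have : kermx (B^T) != 0.
    rewrite kermx_eq0 -row_leq_rank -ltnNge.
    by apply: leq_ltn_trans (rank_leq_col _) _.
  case/rowV0Pn => p /sub_kermxP pB pn; exists p => // i.
  have := congr1 (fun M : 'rV_5 => M 0 i) pB; rewrite !mxE => <-.
  by apply: eq_bigr => j _; rewrite !mxE mulrC.
pose M := col_mx B p : 'M[R]_(5 + 1, 6).
pose T (a b c d e g : E) := dotv g p *: (kf3 P c d e *: kf2 F a b).
have e1 : alt6_at T (fun i => row i M) = 0.
  rewrite (alt6_at_mx M (multilin_F_P_dot p bF tP)).
  have -> : alt6 (fun a b c d e g => T (evec a) (evec b) (evec c) (evec d) (evec e) (evec g)) =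
     12%:R *: Yvec (kf2 F) (kf3 P) p.
    rewrite /Yvec scalerA mulfV ?pnatr_eq0 // scale1r; apply: eq_alt6 => *.
    by rewrite /T dotv_evec.
  by rewrite Y0 !scaler0.
have rl (i : 'I_5) : row (lshift 1 i) M = v i.
  by rewrite /M; apply/rowP => j; rewrite !mxE (unsplitK (inl i)) mxE.
have rr : row (rshift 5 ord0) M = p.
  by apply/rowP => j; rewrite !mxE (unsplitK (inr ord0)).
have om : ord_max = rshift 5 (ord0 : 'I_1) by apply/val_inj.
(* Pairing with [p] kills the first five rows, so only permutations fixing the last index survive,
   with the common factor [dotv p p]. *)
move: e1; rewrite /alt6_at sum_fix5; last first.
  move=> s; rewrite om -o6_last /T; case: (unliftP (rshift 5 (ord0 : 'I_1)) (s (o6 5))) => [k ->|->].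
    have -> : lift (rshift 5 (ord0 : 'I_1)) k = lshift 1 k.
      by apply/val_inj; rewrite /= /bump leqNgt ltn_ord.
    by rewrite rl pB scale0r scaler0.
  by rewrite o6_last eqxx.
have pp : dotv p p != 0 by rewrite dotv_eq0.
move=> e1; apply: (scalerI pp); rewrite scaler0 wedger23E scaleCA scaler_sumr.
rewrite [X in _ *: X](_ : _ = 0) ?scaler0 // -[RHS]e1; apply: eq_bigr => t _.
rewrite odd_emb5 [LHS]scaleCA; congr (_ *: _).
by rewrite /T o6_last !o6_lshift // !emb5_lshift emb5_last !rl rr.
Qed.

End Wedge23.

(** * Frames: metric, complex structure and the torsion equations *)

Section FrameAlgebra.
Context {R : realType}.
Local Notation E := 'rV[R]_6.

Lemma evec_mx (M : 'M[R]_6) i k : (evec i *m M) 0 k = M i k.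
Proof. by rewrite /evec -rowE mxE. Qed.

Lemma lin_expR (h : E -> R) : lin_exp (V := R) h ->
  forall u, h u = \sum_(j < 6) u 0 j * h (evec j).
Proof. by []. Qed.

Definition J0m : 'M[R]_6 := \matrix_(i, j) J0 (evec i) 0 j.

Lemma J0mE i j : J0m i j = J0 (evec i) 0 j.
Proof. by rewrite [LHS]mxE. Qed.

Lemma J0_mx (v : E) : J0 v = v *m J0m.
Proof.
apply/rowP => k; rewrite [RHS]mxE big_ord6 !J0mE.
have V i j : evec i 0 (o6 j) = kd j i :> R by exact: evec_kd.
have [p0 p1 p2 p3 [p4 p5]] := J0_coords v.
have Q i := J0_coords (evec (o6 i) : E).
have [a0 a1 a2 a3 [a4 a5]] := Q 0%N; have [b0 b1 b2 b3 [b4 b5]] := Q 1%N.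
have [c0 c1 c2 c3 [c4 c5]] := Q 2%N; have [d0 d1 d2 d3 [d4 d5]] := Q 3%N.
have [e0 e1 e2 e3 [e4 e5]] := Q 4%N; have [g0 g1 g2 g3 [g4 g5]] := Q 5%N.
move: k; apply: ord6_cases.
- by rewrite p0 a0 b0 c0 d0 e0 g0 !V !kd_o6 // /nkd /=; ring.
- by rewrite p1 a1 b1 c1 d1 e1 g1 !V !kd_o6 // /nkd /=; ring.
- by rewrite p2 a2 b2 c2 d2 e2 g2 !V !kd_o6 // /nkd /=; ring.
- by rewrite p3 a3 b3 c3 d3 e3 g3 !V !kd_o6 // /nkd /=; ring.
- by rewrite p4 a4 b4 c4 d4 e4 g4 !V !kd_o6 // /nkd /=; ring.
- by rewrite p5 a5 b5 c5 d5 e5 g5 !V !kd_o6 // /nkd /=; ring.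
Qed.

Lemma om0_J0 (u v : E) : om0 u v = dotv (J0 u) v.
Proof.
rewrite /dotv big_ord6 /=; have [p0 p1 p2 p3 [p4 p5]] := J0_coords u.
by rewrite p0 p1 p2 p3 p4 p5 /om0; ring.
Qed.

Lemma J0_J0 (v : E) : J0 (J0 v) = - v.
Proof.
have [p0 p1 p2 p3 [p4 p5]] := J0_coords v.
have [q0 q1 q2 q3 [q4 q5]] := J0_coords (J0 v).
apply/rowP; apply: ord6_cases; rewrite [RHS]mxE.
- by rewrite q0 p1.
- by rewrite q1 p0.
- by rewrite q2 p3.
- by rewrite q3 p2.
- by rewrite q4 p5.
- by rewrite q5 p4.
Qed.

Lemma J0m_sq : J0m *m J0m = - 1%:M.
Proof.
apply/row_matrixP => i; rewrite !rowE mulmxA -!J0_mx J0_J0.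
by rewrite mulmxN mulmx1.
Qed.

Lemma dotvC n (u v : 'rV[R]_n) : dotv u v = dotv v u.
Proof. by apply: eq_bigr => i _; rewrite mulrC. Qed.

Lemma dotv_evecr n (u : 'rV[R]_n) i : dotv u (evec i) = u 0 i.
Proof.
rewrite /dotv (bigD1 i) //= mxE !eqxx mulr1 big1 ?addr0 // => j /negbTE ij.
by rewrite mxE ij andbF mulr0.
Qed.

Lemma J0m_tr : J0m^T = - J0m.
Proof.
apply/matrixP => i j; rewrite [LHS]mxE [RHS]mxE !J0mE -!dotv_evecr -!om0_J0 /om0.
by ring.
Qed.

Variable f : 'M[R]_6.
Hypothesis fU : f \in unitmx.
Local Notation f' := (invmx f).

Definition Jmx := f' *m J0m *m f.
(** The rows of [f] are an orthonormal frame: [f^T *m f] is the inverse metric, and the inverse of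
    [\det f] is the volume density up to sign. So [gam] is the inverse metric as a density, and
    [omt] likewise the bivector dual to omega. *)
Definition gam := (\det f)^-1 *: (f^T *m f).
Definition omt := (\det f)^-1 *: (f^T *m J0m *m f).

Lemma detf0 : \det f != 0. Proof. by rewrite -unitfE -unitmxE. Qed.

Lemma gam_omt : gam = - (omt *m Jmx).
Proof.
rewrite /gam /omt /Jmx -scalemxAl -scalerN; congr (_ *: _).
rewrite !mulmxA mulmxK // -!mulmxA [J0m *m (J0m *m f)]mulmxA J0m_sq.
by rewrite mulNmx mul1mx mulmxN opprK.
Qed.

Lemma Jmx_sq : Jmx *m Jmx = - 1%:M.
Proof.
rewrite /Jmx !mulmxA mulmxK // -!mulmxA [J0m *m (J0m *m f)]mulmxA J0m_sq.
by rewrite mulNmx mul1mx mulmxN mulVmx.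
Qed.

Lemma gam_J : gam *m Jmx = omt.
Proof. by rewrite /gam /omt /Jmx -scalemxAl !mulmxA mulmxK. Qed.

Lemma trK : f'^T *m f^T = 1%:M.
Proof. by rewrite -trmx_mul mulmxV // trmx1. Qed.

Lemma trK' : f^T *m f'^T = 1%:M.
Proof. by rewrite -trmx_mul mulVmx // trmx1. Qed.

Lemma trJ_gam : Jmx^T *m gam = - omt.
Proof.
rewrite /Jmx !trmx_mul J0m_tr /gam /omt -scalemxAr -scalerN; congr (_ *: _).
rewrite -!mulmxA [f'^T *m (f^T *m _)]mulmxA trK mul1mx.
by rewrite mulNmx mulmxN.
Qed.

Lemma trJ_omt : Jmx^T *m omt = gam.
Proof.
rewrite /Jmx !trmx_mul J0m_tr /gam /omt -scalemxAr; congr (_ *: _).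
rewrite -!mulmxA [f'^T *m (f^T *m _)]mulmxA trK mul1mx.
by rewrite mulNmx [J0m *m (J0m *m f)]mulmxA J0m_sq mulNmx mul1mx opprK.
Qed.

Variables (W : kform 2 E R) (O3 : kform 3 E (Rcomplex R)).
Hypothesis HW : forall v, W (fun i => v i *m f) = omega0 v.
Hypothesis HO : forall v, O3 (fun i => v i *m f) = Omega0 v.
Let reO : kform 3 E R := fun v => complex.Re (O3 v).
Let imO : kform 3 E R := fun v => complex.Im (O3 v).

Lemma W_frame u v : kf2 W u v = om0 (u *m f') (v *m f').
Proof.
rewrite -[RHS](omega0E (tup 2 [:: u *m f'; v *m f'])) -HW /kf2; congr (W _).
by apply/funext => -[[|[|//]] p]; rewrite /tup /= mulmxKV.
Qed.

Lemma O_frame u v w :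
  kf3 reO u v w = alt3 re3 (u *m f') (v *m f') (w *m f') /\
  kf3 imO u v w = alt3 im3 (u *m f') (v *m f') (w *m f').
Proof.
rewrite /kf3 /reO /imO.
have -> : tup 3 [:: u; v; w] = fun i => tup 3 [:: u *m f'; v *m f'; w *m f'] i *m f.
  by apply/funext => -[[|[|[|//]]] p]; rewrite /tup /= mulmxKV.
by rewrite HO Omega0E.
Qed.

Lemma re_frame u v w : kf3 reO u v w = alt3 re3 (u *m f') (v *m f') (w *m f').
Proof. by have [] := O_frame u v w. Qed.
Lemma im_frame u v w : kf3 imO u v w = alt3 im3 (u *m f') (v *m f') (w *m f').
Proof. by have [] := O_frame u v w. Qed.

Lemma multilin_om_om_dot (l m : E) : multilin6 (V := R)
  (fun a b c d e g => om0 a b * (om0 c d * (dotv e l * dotv g m))).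
Proof.
by split => [?????|?????|?????|]; [..|split => ?????]; apply: lin_exp_linear => k u v;
  rewrite /om0 /dotv ?big_ord6 /= !mxE /GRing.scale /=; ring.
Qed.

(** The right side is omega /\ omega /\ e^i /\ e^j, so [omt] depends on omega alone and not on the
    frame. The 8 is that of [alt6_om0_om0]; the inverse determinant arises from evaluating on the
    rows of [invmx f]. *)
Lemma omtE i j : omt i j = 8^-1 * alt6 (V := R) (fun a b c d e g =>
  kf2 W (evec a) (evec b) * (kf2 W (evec c) (evec d) * (evec i 0 e * evec j 0 g))).
Proof.
set l := evec i *m f^T; set m := evec j *m f^T.
have := alt6_at_mx f' (multilin_om_om_dot l m).
have -> : alt6 (V := R) (fun a b c d e g => om0 (evec a) (evec b) * (om0 (evec c) (evec d) *
    (dotv (evec e) l * dotv (evec g) m))) = 8 * om0 l m.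
  by rewrite -alt6_om0_om0; apply: eq_alt6 => *; rewrite !dotv_evec.
have inv e (k : E) : dotv (evec e *m f') (k *m f^T) = k 0 e.
  by rewrite dotv_mulmx -mulmxA -trmx_mul mulVmx // trmx1 mulmx1 dotv_evec.
set A := alt6_at _ _ => H.
have -> : alt6 (V := R) (fun a b c d e g => kf2 W (evec a) (evec b) *
   (kf2 W (evec c) (evec d) * (evec i 0 e * evec j 0 g))) = A.
  by apply: eq_bigr => s _; rewrite !W_frame !rowE !inv.
rewrite H; have -> : om0 l m = (f^T *m J0m *m f) i j.
  rewrite om0_J0 J0_mx dotvC /m dotv_mulmx trmxK dotv_evec /l /evec.
  by rewrite -!mulmxA -rowE [LHS]mxE.
rewrite /omt [LHS]mxE det_inv -[_ *: _ in RHS]/(_ * (8 * _)).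
by rewrite mulrCA mulKf // pnatr_eq0.
Qed.

(* By [Jmx_gram], J is a rational function of Omega, hence as smooth as Omega. *)
Definition gram : 'M[R]_6 := \matrix_(i, j) \sum_a \sum_b
  kf3 reO (evec i) (evec a) (evec b) * kf3 reO (evec j) (evec a) (evec b).
Definition gramJ : 'M[R]_6 := \matrix_(i, j) \sum_a \sum_b
  kf3 imO (evec i) (evec a) (evec b) * kf3 reO (evec j) (evec a) (evec b).

Lemma re_J u v w : kf3 reO (u *m Jmx) v w = - kf3 imO u v w.
Proof.
rewrite re_frame im_frame /Jmx !mulmxA mulmxK // -J0_mx.
by have [-> _] := alt3_J (u *m f') (v *m f') (w *m f').
Qed.

Hypothesis tRe : trilin (kf3 reO).
Hypothesis tIm : trilin (kf3 imO).

Lemma Jmx_mul_gram : Jmx *m gram = - gramJ.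
Proof.
have [lin1 _ _] := tRe.
apply/matrixP => i j; rewrite [LHS]mxE [RHS]mxE [X in - X]mxE -sumrN.
under eq_bigr do rewrite [gram _ _]mxE mulr_sumr.
rewrite exchange_big; apply: eq_bigr => a _; rewrite -sumrN.
under eq_bigr do rewrite mulr_sumr.
rewrite exchange_big; apply: eq_bigr => b _; rewrite -mulNr -re_J.
rewrite [kf3 reO (_ *m Jmx) _ _](lin_expR (lin1 (evec a) (evec b))). rewrite mulr_suml.
by apply: eq_bigr => k _; rewrite evec_mx mulrA.
Qed.

(** For u in the kernel, the quadratic form of the Gram matrix at u is the sum of the squares of Re
    Omega(u, e_a, e_b), so all of these vanish and [alt3_nondeg] applies. *)
Lemma gram_unit : gram \in unitmx.
Proof.
have [lin1 lin2 lin3] := tRe.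
rewrite unitmxE unitfE; apply/negP => /det0P[u un ug].
have re0 a b : kf3 reO u (evec a) (evec b) = 0.
  have S0 : \sum_a \sum_b kf3 reO u (evec a) (evec b) ^+ 2 = 0.
    have key j : (u *m gram) 0 j = \sum_a \sum_b
        kf3 reO u (evec a) (evec b) * kf3 reO (evec j) (evec a) (evec b).
      rewrite mxE; under eq_bigr do rewrite [gram _ _]mxE mulr_sumr.
      rewrite exchange_big; apply: eq_bigr => c _.
      under eq_bigr do rewrite mulr_sumr.
      rewrite exchange_big; apply: eq_bigr => d _.
      rewrite [kf3 reO u _ _](lin_expR (lin1 (evec c) (evec d))) mulr_suml.
      by apply: eq_bigr => k _; rewrite mulrA.
    transitivity (\sum_j u 0 j * (u *m gram) 0 j); last first.
      by rewrite ug big1 // => i _; rewrite mxE mulr0.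
    under [RHS]eq_bigr do rewrite key mulr_sumr.
    rewrite [RHS]exchange_big; apply: eq_bigr => c _.
    under [RHS]eq_bigr do rewrite mulr_sumr.
    rewrite [RHS]exchange_big; apply: eq_bigr => d _.
    rewrite expr2 {1}[kf3 reO u _ _](lin_expR (lin1 (evec c) (evec d))) mulr_suml.
    by apply: eq_bigr => k _; rewrite -mulrA [X in _ * X]mulrC.
  have h1 c : true -> 0 <= \sum_d kf3 reO u (evec c) (evec d) ^+ 2.
    by move=> _; apply: sumr_ge0 => d _; exact: sqr_ge0.
  have h2 d : true -> 0 <= kf3 reO u (evec a) (evec d) ^+ 2 by move=> _; exact: sqr_ge0.
  have /eqP := psumr_eq0P h2 (psumr_eq0P h1 S0 (i := a) isT) (i := b) isT.
  by rewrite sqrf_eq0 => /eqP.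
have {}re0 v w : kf3 reO u v w = 0.
  rewrite (lin_expR (lin2 _ _)) big1 // => a _; rewrite (lin_expR (lin3 _ _)) big1 ?mulr0 // => b _.
  by rewrite re0 mulr0.
have uf0 : u *m f' = 0.
  apply: alt3_nondeg => v w.
  by have := re_frame u (v *m f) (w *m f); rewrite re0 !mulmxK.
by move: un; rewrite -(mulmxKV fU u) uf0 mul0mx eqxx.
Qed.

Lemma Jmx_gram : Jmx = - (gramJ *m invmx gram).
Proof. by rewrite -mulNmx -Jmx_mul_gram mulmxK // gram_unit. Qed.

Section Fvalued.
Variable V : lmodType R.

Lemma alt6_cycle (T : 'I_6 -> 'I_6 -> 'I_6 -> 'I_6 -> 'I_6 -> 'I_6 -> V) :
  alt6 (fun a b c d e g => T a b c d e g - T a b d c e g + T a b e c d g - T a b g c d e) =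
  4%:R *: alt6 T.
Proof.
have e1 := alt6_swap23 T.
have e2 : alt6 (fun a b c d e g => T a b e c d g) = alt6 T.
  by rewrite (alt6_swap34 (fun a b c d e g => T a b d c e g)) e1 opprK.
have e3 : alt6 (fun a b c d e g => T a b g c d e) = - alt6 T.
  by rewrite (alt6_swap45 (fun a b c d e g => T a b e c d g)) e2.
rewrite (alt6_add (fun a b c d e g => T a b c d e g - T a b d c e g + T a b e c d g)
  (fun a b c d e g => - T a b g c d e)) (alt6_opp (fun a b c d e g => T a b g c d e)).
rewrite (alt6_add (fun a b c d e g => T a b c d e g - T a b d c e g)
  (fun a b c d e g => T a b e c d g)).
rewrite (alt6_add T (fun a b c d e g => - T a b d c e g)) (alt6_opp (fun a b c d e g => T a b d c e g)).
by rewrite e1 e2 e3 !opprK scaler_nat !mulrS mulr0n addr0 !addrA.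
Qed.

Lemma alt6_last_front (T : 'I_6 -> 'I_6 -> 'I_6 -> 'I_6 -> 'I_6 -> 'I_6 -> V) :
  alt6 (fun a b c d e g => T a b g c d e) = - alt6 T.
Proof.
rewrite (alt6_swap45 (fun a b c d e g => T a b e c d g)).
by rewrite (alt6_swap34 (fun a b c d e g => T a b d c e g)) (alt6_swap23 T) opprK.
Qed.

(** Antisymmetrizing over the last four slots shows that the dual vector sees l and P only through
    the 4-form l /\ P. The constant is 12 times the four equal terms of [alt6_cycle]; the sign comes
    from moving l past three slots. *)
Lemma Yvec_wedge (F : E -> E -> V) (P : E -> E -> E -> R) l :
  Yvec F P l = - (48%:R : R)^-1 *: alt6 (fun a b c d e g =>
    (l 0 c * P (evec d) (evec e) (evec g) - l 0 d * P (evec c) (evec e) (evec g)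
     + l 0 e * P (evec c) (evec d) (evec g) - l 0 g * P (evec c) (evec d) (evec e))
    *: F (evec a) (evec b)).
Proof.
pose T a b c d e g := (l 0 c * P (evec d) (evec e) (evec g)) *: F (evec a) (evec b).
transitivity (- (48%:R : R)^-1 *: (4%:R *: alt6 T)); last first.
  rewrite -alt6_cycle; congr (_ *: _); apply: eq_alt6 => a b c d e g.
  by rewrite /T !scalerDl !scaleNr.
rewrite /Yvec; have -> : alt6 (fun a b c d e g =>
     l 0 g *: (P (evec c) (evec d) (evec e) *: F (evec a) (evec b))) = - alt6 T.
  by rewrite -(alt6_last_front T); apply: eq_alt6 => *; rewrite /T scalerA.
rewrite scalerA scalerN -scaleNr; congr (_ *: _).
have n0 (n : nat) : (n.+1%:R : R) != 0 by rewrite pnatr_eq0.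
by rewrite mulNr; congr (- _); apply: (mulfI (n0 11%N)); field.
Qed.

(** By [wedge_J_Omega] the 4-forms l /\ Im Omega and (l o J) /\ Re Omega agree, and [Yvec_wedge]
    depends on nothing else. *)
Lemma Yvec_im_re (F : E -> E -> V) l :
  Yvec F (kf3 imO) l = Yvec F (kf3 reO) (l *m Jmx^T).
Proof.
rewrite !Yvec_wedge; congr (_ *: _); apply: eq_alt6 => a b c d e g; congr (_ *: _).
rewrite !re_frame !im_frame.
have h x : l 0 x = dotv (l *m f^T) (evec x *m f').
  by rewrite dotvC dotv_mulmx -mulmxA trK' mulmx1 dotv_evec.
have h' x : (l *m Jmx^T) 0 x = dotv (l *m f^T) (J0 (evec x *m f')).
  rewrite J0_mx dotvC -mulmxA dotv_mulmx dotv_evec; congr ((_ : E) 0 x).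
  by rewrite /Jmx !trmx_mul !mulmxA.
by rewrite !h !h' wedge_J_Omega.
Qed.

Hypothesis bW : bilin (V := R) (kf2 W).

Lemma multilin_WWF (F : E -> E -> V) : bilin F ->
  multilin6 (fun a b c d e g => (kf2 W a b * kf2 W c d) *: F e g).
Proof.
move=> [F1 F2]; have [W1 W2] := bW.
have hm (k : R) (h : E -> R) : lin_exp (V := R) h -> lin_exp (V := R) (fun u => k * h u).
  by move=> hl; exact: (lin_expZ (V := R) k hl).
have hm' (k : R) (h : E -> R) : lin_exp (V := R) h -> lin_exp (V := R) (fun u => h u * k).
  by move=> hl; exact: (lin_expZl (V := R) k hl).
split => [b c d e g|a c d e g|a b d e g|].
- by apply: lin_expZl; apply: hm'; exact: W1.
- by apply: lin_expZl; apply: hm'; exact: W2.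
- by apply: lin_expZl; apply: hm; exact: W1.
split => [a b c e g|a b c d g|a b c d e].
- by apply: lin_expZl; apply: hm; exact: W2.
- by apply: lin_expZ; exact: F1.
- by apply: lin_expZ; exact: F2.
Qed.

Lemma alt6_scalel (h : 'I_6 -> 'I_6 -> 'I_6 -> 'I_6 -> 'I_6 -> 'I_6 -> R) (x : V) :
  alt6 (fun a b c d e g => h a b c d e g *: x) = alt6 (V := R) h *: x.
Proof. by rewrite /alt6 scaler_suml; apply: eq_bigr => s _; rewrite scalerA. Qed.

(** Lambda F is, up to a constant, F /\ omega^2 measured against the volume form. The alternating
    sum on the right no longer mentions the frame, so this form of the condition can be used in
    coordinates. *)
Lemma Lambda_alt6 (F : E -> E -> V) : bilin F ->
  8%:R *: \sum_(I : {ffun 'I_2 -> 'I_6}) om0 (evec (I ord0)) (evec (I ord_max)) *: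
     F (evec (I ord0) *m f) (evec (I ord_max) *m f) =
  \det f *: alt6 (fun a b c d e g => (kf2 W (evec a) (evec b) *
     kf2 W (evec c) (evec d)) *: F (evec e) (evec g)).
Proof.
move=> bF; rewrite -(alt6_at_mx f (multilin_WWF bF)).
transitivity (alt6 (fun a b c d e g => (om0 (evec a) (evec b) * om0 (evec c) (evec d)) *:
  \sum_(I : {ffun 'I_2 -> 'I_6}) ((evec (I ord0) : E) 0 e * (evec (I ord_max) : E) 0 g) *:
    F (evec (I ord0) *m f) (evec (I ord_max) *m f))); last first.
  apply: eq_bigr => s _; rewrite !W_frame !rowE !mulmxK //; congr (_ *: (_ *: _)).
  rewrite (bigD1 [ffun i => if i == ord0 then s (o6 4) else s (o6 5)]) //= !ffunE /=.
  rewrite !mxE !eqxx mul1r scale1r big1 ?addr0 // => I In.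
  rewrite !mxE !eqxx /= ![s _ == I _]eq_sym.
  case: eqP => [I0|_]; last by rewrite mul0r scale0r.
  case: eqP => [I1|_]; last by rewrite mulr0 scale0r.
  case/eqP: In; apply/ffunP => -[[|[|//]] p]; rewrite ffunE /=.
    by rewrite -I0; congr (I _); apply/val_inj.
  by rewrite -I1; congr (I _); apply/val_inj.
under [RHS]eq_alt6 do rewrite scaler_sumr.
rewrite alt6_sum scaler_sumr; apply: eq_bigr => I _.
under [RHS]eq_alt6 do rewrite scalerA.
rewrite alt6_scalel scalerA; congr (_ *: _); rewrite -alt6_om0_om0.
by apply: eq_alt6 => *; rewrite !mulrA.
Qed.

(** [B u p q r t] stands for the derivative along u of a 4-form on p, q, r, t, and [Z] for its
    exterior derivative. The five terms of [Z] have the same alternating sum, so 5 / 5! = 1 / 24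
    remains. *)
Lemma starf_dext51 (B : E -> E -> E -> E -> E -> R) (Z : kform 5 E R) (w : 'I_1 -> E) :
  (forall l, multilin6 (V := R) (fun a b c d e g => dotv g l * B a b c d e)) ->
  (forall v, Z v = B (v (inord 0)) (v (inord 1)) (v (inord 2)) (v (inord 3)) (v (inord 4))
     - B (v (inord 1)) (v (inord 0)) (v (inord 2)) (v (inord 3)) (v (inord 4))
     + B (v (inord 2)) (v (inord 0)) (v (inord 1)) (v (inord 3)) (v (inord 4))
     - B (v (inord 3)) (v (inord 0)) (v (inord 1)) (v (inord 2)) (v (inord 4))
     + B (v (inord 4)) (v (inord 0)) (v (inord 1)) (v (inord 2)) (v (inord 3))) ->
  starf (k := 5) (l := 1) f Z w = 24^-1 * (\det f * alt6 (V := R) (fun a b c d e g =>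
     (w ord0 *m (f' *m f'^T)) 0 g * B (evec a) (evec b) (evec c) (evec d) (evec e))).
Proof.
move=> mB ZE; rewrite /starf star0E.
pose r (a : 'I_6) : E := evec a *m f.
pose T a b c d e g : R := (w ord0 *m f') 0 g * B (r a) (r b) (r c) (r d) (r e).
set l := w ord0 *m _.
have -> : \det f * alt6 (V := R) (fun a b c d e g => l 0 g *
   B (evec a) (evec b) (evec c) (evec d) (evec e)) = alt6 (V := R) T.
  transitivity (alt6_at (V := R) (fun a b c d e g => dotv g l * B a b c d e) (fun i => row i f)).
    rewrite (alt6_at_mx f (mB l)); congr (_ * _).
    by apply: eq_alt6 => *; rewrite dotv_evec.
  apply: eq_bigr => s _; rewrite /T /r !rowE; congr (_ *: (_ * _)).
  by rewrite dotv_mulmx dotv_evec /l -!mulmxA trK mulmx1.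
have e0 := alt6_swap01 (V := R) T.
have e1 := alt6_swap12 (V := R) (fun a b c d e g => T b a c d e g).
have e2 := alt6_swap23 (V := R) (fun a b c d e g => T c a b d e g).
have e3 := alt6_swap34 (V := R) (fun a b c d e g => T d a b c e g).
have -> : 24^-1 * alt6 (V := R) T = (5`!%:R : R)^-1 * (alt6 (V := R) T
   - alt6 (V := R) (fun a b c d e g => T b a c d e g)
   + alt6 (V := R) (fun a b c d e g => T c a b d e g)
   - alt6 (V := R) (fun a b c d e g => T d a b c e g)
   + alt6 (V := R) (fun a b c d e g => T e a b c d g)).
  by rewrite e3 e2 e1 e0 (_ : 5`! = 120%N) //; field.
rewrite -[_ *: _]/(_ * _); congr (_ * _).
rewrite /alt6 -!sumrB -!big_split -sumrB -big_split /=; apply: eq_bigr => s _.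
rewrite ZE /T /r big_ord_recl big_ord0 mulr1 o6_last !o6_lshift //.
do 5!move: (B _ _ _ _ _) => ?; move: ((_ *m _) _ _) ((-1) ^+ _) => wg sg.
by rewrite -![_ *: _]/(_ * _); ring.
Qed.

(** Evaluating the equation on a covector raised by the metric gives the dual vector of F /\ Im
    Omega; composing with J gives that of F /\ Re Omega. The density weight of [gam] and [omt]
    absorbs the [\det f] of [starf_wedger23]. *)
Lemma torsion_eqs (F : kform 2 E V) (D1 D2 : E -> V) : bilin (kf2 F) ->
  (forall a u v, D1 (a *: u + v) = a *: D1 u + D1 v) ->
  (forall a u v, D2 (a *: u + v) = a *: D2 u + D2 v) ->
  (forall w, starf (k := 5) (l := 1) f (wedger F imO) (fun=> w) + D1 w + D2 (w *m Jmx) = 0) ->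
  forall i, Yvec (kf2 F) (kf3 imO) (evec i) =
      - \sum_j (gam i j *: D1 (evec j) + omt i j *: D2 (evec j)) /\
    Yvec (kf2 F) (kf3 reO) (evec i) =
      \sum_j (gam i j *: D2 (evec j) - omt i j *: D1 (evec j)).
Proof.
move=> bF l1 l2 H.
have zD (D : E -> V) : (forall a u v, D (a *: u + v) = a *: D u + D v) ->
    forall a u, D (a *: u) = a *: D u.
  move=> Dl a u; have D0 : D 0 = 0.
    by have /eqP := Dl 1 0 0; rewrite !scale1r addr0 -subr_eq subrr eq_sym => /eqP.
  by rewrite -[a *: u]addr0 Dl D0 addr0.
have z1 := zD _ l1; have z2 := zD _ l2.
have Y l : Yvec (kf2 F) (kf3 imO) l = - (D1 (l *m gam) + D2 (l *m omt)).
  have := H (l *m (f^T *m f)); rewrite starf_wedger23 //.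
  have -> : l *m (f^T *m f) *m (f' *m f'^T) = l.
    by rewrite !mulmxA mulmxK // -mulmxA trK' mulmx1.
  have d0 := detf0.
  have -> : l *m (f^T *m f) = \det f *: (l *m gam).
    by rewrite /gam -scalemxAr scalerA mulfV // scale1r.
  rewrite -scalemxAl -mulmxA gam_J z1 z2 -!scalerDr -addrA => /eqP.
  by rewrite scaler_eq0 (negbTE d0) /= addr_eq0 => /eqP.
have ex D (M : 'M[R]_6) i : (forall a u v, D (a *: u + v) = a *: D u + D v) ->
    D (evec i *m M) = \sum_j M i j *: D (evec j) :> V.
  move=> Dl; rewrite (lin_exp_linear Dl); apply: eq_bigr => j _.
  by rewrite evec_mx.
move=> i; split; first by rewrite Y !ex // -big_split.
(* [Jmx] squares to -1, which brings the basis covector into the shape that [Yvec_im_re] needs. *)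
have -> : evec i = (- (evec i *m Jmx^T)) *m Jmx^T.
  by rewrite mulNmx -mulmxA -trmx_mul Jmx_sq linearN /= trmx1 mulmxN mulmx1 opprK.
rewrite -Yvec_im_re Y !mulNmx -!mulmxA trJ_gam trJ_omt mulmxN opprK.
by rewrite -[- (_ *m gam)]scaleN1r z2 scaleN1r opprD opprK !ex // addrC -sumrB.
Qed.

End Fvalued.

End FrameAlgebra.

(** * Lie groups and their adjoint action *)

Section CkMore.
Context {R : realType}.

Lemma open_local (T : topologicalType) (U : set T) :
  (forall x, U x -> exists V, [/\ open V, V x & V `<=` U]) -> open U.
Proof.
move=> H; rewrite openE => x Ux; have [V [oV Vx VU]] := H x Ux.
by apply: filterS VU _; exact: open_nbhs_nbhs.
Qed.

Lemma Ck_local (E F : normedModType R) k (U : set E) (f : E -> F) :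
  (forall x, U x -> exists V, [/\ open V, V x & Ck k V f]) -> Ck k U f.
Proof.
elim: k f => [|k IH] f H.
  by split => // x /H[V [oV Vx Cf]]; exact: (Ck_cont Cf).
split; first by move=> x /H[V [oV Vx Cf]]; exact: (Ck_cont Cf).
move=> v; split; first by move=> x /H[V [oV Vx Cf]]; exact: (Ck_der Cf).
by apply: IH => x /H[V [oV Vx Cf]]; exists V; split => //; exact: CkD.
Qed.

(** The group product is smooth on pairs, whereas the chain rule [Ck_comp] wants row vectors in the
    middle; affine maps such as the splitting of a row vector link the two. [L'] is the linear part
    of [L]. *)
Lemma Ck_lincomp (E E' F : normedModType R) k (U : set E) (L L' : E' -> E) (f : E -> F) :
  open U -> continuous L -> (forall v h y, L (h *: v + y) = h *: L' v + L y) ->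
  Ck k U f -> Ck k (L @^-1` U) (fun x => f (L x)).
Proof.
move=> oU cL linL; elim: k f => [|k IH] f Cf.
  by split => // x Ux; apply: (@continuous_comp _ _ _ L f); [exact: cL|exact: (Ck_cont Cf)].
split.
  by move=> x Ux; apply: (@continuous_comp _ _ _ L f); [exact: cL|exact: (Ck_cont Cf)].
have e v x : (fun h : R => h^-1 *: (((fun y => f (L y)) \o shift x) (h *: v) - f (L x)))
    = (fun h => h^-1 *: ((f \o shift (L x)) (h *: L' v) - f (L x))).
  by apply/funext => h /=; rewrite linL.
move=> v; split.
  by move=> x Ux; rewrite /derivable e; exact: (Ck_der Cf Ux).
have -> : 'D_v (fun x => f (L x)) = (fun x => 'D_(L' v) f (L x)).
  by apply/funext => x; rewrite /derive e.
exact: (IH ('D_(L' v) f) (CkD _ Cf)).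
Qed.

(** The two difference quotients are the same function, so no differentiability is involved. *)
Lemma derive_along (E E' F : normedModType R) (f : E -> F) (g : E' -> F) x x' v v' :
  (forall h : R, f (h *: v + x) = g (h *: v' + x')) -> 'D_v f x = 'D_v' g x'.
Proof.
move=> fg; have fx : f x = g x' by have := fg 0; rewrite !scale0r !add0r.
have e : (fun h : R => h^-1 *: ((f \o shift x) (h *: v) - f x)) =
    (fun h => h^-1 *: ((g \o shift x') (h *: v') - g x')).
  by apply/funext => h /=; rewrite fg fx.
by rewrite /derive e.
Qed.

Lemma derive_const_line (E F : normedModType R) (f : E -> F) x v (c : F) :
  (\forall t \near (0 : R), f (t *: v + x) = c) -> 'D_v f x = 0.
Proof.
move=> fc; have fx : f x = c by have := nbhs_singleton fc; rewrite scale0r add0r.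
apply: lim_near_cst => //; near=> h.
have -> : (f \o shift x) (h *: v) = c by near: h; exact: (cvg_within _ fc).
by rewrite fx subrr scaler0.
Unshelve. all: by end_near. Qed.

Definition bilinear_map (m p : nat) (F : lmodType R) (be : 'rV[R]_m -> 'rV[R]_p -> F) :=
  (forall a x x' y, be (a *: x + x') y = a *: be x y + be x' y) /\
  (forall a x y y', be x (a *: y + y') = a *: be x y + be x y').

Section Bilinear.
Context {m p : nat} {F : normedModType R} (be : 'rV[R]_m -> 'rV[R]_p -> F).
Hypothesis bb : bilinear_map be.

Lemma linear_expand n (V : lmodType R) (h : 'rV[R]_n -> V) :
  (forall a u v, h (a *: u + v) = a *: h u + h v) ->
  forall u, h u = \sum_(j < n) u 0 j *: h (evec j).
Proof.
move=> hl u.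
pose hL : {linear 'rV[R]_n -> V} := HB.pack h (GRing.isLinear.Build _ _ _ _ _ hl).
rewrite {1}(row_sum_evec u) -[h]/(hL : _ -> V) linear_sum; apply: eq_bigr => i _.
by rewrite linearZ.
Qed.

Lemma bilinear_expand x y : be x y =
  \sum_(ij : 'I_m * 'I_p) (x 0 ij.1 * y 0 ij.2) *: be (evec ij.1) (evec ij.2).
Proof.
rewrite -(pair_bigA _ (fun i j => (x 0 i * y 0 j) *: be (evec i) (evec j))) /=.
have [b1 b2] := bb.
rewrite (linear_expand (fun a u v => b1 a u v y)); apply: eq_bigr => i _.
rewrite (linear_expand (b2^~ (evec i))) scaler_sumr.
by apply: eq_bigr => j _; rewrite scalerA.
Qed.

Lemma bilin0l y : be 0 y = 0.
Proof. by rewrite bilinear_expand big1 // => i _; rewrite mxE mul0r scale0r. Qed.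

Lemma bilin0r x : be x 0 = 0.
Proof. by rewrite bilinear_expand big1 // => i _; rewrite mxE mulr0 scale0r. Qed.

Lemma bilinDl x x' y : be (x + x') y = be x y + be x' y.
Proof. by have := bb.1 1 x x' y; rewrite !scale1r. Qed.

Lemma bilinDr x y y' : be x (y + y') = be x y + be x y'.
Proof. by have := bb.2 1 x y y'; rewrite !scale1r. Qed.

Lemma bilinZl a x y : be (a *: x) y = a *: be x y.
Proof. by have := bb.1 a x 0 y; rewrite bilin0l !addr0. Qed.

Lemma bilinZr a x y : be x (a *: y) = a *: be x y.
Proof. by have := bb.2 a x y 0; rewrite bilin0r !addr0. Qed.

Lemma bilinNl x y : be (- x) y = - be x y.
Proof. by rewrite -scaleN1r bilinZl scaleN1r. Qed.

Lemma bilinNr x y : be x (- y) = - be x y.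
Proof. by rewrite -scaleN1r bilinZr scaleN1r. Qed.

Lemma bilin_suml (I : Type) (r : seq I) (P : pred I) (u : I -> 'rV[R]_m) y :
  be (\sum_(i <- r | P i) u i) y = \sum_(i <- r | P i) be (u i) y.
Proof. by elim/big_rec2: _ => [|i s t _ <-]; rewrite ?bilin0l // bilinDl. Qed.

Lemma bilin_sumr (I : Type) (r : seq I) (P : pred I) (u : I -> 'rV[R]_p) x :
  be x (\sum_(i <- r | P i) u i) = \sum_(i <- r | P i) be x (u i).
Proof. by elim/big_rec2: _ => [|i s t _ <-]; rewrite ?bilin0r // bilinDr. Qed.

Lemma is_derive_bigsum (E W : normedModType R) (I : finType) (h : I -> E -> W) (dh : I -> W) x v :
  (forall i, is_derive x v (h i) (dh i)) ->
  is_derive x v (fun y => \sum_i h i y) (\sum_i dh i).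
Proof.
move=> H; elim: (index_enum I) => [|i r IH].
  have -> : (fun y => \sum_(i <- [::]) h i y) = (fun=> 0) by apply/funext => y; rewrite big_nil.
  by rewrite big_nil; exact: is_derive_cst.
have -> : (fun y => \sum_(i <- i :: r) h i y) = (h i + fun y => \sum_(i <- r) h i y).
  by apply/funext => y; rewrite big_cons.
by rewrite big_cons; exact: is_deriveD (H i) IH.
Qed.

Lemma is_derive_bilin (E : normedModType R) (f : E -> 'rV[R]_m) (g : E -> 'rV[R]_p) x v :
  derivable f x v -> derivable g x v ->
  is_derive x v (fun y => be (f y) (g y)) (be ('D_v f x) (g x) + be (f x) ('D_v g x)).
Proof.
move=> df dg.
have dfi i : derivable (fun y => f y 0 i) x v by move/derivable_mxP : df; exact.
have dgj j : derivable (fun y => g y 0 j) x v by move/derivable_mxP : dg; exact.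
rewrite (_ : (fun y => be (f y) (g y)) = (fun y => \sum_(ij : 'I_m * 'I_p)
   (f y 0 ij.1 * g y 0 ij.2) *: be (evec ij.1) (evec ij.2))); last first.
  by apply/funext => y; rewrite bilinear_expand.
rewrite !bilinear_expand -big_split /=.
apply: is_derive_bigsum => -[i j] /=.
rewrite -scalerDl !derive_coord // -derive_mulr //.
exact: is_derive_scaler (derivable_mulr (dfi i) (dgj j)).
Qed.

Lemma Ck_bilin (E : normedModType R) k (U : set E) (f : E -> 'rV[R]_m) (g : E -> 'rV[R]_p) :
  open U -> Ck k U f -> Ck k U g -> Ck k U (fun y => be (f y) (g y)).
Proof.
move=> oU /(Ck_mxP _ _ oU) Cf /(Ck_mxP _ _ oU) Cg.
apply: (@Ck_eq _ _ _ _ _ (fun y => \sum_(ij : 'I_m * 'I_p)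
  (f y 0 ij.1 * g y 0 ij.2) *: be (evec ij.1) (evec ij.2))) => //.
  by move=> y _; rewrite -bilinear_expand.
by apply: Ck_sum => // ij _; apply: Ck_scaler => //; apply: Ck_mul.
Qed.

End Bilinear.
Lemma bilin_altC m (F : lmodType R) (be : 'rV[R]_m -> 'rV[R]_m -> F) : bilinear_map be ->
  (forall x, be x x = 0) -> forall x y, be x y = - be y x.
Proof.
move=> bb be0 x y; have := be0 (x + y).
have [b1 b2] := bb.
have := b1 1 x y (x + y); rewrite !scale1r => ->.
have := b2 1 x x y; have := b2 1 y x y; rewrite !scale1r => -> ->.
by rewrite !be0 add0r addr0 => /eqP; rewrite addr_eq0 => /eqP.
Qed.

End CkMore.

Section Charts.
Context {R : realType} {n : nat} {T : Type} (A : set (chart R n T)).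
Implicit Types c d : chart R n T.

Lemma adm_ccoo c p : admissible A c -> cimg c p -> cdom c (ccoo c p) /\ cpar c (ccoo c p) = p.
Proof. by move=> [_ ck _ _] [x xc <-]; rewrite ck. Qed.

Lemma open_preim (E F : normedModType R) (V : set E) (O : set F) (phi : E -> F) :
  open V -> (forall x, V x -> {for x, continuous phi}) -> open O ->
  open (V `&` phi @^-1` O).
Proof.
move=> oV cphi oO; apply: open_local => x [Vx Ox].
have : nbhs x (V `&` phi @^-1` O).
  apply: filterI; first exact: open_nbhs_nbhs.
  by apply: (cphi x Vx); exact: open_nbhs_nbhs.
rewrite nbhsE => -[B [oB Bx] BV]; by exists B.
Qed.

End Charts.

Section SmoothTo.
Context {R : realType} {m : nat} (G : lieGroup R m).
Local Notation A := (latlas G).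

Lemma lie_atlas c : A c -> admissible A c.
Proof. by have [atl _ _ _ _] := lg_manifold G; exact: atl. Qed.

Lemma lie_cover (p : G) : exists2 c, A c & cimg c p.
Proof.
have [_ cov _ _ _] := lg_manifold G.
have [c Ac cp] : (\bigcup_(c in A) cimg c) p by rewrite cov.
by exists c.
Qed.

Lemma smooth_to_subset (E : normedModType R) (U V : set E) (f : E -> G) :
  open V -> V `<=` U -> smooth_to A U f -> smooth_to A V f.
Proof.
move=> oV VU sf c Ac; have [oc1 s1] := sf c Ac.
have -> : V `&` f @^-1` cimg c = V `&` (U `&` f @^-1` cimg c).
  by rewrite setIA (setIidl VU).
by split; [exact: openI|move=> k; apply: Ck_subset (s1 k); exact: subIsetr].
Qed.

Lemma smooth_to_const (E : normedModType R) (U : set E) (h : G) :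
  open U -> smooth_to A U (fun=> h).
Proof.
move=> oU c Ac; split; last by move=> k; exact: Ck_cst.
have [hc|hc] := pselect (cimg c h).
  by rewrite (_ : _ `&` _ = U) //; apply/seteqP; split => [x []//|x Ux]; split.
rewrite (_ : _ `&` _ = set0); first exact: open0.
by apply/seteqP; split => [x []//|x []].
Qed.

Lemma smooth_to_cpar e : A e -> smooth_to A (cdom e) (cpar e).
Proof.
move=> Ae c Ac; have [_ _ _ /(_ c Ac)[[oc s] _]] := lie_atlas Ae.
by split.
Qed.

Lemma smooth_to_lin (E E' : normedModType R) (U : set E) (L L' : E' -> E) (f : E -> G) :
  continuous L -> (forall v h y, L (h *: v + y) = h *: L' v + L y) ->
  smooth_to A U f -> smooth_to A (L @^-1` U) (fun x => f (L x)).
Proof.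
move=> cL linL sf c Ac; have [oc s] := sf c Ac; split.
  by move/continuousP : cL => cL; exact: (cL _ oc).
by move=> k; exact: Ck_lincomp oc cL linL (s k).
Qed.

Lemma smooth_to_inv (E : normedModType R) (U : set E) (f : E -> G) :
  open U -> smooth_to A U f -> smooth_to A U (fun x => linv (f x)).
Proof.
move=> oU sf c Ac.
(* Near x the map factors through a chart [c1] around [f x]; [V] is the open set on which this
   factorization is valid. *)
have loc x : U x -> cimg c (linv (f x)) -> exists V, [/\ open V, V x,
    V `<=` U `&` (fun x => linv (f x)) @^-1` cimg c &
    forall k, Ck k V (fun x => ccoo c (linv (f x)))].
  move=> Ux fx; have [c1 A1 fc1] := lie_cover (f x).
  have [oc1 s1] := sf c1 A1; have [oc2 s2] := linv_smooth A1 Ac.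
  have [d1 p1] := adm_ccoo (lie_atlas A1) fc1.
  pose V := (U `&` f @^-1` cimg c1) `&`
    (fun x => ccoo c1 (f x)) @^-1` (cdom c1 `&` (fun x => linv (cpar c1 x)) @^-1` cimg c).
  have VK y : V y -> cpar c1 (ccoo c1 (f y)) = f y.
    by move=> [[_ fy] _]; have [] := adm_ccoo (lie_atlas A1) fy.
  have oV : open V by apply: open_preim => // y Vy; exact: (Ck_cont (s1 0%N)).
  exists V; split => //.
  - by split => //; split => //=; rewrite p1.
  - by move=> y Vy; have := VK y Vy; case: Vy => [[Uy fy] [_ /= +]] e; rewrite e => ?; split.
  move=> k; apply: (@Ck_eq _ _ _ _ _ (fun y => ccoo c (linv (cpar c1 (ccoo c1 (f y)))))) => //.
    by move=> y; rewrite inE => /VK ->.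
  apply: (Ck_comp (c := fun y => ccoo c1 (f y)) oV oc2) (s2 k).
    by move=> y [].
  by apply: Ck_subset (s1 k); exact: subIsetl.
split.
  by apply: open_local => x [Ux fx]; have [V [oV Vx VU _]] := loc x Ux fx; exists V.
by move=> k; apply: Ck_local => x [Ux fx]; have [V [oV Vx _ CV]] := loc x Ux fx; exists V.
Qed.

Lemma lsub_cont : continuous (@lsubmx R 1 m m).
Proof.
move=> w; apply: mx_cont => i j.
have -> : (fun y : 'rV[R]_(m + m) => lsubmx y i j) = (fun y => y i (lshift m j)).
  by apply/funext => y; rewrite mxE.
exact: coord_continuous.
Qed.

Lemma rsub_cont : continuous (@rsubmx R 1 m m).
Proof.
move=> w; apply: mx_cont => i j.
have -> : (fun y : 'rV[R]_(m + m) => rsubmx y i j) = (fun y => y i (rshift m j)).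
  by apply/funext => y; rewrite mxE.
exact: coord_continuous.
Qed.

Lemma smooth_to_mul (E : normedModType R) (U : set E) (f g : E -> G) :
  open U -> smooth_to A U f -> smooth_to A U g -> smooth_to A U (fun x => lmul (f x) (g x)).
Proof.
move=> oU sf sg c Ac.
have loc x : U x -> cimg c (lmul (f x) (g x)) -> exists V, [/\ open V, V x,
    V `<=` U `&` (fun x => lmul (f x) (g x)) @^-1` cimg c &
    forall k, Ck k V (fun x => ccoo c (lmul (f x) (g x)))].
  move=> Ux fx; have [c1 A1 fc1] := lie_cover (f x); have [c2 A2 gc2] := lie_cover (g x).
  have [oc1 s1] := sf c1 A1; have [oc2 s2] := sg c2 A2.
  have [oc3 s3] := lmul_smooth A1 A2 Ac.
  have [d1 p1] := adm_ccoo (lie_atlas A1) fc1.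
  have [d2 p2] := adm_ccoo (lie_atlas A2) gc2.
  (* Pairs are encoded as row vectors of length m + m, so that the chain rule applies to [phi]
     below. *)
  pose L (w : 'rV[R]_(m + m)) : 'rV[R]_m * 'rV[R]_m := (lsubmx w, rsubmx w).
  have cL : continuous L by move=> w; exact: (cvg_pair (@lsub_cont w) (@rsub_cont w)).
  have linL v h y : L (h *: v + y) = h *: L v + L y by rewrite /L !linearP.
  pose O := [set z : 'rV[R]_m * 'rV[R]_m | cdom c1 z.1 /\ cdom c2 z.2] `&`
     (fun z => lmul (cpar c1 z.1) (cpar c2 z.2)) @^-1` cimg c.
  have oO : open (L @^-1` O) by move/continuousP : (cL) => cL'; exact: (cL' _ oc3).
  pose phi y : 'rV[R]_(m + m) := row_mx (ccoo c1 (f y)) (ccoo c2 (g y)).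
  pose V0 := (U `&` f @^-1` cimg c1) `&` (U `&` g @^-1` cimg c2).
  have oV0 : open V0 by exact: openI.
  have Cphi k : Ck k V0 phi.
    apply/Ck_mxP => // i j; rewrite /phi.
    case: (fintype.splitP j) => k' jk'.
      have -> : j = lshift m k' by apply/val_inj.
      apply: (@Ck_eq _ _ _ _ _ (fun y => ccoo c1 (f y) i k')) => //.
        by move=> y _; rewrite row_mxEl.
      have /Ck_mxP := s1 k; move/(_ oc1)/(_ i k'); apply: Ck_subset; exact: subIsetl.
    have -> : j = rshift m k' by apply/val_inj.
    apply: (@Ck_eq _ _ _ _ _ (fun y => ccoo c2 (g y) i k')) => //.
      by move=> y _; rewrite row_mxEr.
    have /Ck_mxP := s2 k; move/(_ oc2)/(_ i k'); apply: Ck_subset; exact: subIsetr.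
  pose V := V0 `&` phi @^-1` (L @^-1` O).
  have Lphi y : L (phi y) = (ccoo c1 (f y), ccoo c2 (g y)) by rewrite /L /phi row_mxKl row_mxKr.
  have VK y : V y -> cpar c1 (ccoo c1 (f y)) = f y /\ cpar c2 (ccoo c2 (g y)) = g y.
    move=> [[[_ fy] [_ gy]] _]; have [_ ->] := adm_ccoo (lie_atlas A1) fy.
    by have [_ ->] := adm_ccoo (lie_atlas A2) gy.
  have oV : open V by apply: open_preim => // y Vy; exact: (Ck_cont (Cphi 0%N)).
  exists V; split => //.
  - by split => //; rewrite /= Lphi; split => //=; rewrite p1 p2.
  - move=> y Vy; have [e1 e2] := VK y Vy; case: Vy => [[[Uy _] _]].
    by rewrite /= Lphi => -[_ /=]; rewrite e1 e2.
  move=> k.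
  apply: (@Ck_eq _ _ _ _ _ (fun y => (fun z => ccoo c (lmul (cpar c1 z.1) (cpar c2 z.2))) (L (phi y)))) => //.
    by move=> y; rewrite inE => /VK[e1 e2]; rewrite Lphi /= e1 e2.
  have CF := Ck_lincomp oc3 cL linL (s3 k).
  apply: (Ck_comp (c := phi) oV oO) CF; first by move=> y [].
  by apply: Ck_subset (Cphi k); exact: subIsetl.
split.
  by apply: open_local => x [Ux fx]; have [V [oV Vx VU _]] := loc x Ux fx; exists V.
by move=> k; apply: Ck_local => x [Ux fx]; have [V [oV Vx _ CV]] := loc x Ux fx; exists V.
Qed.

End SmoothTo.

Local Opaque derive.

Section LieGroupFacts.
Context {R : realType} {m : nat} (G : lieGroup R m).
Local Notation "1" := (lone G).
Implicit Types g h k : G.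

Lemma lmulgV h : lmul h (linv h) = 1.
Proof.
have H : lmul (linv (linv h)) (linv h) = 1 by exact: lmulV.
transitivity (lmul (lmul (linv (linv h)) (linv h)) (lmul h (linv h))); first by rewrite H lmul1.
by rewrite -lmulA [lmul (linv h) (lmul _ _)]lmulA lmulV lmul1.
Qed.

Lemma lmulg1 h : lmul h 1 = h.
Proof. by rewrite -(lmulV h) lmulA lmulgV lmul1. Qed.

Lemma lmulKg h k : lmul (linv h) (lmul h k) = k.
Proof. by rewrite lmulA lmulV lmul1. Qed.

Lemma lmulI h k k' : lmul h k = lmul h k' -> k = k'.
Proof. by move=> e; rewrite -(lmulKg h k) e lmulKg. Qed.

Lemma linv1 : linv 1 = 1.
Proof. by rewrite -[LHS]lmul1 lmulgV. Qed.

Lemma linvM h k : linv (lmul h k) = lmul (linv k) (linv h).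
Proof.
apply: (@lmulI (lmul h k)); rewrite lmulgV -lmulA [lmul k _]lmulA lmulgV lmul1.
by rewrite lmulgV.
Qed.

End LieGroupFacts.

(** * Conjugation, the adjoint action and the bracket *)

Section LieAlgebraFacts.
Context {R : realType} {m : nat} (G : lieGroup R m).
Local Notation e := (lchart G).
Local Notation u1 := (ccoo (lchart G) (lone G)).
Local Notation E := 'rV[R]_m.
Local Notation br := (brk G).

Definition cj (h g : G) : G := lmul (lmul h g) (linv h).

Definition cjc (h : G) (u : E) : E := ccoo e (cj h (cpar e u)).

Definition cjdom (h : G) : set E := cdom e `&` (fun u => cj h (cpar e u)) @^-1` cimg e.

Lemma AdE (h : G) (X : E) : Ad h X = 'D_X (cjc h) u1.
Proof. by []. Qed.

Lemma cjM g h k : cj (lmul g h) k = cj g (cj h k).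
Proof. by rewrite /cj linvM !lmulA. Qed.

Lemma cj1 h : cj h (lone G) = lone G.
Proof. by rewrite /cj lmulg1 lmulgV. Qed.

Lemma cj1l h : cj (lone G) h = h.
Proof. by rewrite /cj linv1 lmulg1 lmul1. Qed.

Lemma e_atlas : latlas G e.
Proof. by have [] := lg_chart G. Qed.

Lemma e_open : open (cdom e).
Proof. by have [] := lie_atlas e_atlas. Qed.

Lemma e_cooK u : cdom e u -> ccoo e (cpar e u) = u.
Proof. by have [_ H _ _] := lie_atlas e_atlas; exact: H. Qed.

Lemma e_parK p : cimg e p -> cdom e (ccoo e p) /\ cpar e (ccoo e p) = p.
Proof. exact: adm_ccoo (lie_atlas e_atlas). Qed.

Lemma e_one : cdom e u1 /\ cpar e u1 = lone G.
Proof. by apply: e_parK; have [] := lg_chart G. Qed.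

Lemma cj_smooth h : smooth_to (latlas G) (cdom e) (fun u => cj h (cpar e u)).
Proof.
have o := e_open; have s := smooth_to_cpar e_atlas.
by do 2?apply: smooth_to_mul => //; exact: smooth_to_const.
Qed.

Lemma cjdom_open h : open (cjdom h).
Proof. by have [] := cj_smooth h e_atlas. Qed.

Arguments cjdom_open : clear implicits.

Lemma cjdom1 h : cjdom h u1.
Proof.
have [d p] := e_one; split => //=; rewrite p cj1.
by have [] := lg_chart G.
Qed.

Lemma cjc_Ck h k : Ck k (cjdom h) (cjc h).
Proof. by have [_] := cj_smooth h e_atlas; exact. Qed.

Lemma Ad_linear (h : G) a (X Y : E) : Ad h (a *: X + Y) = a *: (Ad h X : E) + Ad h Y.
Proof. exact: (derive_linear a X Y (cjdom_open h) (cjc_Ck h 1) (cjdom1 h)). Qed.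

Lemma Ad0 (h : G) : Ad h (0 : E) = 0 :> E.
Proof. exact: derive0. Qed.

Lemma AdD (h : G) (X Y : E) : Ad h (X + Y) = Ad h X + Ad h Y :> E.
Proof. by have := Ad_linear h 1 X Y; rewrite !scale1r. Qed.

Lemma Ad1 (X : E) : Ad (lone G) X = X :> E.
Proof.
rewrite AdE (@eq_derive _ _ _ (cdom e) _ id) ?derive_id //; first exact: e_open.
  by move=> u; rewrite inE => eu; rewrite /cjc cj1l e_cooK.
by have [] := e_one.
Qed.

Lemma cjc_u1 h : cjc h u1 = u1.
Proof. by rewrite /cjc (e_one).2 cj1. Qed.

Lemma AdM (g h : G) (X : E) : Ad (lmul g h) X = Ad g (Ad h X : lie G) :> E.
Proof.
rewrite !AdE; pose V := cjdom h `&` cjc h @^-1` cjdom g.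
have oV : open V.
  by apply: open_preim; [exact: cjdom_open|move=> x; exact: Ck_cont (cjc_Ck h 0)|exact: cjdom_open].
have V1 : V u1 by split; [exact: cjdom1|rewrite /= cjc_u1; exact: cjdom1].
transitivity ('D_X (fun u => cjc g (cjc h u)) u1).
  apply: (@eq_derive _ _ _ V) => // u; rewrite inE => -[[du iu] _]; rewrite /cjc cjM.
  by have [_ ->] := e_parK iu.
have cg1 : cjdom g (cjc h u1) by rewrite cjc_u1; exact: cjdom1.
have dh : derivable (cjc h) u1 X by exact: (Ck_der (cjc_Ck h 1) (cjdom1 h)).
have [_ ->] := derive_comp (cjdom_open g) (cjc_Ck g 1) cg1 dh.
by rewrite cjc_u1.
Qed.

(* (u, v) |-> u v u^-1 in the chart e, as a function on R^(2m). *)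
Definition K (w : 'rV[R]_(m + m)) : E := cjc (cpar e (lsubmx w)) (rsubmx w).
Definition Kdom : set 'rV[R]_(m + m) :=
  [set w | cdom e (lsubmx w) /\ cdom e (rsubmx w)] `&`
  (fun w => cj (cpar e (lsubmx w)) (cpar e (rsubmx w))) @^-1` cimg e.
Local Notation k0 := (row_mx u1 u1).

Lemma K_smooth : open Kdom /\ smooth_on Kdom K.
Proof.
have s := smooth_to_cpar e_atlas; have o := e_open.
have lsl (v : 'rV[R]_(m + m)) (h : R) y : lsubmx (h *: v + y) = h *: lsubmx v + lsubmx y.
  by rewrite linearP.
have rsl (v : 'rV[R]_(m + m)) (h : R) y : rsubmx (h *: v + y) = h *: rsubmx v + rsubmx y.
  by rewrite linearP.
have ol : open (@lsubmx R 1 m m @^-1` cdom e).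
  by have /continuousP c := @lsub_cont R m; exact: (c _ o).
have or : open (@rsubmx R 1 m m @^-1` cdom e).
  by have /continuousP c := @rsub_cont R m; exact: (c _ o).
have sl := smooth_to_lin (@lsub_cont R m) lsl s.
have sr := smooth_to_lin (@rsub_cont R m) rsl s.
pose D := @lsubmx R 1 m m @^-1` cdom e `&` @rsubmx R 1 m m @^-1` cdom e.
have oD : open D by exact: openI.
have sl' := smooth_to_subset oD (@subIsetl _ _ _) sl.
have sr' := smooth_to_subset oD (@subIsetr _ _ _) sr.
have := smooth_to_mul oD (smooth_to_mul oD sl' sr') (smooth_to_inv oD sl').
by move=> /(_ _ e_atlas).
Qed.

Lemma Kdom0 : Kdom k0.
Proof.
have [d p] := e_one.
split; first by rewrite /= row_mxKl row_mxKr.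
by rewrite /= row_mxKl row_mxKr p cj1; have [] := lg_chart G.
Qed.

Lemma Kdom_open : open Kdom. Proof. by have [H _] := K_smooth; exact: H. Qed.
Lemma K_Ck k : Ck k Kdom K. Proof. by have [_ H] := K_smooth; exact: H. Qed.

Lemma Ad_K u (Y : E) : Ad (cpar e u) Y = 'D_(row_mx 0 Y) K (row_mx u u1).
Proof.
rewrite AdE; apply: derive_along => h.
by rewrite scale_row_mx scaler0 add_row_mx add0r /K !row_mxKl !row_mxKr.
Qed.

Lemma brkE (X Y : E) : br X Y = 'D_X (fun u => Ad (cpar e u) Y : E) u1.
Proof. exact: erefl. Qed.

(** As a mixed second derivative of the conjugation map, the bracket inherits bilinearity, and the
    symmetry of second derivatives becomes available. *)
Lemma brk_K (X Y : E) : br X Y = 'D_(row_mx X 0) ('D_(row_mx 0 Y) K) k0.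
Proof.
apply: etrans (brkE X Y) _; apply: derive_along => h.
by rewrite scale_row_mx scaler0 add_row_mx add0r -!Ad_K.
Qed.

Lemma brk_bilinear : bilinear_map (F := E) br.
Proof.
split=> a X X' Y.
  rewrite !brk_K.
  have -> : row_mx (a *: X + X') 0 = a *: row_mx X 0 + row_mx X' 0 :> 'rV[R]_(m + m).
    by rewrite scale_row_mx scaler0 add_row_mx add0r.
  exact: derive_linear Kdom_open (CkD _ (K_Ck 2)) Kdom0.
rewrite !brk_K.
have -> : row_mx 0 (a *: X' + Y) = a *: row_mx 0 X' + row_mx 0 Y :> 'rV[R]_(m + m).
  by rewrite scale_row_mx scaler0 add_row_mx add0r.
have oK := Kdom_open.
have d1 (Z : 'rV[R]_(m + m)) : derivable ('D_Z K) k0 (row_mx X 0).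
  exact: Ck_der (CkD Z (K_Ck 2)) Kdom0.
transitivity ('D_(row_mx X 0) (a *: 'D_(row_mx 0 X') K + 'D_(row_mx 0 Y) K) k0).
  apply: (@eq_derive _ _ _ Kdom) Kdom0; first exact: oK.
  move=> w; rewrite inE => Kw.
  exact: derive_linear (K_Ck 1) Kw.
have d2 : derivable (a *: 'D_(row_mx 0 X') K) k0 (row_mx X 0) by exact: derivableZ.
exact: etrans (deriveD d2 (d1 _)) (congr1 (fun z => z + _) (deriveZ a (d1 _))).
Qed.

Lemma schwarz_rV p (U : set 'rV[R]_p) (f : 'rV[R]_p -> E) x u v : open U -> Ck 2 U f -> U x ->
  'D_u ('D_v f) x = 'D_v ('D_u f) x.
Proof.
move=> oU Cf Ux; apply/rowP => j.
have Cj : Ck 2 U (fun y => f y 0 j) by move/Ck_mxP : Cf; apply.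
have h w z : 'D_w ('D_z f) x 0 j = 'D_w ('D_z (fun y => f y 0 j)) x.
  have d : derivable ('D_z f) x w by exact: Ck_der (CkD _ Cf) Ux.
  apply: etrans (derive_coord 0 j d) _; apply: (@eq_derive _ _ _ U) => // y.
  rewrite inE => Uy; have df : derivable f y z by exact: Ck_der Cf Uy.
  exact: (derive_coord 0 j df).
exact: etrans (h u v) (etrans (schwarz u v oU Cj Ux) (esym (h v u))).
Qed.

Lemma near_line_open (p : nat) (U : set 'rV[R]_p) x v : open U -> U x ->
  \forall t \near (0 : R), U (t *: v + x).
Proof.
move=> oU Ux; have [d d0 dP] := near_line v (near_open oU Ux).
near=> t; rewrite addrC; apply: dP; apply: ltW; near: t.
exact: (@pseudometric_normed_Zmodule.nbhs0_lt R R^o d d0).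
Unshelve. all: by end_near. Qed.

(** In the chart, conjugation satisfies K(u, 1) = 1, K(1, v) = v and K(u, u) = u, so the second
    derivatives along [a], [b] and [a + b] all vanish. Expanding the third leaves twice the mixed
    derivative, by symmetry, and this is the bracket. *)
Lemma brkXX (X : E) : br X X = 0.
Proof.
have oK := Kdom_open; have K0 := Kdom0; have C2 := K_Ck 2.
have [d1 p1] := e_one; have oe := e_open.
set a := row_mx X 0 : 'rV[R]_(m + m); set b := row_mx 0 X : 'rV[R]_(m + m).
have nearU v : \forall t \near (0 : R), cdom e (t *: v + u1) by exact: near_line_open.
have aa : 'D_a ('D_a K) k0 = 0.
  apply: (@derive_const_line _ _ _ _ _ _ 0); near=> t.
  have tu : cdom e (t *: X + u1) by near: t; exact: nearU.
  rewrite /a scale_row_mx scaler0 add_row_mx add0r.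
  apply: (@derive_const_line _ _ _ _ _ _ u1); near=> s.
  rewrite scale_row_mx scaler0 add_row_mx add0r /K row_mxKl row_mxKr.
  by rewrite cjc_u1.
have bb : 'D_b ('D_b K) k0 = 0.
  apply: (@derive_const_line _ _ _ _ _ _ X); near=> t.
  have tu : cdom e (t *: X + u1) by near: t; exact: nearU.
  rewrite /b scale_row_mx scaler0 add_row_mx add0r -/b.
  have -> : 'D_b K (row_mx u1 (t *: X + u1)) = 'D_X id (t *: X + u1); last exact: derive_id.
  transitivity ('D_X (cjc (lone G)) (t *: X + u1)).
    apply: derive_along => h.
    by rewrite /b scale_row_mx scaler0 add_row_mx add0r /K !row_mxKl !row_mxKr p1.
  apply: (@eq_derive _ _ _ (cdom e)) => // u; rewrite inE => du.
  by rewrite /cjc cj1l e_cooK.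
have cc : 'D_(a + b) ('D_(a + b) K) k0 = 0.
  apply: (@derive_const_line _ _ _ _ _ _ X); near=> t.
  have tu : cdom e (t *: X + u1) by near: t; exact: nearU.
  rewrite /a /b add_row_mx addr0 add0r scale_row_mx add_row_mx.
  have -> : 'D_(row_mx X X) K (row_mx (t *: X + u1) (t *: X + u1)) = 'D_X id (t *: X + u1);
    last exact: derive_id.
  transitivity ('D_X (fun u => K (row_mx u u)) (t *: X + u1)).
    apply: derive_along => h.
    by rewrite scale_row_mx add_row_mx.
  apply: (@eq_derive _ _ _ (cdom e)) => // u; rewrite inE => du.
  by rewrite /K row_mxKl row_mxKr /cjc /cj -lmulA lmulgV lmulg1 e_cooK.
have sc : 'D_b ('D_a K) k0 = 'D_a ('D_b K) k0 by exact: schwarz_rV C2 K0.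
have d2 Z W : derivable ('D_Z K) k0 W by exact: Ck_der (CkD Z C2) K0.
have lin (Z W : 'rV[R]_(m + m)) w : Kdom w -> 'D_(Z + W) K w = 'D_Z K w + 'D_W K w.
  by move=> Kw; have := derive_linear 1 Z W oK (K_Ck 1) Kw; rewrite !scale1r.
have lin2 (Z W V : 'rV[R]_(m + m)) : 'D_(Z + W) ('D_V K) k0 = 'D_Z ('D_V K) k0 + 'D_W ('D_V K) k0.
  by have := derive_linear 1 Z W oK (CkD V C2) K0; rewrite !scale1r.
have e1 : 'D_(a + b) ('D_(a + b) K) k0 = 'D_(a + b) ('D_a K + 'D_b K) k0.
  apply: (@eq_derive _ _ _ Kdom) K0; first exact: oK.
  by move=> w; rewrite inE => Kw; exact: (lin _ _ _ Kw).
have e2 : 'D_(a + b) ('D_a K + 'D_b K) k0 = 'D_(a + b) ('D_a K) k0 + 'D_(a + b) ('D_b K) k0.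
  exact: deriveD.
have gen (x y z w c : E) : c = 0 -> c = (x + y) + (z + w) -> x = 0 -> y = z -> w = 0 -> z = 0.
  move=> -> + x0 yz w0; rewrite x0 yz w0 add0r addr0 -mulr2n -scaler_nat => /esym/eqP.
  by rewrite scaler_eq0 pnatr_eq0 => /eqP.
apply: etrans (brk_K X X) _.
apply: (gen _ _ _ _ _ cc _ aa sc bb).
exact: etrans e1 (etrans e2 (congr2 +%R (lin2 a b a) (lin2 a b b))).
Unshelve. all: by end_near. Qed.

Lemma brkC (X Y : E) : br X Y = - br Y X.
Proof.
exact: (bilin_altC brk_bilinear brkXX).
Qed.

Lemma Ad_cpar_Ck k (Y : E) : exists V, [/\ open V, V u1, V `<=` cdom e &
  Ck k V (fun u => Ad (cpar e u) Y : E)].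
Proof.
pose L (u : E) : 'rV[R]_(m + m) := row_mx u u1.
pose L' (u : E) : 'rV[R]_(m + m) := row_mx u 0.
have cL : continuous L.
  move=> u; apply: mx_cont => i j; rewrite /L.
  case: (fintype.splitP j) => k' jk'.
    have -> : j = lshift m k' by apply/val_inj.
    have -> : (fun y : E => row_mx y u1 i (lshift m k')) = (fun y => y i k').
      by apply/funext => y; rewrite row_mxEl.
    exact: coord_continuous.
  have -> : j = rshift m k' by apply/val_inj.
  have -> : (fun y : E => row_mx y u1 i (rshift m k')) = (fun y => u1 i k').
    by apply/funext => y; rewrite row_mxEr.
  exact: cst_continuous.
have linL v h y : L (h *: v + y) = h *: L' v + L y.
  by rewrite /L /L' scale_row_mx scaler0 add_row_mx add0r.
have C := Ck_lincomp Kdom_open cL linL (CkD (row_mx 0 Y) (K_Ck k.+1)).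
exists (L @^-1` Kdom); split.
- by move/continuousP : (cL) => cL'; exact: (cL' _ Kdom_open).
- exact: Kdom0.
- by move=> u [[]]; rewrite /L row_mxKl.
have e1 : (fun u => Ad (cpar e u) Y) = (fun x : E => 'D_(row_mx 0 Y) K (L x)).
  by apply/funext => u; rewrite Ad_K.
by rewrite e1.
Qed.

(** Differentiate Ad(h u h^-1) Ad(h) Y = Ad(h) Ad(u) Y in u at the identity, the left side by the
    chain rule. *)
Lemma brk_Ad (h : G) (X Y : E) : br (Ad h X) (Ad h Y) = Ad h (br X Y).
Proof.
pose psi (Z : E) u : E := Ad (cpar e u) Z.
have [V [oV V1 Ve CV]] := Ad_cpar_Ck 1 (Ad h Y).
have [V' [oV' V1' Ve' CV']] := Ad_cpar_Ck 1 Y.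
have dcj : derivable (cjc h) u1 X by exact: Ck_der (cjc_Ck h 1) (cjdom1 h).
have Vc : V (cjc h u1) by rewrite cjc_u1.
have [_] := derive_comp oV CV Vc dcj.
rewrite cjc_u1 -!AdE => e1.
apply: etrans (brkE _ _) _; apply: etrans (esym e1) _.
transitivity ('D_X (fun u => Ad h (psi Y u) : E) u1).
  apply: (@eq_derive _ _ _ (cjdom h)) (cjdom1 h); first exact: cjdom_open.
  move=> u; rewrite inE => -[du iu]; rewrite /psi /cjc; have [_ ->] := e_parK iu.
  by rewrite /cj !AdM -[Ad (linv h) (Ad h Y)]AdM lmulV Ad1.
have dpsi : derivable (psi Y) u1 X by exact: Ck_der CV' V1'.
have -> : (fun u => Ad h (psi Y u)) = (fun u => \sum_i psi Y u 0 i *: (Ad h (evec i) : E)).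
  apply/funext => u; exact: (linear_expand (fun a u v => Ad_linear h a u v)).
have dci i : derivable (fun u => psi Y u 0 i) u1 X by move/derivable_mxP : dpsi; exact.
have [_ ->] := is_derive_bigsum (fun i => is_derive_scaler (Ad h (evec i) : E) (dci i)).
rewrite [RHS](linear_expand (fun a u v => Ad_linear h a u v)); apply: eq_bigr => i _.
by rewrite -derive_coord.
Qed.

(** The derivative of the invariance [brk_Ad] along Z at the identity. *)
Lemma jacobi (X Y Z : E) : br Z (br X Y) = (br (br Z X) Y : E) + br X (br Z Y).
Proof.
pose psi (Z : E) u : E := Ad (cpar e u) Z.
have dpsi W : derivable (psi W) u1 Z.
  by have [V [oV V1 Ve CV]] := Ad_cpar_Ck 1 W; exact: Ck_der CV V1.
have psi1 W : psi W u1 = W by rewrite /psi (e_one).2 Ad1.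
apply: etrans (brkE _ _) _; rewrite -/(psi (br X Y)).
have -> : psi (br X Y) = (fun u => br (psi X u) (psi Y u)).
  by apply/funext => u; rewrite /psi brk_Ad.
have [_ ->] := is_derive_bilin brk_bilinear (dpsi X) (dpsi Y).
by rewrite !psi1.
Qed.

Variable ip : lie G -> lie G -> R.
Hypothesis ipP : Ad_inner_product ip.

Lemma ip_bilinear : bilinear_map (F := R^o) (ip : E -> E -> R^o).
Proof.
have [ipl ips _ _] := ipP; split=> a x x' y; first exact: ipl.
by rewrite ips ipl ![ip _ x]ips.
Qed.

Lemma ipC (X Y : E) : ip X Y = ip Y X. Proof. by have [_ + _ _] := ipP; exact. Qed.

Lemma ip_ge0 (X : E) : 0 <= ip X X.
Proof.
have [X0|X0] := eqVneq (X : E) 0.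
  by rewrite X0 [ip 0 0](bilin0l ip_bilinear).
by have [_ _ + _] := ipP; move/(_ _ X0); exact: ltW.
Qed.

Lemma ip_eq0 (X : E) : ip X X = 0 -> X = 0.
Proof.
move=> i0; apply/eqP/negPn/negP => X0.
by have [_ _ + _] := ipP; move/(_ _ X0); rewrite i0 ltxx.
Qed.

(** The derivative at the identity of the Ad-invariance of the inner product. *)
Lemma ip_brk (X Y Z : E) : ip (br X Y) Z + ip Y (br X Z) = 0.
Proof.
pose psi (Z : E) u : E := Ad (cpar e u) Z.
have dpsi W : derivable (psi W) u1 X.
  by have [V [oV V1 Ve CV]] := Ad_cpar_Ck 1 W; exact: Ck_der CV V1.
have psi1 W : psi W u1 = W by rewrite /psi (e_one).2 Ad1.
have [_] := is_derive_bilin ip_bilinear (dpsi Y) (dpsi Z).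
rewrite !psi1 -[X in ip X Z]/(br X Y) -[X in ip Y X]/(br X Z) => <-.
have -> : (fun u => (ip : E -> E -> R^o) (psi Y u) (psi Z u)) = (fun=> ip Y Z).
  by apply/funext => u; rewrite /psi; have [_ _ _ ->] := ipP.
exact: derive_cst.
Qed.

End LieAlgebraFacts.

(** * Gauge theory in a chart *)

Section LocalGauge.
Context {R : realType} {m : nat}.
Local Notation E := 'rV[R]_6.
Local Notation V := 'rV[R]_m.

Lemma is_derive_scalev (E' : normedModType R) (f : E' -> R) (g : E' -> V) x v :
  derivable f x v -> derivable g x v ->
  is_derive x v (fun y => f y *: g y) ('D_v f x *: g x + f x *: 'D_v g x).
Proof.
move=> df dg.
have dgj j : derivable (fun y => g y 0 j) x v := (derivable_mxP g x v).1 dg 0 j.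
have d : derivable (fun y => f y *: g y) x v.
  apply/derivable_mxP => i j; rewrite !ord1.
  have -> : (fun y => (f y *: g y) 0 j) = (fun y => f y * g y 0 j).
    by apply/funext => y; rewrite mxE.
  exact: (derivable_mulr df (dgj j)).
split => //; apply/rowP => j; apply: etrans (derive_coord 0 j d) _.
have -> : (fun y => (f y *: g y) 0 j) = (fun y => f y * g y 0 j).
  by apply/funext => y; rewrite mxE.
apply: etrans (derive_mulr df (dgj j)) _.
by rewrite [RHS]mxE [X in _ = X + _]mxE [X in _ = _ + X]mxE (derive_coord 0 j dg).
Qed.

Lemma Ck_scalev (E' : normedModType R) k (U : set E') (f : E' -> R) (g : E' -> V) :
  open U -> Ck k U f -> Ck k U g -> Ck k U (fun y => f y *: g y).
Proof.
move=> oU Cf /(Ck_mxP _ _ oU) Cg; apply/Ck_mxP => // i j.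
apply: (@Ck_eq _ _ _ _ _ (fun y => f y * g y i j)) => //.
  by move=> y _; rewrite mxE.
exact: Ck_mul.
Qed.

Lemma is_derive_alt6 (E' W : normedModType R)
    (T : 'I_6 -> 'I_6 -> 'I_6 -> 'I_6 -> 'I_6 -> 'I_6 -> E' -> W) dT x v :
  (forall a b c d e g, is_derive x v (T a b c d e g) (dT a b c d e g)) ->
  is_derive x v (fun y => alt6 (fun a b c d e g => T a b c d e g y)) (alt6 dT).
Proof.
by move=> H; rewrite /alt6; apply: is_derive_bigsum => s.
Qed.

Lemma Ck_alt6 (E' W : normedModType R) k (U : set E')
    (T : 'I_6 -> 'I_6 -> 'I_6 -> 'I_6 -> 'I_6 -> 'I_6 -> E' -> W) : open U ->
  (forall a b c d e g, Ck k U (T a b c d e g)) ->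
  Ck k U (fun y => alt6 (fun a b c d e g => T a b c d e g y)).
Proof. by move=> oU H; apply: Ck_sum => // s _; exact: Ck_scale. Qed.

Variables (be : V -> V -> V).
Hypothesis bb : bilinear_map (F := V) be.
Hypothesis beC : forall X Y, be X Y = - be Y X.
Hypothesis beJ : forall X Y Z, be Z (be X Y) = be (be Z X) Y + be X (be Z Y).

Variables (U : set E) (B : 'I_6 -> E -> V).
Hypothesis oU : open U.
Hypothesis sB : forall i, smooth_on U (B i).


Definition Fc (i j : 'I_6) (x : E) : V :=
  'D_(evec i) (B j) x - 'D_(evec j) (B i) x + be (B i x) (B j x).

Definition nab (i : 'I_6) (f : E -> V) (x : E) : V :=
  'D_(evec i) f x + be (B i x) (f x).

Lemma CkDs (F' : normedModType R) k (f : E -> F') v : smooth_on U f -> Ck k U ('D_v f).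
Proof. by move=> sf; exact: CkD. Qed.

Lemma Fc_Ck i j k : Ck k U (Fc i j).
Proof.
apply: Ck_add => //; last by apply: Ck_bilin => //; exact: sB.
by apply: Ck_add => //; [exact: CkDs|apply: Ck_opp => //; exact: CkDs].
Qed.

Lemma nab_Ck i f k : smooth_on U f -> Ck k U (nab i f).
Proof.
by move=> sf; apply: Ck_add => //; [exact: CkDs|apply: Ck_bilin => //; exact: sB].
Qed.

Lemma is_derive_Fc i j l x : U x -> is_derive x (evec l) (Fc i j)
  ('D_(evec l) ('D_(evec i) (B j)) x - 'D_(evec l) ('D_(evec j) (B i)) x
   + (be ('D_(evec l) (B i) x) (B j x) + be (B i x) ('D_(evec l) (B j) x))).
Proof.
move=> Ux.
have dB k v : derivable (B k) x v by exact: Ck_der (sB k 1%N) Ux.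
have ddB k v w : derivable ('D_v (B k)) x w by exact: Ck_der (CkDs 1%N v (sB k)) Ux.
have h1 := derivableP (ddB j (evec i) (evec l)).
have h2 := derivableP (ddB i (evec j) (evec l)).
have h3 := is_derive_bilin bb (dB i (evec l)) (dB j (evec l)).
exact: is_deriveD (is_deriveB h1 h2) h3.
Qed.

Lemma rV_schwarz (f : E -> V) x v w : smooth_on U f -> U x ->
  'D_v ('D_w f) x = 'D_w ('D_v f) x.
Proof. by move=> sf Ux; apply: schwarz_rV oU (sf 2%N) Ux. Qed.

(** Reading key: X, Y, Z are the potentials with indices i, j, k; [ij] is the i-th derivative of the
    j-th potential; the letters a are second derivatives, and the three hypotheses are their
    symmetry. *)
Lemma bianchi_alg a1 a2 a3 a1' a2' a3' ij ji ik ki jk kj X Y Z :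
  a1' = a1 -> a2' = a2 -> a3' = a3 ->
  (a1 - a2 + (be ij Z + be Y ik) + be X (jk - kj + be Y Z))
  + (a3 - a1' + (be jk X + be Z ji) + be Y (ki - ik + be Z X))
  + (a2' - a3' + (be ki Y + be X kj) + be Z (ij - ji + be X Y)) = 0.
Proof.
move=> -> -> ->; rewrite !(bilinDr bb) !(bilinNr bb).
have J := beJ X Y Z; rewrite (beC (be Z X) Y) (beC Z Y) (bilinNr bb) in J.
rewrite (beC ij Z) (beC jk X) (beC ki Y) J.
by apply/rowP => l; rewrite !mxE; ring.
Qed.

Lemma bianchi i j k x : U x ->
  nab i (Fc j k) x + nab j (Fc k i) x + nab k (Fc i j) x = 0.
Proof.
move=> Ux; rewrite /nab.
have [_ e1] := is_derive_Fc j k i Ux; have [_ e2] := is_derive_Fc k i j Ux.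
have [_ e3] := is_derive_Fc i j k Ux.
rewrite e1 e2 e3 /Fc {e1 e2 e3}.
exact: (bianchi_alg _ _ _ _ _ _ _ _ _ (rV_schwarz (evec j) (evec i) (sB k) Ux)
  (rV_schwarz (evec k) (evec i) (sB j) Ux) (rV_schwarz (evec k) (evec j) (sB i) Ux)).
Qed.

Lemma nab_comm i j f x : smooth_on U f -> U x ->
  nab i (nab j f) x - nab j (nab i f) x = be (Fc i j x) (f x).
Proof.
move=> sf Ux.
have dn k l : is_derive x (evec l) (nab k f)
   ('D_(evec l) ('D_(evec k) f) x + (be ('D_(evec l) (B k) x) (f x) + be (B k x) ('D_(evec l) f x))).
  have h1 : is_derive x (evec l) ('D_(evec k) f) ('D_(evec l) ('D_(evec k) f) x).
    by apply: derivableP; exact: Ck_der (CkDs 1%N _ sf) Ux.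
  have dB : derivable (B k) x (evec l) by exact: Ck_der (sB k 1%N) Ux.
  have df : derivable f x (evec l) by exact: Ck_der (sf 1%N) Ux.
  exact: is_deriveD h1 (is_derive_bilin bb dB df).
have alg (a a' p q r t X Y f0 : V) : a' = a ->
    (a + (be p f0 + be Y r)) + be X (t + be Y f0) - ((a' + (be q f0 + be X t)) + be Y (r + be X f0))
    = be (p - q + be X Y) f0.
  move=> ->; rewrite !(bilinDr bb) !(bilinDl bb) (bilinNl bb) (beJ Y f0 X).
  by apply/rowP => l; rewrite !mxE; ring.
rewrite /nab; have [_ e1] := dn j i; have [_ e2] := dn i j.
rewrite -/(nab i f) -/(nab j f) e1 e2.
exact: (alg _ _ _ _ _ _ _ _ _ (rV_schwarz (evec j) (evec i) sf Ux)).
Qed.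

Lemma nab_eq i f g x : U x -> {in U, f =1 g} -> nab i f x = nab i g x.
Proof.
move=> Ux fg; rewrite /nab (eq_derive _ oU fg Ux) fg //; exact/mem_set.
Qed.

Lemma nab_add i f g x : U x -> Ck 1 U f -> Ck 1 U g ->
  nab i (fun y => f y + g y) x = nab i f x + nab i g x.
Proof.
move=> Ux Cf Cg; have df : derivable f x (evec i) by exact: Ck_der Cf Ux.
have dg : derivable g x (evec i) by exact: Ck_der Cg Ux.
rewrite /nab (bilinDr bb) addrACA; congr (_ + _); exact: deriveD.
Qed.

Lemma nab_scale i (c : E -> R) f x : U x -> Ck 1 U c -> Ck 1 U f ->
  nab i (fun y => c y *: f y) x = 'D_(evec i) c x *: f x + c x *: nab i f x.
Proof.
move=> Ux Cc Cf; have df : derivable f x (evec i) by exact: Ck_der Cf Ux.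
have dc : derivable c x (evec i) by exact: Ck_der Cc Ux.
by rewrite /nab; have [_ ->] := is_derive_scalev dc df; rewrite (bilinZr bb) scalerDr addrA.
Qed.

Lemma nab_sum i (I : finType) (f : I -> E -> V) x : U x -> (forall k, Ck 1 U (f k)) ->
  nab i (fun y => \sum_k f k y) x = \sum_k nab i (f k) x.
Proof.
move=> Ux Cf; have df k : is_derive x (evec i) (f k) ('D_(evec i) (f k) x).
  by apply: derivableP; exact: Ck_der (Cf k) Ux.
by rewrite /nab; have [_ ->] := is_derive_bigsum df; rewrite (bilin_sumr bb) -big_split.
Qed.

(* By the Bianchi identity only dP survives. *)
Lemma div_Yvec (P : 'I_6 -> 'I_6 -> 'I_6 -> E -> R) x : U x ->
  (forall c d e, smooth_on U (P c d e)) ->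
  \sum_i nab i (fun y => (12%:R : R)^-1 *: alt6 (fun a b c d e g =>
     (evec i : E) 0 g *: (P c d e y *: Fc a b y))) x
  = - (48%:R : R)^-1 *: alt6 (fun a b c d e g =>
    ('D_(evec c) (P d e g) x - 'D_(evec d) (P c e g) x + 'D_(evec e) (P c d g) x
      - 'D_(evec g) (P c d e) x) *: Fc a b x).
Proof.
move=> Ux sP.
have step i : nab i (fun y => (12%:R : R)^-1 *: alt6 (fun a b c d e g =>
     (evec i : E) 0 g *: (P c d e y *: Fc a b y))) x =
   (12%:R : R)^-1 *: alt6 (fun a b c d e g => (evec i : E) 0 g *:
     ('D_(evec g) (P c d e) x *: Fc a b x + P c d e x *: nab g (Fc a b) x)).
  have d a b c d e g : is_derive x (evec i) (fun y => (evec i : E) 0 g *: (P c d e y *: Fc a b y))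
     ((evec i : E) 0 g *: ('D_(evec i) (P c d e) x *: Fc a b x + P c d e x *: 'D_(evec i) (Fc a b) x)).
    apply: is_deriveZ; apply: is_derive_scalev; first exact: Ck_der (sP _ _ _ 1%N) Ux.
    exact: Ck_der (Fc_Ck a b 1) Ux.
  rewrite {1}/nab; have [_ ->] := is_deriveZ (12%:R^-1) (is_derive_alt6 d).
  rewrite (bilinZr bb) -scalerDr; congr (_ *: _).
  rewrite /alt6 (bilin_sumr bb) -big_split; apply: eq_bigr => s _ /=.
  rewrite (bilinZr bb) -scalerDr; congr (_ *: _); rewrite (bilinZr bb) -scalerDr.
  rewrite !mxE eqxx /=; case: eqP => [->|_]; last by rewrite !scale0r.
  by rewrite (bilinZr bb) -addrA -scalerDr.
under eq_bigr do rewrite step.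
rewrite -scaler_sumr -alt6_sum.
have -> : alt6 (fun a b c d e g => \sum_i (evec i : E) 0 g *:
     ('D_(evec g) (P c d e) x *: Fc a b x + P c d e x *: nab g (Fc a b) x)) =
  alt6 (fun a b c d e g => 'D_(evec g) (P c d e) x *: Fc a b x + P c d e x *: nab g (Fc a b) x).
  apply: eq_alt6 => a b c d e g; rewrite -scaler_suml.
  rewrite (bigD1 g) //= big1 ?mxE ?eqxx ?addr0 ?scale1r // => i /negbTE ig.
  by rewrite mxE eq_sym ig andbF.
rewrite alt6_add.
pose T a b c d e g := P c d e x *: nab g (Fc a b) x.
(* The rotations of the indices a, b, c are even, so the alternating sum of the cyclic Bianchi sum
   is three times the wanted one. *)
have T0 : alt6 T = 0.
  pose T' a b c d e g := P d e g x *: nab c (Fc a b) x.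
  have s1 : alt6 T = - alt6 T' by rewrite -(alt6_last_front T').
  rewrite s1; have c1 : alt6 (fun a b c d e g => T' b c a d e g) = alt6 T'.
    by rewrite (alt6_swap01 (fun a b c d e g => T' a c b d e g)) (alt6_swap12 T') opprK.
  have c2 : alt6 (fun a b c d e g => T' c a b d e g) = alt6 T'.
    by rewrite (alt6_swap12 (fun a b c d e g => T' b a c d e g)) (alt6_swap01 T') opprK.
  have : alt6 (fun a b c d e g => T' a b c d e g + T' b c a d e g + T' c a b d e g) = 0.
    rewrite /alt6 big1 // => s _; rewrite /T' -!scalerDr.
    by rewrite bianchi // !scaler0.
  rewrite (alt6_add (fun a b c d e g => T' a b c d e g + T' b c a d e g)
    (fun a b c d e g => T' c a b d e g)) (alt6_add T' (fun a b c d e g => T' b c a d e g)).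
  rewrite c1 c2 -mulr2n -mulrSr -scaler_nat => /eqP.
  by rewrite scaler_eq0 pnatr_eq0 => /eqP ->; rewrite oppr0.
rewrite -/T T0 addr0.
pose S a b c d e g := 'D_(evec c) (P d e g) x *: Fc a b x.
have -> : alt6 (fun a b c d e g => 'D_(evec g) (P c d e) x *: Fc a b x) = - alt6 S.
  by rewrite -(alt6_last_front S).
transitivity (- (48%:R : R)^-1 *: (4%:R *: alt6 S)).
  rewrite scalerA scalerN -scaleNr; congr (_ *: _).
  have n0 (n : nat) : (n.+1%:R : R) != 0 by rewrite pnatr_eq0.
  by rewrite mulNr; congr (- _); apply: (mulfI (n0 11%N)); field.
rewrite -alt6_cycle; congr (_ *: _); apply: eq_alt6 => a b c d e g.
by rewrite /S !scalerDl !scaleNr.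
Qed.

Lemma alt6_rot (M : lmodType R) (T : 'I_6 -> 'I_6 -> 'I_6 -> 'I_6 -> 'I_6 -> 'I_6 -> M) :
  alt6 (fun a b c d e g => T b c d e g a) = - alt6 T.
Proof.
rewrite (alt6_swap01 (fun a b c d e g => T a c d e g b)).
rewrite (alt6_swap12 (fun a b c d e g => T a b d e g c)).
rewrite (alt6_swap23 (fun a b c d e g => T a b c e g d)).
by rewrite (alt6_swap34 (fun a b c d e g => T a b c d g e)) (alt6_swap45 T) !opprK.
Qed.

Variable W : 'I_6 -> 'I_6 -> E -> R.
Hypothesis sW : forall a b, smooth_on U (W a b).

Definition om_sq (a b c d : 'I_6) (y : E) : R :=
  W a b y * W c d y - W a c y * W b d y + W a d y * W b c y.

(** The coordinate expression of [omt] given by [omtE]; it involves no frame and can be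
    differentiated. *)
Definition omtc (i j : 'I_6) (y : E) : R := 8^-1 * alt6 (V := R) (fun a b c d e g =>
  W a b y * (W c d y * ((evec i : E) 0 e * (evec j : E) 0 g))).

Lemma omtc_anti i j y : omtc j i y = - omtc i j y.
Proof.
rewrite /omtc -mulrN; congr (_ * _).
rewrite -(alt6_swap45 (fun a b c d e g =>
  W a b y * (W c d y * ((evec i : E) 0 e * (evec j : E) 0 g)))).
by apply: eq_alt6 => *; rewrite [(evec j : E) 0 _ * _]mulrC.
Qed.

Lemma Ck_mulc k (f : E -> R) c : Ck k U f -> Ck k U (fun y => f y * c).
Proof. by move=> Cf; apply: Ck_mul => //; exact: Ck_cst. Qed.

Lemma omtc_Ck i j k : Ck k U (omtc i j).
Proof.
apply: Ck_mul => //; first exact: Ck_cst.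
apply: (Ck_alt6 (W := R) (T := fun a b c d e g y =>
  W a b y * (W c d y * ((evec i : E) 0 e * (evec j : E) 0 g)))) => // a b c d e g.
by apply: Ck_mul => //; [exact: sW|apply: Ck_mulc; exact: sW].
Qed.

Lemma is_derive_mulr (f g : E -> R) x v : derivable f x v -> derivable g x v ->
  is_derive x v (fun y => f y * g y) ('D_v f x * g x + f x * 'D_v g x).
Proof. by move=> df dg; split; [exact: derivable_mulr|exact: derive_mulr]. Qed.

(** The hypothesis says that omega^2 is closed. The three pairings in [om_sq] have the same
    alternating sum, and one of them is, by the Leibniz rule and after moving the derivative index
    to the front, the divergence of [omtc]. *)
Lemma div_omtc x : U x -> (forall l : E, alt6 (V := R) (fun a b c d e g =>
    l 0 g * 'D_(evec a) (om_sq b c d e) x) = 0) ->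
  forall j, \sum_i 'D_(evec i) (omtc i j) x = 0.
Proof.
move=> Ux H j.
have dW a b v : derivable (W a b) x v by exact: Ck_der (sW a b 1%N) Ux.
pose D a b c d e := 'D_(evec a) (W b c) x * W d e x + W b c x * 'D_(evec a) (W d e) x.
have dD a b c d e : is_derive x (evec a) (fun y => W b c y * W d e y) (D a b c d e).
  exact: is_derive_mulr.
pose T a b c d e g : R := (evec j : E) 0 g * D a b c d e.
have T0 : alt6 (V := R) T = 0.
  have e1 := alt6_swap23 (V := R) T.
  have e2 : alt6 (V := R) (fun a b c d e g => T a b e c d g) = alt6 T.
    by rewrite (alt6_swap34 (V := R) (fun a b c d e g => T a b d c e g)) e1 opprK.
  have : alt6 (V := R) (fun a b c d e g => T a b c d e g + (- T a b d c e g + T a b e c d g)) = 0.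
    rewrite -[RHS](H (evec j)); apply: eq_alt6 => a b c d e g.
    have [_ ->] : is_derive x (evec a) (om_sq b c d e) (D a b c d e - D a b d c e + D a b e c d).
      exact: is_deriveD (is_deriveB (dD a b c d e) (dD a b d c e)) (dD a b e c d).
    by rewrite /T; ring.
  rewrite (alt6_add (V := R) T (fun a b c d e g => - T a b d c e g + T a b e c d g)).
  rewrite (alt6_add (V := R) (fun a b c d e g => - T a b d c e g) (fun a b c d e g => T a b e c d g)).
  rewrite (alt6_opp (V := R) (fun a b c d e g => T a b d c e g)) e1 e2 opprK.
  by move: (alt6 T) => z; lra.
have step i : 'D_(evec i) (omtc i j) x = 8^-1 * alt6 (V := R) (fun a b c d e g =>
    (evec i : E) 0 e * T e a b c d g).
  have d1 a b c d e g : is_derive x (evec i)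
     (fun y => W a b y * (W c d y * ((evec i : E) 0 e * (evec j : E) 0 g)))
     ((evec i : E) 0 e * T e a b c d g).
    have dc : derivable (fun y => W c d y * ((evec i : E) 0 e * (evec j : E) 0 g)) x (evec i).
      by apply: derivable_mulr => //; exact: derivable_cst.
    apply: is_derive_eq (is_derive_mulr (dW a b _) dc) _.
    have [_ ->] := is_derive_mulr (dW c d (evec i)) (derivable_cst ((evec i : E) 0 e * (evec j : E) 0 g) x (evec i)).
    rewrite derive_cst mulr0 addr0 /T /D !mxE eqxx /=.
    by case: (eqVneq e i) => [->|_]; rewrite ?mul1r ?mul0r ?mulr0 ?addr0 //; ring.
  have [_ e] := is_deriveZ (8^-1) (is_derive_alt6 d1).
  exact: e.
under eq_bigr do rewrite step.
rewrite -mulr_sumr -(alt6_sum (V := R) (fun i a b c d e g => (evec i : E) 0 e * T e a b c d g)).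
have -> : alt6 (V := R) (fun a b c d e g => \sum_i (evec i : E) 0 e * T e a b c d g) =
   alt6 (V := R) (fun a b c d e g => T e a b c d g).
  apply: eq_alt6 => a b c d e g; rewrite -mulr_suml.
  rewrite (bigD1 e) //= big1 ?mxE ?eqxx ?addr0 ?mul1r // => i /negbTE ie.
  by rewrite mxE eq_sym ie andbF.
rewrite (alt6_swap34 (V := R) (fun a b c d e g => T d a b c e g)).
rewrite (alt6_swap23 (V := R) (fun a b c d e g => T c a b d e g)).
rewrite (alt6_swap12 (V := R) (fun a b c d e g => T b a c d e g)).
by rewrite (alt6_swap01 (V := R) T) T0 !oppr0 mulr0.
Qed.

Definition WWF (x : E) : V :=
  alt6 (fun a b c d e g => (W a b x * W c d x) *: Fc e g x).

(** [omtc] carries omega^2 in its first four slots, so contracting its free indices with the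
    curvature gives F /\ omega^2. *)
Lemma omtc_F x : WWF x = 0 -> \sum_i \sum_j omtc i j x *: Fc i j x = 0.
Proof.
move=> H; suff : 8%:R *: \sum_i \sum_j omtc i j x *: Fc i j x = 0.
  by move/eqP; rewrite scaler_eq0 pnatr_eq0 => /eqP.
rewrite -[RHS]H /WWF scaler_sumr.
under eq_bigr do rewrite scaler_sumr.
transitivity (\sum_i \sum_j alt6 (fun a b c d e g =>
  (W a b x * (W c d x * ((evec i : E) 0 e * (evec j : E) 0 g))) *: Fc i j x)).
  apply: eq_bigr => i _; apply: eq_bigr => j _.
  by rewrite alt6_scalel scalerA /omtc mulrA mulfV ?mul1r // pnatr_eq0.
under eq_bigr do rewrite -alt6_sum.
rewrite -alt6_sum; apply: eq_alt6 => a b c d e g.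
rewrite (bigD1 e) //= [X in _ + X]big1 ?addr0; last first.
  move=> i /negbTE ie; rewrite big1 // => j _.
  by rewrite mxE eq_sym ie andbF mul0r !mulr0 scale0r.
rewrite (bigD1 g) //= [X in _ + X]big1 ?addr0; last first.
  by move=> i /negbTE ie; rewrite [(evec i : E) 0 g]mxE eq_sym ie andbF !mulr0 scale0r.
by rewrite !mxE !eqxx !mulr1.
Qed.

(** The derivative of the coefficients vanishes by hypothesis. What remains contracts the
    antisymmetric [omtc] with second covariant derivatives, hence with half their commutator, and
    this is the bracket with the contraction of [omtc_F]. *)
Lemma div_omt_nab f x : smooth_on U f -> U x ->
  (forall j, \sum_i 'D_(evec i) (omtc i j) x = 0) -> WWF x = 0 ->
  \sum_i nab i (fun y => \sum_j omtc i j y *: nab j f y) x = 0.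
Proof.
move=> sf Ux do0 wf0.
have Cn j : Ck 1 U (nab j f) by exact: nab_Ck.
have step i : nab i (fun y => \sum_j omtc i j y *: nab j f y) x =
   \sum_j 'D_(evec i) (omtc i j) x *: nab j f x + \sum_j omtc i j x *: nab i (nab j f) x.
  apply: etrans (nab_sum i (f := fun j y => omtc i j y *: nab j f y) Ux _) _.
    by move=> k; apply: Ck_scalev => //; exact: omtc_Ck.
  rewrite -big_split; apply: eq_bigr => j _.
  exact: nab_scale Ux (omtc_Ck i j 1) (Cn j).
under eq_bigr do rewrite step.
rewrite big_split /= [X in X + _]exchange_big /= [X in X + _]big1 ?add0r; last first.
  by move=> j _; rewrite -scaler_suml do0 scale0r.
set S := \sum_i _.
have SN : S = - \sum_i \sum_j omtc i j x *: nab j (nab i f) x.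
  rewrite /S exchange_big -sumrN; apply: eq_bigr => i _; rewrite -sumrN; apply: eq_bigr => j _.
  by rewrite omtc_anti scaleNr.
have S2 : S + S = 0.
  rewrite {2}SN -sumrB.
  transitivity (be (\sum_i \sum_j omtc i j x *: Fc i j x) (f x)); last first.
    by rewrite omtc_F // (bilin0l bb).
  rewrite (bilin_suml bb); apply: eq_bigr => i _; rewrite (bilin_suml bb) -sumrB.
  apply: eq_bigr => j _; rewrite (bilinZl bb) -nab_comm //.
  by rewrite scalerBr.
by move/eqP: S2; rewrite -mulr2n -scaler_nat scaler_eq0 pnatr_eq0 => /eqP.
Qed.

Definition Yc (P : 'I_6 -> 'I_6 -> 'I_6 -> E -> R) (i : 'I_6) (y : E) : V :=
  (12%:R : R)^-1 *: alt6 (fun a b c d e g =>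
     (evec i : E) 0 g *: (P c d e y *: Fc a b y)).

Lemma Yc_Ck P i k : (forall c d e, smooth_on U (P c d e)) -> Ck k U (Yc P i).
Proof.
move=> sP; apply: Ck_scale => //.
apply: (Ck_alt6 (T := fun a b c d e g y => (evec i : E) 0 g *: (P c d e y *: Fc a b y))) => //.
move=> a b c d e g; apply: Ck_scale => //; apply: Ck_scalev => //; first exact: sP.
exact: Fc_Ck.
Qed.

(** When dP is a multiple of omega^2, [div_Yvec] leaves a multiple of F /\ omega^2: the three
    pairings in [om_sq] have alternating sums that agree up to sign. *)
Lemma div_Yc P x (lam : R) : U x -> (forall c d e, smooth_on U (P c d e)) -> WWF x = 0 ->
  (forall c d e g, 'D_(evec c) (P d e g) x - 'D_(evec d) (P c e g) x + 'D_(evec e) (P c d g) x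
      - 'D_(evec g) (P c d e) x = lam * om_sq c d e g x) ->
  \sum_i nab i (Yc P i) x = 0.
Proof.
move=> Ux sP wf0 dP; apply: etrans (div_Yvec Ux sP) _.
under eq_alt6 do rewrite dP -scalerA.
rewrite alt6_scale.
pose T a b c d e g := (W c d x * W e g x) *: Fc a b x.
have T0 : alt6 T = 0.
  pose X a b c d e g := (W a b x * W c d x) *: Fc e g x.
  have := alt6_rot (fun a b c d e g => X b c d e g a); rewrite (alt6_rot X) opprK -/(WWF x) wf0.
  by move=> <-.
have -> : alt6 (fun a b c d e g => om_sq c d e g x *: Fc a b x) =
    alt6 T - alt6 (fun a b c d e g => T a b c e d g) + alt6 (fun a b c d e g => T a b c g d e).
  rewrite /alt6 -sumrB -big_split; apply: eq_bigr => s _ /=.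
  by rewrite -scalerBr -scalerDr /T -scalerBl -scalerDl.
rewrite (alt6_swap34 T) (alt6_swap45 (fun a b c d e g => T a b c e d g)) (alt6_swap34 T) T0.
by rewrite !oppr0 !addr0 !scaler0.
Qed.

Lemma div_comb (X Y Z : 'I_6 -> E -> V) (p q : R) x : U x ->
  (forall i, Ck 1 U (Y i)) -> (forall i, Ck 1 U (Z i)) ->
  (forall i y, U y -> X i y = p *: Y i y + q *: Z i y) ->
  \sum_i nab i (Y i) x = 0 -> \sum_i nab i (Z i) x = 0 -> \sum_i nab i (X i) x = 0.
Proof.
move=> Ux CY CZ XE Y0 Z0.
have sc (k : R) f i : Ck 1 U f -> nab i (fun y => k *: f y) x = k *: nab i f x.
  move=> Cf; have := nab_scale i Ux (Ck_cst 1 U k) Cf.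
  by rewrite derive_cst scale0r add0r.
transitivity (\sum_i (p *: nab i (Y i) x + q *: nab i (Z i) x)).
  apply: eq_bigr => i _.
  have h : {in U, X i =1 fun y => p *: Y i y + q *: Z i y}.
    by move=> y; rewrite inE; exact: XE.
  apply: etrans (nab_eq i Ux h) _.
  apply: etrans (nab_add i Ux (Ck_scale p oU (CY i)) (Ck_scale q oU (CZ i))) _.
  exact: congr2 (sc p _ i (CY i)) (sc q _ i (CZ i)).
by rewrite big_split /= -!scaler_sumr Y0 Z0 !scaler0 addr0.
Qed.

Variable ip : V -> V -> R.
Hypothesis ib : bilinear_map (F := R^o) (ip : V -> V -> R^o).
Hypothesis ipC' : forall X Y, ip X Y = ip Y X.
Hypothesis ipI : forall X Y Z, ip (be X Y) Z + ip Y (be X Z) = 0.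

Lemma is_derive_ip (f g : E -> V) i x : derivable f x (evec i) -> derivable g x (evec i) ->
  is_derive x (evec i) (fun y => ip (f y) (g y)) (ip (nab i f x) (g x) + ip (f x) (nab i g x)).
Proof.
move=> df dg; apply: is_derive_eq (is_derive_bilin ib df dg) _.
rewrite /nab [ip (_ + _) _](bilinDl ib) [ip _ (_ + _)](bilinDr ib) addrACA.
by rewrite ipI addr0.
Qed.

(** A Bochner identity: as the inner product is parallel, the flux of |f|^2 is 2 <f, X> with X the
    raised gradient of f. Its divergence is 2 <nabla f, X> + 2 <f, div X>, and div X = 0. *)
Lemma lap_norm (gm : 'I_6 -> 'I_6 -> E -> R) f x : U x -> smooth_on U f ->
  (forall i j, Ck 1 U (gm i j)) ->
  \sum_i nab i (fun y => \sum_j gm i j y *: nab j f y) x = 0 ->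
  \sum_i 'D_(evec i) (fun y => \sum_j gm i j y * 'D_(evec j) (fun z => ip (f z) (f z)) y) x
   = 2 * \sum_i \sum_j gm i j x * ip (nab i f x) (nab j f x).
Proof.
move=> Ux sf Cg div0.
pose X i y := \sum_j gm i j y *: nab j f y.
have CX i : Ck 1 U (X i).
  apply: Ck_sum; first exact: oU.
  by move=> j _; apply: Ck_scalev; [exact: oU|exact: Cg|exact: nab_Ck].
have df i y : U y -> derivable f y (evec i) by move=> Uy; exact: Ck_der (sf 1%N) Uy.
have e1 i : 'D_(evec i) (fun y => \sum_j gm i j y * 'D_(evec j) (fun z => ip (f z) (f z)) y) x
    = 2 * (ip (nab i f x) (X i x) + ip (f x) (nab i (X i) x)).
  have dX : derivable (X i) x (evec i) by exact: Ck_der (CX i) Ux.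
  have [_ e3] := is_deriveZ 2 (is_derive_ip (df i x Ux) dX).
  apply: etrans e3; apply: (eq_derive _ oU _ Ux) => y; rewrite inE => Uy.
  suff hy : \sum_j gm i j y * 'D_(evec j) (fun z => ip (f z) (f z)) y = 2 * ip (f y) (X i y).
    by rewrite hy.
  have -> : ip (f y) (X i y) = \sum_j ip (f y) (gm i j y *: nab j f y).
    exact: (bilin_sumr ib).
  rewrite mulr_sumr; apply: eq_bigr => j _.
  have [_ ->] := is_derive_ip (df j y Uy) (df j y Uy).
  have -> : ip (f y) (gm i j y *: nab j f y) = gm i j y * ip (f y) (nab j f y).
    exact: (bilinZr ib).
  by rewrite [ip (nab _ _ _) _]ipC'; ring.
under eq_bigr do rewrite e1.
rewrite -mulr_sumr big_split /=; congr (_ * _).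
have -> : \sum_i ip (f x) (nab i (X i) x) = 0.
  apply: etrans (esym (bilin_sumr ib _ _ _ _)) _.
  by rewrite [X in ip _ X](_ : _ = 0); [exact: (bilin0r ib)|exact: div0].
rewrite addr0; apply: eq_bigr => i _.
have -> : ip (nab i f x) (X i x) = \sum_j ip (nab i f x) (gm i j x *: nab j f x).
  exact: (bilin_sumr ib).
by apply: eq_bigr => j _; exact: (bilinZr ib).
Qed.

End LocalGauge.

(** * Wedge products of low degree *)

Section SmallPerms.
Context {R : realType} {V : lmodType R}.

Lemma lift_perm_inj n : injective (fun p : 'I_n.+1 * 'S_n => lift_perm ord0 p.1 p.2).
Proof.
move=> [i s] [j t] /= e.
have ij : i = j by have := congr1 (fun u : 'S_n.+1 => u ord0) e; rewrite !lift_perm_id.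
rewrite -{}ij in e *; congr (_, _); apply/permP => k.
have := congr1 (fun u : 'S_n.+1 => u (lift ord0 k)) e; rewrite !lift_perm_lift.
exact: lift_inj.
Qed.

Lemma sum_perm_lift n (F : 'S_n.+1 -> V) :
  \sum_(s : 'S_n.+1) F s = \sum_(i < n.+1) \sum_(t : 'S_n) F (lift_perm ord0 i t).
Proof.
rewrite pair_bigA /= (reindex (fun p : 'I_n.+1 * 'S_n => lift_perm ord0 p.1 p.2)) //.
apply: onW_bij; apply: inj_card_bij; first exact: lift_perm_inj.
by rewrite card_prod !card_Sn card_ord factS.
Qed.

Lemma sum_perm1 (F : 'S_1 -> V) : \sum_(s : 'S_1) F s = F 1%g.
Proof.
by rewrite (big_pred1 1%g) // => s; apply/esym/eqP/permP => i; rewrite !ord1.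
Qed.

Lemma sign_sum_perm2 (T : 'I_2 -> 'I_2 -> V) :
  \sum_(s : 'S_2) ((-1) ^+ s : R) *: T (s ord0) (s ord_max) = T ord0 ord_max - T ord_max ord0.
Proof.
rewrite sum_perm_lift !big_ord_recl big_ord0 !sum_perm1 !odd_lift_perm !odd_perm1 /= addr0.
rewrite expr0 expr1 scale1r scaleN1r !lift_perm_id.
have om : ord_max = lift ord0 ord0 :> 'I_2 by apply/val_inj.
by rewrite om !lift_perm_lift !perm1; congr (T _ _ - T _ _); apply/val_inj.
Qed.

End SmallPerms.

Section Forms.
Context {R : realType}.
Local Notation E := 'rV[R]_6.

Lemma is_form1_linear n (V : lmodType R) (al : kform 1 'rV[R]_n V) a u w : is_form al ->
  al (fun=> a *: u + w) = a *: al (fun=> u) + al (fun=> w).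
Proof.
move=> [lin _]; have := lin (fun=> u) ord0 a u w.
have e z : [eta (fun=> u) with ord0 |-> z] = (fun=> z) :> ('I_1 -> 'rV[R]_n).
  by apply/funext => i /=; rewrite ord1 eqxx.
by rewrite !e.
Qed.

Lemma is_form_bilin (V : lmodType R) (al : kform 2 E V) : is_form al -> bilin (kf2 al).
Proof.
move=> [lin _]; split => [b|a]; apply: lin_exp_linear => k u w; rewrite /kf2.
  have := lin (tup 2 [:: 0; b]) ord0 k u w.
  have e z : [eta tup 2 [:: 0; b] with ord0 |-> z] = tup 2 [:: z; b] :> ('I_2 -> E).
    by apply/funext => -[[|[|//]] p].
  by rewrite !e.
have := lin (tup 2 [:: a; 0]) ord_max k u w.
have e z : [eta tup 2 [:: a; 0] with ord_max |-> z] = tup 2 [:: a; z] :> ('I_2 -> E).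
  by apply/funext => -[[|[|//]] p].
by rewrite !e.
Qed.

Lemma is_form_trilin (al : kform 3 E R) : is_form al -> trilin (kf3 al).
Proof.
move=> [lin _]; split => [b c|a c|a b]; apply: lin_exp_linear => k u w; rewrite /kf3.
- have := lin (tup 3 [:: 0; b; c]) ord0 k u w.
  have e z : [eta tup 3 [:: 0; b; c] with ord0 |-> z] = tup 3 [:: z; b; c] :> ('I_3 -> E).
    by apply/funext => -[[|[|[|//]]] p].
  by rewrite !e.
- have := lin (tup 3 [:: a; 0; c]) (lift ord0 ord0) k u w.
  have e z : [eta tup 3 [:: a; 0; c] with lift ord0 ord0 |-> z] = tup 3 [:: a; z; c] :> ('I_3 -> E).
    by apply/funext => -[[|[|[|//]]] p].
  by rewrite !e.
have := lin (tup 3 [:: a; b; 0]) ord_max k u w.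
have e z : [eta tup 3 [:: a; b; 0] with ord_max |-> z] = tup 3 [:: a; b; z] :> ('I_3 -> E).
  by apply/funext => -[[|[|[|//]]] p].
by rewrite !e.
Qed.

Lemma is_form2_anti (al : kform 2 E R) u v : is_form al -> kf2 al u v = - kf2 al v u.
Proof.
move=> fal; have [lin1 lin2] := is_form_bilin fal.
have alt z : kf2 al z z = 0.
  have [_ H] := fal; apply: (H _ ord0 ord_max) => //.
have l1 b a x y : kf2 al (a *: x + y) b = a * kf2 al x b + kf2 al y b.
  rewrite (lin_expR (lin1 b) (a *: x + y)) (lin_expR (lin1 b) x) (lin_expR (lin1 b) y).
  by rewrite mulr_sumr -big_split; apply: eq_bigr => j _; rewrite !mxE /= mulrDl mulrA.
have l2 b a x y : kf2 al b (a *: x + y) = a * kf2 al b x + kf2 al b y.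
  rewrite (lin_expR (lin2 b) (a *: x + y)) (lin_expR (lin2 b) x) (lin_expR (lin2 b) y).
  by rewrite mulr_sumr -big_split; apply: eq_bigr => j _; rewrite !mxE /= mulrDl mulrA.
have := alt (1 *: u + v); rewrite l1 !l2 !alt !mul1r add0r addr0 => /eqP.
by rewrite addr_eq0 => /eqP.
Qed.

Definition kf2_sq (al : kform 2 E R) (p q r t : E) : R :=
  kf2 al p q * kf2 al r t - kf2 al p r * kf2 al q t + kf2 al p t * kf2 al q r.

(** The 24 permutations fall into the three pairings of the four slots, eight for each; dividing by
    2! 2! leaves 2. Iterated [lift_perm] enumerates them. *)
Lemma wedge22E (al : kform 2 E R) (v : 'I_4 -> E) : is_form al ->
  wedgef (V3 := R) *%R al al v =
  2 * kf2_sq al (v (inord 0)) (v (inord 1)) (v (inord 2)) (v (inord 3)).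
Proof.
move=> fal.
pose w (i j : nat) := kf2 al (v (inord i)) (v (inord j)).
have wA i j : w i j = - w j i by exact: is_form2_anti.
have -> : wedgef (V3 := R) *%R al al v = 4^-1 * \sum_(s : 'S_4) (-1) ^+ s *
   (w (s (inord 0)) (s (inord 1)) * w (s (inord 2)) (s (inord 3))).
  have iK (i : 'I_4) : inord i = i by apply/val_inj; rewrite /= inordK.
  rewrite /wedgef; congr (_ * _); apply: eq_bigr => s _; congr (_ * (_ * _));
  rewrite /w /kf2 !iK; congr (al _); rewrite [LHS]tup2E; congr (tup 2 [:: _; _]);
  by congr (v (s _)); apply/val_inj; rewrite /= inordK.
rewrite sum_perm_lift.
under eq_bigr do rewrite sum_perm_lift.
under eq_bigr do under eq_bigr do rewrite sum_perm_lift.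
under eq_bigr do under eq_bigr do under eq_bigr do rewrite sum_perm1.
have i0 : inord 0 = ord0 :> 'I_4 by apply/val_inj; rewrite /= inordK.
have i1 : inord 1 = lift ord0 ord0 :> 'I_4 by apply/val_inj; rewrite /= inordK.
have i2 : inord 2 = lift ord0 (lift ord0 ord0) :> 'I_4 by apply/val_inj; rewrite /= inordK.
have i3 : inord 3 = lift ord0 (lift ord0 (lift ord0 ord0)) :> 'I_4.
  by apply/val_inj; rewrite /= inordK.
transitivity (4^-1 * \sum_(i < 4) \sum_(j < 3) \sum_(k < 2) (-1) ^+ (odd i (+) odd j (+) odd k) *
  (w i (bump i j) * w (bump i (bump j k)) (bump i (bump j (bump k 0))))).
  congr (_ * _); apply: eq_bigr => i _; apply: eq_bigr => j _; apply: eq_bigr => k _.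
  rewrite i0 i1 i2 i3 !(lift_perm_id, lift_perm_lift) perm1 !odd_lift_perm odd_perm1 /=.
  by rewrite addbF !addbA.
rewrite !big_ord_recl !big_ord0 /= /bump /= !(expr0, expr1).
rewrite /kf2_sq -!/(w _ _) (wA 1%N 0%N) (wA 2%N 0%N) (wA 3%N 0%N) (wA 2%N 1%N) (wA 3%N 1%N) (wA 3%N 2%N).
by field.
Qed.

End Forms.

Section MatrixCk.
Context {R : realType} {E : normedModType R}.

Lemma Ck_det k n (U : set E) (M : E -> 'M[R]_n) : open U ->
  (forall i j, Ck k U (fun x => M x i j)) -> Ck k U (fun x => \det (M x)).
Proof.
move=> oU CM; apply: Ck_sum => // s _; apply: Ck_mul => //; first exact: Ck_cst.
by apply: Ck_prod => // i _; exact: CM.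
Qed.

Lemma Ck_mulmx k p q r (U : set E) (M : E -> 'M[R]_(p, q)) (N : E -> 'M[R]_(q, r)) : open U ->
  (forall i j, Ck k U (fun x => M x i j)) -> (forall i j, Ck k U (fun x => N x i j)) ->
  forall i j, Ck k U (fun x => (M x *m N x) i j).
Proof.
move=> oU CM CN i j.
apply: (@Ck_eq _ _ _ _ _ (fun x => \sum_l M x i l * N x l j)) => //.
  by move=> x _; rewrite mxE.
by apply: Ck_sum => // l _; apply: Ck_mul.
Qed.

Lemma Ck_invmx k n (U : set E) (M : E -> 'M[R]_n.+1) : open U ->
  (forall x, U x -> M x \in unitmx) ->
  (forall i j, Ck k U (fun x => M x i j)) -> forall i j, Ck k U (fun x => invmx (M x) i j).
Proof.
move=> oU uM CM i j.
apply: (@Ck_eq _ _ _ _ _ (fun x => (\det (M x))^-1 * ((-1) ^+ (j + i) * \det (row' j (col' i (M x)))))) => //.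
  by move=> x; rewrite inE => Ux; rewrite /invmx uM // mxE [(\adj _) _ _]mxE.
apply: Ck_mul => //.
  apply: Ck_inv => // [x Ux|]; last exact: Ck_det.
  by have := uM x Ux; rewrite unitmxE unitfE.
apply: Ck_mul => //; first exact: Ck_cst.
apply: Ck_det => // a b.
apply: (@Ck_eq _ _ _ _ _ (fun x => M x (lift j a) (lift i b))) => //.
by move=> x _; rewrite !mxE.
Qed.

End MatrixCk.

Lemma big_ord5 (V : nmodType) (F : 'I_5 -> V) : \sum_i F i =
  F ord0 + (F (lift ord0 ord0) + (F (lift ord0 (lift ord0 ord0)) +
  (F (lift ord0 (lift ord0 (lift ord0 ord0))) +
   F (lift ord0 (lift ord0 (lift ord0 (lift ord0 ord0))))))).
Proof. by rewrite !big_ord_recl big_ord0 addr0. Qed.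

(** * Smooth coefficients attached to the SU(3)-structure in a chart *)

Section ChartTensors.
Context {R : realType} {Z : Type} (sg : su3 R Z) (A : set (chart R 6 Z)).
Local Notation E := 'rV[R]_6.
Hypothesis sgS : su3_structure sg A.

Definition Wc (c : chart R 6 Z) (a b : 'I_6) (x : E) : R := kf2 (om sg c x) (evec a) (evec b).
Definition Rc (c : chart R 6 Z) (a b d : 'I_6) (x : E) : R :=
  kf3 (reform (Om sg c) x) (evec a) (evec b) (evec d).
Definition Ic (c : chart R 6 Z) (a b d : 'I_6) (x : E) : R :=
  kf3 (imform (Om sg c) x) (evec a) (evec b) (evec d).

(* The densitized inverse metric, see [Gm_frame]. *)
Definition Gm (c : chart R 6 Z) (x : E) : 'M[R]_6 :=
  (\matrix_(i, j) omtc (Wc c) i j x) *m (gramJ (Om sg c x) *m invmx (gram (Om sg c x))).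

Section OneChart.
Variable c : chart R 6 Z.
Hypothesis cA : admissible A c.
Local Notation U := (cdom c).
Local Notation fr := (frame sg c).

Lemma chart_open : open U. Proof. by have [] := cA. Qed.

Lemma frame_spec x : U x -> su3_frame sg c x (fr x).
Proof.
move=> Ux; have [_ _ _ H] := sgS; have ex := H c x cA Ux.
exact: (@xgetPex _ 1%:M [set f | su3_frame sg c x f] ex).
Qed.

Lemma Wc_smooth a b : smooth_on U (Wc c a b).
Proof. by have [[_ s _] _ _ _] := sgS; exact: s. Qed.
Lemma Rc_smooth a b d : smooth_on U (Rc c a b d).
Proof. by have [_ [_ s _] _ _] := sgS; exact: s. Qed.
Lemma Ic_smooth a b d : smooth_on U (Ic c a b d).
Proof. by have [_ _ [_ s _] _] := sgS; exact: s. Qed.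

Lemma om_form x : U x -> is_form (om sg c x).
Proof. by have [[s _ _] _ _ _] := sgS; exact: s. Qed.
Lemma re_form x : U x -> is_form (reform (Om sg c) x).
Proof. by have [_ [s _ _] _ _] := sgS; exact: s. Qed.
Lemma im_form x : U x -> is_form (imform (Om sg c) x).
Proof. by have [_ _ [s _ _] _] := sgS; exact: s. Qed.

Lemma omtc_frame x : U x -> (\matrix_(i, j) omtc (Wc c) i j x) = omt (fr x).
Proof.
move=> Ux; have [fU Hom _] := frame_spec Ux.
by apply/matrixP => i j; rewrite mxE (omtE fU Hom).
Qed.

Lemma gram_fU x : U x -> gram (Om sg c x) \in unitmx.
Proof.
move=> Ux; have [fU _ HO] := frame_spec Ux.
exact: (gram_unit fU HO (is_form_trilin (re_form Ux))).
Qed.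

Lemma Gm_frame x : U x -> Gm c x = gam (fr x).
Proof.
move=> Ux; have [fU _ HO] := frame_spec Ux.
have J := Jmx_gram fU HO (is_form_trilin (re_form Ux)).
by rewrite /Gm omtc_frame // gam_omt // J mulmxN opprK.
Qed.

Lemma gram_Ck k i j : Ck k U (fun x => gram (Om sg c x) i j).
Proof.
have oU := chart_open.
apply: (@Ck_eq _ _ _ _ _ (fun x => \sum_a \sum_b Rc c i a b x * Rc c j a b x)) => //.
  by move=> x _; rewrite mxE.
by do 2!(apply: Ck_sum => // ? _); apply: Ck_mul => //; exact: Rc_smooth.
Qed.

Lemma gramJ_Ck k i j : Ck k U (fun x => gramJ (Om sg c x) i j).
Proof.
have oU := chart_open.
apply: (@Ck_eq _ _ _ _ _ (fun x => \sum_a \sum_b Ic c i a b x * Rc c j a b x)) => //.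
  by move=> x _; rewrite mxE.
by do 2!(apply: Ck_sum => // ? _); apply: Ck_mul => //; [exact: Ic_smooth|exact: Rc_smooth].
Qed.

Lemma Gm_Ck k i j : Ck k U (fun x => Gm c x i j).
Proof.
have oU := chart_open; move: i j; apply: Ck_mulmx => // i j.
  apply: (@Ck_eq _ _ _ _ _ (omtc (Wc c) i j)) => //; last exact: (omtc_Ck oU Wc_smooth).
  by move=> x _; rewrite mxE.
move: i j; apply: Ck_mulmx => //; first exact: gramJ_Ck.
by apply: Ck_invmx => //; [exact: gram_fU|exact: gram_Ck].
Qed.

Lemma dext3E (al : E -> kform 3 E R) x p q r t :
  dext al x (tup 4 [:: p; q; r; t]) =
  'D_p (fun y => kf3 (al y) q r t) x - 'D_q (fun y => kf3 (al y) p r t) x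
  + 'D_r (fun y => kf3 (al y) p q t) x - 'D_t (fun y => kf3 (al y) p q r) x.
Proof.
have e (i : 'I_4) s : (fun j => tup 4 [:: p; q; r; t] (lift i j)) = tup 3 s ->
   (fun y => al y (fun j => tup 4 [:: p; q; r; t] (lift i j))) = (fun y => kf3 (al y) (nth 0 s 0) (nth 0 s 1) (nth 0 s 2)).
  move=> h; apply/funext => y; rewrite h /kf3; congr (al y _).
  by apply/funext => -[[|[|[|//]]] ?].
rewrite /dext !big_ord_recl big_ord0 addr0.
rewrite (e _ [:: q; r; t]); last by apply/funext => -[[|[|[|//]]] ?].
rewrite (e _ [:: p; r; t]); last by apply/funext => -[[|[|[|//]]] ?].
rewrite (e _ [:: p; q; t]); last by apply/funext => -[[|[|[|//]]] ?].
rewrite (e _ [:: p; q; r]); last by apply/funext => -[[|[|[|//]]] ?].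
rewrite /tup /= expr0 expr1 sqrrN expr1n exprS sqrrN expr1n mulr1.
by rewrite !scale1r !scaleN1r !addrA.
Qed.

Variable w1 : R[i].
Hypothesis dOm : forall x v, U x ->
  Complex (dext (reform (Om sg c)) x v) (dext (imform (Om sg c)) x v)
     = w1 * real_complex R (wedgef (V3 := R) *%R (om sg c x) (om sg c x) v).

Lemma dOm_parts x v : U x ->
  dext (reform (Om sg c)) x v = complex.Re w1 * wedgef (V3 := R) *%R (om sg c x) (om sg c x) v /\
  dext (imform (Om sg c)) x v = complex.Im w1 * wedgef (V3 := R) *%R (om sg c x) (om sg c x) v.
Proof.
move=> Ux; have := dOm v Ux; case: w1 => p q /=.
by simpc => -[-> ->].
Qed.

Lemma wedge_om_sq x a b d e : U x ->
  wedgef (V3 := R) *%R (om sg c x) (om sg c x)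
     (tup 4 [:: evec a; evec b; evec d; evec e]) = 2 * om_sq (Wc c) a b d e x.
Proof.
by move=> Ux; rewrite wedge22E; [rewrite /tup !inordK|exact: om_form].
Qed.

Lemma dRc x : U x -> forall a b d e, 'D_(evec a) (Rc c b d e) x - 'D_(evec b) (Rc c a d e) x
   + 'D_(evec d) (Rc c a b e) x - 'D_(evec e) (Rc c a b d) x =
   (complex.Re w1 * 2) * om_sq (Wc c) a b d e x.
Proof.
move=> Ux a b d e.
have [h _] := dOm_parts (tup 4 [:: evec a; evec b; evec d; evec e]) Ux.
by move: h; rewrite dext3E wedge_om_sq // mulrA.
Qed.

Lemma dIc x : U x -> forall a b d e, 'D_(evec a) (Ic c b d e) x - 'D_(evec b) (Ic c a d e) x
   + 'D_(evec d) (Ic c a b e) x - 'D_(evec e) (Ic c a b d) x =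
   (complex.Im w1 * 2) * om_sq (Wc c) a b d e x.
Proof.
move=> Ux a b d e.
have [_ h] := dOm_parts (tup 4 [:: evec a; evec b; evec d; evec e]) Ux.
by move: h; rewrite dext3E wedge_om_sq // mulrA.
Qed.

Hypothesis dstar : forall x v, U x -> codiff2 sg c (om sg c) x v = 0.

Lemma star_om y (v : 'I_4 -> E) : U y ->
  starf (k := 2) (l := 4) (fr y) (om sg c y) v =
  kf2_sq (om sg c y) (v (inord 0)) (v (inord 1)) (v (inord 2)) (v (inord 3)).
Proof.
move=> Uy; have [fU Hom _] := frame_spec Uy.
rewrite /starf (_ : (fun w => om sg c y (fun i => w i *m fr y)) = @omega0 R); last first.
  by apply/funext => w; exact: Hom.
by rewrite star0_omega0 /kf2_sq /om0_sq !(W_frame fU Hom).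
Qed.

Lemma codiff_alt x (l : E) : U x -> alt6 (V := R) (fun a b d e h g =>
    l 0 g * 'D_(evec a) (om_sq (Wc c) b d e h) x) = 0.
Proof.
move=> Ux; have oU := chart_open; have [fU Hom _] := frame_spec Ux.
pose OS (p q r t : E) (y : E) := kf2_sq (om sg c y) p q r t.
pose B (u p q r t : E) := 'D_u (OS p q r t) x.
pose beta y := starf (k := 2) (l := 4) (fr y) (om sg c y).
have w_smooth u v k : Ck k U (fun y => kf2 (om sg c y) u v).
  by have [[_ s _] _ _ _] := sgS; exact: (s c (tup 2 [:: u; v]) cA k).
have OS_Ck p q r t k : Ck k U (OS p q r t).
  by apply: Ck_add => //; [apply: Ck_add => //; [|apply: Ck_opp => //]|]; apply: Ck_mul.
have lin2 y u v : U y -> kf2 (om sg c y) u v = \sum_j u 0 j * kf2 (om sg c y) (evec j) v.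
  move=> Uy; have [l1 _] := is_form_bilin (om_form Uy).
  exact: (lin_expR (l1 v)).
have an y u v : U y -> kf2 (om sg c y) u v = - kf2 (om sg c y) v u.
  by move=> Uy; exact: is_form2_anti (om_form Uy).
have OSlin (h : E -> E -> R) : (forall p, Ck 1 U (h p)) ->
    (forall p y, U y -> h p y = \sum_j p 0 j * h (evec j) y) ->
    forall u, lin_exp (V := R) (fun p => 'D_u (h p) x).
  move=> Ch hl u p.
  have d j : is_derive x u (fun y => p 0 j * h (evec j) y) (p 0 j * 'D_u (h (evec j)) x).
    by have df : derivable (h (evec j)) x u := Ck_der (Ch _) Ux; exact: is_deriveZ.
  have [_ e] := is_derive_bigsum d.
  by apply: etrans e; apply: (eq_derive _ oU _ Ux) => y; rewrite inE => Uy; exact: hl.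
(* Linearity is checked in the first slot only; the antisymmetry [OS2] and the exchange of pairs
   [OS3] carry it to the other slots. *)
have OS1 p q r t y : U y -> OS p q r t y = \sum_j p 0 j * OS (evec j) q r t y.
  move=> Uy; rewrite /OS /kf2_sq (lin2 y p q) // (lin2 y p r) // (lin2 y p t) //.
  by rewrite !mulr_suml -sumrB -big_split; apply: eq_bigr => j _ /=; ring.
have OS2 p q r t y : U y -> OS p q r t y = - OS q p r t y.
  move=> Uy; rewrite /OS /kf2_sq (an y q p) // -?(an y r t) //; ring.
have OS3 p q r t y : U y -> OS p q r t y = OS r t p q y.
  move=> Uy; rewrite /OS /kf2_sq (an y r q) // (an y t p) // (an y r p) // (an y t q) //; ring.
have lB1 q r t p : lin_exp (V := R) (fun u => B u p q r t).
  move=> u; exact: (derive_scalar_sum u oU (OS_Ck p q r t 1) Ux).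
have lB2 u q r t : lin_exp (V := R) (fun p => B u p q r t).
  by apply: (OSlin (fun p => OS p q r t)) => [p|p y Uy]; [exact: OS_Ck|exact: OS1].
have lB3 u p r t : lin_exp (V := R) (fun q => B u p q r t).
  apply: (OSlin (fun q => OS p q r t)) => [q|q y Uy]; first exact: OS_Ck.
  rewrite OS2 // OS1 // -sumrN; apply: eq_bigr => j _.
  by rewrite -mulrN -OS2.
have lB4 u p q t : lin_exp (V := R) (fun r => B u p q r t).
  apply: (OSlin (fun r => OS p q r t)) => [r|r y Uy]; first exact: OS_Ck.
  by rewrite OS3 // OS1 //; apply: eq_bigr => j _; rewrite -OS3.
have lB5 u p q r : lin_exp (V := R) (fun t => B u p q r t).
  apply: (OSlin (fun t => OS p q r t)) => [t|t y Uy]; first exact: OS_Ck.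
  rewrite OS3 // OS2 // OS1 // -sumrN; apply: eq_bigr => j _.
  by rewrite -mulrN -OS2 // -OS3.
have mB l' : multilin6 (V := R) (fun a b d e h g => dotv g l' * B a b d e h).
  have lZ k f : lin_exp (V := R) f -> lin_exp (V := R) (fun u => k * f u).
    by move=> hf; exact: (lin_expZ (V := R) k hf).
  split => [b d e h g|a d e h g|a b e h g|].
  - by apply: lZ; exact: lB1.
  - by apply: lZ; exact: lB2.
  - by apply: lZ; exact: lB3.
  split => [a b d h g|a b d e g|a b d e h].
  - by apply: lZ; exact: lB4.
  - by apply: lZ; exact: lB5.
  exact: (lin_expZl (V := R) _ (lin_exp_dot l')).
have ZE v : dext beta x v =
     B (v (inord 0)) (v (inord 1)) (v (inord 2)) (v (inord 3)) (v (inord 4))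
     - B (v (inord 1)) (v (inord 0)) (v (inord 2)) (v (inord 3)) (v (inord 4))
     + B (v (inord 2)) (v (inord 0)) (v (inord 1)) (v (inord 3)) (v (inord 4))
     - B (v (inord 3)) (v (inord 0)) (v (inord 1)) (v (inord 2)) (v (inord 4))
     + B (v (inord 4)) (v (inord 0)) (v (inord 1)) (v (inord 2)) (v (inord 3)).
  have bE (i : 'I_5) (p q r t : E) : v (lift i (inord 0)) = p -> v (lift i (inord 1)) = q ->
      v (lift i (inord 2)) = r -> v (lift i (inord 3)) = t ->
      'D_(v i) (fun y => beta y (fun j => v (lift i j))) x = B (v i) p q r t.
    move=> <- <- <- <-; apply: (eq_derive _ oU _ Ux) => y; rewrite inE => Uy.
    exact: star_om.
  have iE k (i : 'I_5) : (k < 5)%N -> i = k :> nat -> v i = v (inord k).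
    by move=> k5 ik; congr v; apply/val_inj; rewrite /= inordK.
  rewrite /dext big_ord5.
  rewrite (bE _ (v (inord 1)) (v (inord 2)) (v (inord 3)) (v (inord 4)));
    try by apply: iE => //; rewrite /= inordK.
  rewrite (bE _ (v (inord 0)) (v (inord 2)) (v (inord 3)) (v (inord 4)));
    try by apply: iE => //; rewrite /= /bump inordK.
  rewrite (bE _ (v (inord 0)) (v (inord 1)) (v (inord 3)) (v (inord 4)));
    try by apply: iE => //; rewrite /= /bump inordK.
  rewrite (bE _ (v (inord 0)) (v (inord 1)) (v (inord 2)) (v (inord 4)));
    try by apply: iE => //; rewrite /= /bump inordK.
  rewrite (bE _ (v (inord 0)) (v (inord 1)) (v (inord 2)) (v (inord 3)));
    try by apply: iE => //; rewrite /= /bump inordK.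
  rewrite (iE 0%N ord0) // (iE 1%N (lift ord0 ord0)) // (iE 2%N (lift ord0 (lift ord0 ord0))) //.
  rewrite (iE 3%N (lift ord0 (lift ord0 (lift ord0 ord0)))) //.
  rewrite (iE 4%N (lift ord0 (lift ord0 (lift ord0 (lift ord0 ord0))))) //.
  by rewrite -![_ *: _]/(_ * _) /= /bump /=; ring.
(* Raising [l] with the inverse metric cancels the metric that [starf_dext51] produces. *)
have := dstar (fun=> l *m ((fr x)^T *m fr x)) Ux.
rewrite /codiff2 -/beta => /eqP; rewrite oppr_eq0 => /eqP.
rewrite (starf_dext51 fU (fun=> l *m ((fr x)^T *m fr x)) mB ZE).
have -> : l *m ((fr x)^T *m fr x) *m (invmx (fr x) *m (invmx (fr x))^T) = l.
  by rewrite !mulmxA mulmxK // -mulmxA trK' // mulmx1.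
move/eqP; rewrite !mulf_eq0 invr_eq0 pnatr_eq0 /= (negbTE (detf0 fU)) /= => /eqP.
by [].
Qed.

Lemma div_omt_chart x : U x -> forall j, \sum_i 'D_(evec i) (omtc (Wc c) i j) x = 0.
Proof.
move=> Ux; apply: (div_omtc Wc_smooth Ux) => l; exact: codiff_alt.
Qed.

End OneChart.
End ChartTensors.

Section WedgeOneForms.
Context {R : realType} {n : nat} {V1 V2 : Type} {V3 : lmodType R}.
Local Notation E := 'rV[R]_n.

Lemma wedgef11 (op : V1 -> V2 -> V3) (al : kform 1 E V1) (be : kform 1 E V2) v :
  wedgef op al be v = op (al (fun=> v ord0)) (be (fun=> v ord_max))
                      - op (al (fun=> v ord_max)) (be (fun=> v ord0)).
Proof.
rewrite /wedgef (_ : (1`! * 1`!)%N = 1%N) // invr1 scale1r.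
rewrite -[RHS](sign_sum_perm2 (fun i j => op (al (fun=> v i)) (be (fun=> v j)))).
apply: eq_bigr => s _; congr (_ *: op (al _) (be _)); apply/funext => i; rewrite ord1;
  congr (v (s _)); exact/val_inj.
Qed.

Lemma wedgef10 (op : V1 -> V2 -> V3) (al : kform 1 E V1) (be : kform 0 E V2) v w :
  wedgef op al be v = op (al (fun=> v ord0)) (be w).
Proof.
rewrite /wedgef (_ : (1`! * 0`!)%N = 1%N) // sum_perm1 odd_perm1 expr0 invr1 !scale1r.
congr (op (al _) (be _)); apply/funext => i; last by case: i.
by congr v; rewrite [LHS]ord1.
Qed.

End WedgeOneForms.

Lemma lin3 (R : realType) (V : lmodType R) a (x1 x2 y1 y2 z1 z2 : V) :
  a *: x1 + x2 - (a *: y1 + y2) + (a *: z1 + z2) = a *: (x1 - y1 + z1) + (x2 - y2 + z2).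
Proof. by rewrite opprD [X in X + _]addrACA -scalerBr addrACA -scalerDr. Qed.

Lemma Lambda_om0 (R : realType) (Z : Type) (sg : su3 R Z) (V : lmodType R) c x
    (al : kform 2 'rV[R]_6 V) :
  (forall v, om sg c x (fun i => v i *m frame sg c x) = omega0 v) ->
  Lambda sg c x al = (2%:R : R)^-1 *: \sum_(I : {ffun 'I_2 -> 'I_6})
    om0 (evec (I ord0)) (evec (I ord_max)) *:
     kf2 al (evec (I ord0) *m frame sg c x) (evec (I ord_max) *m frame sg c x).
Proof.
move=> Hom; congr (_ *: _).
have e2 (T : Type) (h g : 'I_2 -> T) : h ord0 = g ord0 -> h ord_max = g ord_max -> h = g.
  move=> h0 h1; apply/funext => -[[|[|//]] p].
    by rewrite (_ : Ordinal p = ord0) //; apply/val_inj.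
  by rewrite (_ : Ordinal p = ord_max) //; apply/val_inj.
apply: eq_bigr => I _; rewrite Hom; congr (_ *: _).
  rewrite -(omega0E (tup 2 [:: evec (I ord0); evec (I ord_max)])); congr omega0; exact: e2.
by congr (al _); exact: e2.
Qed.

(** * The equations in a local gauge *)

Section GaugeLevel.
Context {R : realType} {m : nat} {G : lieGroup R m} {Z : Type}.
Context {A : set (chart R 6 Z)} {X : set Z} (P : pbundle G A X).
Local Notation E := 'rV[R]_6.
Local Notation V := 'rV[R]_m.
Variable (b : gauge R 6 Z P).
Local Notation U := (cdom (gch b)).
Hypothesis bA : adm_gauge b.

Definition pot (B : gfield P 1) (i : 'I_6) (x : E) : V := B b x (fun=> evec i).
Definition sec (xi : gfield P 0) (x : E) : V := xi b x (fun=> 0).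

Lemma gauge_adm : admissible A (gch b). Proof. by have [] := bA. Qed.
Lemma gauge_open : open U. Proof. by have [[]] := bA. Qed.

Lemma fun_ord0 (T : Type) (v w : 'I_0 -> T) : v = w.
Proof. by apply/funext => -[]. Qed.

Lemma fun_ord1 (T : Type) (v : 'I_1 -> T) : v = fun=> v ord0.
Proof. by apply/funext => i; rewrite ord1. Qed.

Section OneConnection.
Variable B : gfield P 1.
Hypothesis sB : smooth_gfield B.
Local Notation Bv u x := (B b x (fun=> u) : V).

Lemma pot_smooth i : smooth_on U (pot B i).
Proof. by have [_ s] := sB bA; exact: s. Qed.

Lemma conn_lin x a u v : U x -> Bv (a *: u + v) x = a *: Bv u x + Bv v x.
Proof. by move=> Ux; have [s _] := sB bA; exact: is_form1_linear (s x Ux). Qed.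

Lemma conn_derive_lin x w a u v : U x ->
  'D_w (fun y => Bv (a *: u + v) y) x = a *: 'D_w (fun y => Bv u y) x + 'D_w (fun y => Bv v y) x.
Proof.
move=> Ux; have oU := gauge_open; have [_ s] := sB bA.
have d u' : derivable (fun y => Bv u' y) x w := Ck_der (s (fun=> u') 1%N) Ux.
apply: etrans (eq_derive w oU _ Ux) _.
  by move=> y; rewrite inE => Uy; exact: conn_lin.
have iu u' : is_derive x w (fun y => Bv u' y) ('D_w (fun y => Bv u' y) x) by exact/derivableP.
have D : is_derive x w (fun y => a *: Bv u y + Bv v y)
    (a *: 'D_w (fun y => Bv u y) x + 'D_w (fun y => Bv v y) x).
  by apply: is_deriveD; exact: is_deriveZ.
by have [_ e] := D.
Qed.

Lemma dext_conn x (v : 'I_2 -> E) : dext (B b) x v =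
  'D_(v ord0) (fun y => Bv (v ord_max) y) x - 'D_(v ord_max) (fun y => Bv (v ord0) y) x.
Proof.
rewrite /dext big_ord_recl big_ord1.
have e (i : 'I_2) u : v (lift i ord0) = u ->
   (fun y => B b y (fun j => v (lift i j))) = (fun y => Bv u y).
  by move=> <-; apply/funext => y; congr (B b y _); apply/funext => j; rewrite ord1.
rewrite (e ord0 (v ord_max)); last by congr v; apply/val_inj.
rewrite (e (lift ord0 ord0) (v ord0)); last by congr v; apply/val_inj.
have -> : lift ord0 ord0 = ord_max :> 'I_2 by apply/val_inj.
congr (_ + _); first exact: scale1r.
exact: scaleN1r.
Qed.

Lemma curv_kf2 x u v : kf2 (curv B b x) u v =
  'D_u (fun y => Bv v y) x - 'D_v (fun y => Bv u y) x + brk G (Bv u x) (Bv v x).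
Proof.
rewrite /kf2 /curv; congr (_ + _); first exact: dext_conn.
have h (y : V) : (2^-1 : R) *: (y + y) = y.
  by rewrite scalerDr -scalerDl (_ : 2^-1 + 2^-1 = 1 :> R) ?scale1r //; field.
by rewrite wedgef11 /tup /= (brkC G (Bv v x)) opprK; exact: h.
Qed.

Lemma curv_Fc x i j : kf2 (curv B b x) (evec i) (evec j) = Fc (brk G) (pot B) i j x.
Proof. by rewrite curv_kf2. Qed.

Lemma curv_bilin x : U x -> bilin (kf2 (curv B b x)).
Proof.
move=> Ux; have oU := gauge_open; have [_ s] := sB bA; have [b1 b2] := brk_bilinear G.
have D1 u v w a : 'D_(a *: u + v) (fun y => Bv w y) x =
    a *: 'D_u (fun y => Bv w y) x + 'D_v (fun y => Bv w y) x.
  exact: (derive_linear a u v oU (s (fun=> w) 1%N) Ux).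
split => [v|u]; apply: lin_exp_linear => a p q; rewrite !curv_kf2.
  rewrite D1 conn_derive_lin // conn_lin // b1; exact: lin3.
rewrite D1 conn_derive_lin // conn_lin // b2; exact: lin3.
Qed.

Section OneSection.
Variable xi : gfield P 0.
Hypothesis sxi : smooth_gfield xi.

Lemma sec_smooth : smooth_on U (sec xi).
Proof. by have [_ s] := sxi bA; exact: s. Qed.

Lemma dcovE x u : dcov B xi b x (fun=> u) =
  'D_u (sec xi) x + brk G (Bv u x) (sec xi x).
Proof.
rewrite /dcov /dext big_ord1; congr (_ + _).
  apply: etrans (scale1r _) _.
  by congr ('D_u _ x); apply/funext => y; congr (xi b y _); exact: fun_ord0.
exact: wedgef10.
Qed.

Lemma dcov_nab x i : dcov B xi b x (fun=> evec i) = nab (brk G) (pot B) i (sec xi) x.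
Proof. exact: dcovE. Qed.

Lemma dcov_lin x a u v : U x -> dcov B xi b x (fun=> a *: u + v) =
  a *: (dcov B xi b x (fun=> u) : V) + dcov B xi b x (fun=> v).
Proof.
move=> Ux; have [b1 _] := brk_bilinear G.
rewrite !dcovE (derive_linear a u v gauge_open (sec_smooth 1%N) Ux) conn_lin // b1.
by rewrite addrACA -scalerDr.
Qed.

End OneSection.
End OneConnection.

Variable sg : su3 R Z.
Hypothesis sgS : su3_structure sg A.
Local Notation c := (gch b).
Local Notation fr := (frame sg c).

Lemma Jx_mx x v : Jx sg c x v = v *m Jmx (fr x).
Proof. by rewrite /Jx J0_mx /Jmx !mulmxA. Qed.

Lemma flat_WWF (B : gfield P 1) x : smooth_gfield B -> U x -> Lambda_curv sg B b x = 0 ->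
  WWF (brk G) (pot B) (Wc sg c) x = 0.
Proof.
move=> sB Ux; have [fU Hom _] := frame_spec sgS gauge_adm Ux.
(* The 8 is the constant of [Lambda_alt6]; the 2 clears the 1/2! in [Lambda]. *)
move=> /(congr1 (fun y : V => (8%:R * 2%:R : R) *: y)); rewrite scaler0 /Lambda_curv (Lambda_om0 _ Hom).
rewrite -scalerA [2%:R *: _]scalerA mulfV ?pnatr_eq0 // scale1r.
rewrite (Lambda_alt6 fU Hom (is_form_bilin (om_form sgS gauge_adm Ux)) (curv_bilin sB Ux)).
move/eqP; rewrite scaler_eq0 (negbTE (detf0 fU)) /= => /eqP e.
by rewrite -[RHS]e; apply: eq_alt6 => *; rewrite curv_Fc.
Qed.

Hypothesis dstar : forall x v, U x -> codiff2 sg c (om sg c) x v = 0.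
Variable w1 : R[i].
Hypothesis dOm : forall x v, U x ->
  Complex (dext (reform (Om sg c)) x v) (dext (imform (Om sg c)) x v)
     = w1 * real_complex R (wedgef (V3 := R) *%R (om sg c x) (om sg c x) v).

Variables (B : gfield P 1) (xi1 xi2 : gfield P 0).
Hypothesis sB : smooth_gfield B.
Hypothesis sxi1 : smooth_gfield xi1.
Hypothesis sxi2 : smooth_gfield xi2.
Hypothesis flat : forall x, U x -> Lambda_curv sg B b x = 0.
Hypothesis sys : forall x v, U x ->
  addg (addg (star_curv_ImOm sg B) (dcov B xi1)) (Jpull sg (dcov B xi2)) b x v = 0.

(** [torsion_eqs] with the pointwise frame replaced by [Gm] and [omtc], so that the identities may
    be differentiated. *)
Lemma torsion_gauge x i : U x ->
  Yc (brk G) (pot B) (Ic sg c) i x = - \sum_j (Gm sg c x i j *: nab (brk G) (pot B) j (sec xi1) x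
     + omtc (Wc sg c) i j x *: nab (brk G) (pot B) j (sec xi2) x) /\
  Yc (brk G) (pot B) (Rc sg c) i x = \sum_j (Gm sg c x i j *: nab (brk G) (pot B) j (sec xi2) x
     - omtc (Wc sg c) i j x *: nab (brk G) (pot B) j (sec xi1) x).
Proof.
move=> Ux; have cA := gauge_adm; have [fU Hom HO] := frame_spec sgS cA Ux.
have YcE (Q : kform 3 E R) : Yvec (kf2 (curv B b x)) (kf3 Q) (evec i) =
    Yc (brk G) (pot B) (fun a' b' c' _ => kf3 Q (evec a') (evec b') (evec c')) i x.
  by rewrite /Yvec /Yc; congr (_ *: _); apply: eq_alt6 => *; rewrite curv_Fc.
have [|e1 e2] := @torsion_eqs R _ fU _ HO (is_form_trilin (im_form sgS cA Ux)) V (curv B b x)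
   (fun u => dcov B xi1 b x (fun=> u)) (fun u => dcov B xi2 b x (fun=> u)) (curv_bilin sB Ux)
   (fun a u v => dcov_lin sB sxi1 a u v Ux) (fun a u v => dcov_lin sB sxi2 a u v Ux) _ i.
  by move=> w; have := sys (fun=> w) Ux; rewrite /addg /Jpull Jx_mx /star_curv_ImOm /curv_ImOm.
have gE j : gam (fr x) i j = Gm sg c x i j by rewrite (Gm_frame sgS).
have oE j : omt (fr x) i j = omtc (Wc sg c) i j x by rewrite -(omtc_frame sgS cA Ux) mxE.
split.
  transitivity (Yvec (kf2 (curv B b x)) (kf3 (fun v => complex.Im (Om sg c x v))) (evec i)).
    by rewrite YcE.
  by rewrite e1; congr (- _); apply: eq_bigr => j _; rewrite gE oE !dcov_nab.
transitivity (Yvec (kf2 (curv B b x)) (kf3 (fun v => complex.Re (Om sg c x v))) (evec i)).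
  by rewrite YcE.
by rewrite e2; apply: eq_bigr => j _; rewrite gE oE !dcov_nab.
Qed.

Lemma nab_sec_Ck k xi j : smooth_gfield xi -> Ck k U (nab (brk G) (pot B) j (sec xi)).
Proof.
by move=> s; exact: (nab_Ck (brk_bilinear G) gauge_open (pot_smooth sB) j k (sec_smooth s)).
Qed.

(** Solved for the gradients, [torsion_gauge] reads Gm d xi1 = - Y_Im - omtc d xi2 and Gm d xi2 =
    Y_Re + omtc d xi1. All terms on the right are divergence free, by [div_Yc] and [div_omt_nab]. *)
Lemma div_gm_nab x : U x ->
  \sum_i nab (brk G) (pot B) i
    (fun y => \sum_j Gm sg c y i j *: nab (brk G) (pot B) j (sec xi1) y) x = 0 /\
  \sum_i nab (brk G) (pot B) i
    (fun y => \sum_j Gm sg c y i j *: nab (brk G) (pot B) j (sec xi2) y) x = 0.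
Proof.
move=> Ux; have oU := gauge_open; have cA := gauge_adm; have bb := brk_bilinear G.
have pS := pot_smooth sB; have W0 := flat_WWF sB Ux (flat Ux).
have dI := div_Yc bb (brkC G) (jacobi G) oU pS Ux (Ic_smooth sgS cA) W0
   (fun a b' d e => dIc sgS cA dOm Ux a b' d e).
have dR := div_Yc bb (brkC G) (jacobi G) oU pS Ux (Rc_smooth sgS cA) W0
   (fun a b' d e => dRc sgS cA dOm Ux a b' d e).
have dW xi : smooth_gfield xi -> \sum_i nab (brk G) (pot B) i
    (fun y => \sum_j omtc (Wc sg c) i j y *: nab (brk G) (pot B) j (sec xi) y) x = 0.
  move=> s; apply: (div_omt_nab bb (jacobi G) oU pS (Wc_smooth sgS cA) (sec_smooth s) Ux _ W0).
  exact: (div_omt_chart sgS cA dstar Ux).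
have WCk xi i : smooth_gfield xi ->
    Ck 1 U (fun y => \sum_j omtc (Wc sg c) i j y *: nab (brk G) (pot B) j (sec xi) y).
  move=> s; apply: (@Ck_sum _ _ _ 1%N U _ _ xpredT (fun j y => omtc (Wc sg c) i j y *: nab (brk G) (pot B) j (sec xi) y) oU) => j _.
  apply: (Ck_scalev oU); last exact: nab_sec_Ck.
  exact: (omtc_Ck oU (Wc_smooth sgS cA)).
split.
  apply: (div_comb bb oU (p := -1) (q := -1) Ux _ _ _ dI (dW _ sxi2)) => [i|i|i y Uy].
  - exact: (Yc_Ck bb oU pS i 1%N (Ic_smooth sgS cA)).
  - exact: WCk.
  rewrite (torsion_gauge i Uy).1 !scaleN1r opprK big_split /= addrK //.
apply: (div_comb bb oU (p := 1) (q := 1) Ux _ _ _ dR (dW _ sxi1)) => [i|i|i y Uy].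
- exact: (Yc_Ck bb oU pS i 1%N (Rc_smooth sgS cA)).
- exact: WCk.
by rewrite (torsion_gauge i Uy).2 !scale1r sumrB subrK.
Qed.

Variable ip : lie G -> lie G -> R.
Hypothesis ipP : Ad_inner_product ip.

Definition nsq (xi : gfield P 0) (x : E) : R := ip (sec xi x) (sec xi x).

Lemma lap_nsq x : U x -> forall xi, xi = xi1 \/ xi = xi2 ->
  \sum_i 'D_(evec i) (fun y => \sum_j Gm sg c y i j * 'D_(evec j) (nsq xi) y) x =
  2 * \sum_i \sum_j Gm sg c x i j *
     ip (nab (brk G) (pot B) i (sec xi) x) (nab (brk G) (pot B) j (sec xi) x).
Proof.
move=> Ux xi xiE; have oU := gauge_open; have [d1 d2] := div_gm_nab Ux.
have GC i j : Ck 1 U (fun y => Gm sg c y i j) by exact: (Gm_Ck sgS gauge_adm).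
have sxi : smooth_gfield xi by case: xiE => ->.
apply: (lap_norm (gm := fun i j y => Gm sg c y i j) (brk_bilinear G) oU (pot_smooth sB)
  (ip_bilinear ipP) (ipC ipP) (ip_brk ipP) Ux (sec_smooth sxi) GC).
by case: xiE => ->.
Qed.

End GaugeLevel.

(** * The maximum principle *)

Section Barrier.
Context {R : realType}.
Local Notation E := 'rV[R]_6.
Variable c : E.

Definition sqd (y : E) : R := dotv (y - c) (y - c).
Definition barrier (q : nat) (y : E) : R := (sqd y)^-1 ^+ q.

Lemma dotvD n (u v w : 'rV[R]_n) : dotv (u + v) w = dotv u w + dotv v w.
Proof. by rewrite /dotv -big_split; apply: eq_bigr => i _; rewrite mxE mulrDl. Qed.

Lemma dotvZ n a (u w : 'rV[R]_n) : dotv (a *: u) w = a * dotv u w.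
Proof. by rewrite /dotv mulr_sumr; apply: eq_bigr => i _; rewrite mxE mulrA. Qed.

Lemma sqd_gt0 y : y != c -> 0 < sqd y.
Proof.
move=> yc; rewrite lt_def dotv_ge0 andbT; apply: contra_neq yc => /eqP.
by rewrite dotv_eq0 subr_eq0 => /eqP.
Qed.

Lemma is_derive_dot v w x : is_derive x w (fun y : E => dotv (y - c) v) (dotv w v).
Proof.
apply: (is_derive_affine (L := fun w => dotv w v)) => h y.
by rewrite -addrA !dotvD dotvZ.
Qed.

Lemma is_derive_sqd x v : is_derive x v sqd (2 * dotv (x - c) v).
Proof.
have d (i : 'I_6) : is_derive x v (fun y : E => y 0 i - c 0 i) (v 0 i).
  by apply: (is_derive_affine (L := fun w : E => w 0 i)) => h y; rewrite !mxE addrA.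
have d2 (i : 'I_6) : is_derive x v (fun y : E => (y 0 i - c 0 i) * (y 0 i - c 0 i))
    (2 * ((x 0 i - c 0 i) * v 0 i)).
  split; first by apply: derivable_mulr; have [] := d i.
  have [d1 e] := d i.
  by apply: etrans (derive_mulr d1 d1) _; rewrite e; ring.
have D := is_derive_bigsum d2.
rewrite (_ : sqd = (fun y => \sum_i (y 0 i - c 0 i) * (y 0 i - c 0 i))); last first.
  by apply/funext => y; apply: eq_bigr => i _; rewrite !mxE.
rewrite (_ : 2 * _ = \sum_i 2 * ((x 0 i - c 0 i) * v 0 i)) //.
by rewrite mulr_sumr; apply: eq_bigr => i _; rewrite !mxE.
Qed.

Lemma sqd_Ck k (U : set E) : open U -> Ck k U sqd.
Proof.
move=> oU; have C i : Ck k U (fun y : E => (y - c) 0 i).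
  apply: (@Ck_affine _ _ _ k U _ (fun v : E => v 0 i)) => //.
    move=> x; apply: (@coord_cont _ _ _ _ (fun y : E => y - c)).
    exact: (cvgB (@cvg_id _ _) (@cvg_cst _ _ _ _ _)).
  by move=> v h y; rewrite !mxE addrA.
by apply: Ck_sum => // i _; exact: Ck_mul.
Qed.

Lemma barrier_Ck k q (U : set E) : open U -> ~ U c -> Ck k U (barrier q).
Proof.
move=> oU Uc; apply: Ck_exp => //; apply: Ck_inv => //; last exact: sqd_Ck.
move=> x Ux; apply: lt0r_neq0; apply: sqd_gt0; apply/eqP => xc; apply: Uc.
by rewrite -xc.
Qed.

Lemma is_derive_barrier q x v : x != c ->
  is_derive x v (barrier q) (- (2 * q%:R) * barrier q.+1 x * dotv (x - c) v).
Proof.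
move=> xc; have s0 := lt0r_neq0 (sqd_gt0 xc).
have D1 := is_derive_sqd x v.
have D2 : is_derive x v (fun y => (sqd y)^-1) (- (sqd x) ^- 2 *: (2 * dotv (x - c) v)).
  have [d1 <-] := D1; split; first exact: derivableV.
  exact: deriveV.
have D3 := is_deriveX q D2.
have bE : barrier q = (fun y => (sqd y)^-1) ^+ q.
  apply/funext => y; rewrite /barrier; elim: (q) => [|p IH] //.
  by rewrite !exprS IH.
suff -> : - (2 * q%:R) * barrier q.+1 x * dotv (x - c) v =
   (q%:R * (sqd x)^-1 ^+ q.-1) *: (- (sqd x) ^- 2 *: (2 * dotv (x - c) v)) by rewrite bE.
rewrite /GRing.scale /= -exprVn.
case: q {D3 bE} => [|q]; first by rewrite mulr0n !(mul0r, mulr0, oppr0).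
rewrite /barrier /= !exprS expr0; ring.
Qed.

Definition offc : set E := [set y | y != c].

Lemma offc_open : open offc.
Proof.
rewrite (_ : offc = ~` [set c]); first by apply/closed_openC/accessible_closed_set1/hausdorff_accessible/norm_hausdorff.
by apply/seteqP; split => y; rewrite /offc /=; [move/eqP|move=> h; apply/eqP].
Qed.

Lemma barrier_deriv q x v : x != c ->
  'D_v (barrier q) x = - (2 * q%:R) * barrier q.+1 x * dotv (x - c) v.
Proof. by move=> xc; have [_ ->] := is_derive_barrier q v xc. Qed.

Lemma barrier_deriv2 q x v w : x != c ->
  'D_w ('D_v (barrier q)) x =
  4 * q%:R * q.+1%:R * barrier q.+2 x * (dotv (x - c) v * dotv (x - c) w)
   - 2 * q%:R * barrier q.+1 x * dotv w v.
Proof.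
move=> xc.
apply: etrans (eq_derive w offc_open _ (xc : offc x)) _.
  by move=> y; rewrite inE => yc; exact: barrier_deriv yc.
have D1 := is_derive_barrier q.+1 w xc; have D2 := is_derive_dot v w x.
have d1 : derivable (fun y => - (2 * q%:R) * barrier q.+1 y) x w.
  by apply: derivable_mulr; [exact: derivable_cst|case: D1].
have d2 : derivable (fun y : E => dotv (y - c) v) x w by case: D2.
apply: etrans (derive_mulr d1 d2) _.
have -> : 'D_w (fun y : E => dotv (y - c) v) x = dotv w v by case: D2.
have -> : 'D_w (fun y => - (2 * q%:R) * barrier q.+1 y) x =
   - (2 * q%:R) * 'D_w (barrier q.+1) x.
  have d1' : derivable (barrier q.+1) x w by case: D1.
  by apply: etrans (derive_mulr (derivable_cst _ x w) d1') _; rewrite derive_cst mul0r add0r.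
by rewrite barrier_deriv //; ring.
Qed.

End Barrier.

(** * The divergence-form operator of a metric density *)

Section Operator.
Context {R : realType}.
Local Notation E := 'rV[R]_6.
Implicit Types (gm : E -> 'M[R]_6) (w : E -> R) (U : set E).

(** For [gm] the inverse metric as a density, this is the Laplace-Beltrami operator times the
    density. *)
Definition Lop gm w x : R :=
  \sum_i 'D_(evec i) (fun y => \sum_j gm y i j * 'D_(evec j) w y) x.

Definition quad (M : 'M[R]_6) (z : E) : R := \sum_i \sum_j M i j * (z 0 i * z 0 j).
Definition drift gm (x : E) (j : 'I_6) : R := \sum_i 'D_(evec i) (fun y => gm y i j) x.

Lemma LopE gm w U x : open U -> (forall i j, Ck 1 U (fun y => gm y i j)) -> Ck 2 U w -> U x ->
  Lop gm w x = \sum_j drift gm x j * 'D_(evec j) w x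
    + \sum_i \sum_j gm x i j * 'D_(evec i) ('D_(evec j) w) x.
Proof.
move=> oU Cg Cw Ux.
transitivity (\sum_i \sum_j ('D_(evec i) (fun y => gm y i j) x * 'D_(evec j) w x
    + gm x i j * 'D_(evec i) ('D_(evec j) w) x)).
  apply: eq_bigr => i _.
  have d j : is_derive x (evec i) (fun y => gm y i j * 'D_(evec j) w y)
     ('D_(evec i) (fun y => gm y i j) x * 'D_(evec j) w x
    + gm x i j * 'D_(evec i) ('D_(evec j) w) x).
    have d1 : derivable (fun y => gm y i j) x (evec i) := Ck_der (Cg i j) Ux.
    have d2 : derivable ('D_(evec j) w) x (evec i) := Ck_der (CkD (evec j) Cw) Ux.
    by split; [exact: derivable_mulr|exact: derive_mulr].
  by have [_ e] := is_derive_bigsum d.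
under eq_bigr do rewrite big_split /=.
rewrite big_split /=; congr (_ + _); rewrite exchange_big /=.
by apply: eq_bigr => j _; rewrite /drift mulr_suml.
Qed.

Lemma gamE (f : 'M[R]_6) i j : gam f i j = (\det f)^-1 * \sum_a f a i * f a j.
Proof. by rewrite [LHS]mxE [(_ *m _) i j]mxE; congr (_ * _); apply: eq_bigr => a _; rewrite mxE. Qed.

(** Multiplied by [\det f], the density [gam f] becomes the sum of the squares of the frame
    vectors. *)
Lemma gam_contract (V : lmodType R) (f : 'M[R]_6) (B : E -> E -> V) : f \in unitmx -> bilin B ->
  \det f *: (\sum_i \sum_j gam f i j *: B (evec i) (evec j)) =
  \sum_a B (row a f) (row a f).
Proof.
move=> fU [B1 B2]; rewrite scaler_sumr.
transitivity (\sum_i \sum_j \sum_a (f a i * f a j) *: B (evec i) (evec j)).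
  apply: eq_bigr => i _; rewrite scaler_sumr; apply: eq_bigr => j _.
  by rewrite gamE scalerA mulrA mulfV ?detf0 // mul1r scaler_suml.
under eq_bigr do rewrite exchange_big.
rewrite exchange_big; apply: eq_bigr => a _ /=.
rewrite [RHS]B1; apply: eq_bigr => i _; rewrite (B2 _ (row a f)) scaler_sumr.
by apply: eq_bigr => j _; rewrite scalerA !mxE.
Qed.

(** At a maximum the first-order part vanishes, and [gam_contract] turns the second-order part into
    pure second derivatives along the frame vectors. The factor [\det f] removes the sign carried by
    [gam]. *)
Lemma Lop_at_max gm w U (f : 'M[R]_6) x : open U ->
  (forall i j, Ck 1 U (fun y => gm y i j)) -> Ck 2 U w -> U x ->
  f \in unitmx -> gm x = gam f ->
  (forall y, U y -> w y <= w x) -> \det f * Lop gm w x <= 0.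
Proof.
move=> oU Cg Cw Ux fU gf mx.
have B : bilin (V := R^o) (fun u v => 'D_u ('D_v w) x : R^o).
  split=> [v|u] z.
    exact: (derive_scalar_sum z oU (CkD v Cw) Ux).
  apply: etrans (schwarz u z oU Cw Ux) _.
  apply: etrans (derive_scalar_sum z oU (CkD u Cw) Ux) _.
  by apply: eq_bigr => j _; rewrite (schwarz _ u oU Cw Ux).
rewrite (LopE oU Cg Cw Ux) big1 ?add0r; last first.
  by move=> j _; rewrite (deriv_at_max _ oU (Ck_pred Cw) Ux mx) mulr0.
have -> : \det f * (\sum_i \sum_j gm x i j * 'D_(evec i) ('D_(evec j) w) x) =
   \sum_a 'D_(row a f) ('D_(row a f) w) x.
  by rewrite gf; exact: (gam_contract fU B).
by apply: sumr_le0 => a _; exact: (deriv2_at_max _ oU Cw Ux mx).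
Qed.

Lemma Lop_add gm (w1 w2 : E -> R) (k : R) U x : open U ->
  (forall i j, Ck 1 U (fun y => gm y i j)) -> Ck 2 U w1 -> Ck 2 U w2 -> U x ->
  Lop gm (fun y => w1 y + k * w2 y) x = Lop gm w1 x + k * Lop gm w2 x.
Proof.
move=> oU Cg C1 C2 Ux.
have D n (f g : E -> R) (y v : E) : Ck n.+1 U f -> Ck n.+1 U g -> U y ->
    'D_v (fun y => f y + k * g y) y = 'D_v f y + k * 'D_v g y.
  move=> Cf Cg' Uy.
  have df : derivable f y v := Ck_der Cf Uy; have dg : derivable g y v := Ck_der Cg' Uy.
  have [_ e] : is_derive y v (fun y => f y + k *: g y) ('D_v f y + k *: 'D_v g y).
    by apply: is_deriveD; [exact/derivableP|apply: is_deriveZ; exact/derivableP].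
  exact: e.
have C12 : Ck 2 U (fun y => w1 y + k * w2 y).
  exact: (Ck_add oU C1 (Ck_scale k oU C2)).
rewrite (LopE oU Cg C12 Ux) (LopE oU Cg C1 Ux) (LopE oU Cg C2 Ux) mulrDr addrACA; congr (_ + _).
  rewrite mulr_sumr -big_split; apply: eq_bigr => j _.
  rewrite (D 1%N w1 w2 x (evec j) C1 C2 Ux) /=; ring.
rewrite mulr_sumr -big_split; apply: eq_bigr => i _.
rewrite mulr_sumr -big_split; apply: eq_bigr => j _ /=.
have -> : 'D_(evec i) ('D_(evec j) (fun y => w1 y + k * w2 y)) x =
   'D_(evec i) (fun y => 'D_(evec j) w1 y + k * 'D_(evec j) w2 y) x.
  apply: (eq_derive _ oU _ Ux) => y; rewrite inE => Uy.
  exact: (D 1%N w1 w2 y (evec j) C1 C2 Uy).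
apply: etrans (congr1 (fun t => gm x i j * t)
  (D 0%N ('D_(evec j) w1) ('D_(evec j) w2) x (evec i) (CkD _ C1) (CkD _ C2) Ux)) _.
by rewrite mulrDr mulrCA.
Qed.

(** The formula isolates the bracket that decides the sign: the quadratic form comes with q + 1,
    trace and drift do not. For [gm] constantly 1 the bracket is (2q + 2 - 6) |x - c|^2, negative
    exactly for 2q < 4. *)
Lemma Lop_barrier gm c q U x : open U -> (forall i j, Ck 1 U (fun y => gm y i j)) -> ~ U c -> U x ->
  Lop gm (barrier c q) x = 2 * q%:R * barrier c q.+2 x *
   (2 * q.+1%:R * quad (gm x) (x - c)
    - sqd c x * (\sum_i gm x i i + \sum_j drift gm x j * (x - c) 0 j)).
Proof.
move=> oU Cg Uc Ux; have xc : x != c by apply/eqP => e; apply: Uc; rewrite -e.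
have s0 := lt0r_neq0 (sqd_gt0 xc).
rewrite (LopE oU Cg (barrier_Ck 2 q oU Uc) Ux).
have b1 : barrier c q.+1 x = sqd c x * barrier c q.+2 x.
  by rewrite /barrier [in RHS]exprS mulrA mulfV // mul1r.
have -> : \sum_j drift gm x j * 'D_(evec j) (barrier c q) x =
   - (2 * q%:R) * barrier c q.+2 x * sqd c x * \sum_j drift gm x j * (x - c) 0 j.
  rewrite mulr_sumr; apply: eq_bigr => j _.
  by rewrite barrier_deriv // dotv_evecr b1; ring.
have -> : \sum_i \sum_j gm x i j * 'D_(evec i) ('D_(evec j) (barrier c q)) x =
   4 * q%:R * q.+1%:R * barrier c q.+2 x * quad (gm x) (x - c)
   - 2 * q%:R * barrier c q.+2 x * sqd c x * \sum_i gm x i i.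
  rewrite /quad !mulr_sumr -sumrB; apply: eq_bigr => i _.
  pose K1 : R := 4 * q%:R * q.+1%:R * barrier c q.+2 x.
  pose K2 : R := 2 * q%:R * barrier c q.+2 x * sqd c x; set z := x - c.
  transitivity (\sum_j (K1 * (gm x i j * (z 0 i * z 0 j)) - K2 * (gm x i j * (j == i)%:R))).
    apply: eq_bigr => j _; rewrite barrier_deriv2 // !dotv_evecr b1.
    have -> : (evec i : E) 0 j = (j == i)%:R by rewrite mxE eqxx.
    rewrite /K1 /K2 /z; ring.
  rewrite sumrB -!mulr_sumr -/K1 -/K2. congr (_ - _ * _).
  rewrite (bigD1 i) //= eqxx mulr1 big1 ?addr0 // => j /negbTE ->.
  by rewrite mulr0.
ring.
Qed.

End Operator.

(** * Comparison with barriers and the strong maximum principle *)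

Section MaxPrinciple.
Context {R : realType}.
Local Notation E := 'rV[R]_6.
Implicit Types (gm : E -> 'M[R]_6) (w u : E -> R) (U K : set E) (c : E).

Lemma coord_sqd c (y : E) i : (y 0 i - c 0 i) ^+ 2 <= sqd c y.
Proof.
rewrite /sqd /dotv (bigD1 i) //= !mxE expr2 lerDl.
by apply: sumr_ge0 => j _; rewrite -expr2 sqr_ge0.
Qed.

Lemma sqd_ge0 c y : 0 <= sqd c y.
Proof. exact: dotv_ge0. Qed.

Lemma sqd_self c : sqd c c = 0.
Proof. by rewrite /sqd subrr; apply: big1 => i _; rewrite mxE mul0r. Qed.

Lemma sqdC c y : sqd c y = sqd y c.
Proof. by apply: eq_bigr => i _; rewrite !mxE; ring. Qed.

Lemma sqd_double c y z : sqd c z <= 2 * (sqd y z + sqd c y).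
Proof.
rewrite /sqd /dotv -big_split mulr_sumr; apply: ler_sum => i _ /=; rewrite !mxE.
have : 0 <= (z 0 i - y 0 i - (y 0 i - c 0 i)) ^+ 2 by exact: sqr_ge0.
nra.
Qed.

Lemma norm_sqd c y (e : R) : 0 < e -> sqd c y < e ^+ 2 -> `|y - c| < e.
Proof.
move=> e0 h; rewrite /Num.Def.normr /= mx_normrE bigmax_lt //= => -[i j] _ /=.
rewrite ord1 !mxE -(@ltr_pXn2r _ 2) ?nnegrE ?(ltW e0) //.
by rewrite real_normK ?num_real //; apply: le_lt_trans (coord_sqd c y j) h.
Qed.

Lemma near_sqd c (Q : set E) : (\forall y \near c, Q y) ->
  exists2 k : R, 0 < k & forall y, sqd c y <= k -> Q y.
Proof.
move=> /nbhs_ballP[e /= e0 eQ]; exists (e ^+ 2 / 2); first by rewrite divr_gt0 // exprn_gt0.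
move=> y h; apply: eQ; rewrite -ball_normE /= distrC; apply: norm_sqd => //.
by apply: le_lt_trans h _; rewrite ltr_pdivrMr // ltr_pMr ?exprn_gt0 // ltr1n.
Qed.

Lemma sqd_cont c : continuous (sqd c).
Proof. by move=> x; exact: (Ck_cont (sqd_Ck c 0%N openT)). Qed.

Lemma sqd_lt_open c k : open [set y | sqd c y < k].
Proof.
apply: (@open_comp _ _ (sqd c) [set t | t < k]); last exact: open_lt.
by move=> y _; exact: sqd_cont.
Qed.

Lemma sqd_gt_open c k : open [set y | k < sqd c y].
Proof.
apply: (@open_comp _ _ (sqd c) [set t | k < t]); last exact: open_gt.
by move=> y _; exact: sqd_cont.
Qed.

Lemma sqd_le_closed c k : closed [set y | sqd c y <= k].
Proof.
rewrite (_ : [set y | _] = ~` [set y | k < sqd c y]); first exact/open_closedC/sqd_gt_open.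
by apply/seteqP; split => y /=; [move=> h; apply/negP; rewrite -leNgt|move/negP; rewrite -leNgt].
Qed.

Lemma sqd_ge_closed c k : closed [set y | k <= sqd c y].
Proof.
rewrite (_ : [set y | _] = ~` [set y | sqd c y < k]); first exact/open_closedC/sqd_lt_open.
by apply/seteqP; split => y /=; [move=> h; apply/negP; rewrite -leNgt|move/negP; rewrite -leNgt].
Qed.

Lemma sqd_compact c k K : closed K -> (forall y, K y -> sqd c y <= k) -> compact K.
Proof.
move=> cK hK; apply: bounded_closed_compact cK.
exists (`|c| + (k + 1)); split; first exact: num_real.
move=> M hM y Ky; apply: le_trans (ltW hM).
have k0 : 0 <= k by apply: le_trans (hK y Ky); exact: sqd_ge0.
have k1 : 0 < k + 1 by rewrite ltr_wpDl.
rewrite -{1}(subrK c y) addrC; apply: le_trans (ler_normD _ _) _.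
rewrite lerD2l; apply/ltW/(norm_sqd k1); apply: le_lt_trans (hK y Ky) _; nra.
Qed.

(** The contradiction common to both comparison arguments: [a] and [b] are the operator on a
    subsolution and on a strict one, and the last inequality holds at an interior maximum of their
    combination. *)
Lemma subsol_absurd (d k a b : R) : 0 < k -> 0 <= d * a -> 0 < d * b -> d * (a + k * b) <= 0 -> False.
Proof.
move=> k0 a0 b0; rewrite mulrDr mulrCA leNgt => /negP; apply.
by rewrite ltr_wpDl // mulr_gt0.
Qed.

Lemma Ck0_max K U w : K !=set0 -> compact K -> K `<=` U -> Ck 0 U w ->
  exists2 p, K p & forall y, K y -> w y <= w p.
Proof.
move=> K0 cK KU Cw.
have [|p] := @compact_EVT_max _ _ w K K0 cK.
  by apply: continuous_in_subspaceT => x; rewrite inE => /KU; exact: (Ck_cont Cw).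
by rewrite inE => Kp h; exists p => // y Ky; apply: h; rewrite inE.
Qed.

Definition elliptic gm U := forall x, U x -> exists2 f : 'M[R]_6, f \in unitmx & gm x = gam f.

(** [gam f] carries the sign of [\det f]; the factor makes the inequality independent of the
    orientation of the chart. *)
Definition subsol gm U u := forall x f, U x -> f \in unitmx -> gm x = gam f ->
  0 <= \det f * Lop gm u x.

Lemma quad_gam (f : 'M[R]_6) z : f \in unitmx -> \det f * quad (gam f) z = dotv (z *m f^T) (z *m f^T).
Proof.
move=> fU; have B : bilin (V := R^o) (fun u v : E => dotv u z * dotv v z : R^o).
  by split => [v|u]; apply: lin_exp_linear => a p q; rewrite /= dotvD dotvZ /GRing.scale /=; ring.
transitivity (\det f *: (\sum_i \sum_j gam f i j *: (dotv (evec i) z * dotv (evec j) z : R^o))).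
  congr (_ * _); apply: eq_bigr => i _; apply: eq_bigr => j _.
  by rewrite !(dotvC (evec _)) !dotv_evecr.
rewrite (gam_contract fU B); apply: eq_bigr => a _.
have -> : (z *m f^T) 0 a = dotv (row a f) z by rewrite mxE dotvC; apply: eq_bigr => k _; rewrite !mxE.
by [].
Qed.

Lemma quad_gam_gt0 (f : 'M[R]_6) z : f \in unitmx -> z != 0 -> 0 < \det f * quad (gam f) z.
Proof.
move=> fU z0; rewrite quad_gam // lt_def dotv_ge0 andbT dotv_eq0.
apply: contra_neq z0 => e.
by rewrite -[z]mulmx1 -(trK' fU) mulmxA e mul0mx.
Qed.

Section Equation.
Variables (gm : E -> 'M[R]_6) (U : set E).
Hypothesis oU : open U.
Hypothesis Cg : forall i j, Ck 1 U (fun y => gm y i j).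
Hypothesis ell : elliptic gm U.

Lemma quad_Ck c : Ck 0 U (fun y => quad (gm y) (y - c)).
Proof.
have C i : Ck 0 U (fun y : E => (y - c) 0 i).
  apply: (@Ck_affine _ _ _ 0%N U _ (fun v : E => v 0 i)) => //.
    move=> x; apply: (@coord_cont _ _ _ _ (fun y : E => y - c)).
    exact: (cvgB (@cvg_id _ _) (@cvg_cst _ _ _ _ _)).
  by move=> v h y; rewrite !mxE addrA.
do 2!(apply: Ck_sum; [exact: oU|move=> ? _]); apply: (Ck_mul oU); last exact: (Ck_mul oU).
exact: Ck_pred.
Qed.

Lemma drift_Ck c : Ck 0 U (fun x => \sum_i gm x i i + \sum_j drift gm x j * (x - c) 0 j).
Proof.
have C i : Ck 0 U (fun y : E => (y - c) 0 i).
  apply: (@Ck_affine _ _ _ 0%N U _ (fun v : E => v 0 i)) => //.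
    move=> x; apply: (@coord_cont _ _ _ _ (fun y : E => y - c)).
    exact: (cvgB (@cvg_id _ _) (@cvg_cst _ _ _ _ _)).
  by move=> v h y; rewrite !mxE addrA.
apply: (Ck_add oU); first by apply: Ck_sum; [exact: oU|move=> i _]; exact: Ck_pred.
apply: Ck_sum; [exact: oU|move=> j _]; apply: (Ck_mul oU); last exact: C.
by apply: Ck_sum; [exact: oU|move=> i _]; exact: CkD.
Qed.

(* The second order part of [Lop (barrier c q)] grows like [q^2], the rest like [q]. *)
Lemma barrier_subsol c K : compact K -> K `<=` U -> ~ K c -> exists n, forall x f,
  K x -> f \in unitmx -> gm x = gam f -> 0 < \det f * Lop gm (barrier c n.+1) x.
Proof.
move=> cK KU Kc; pose V := U `&` offc c.
have oV : open V by apply: openI => //; exact: offc_open.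
have VU : V `<=` U by move=> x [].
have KV : K `<=` V by move=> x Kx; split; [exact: KU|apply/eqP => e; apply: Kc; rewrite -e].
have q0 x : V x -> quad (gm x) (x - c) != 0.
  move=> [Ux xc]; have [f fU ->] := ell Ux.
  have : 0 < \det f * quad (gam f) (x - c) by apply: quad_gam_gt0; rewrite ?subr_eq0.
  by move/lt0r_neq0; rewrite mulf_eq0 negb_or => /andP[].
(* The bracket in [Lop_barrier] has the right sign once 2 (q + 1) exceeds [psi], whose maximum over
   K is finite. With q = n + 1 this asks for 2 (n + 2). *)
pose psi x := sqd c x * (\sum_i gm x i i + \sum_j drift gm x j * (x - c) 0 j)
              * (quad (gm x) (x - c))^-1.
have Cpsi : Ck 0 V psi.
  apply: (Ck_mul oV); first apply: (Ck_mul oV); first exact: sqd_Ck.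
    exact: Ck_subset VU (drift_Ck c).
  apply: (Ck_inv oV q0); exact: Ck_subset VU (quad_Ck c).
have [K0|K0] := pselect (K !=set0); last first.
  by exists 0%N => x f Kx; case: K0; exists x.
have [p Kp pmax] := Ck0_max K0 cK KV Cpsi.
have [n hn] : exists n : nat, psi p < 2 * n.+2%:R.
  have [n hn] := ltr_add_invr (ltr01 : (0 : R) < 1).
  exists (Num.truncn `|psi p|); apply: le_lt_trans (ler_norm _) _.
  have := truncnS_gt `|psi p|; rewrite -![_.+2%:R]natr1 -![_.+1%:R]natr1.
  have : 0 <= `|psi p| by []. lra.
exists n => x f Kx fU gf.
have [Ux xc] := KV x Kx.
have Vc : ~ V c by move=> [_]; rewrite /offc /= eqxx.
rewrite (Lop_barrier n.+1 oV _ Vc (KV x Kx)); last by move=> i j; exact: Ck_subset VU (Cg i j).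
set S := \sum_i _ + _.
have pq : 0 < \det f * quad (gm x) (x - c) by rewrite gf; apply: quad_gam_gt0; rewrite ?subr_eq0.
have e : sqd c x * S = psi x * quad (gm x) (x - c).
  by rewrite /psi mulfVK // q0 //; exact: KV.
rewrite e -mulrBl.
have b0 : 0 < barrier c n.+3 x by rewrite exprn_gt0 // invr_gt0 sqd_gt0.
have c0 : 0 < 2 * n.+2%:R - psi x.
  by rewrite subr_gt0; apply: le_lt_trans hn; exact: pmax.
rewrite mulrCA; apply: mulr_gt0; first by apply: (mulr_gt0 _ b0); rewrite mulr_gt0 ?ltr0Sn.
by rewrite mulrCA; exact: mulr_gt0.
Qed.

(* Comparison with [u + e * barrier] on an annulus around [c]. *)
Lemma hopf u c M s x0 : (forall y, sqd c y <= s -> U y) -> Ck 2 U u -> subsol gm U u ->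
  (forall y, sqd c y <= s -> u y <= M) -> u c < M -> sqd c x0 < s -> u x0 < M.
Proof.
move=> BU Cu su uM ucM x0s.
have s0 : 0 < s by apply: le_lt_trans x0s; exact: sqd_ge0.
have Uc : U c by apply: BU; rewrite sqd_self ltW.
(* An intermediate level: [u] stays below it near [c], which leaves room M - M' for the barrier on
   the inner sphere. *)
pose M' := (u c + M) / 2; have ucM' : u c < M' by rewrite /M'; lra.
have M'M : M' < M by rewrite /M'; lra.
have [k k0 kP] : exists2 k : R, 0 < k & forall y, sqd c y <= k -> u y <= M'.
  apply: near_sqd; have /cvgrPdist_lt/(_ (M' - u c)) := Ck_cont Cu Uc.
  rewrite subr_gt0 => /(_ ucM'); apply: filterS => y; rewrite distrC => h.
  by have := le_lt_trans (ler_norm _) h; lra.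
have [x0k|x0k] := leP (sqd c x0) k; first by apply: le_lt_trans M'M; exact: kP.
pose K := [set y | k <= sqd c y] `&` [set y | sqd c y <= s].
have KU : K `<=` U by move=> y [_ /BU].
have cK : compact K.
  by apply: (@sqd_compact c s) => [|y []//]; apply: closedI; [exact: sqd_ge_closed|exact: sqd_le_closed].
have Kc : ~ K c by move=> [/=]; rewrite sqd_self leNgt k0.
have [n nP] := barrier_subsol cK KU Kc.
pose h := barrier c n.+1; pose hs := s^-1 ^+ n.+1.
(* On the inner sphere the barrier equals k^-(n+1), so e times it is exactly the room M - M'. *)
pose e := (M - M') * k ^+ n.+1.
have e0 : 0 < e by rewrite mulr_gt0 ?subr_gt0 // exprn_gt0.
pose V := U `&` offc c.
have oV : open V by apply: openI => //; exact: offc_open.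
have VU : V `<=` U by move=> x [].
have Vc : ~ V c by move=> [_]; rewrite /offc /= eqxx.
have KV : K `<=` V by move=> x Kx; split; [exact: KU|apply/eqP => xc; apply: Kc; rewrite -xc].
have Ch : Ck 2 V h by exact: barrier_Ck.
have CuV : Ck 2 V u := Ck_subset VU Cu.
pose w y := u y + e * h y.
have Cw : Ck 2 V w by exact: (Ck_add oV CuV (Ck_scale e oV Ch)).
have K0 : K !=set0 by exists x0; split; exact: ltW.
have [p Kp pmax] := Ck0_max K0 cK KV (Ck_leq (leq0n 2) Cw).
have wp : w p <= M + e * hs.
  rewrite leNgt; apply/negP => wp; have [/= kp ps] := Kp.
  have hs0 : 0 <= e * hs by rewrite mulr_ge0 ?(ltW e0) // exprn_ge0 // invr_ge0 ltW.
  move: kp; rewrite le_eqVlt => /orP[/eqP kp|kp].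
    have : w p <= M.
      rewrite /w /h /barrier -kp /e -mulrA -exprMn divff ?lt0r_neq0 // expr1n mulr1.
      by have := kP p; rewrite -kp lexx => /(_ isT); lra.
    by move: wp; lra.
  move: (ps); rewrite le_eqVlt => /orP[/eqP ps'|ps'].
    have := uM p ps; have : w p = u p + e * hs by rewrite /w /h /barrier ps'.
    by move: wp; lra.
  pose W := [set y | k < sqd c y] `&` [set y | sqd c y < s].
  have oW : open W by apply: openI; [exact: sqd_gt_open|exact: sqd_lt_open].
  have WK : W `<=` K by move=> y [/= a b]; split; exact: ltW.
  have WV : W `<=` V by move=> y /WK/KV.
  have CgW i j : Ck 1 W (fun y => gm y i j) by apply: Ck_subset (Cg i j) => y /WV/VU.
  have Wp : W p by [].
  have [f fU gf] := ell (KU p Kp).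
  have := @Lop_at_max _ gm w W f p oW CgW (Ck_subset WV Cw) Wp fU gf (fun y Wy => pmax y (WK y Wy)).
  rewrite (Lop_add e oW CgW (Ck_subset WV CuV) (Ck_subset WV Ch) Wp).
  exact: subsol_absurd e0 (su p f (KU p Kp) fU gf) (nP p f Kp fU gf).
have wx : w x0 <= M + e * hs by apply: le_trans wp; apply: pmax; split; exact: ltW.
(* The comparison bounds u + e h by M + e hs at [x0]; strictly inside the outer sphere the barrier
   exceeds its value [hs] there, so u < M strictly. *)
have hx : hs < h x0.
  rewrite /hs /h /barrier ltr_pXn2r ?nnegrE ?invr_ge0 ?(ltW s0) ?sqd_ge0 //.
  by rewrite ltf_pV2 // posrE; apply: lt_trans x0k.
have : e * hs < e * h x0 by rewrite ltr_pM2l.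
by move: wx; rewrite /w; lra.
Qed.

(** If u were below M at some y near x0, [hopf] on a ball around y containing x0 would give u < M at
    x0. *)
Lemma strong_max u M x0 : Ck 2 U u -> subsol gm U u -> (forall y, U y -> u y <= M) ->
  U x0 -> u x0 = M -> \forall y \near x0, u y = M.
Proof.
move=> Cu su uM Ux0 ux0.
have [k k0 kU] := near_sqd (near_open oU Ux0).
have nb : \forall y \near x0, sqd x0 y < k / 4.
  apply: (@near_open R E [set y | sqd x0 y < k / 4] x0); first exact: sqd_lt_open.
  by rewrite /= sqd_self divr_gt0.
apply: filterS nb => y yk.
have Uy : U y by apply: kU; apply: le_trans (ltW yk) _; lra.
apply/eqP; rewrite eq_le uM //= leNgt; apply/negP => uyM.
(* By [sqd_double], 2 (k / 4 + k / 4) = k: the ball around y stays in the ball around [x0]. *)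
have BU z : sqd y z <= k / 4 -> U z.
  by move=> h; apply: kU; apply: le_trans (sqd_double x0 y z) _; lra.
have := @hopf u y M (k / 4) x0 BU Cu su (fun z hz => uM z (BU z hz)) uyM.
by rewrite ux0 ltxx sqdC => /(_ yk).
Qed.

End Equation.

(* Since [gm 0 = 1] and 2 < 6 - 2, the function [|x|^(-2)] is a strict
   supersolution near 0, and it dominates [u] there. *)
Lemma sphere_max gm U (C : set E) u : open U -> (forall i j, Ck 1 U (fun y => gm y i j)) ->
  elliptic gm U -> U 0 -> gm 0 = 1%:M ->
  let V := U `&` offc 0 in
  Ck 2 V u -> subsol gm V u ->
  (forall d : R, 0 < d -> exists2 k, 0 < k & forall y, y != 0 -> sqd 0 y <= k -> u y * sqd 0 y <= d) ->
  open C -> C `<=` V -> open (V `\` C) ->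
  exists2 s : R, 0 < s & (forall y, sqd 0 y <= s -> U y) /\
    ((exists2 x, C x & sqd 0 x <= s) ->
     exists2 p, C p & forall x, C x -> sqd 0 x <= s -> u x <= u p).
Proof.
move=> oU Cg ell U0 g0 V Cu su dec oC CV oVC.
have oV : open V by apply: openI => //; exact: offc_open.
have VU : V `<=` U by move=> x [].
have V0 : ~ V 0 by move=> [_]; rewrite /offc /= eqxx.
have CgV i j : Ck 1 V (fun y => gm y i j) := Ck_subset VU (Cg i j).
(* The tolerance has to make the bracket of [Lop_barrier] negative for q = 1: indeed 4 (1 + 36 /
   400) < 6 - 12 / 400. *)
have n1 i j : \forall x \near (0 : E), `|gm x i j - (i == j)%:R| <= 400^-1.
  have /cvgrPdist_le/(_ 400^-1) := Ck_cont (Cg i j) U0.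
  rewrite invr_gt0 ltr0n => /(_ isT); apply: filterS => x.
  by rewrite g0 mxE distrC.
have n2 j : \forall x \near (0 : E), `|drift gm x j * x 0 j| <= 400^-1.
  have Cd : Ck 0 U (fun x => drift gm x j * x 0 j).
    apply: (Ck_mul oU); last exact: Ck_coord.
    by apply: Ck_sum; [exact: oU|move=> i _]; exact: CkD.
  have /cvgrPdist_le/(_ 400^-1) := Ck_cont Cd U0.
  rewrite invr_gt0 ltr0n => /(_ isT); apply: filterS => x.
  by rewrite [(0 : E) 0 j]mxE mulr0 sub0r normrN.
have [s s0 sP] : exists2 s : R, 0 < s & forall y : E, sqd 0 y <= s ->
    [/\ U y, forall i j, `|gm y i j - (i == j)%:R| <= 400^-1 & forall j, `|drift gm y j * y 0 j| <= 400^-1].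
  apply: near_sqd; near=> y; split; first by near: y; exact: (near_open oU U0).
    by near: y; apply: filter_forall => i; apply: filter_forall => j; exact: n1.
  by near: y; apply: filter_forall => j; exact: n2.
exists s => //; split; first by move=> y /sP[].
have Lneg y f : y != 0 -> sqd 0 y <= s -> f \in unitmx -> gm y = gam f ->
    \det f * Lop gm (barrier 0 1) y < 0.
  move=> y0 ys fU gf; have [Uy g1 d1] := sP y ys.
  have Vy : V y by [].
  have tr : \sum_i gm y i i >= 6 - 6 / 400.
    have : \sum_(i < 6) (1 - 400^-1) <= \sum_i gm y i i.
      apply: ler_sum => i _; have := g1 i i; rewrite eqxx -[true%:R]/(1 : R) ler_norml => /andP[]; lra.
    by rewrite sumr_const card_ord -[_ *+ 6]mulr_natl; lra.
  have dr : - (6 / 400) <= \sum_j drift gm y j * (y - 0) 0 j.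
    have : \sum_(i < 6) - 400^-1 <= \sum_j drift gm y j * (y - 0) 0 j.
      apply: ler_sum => j _; rewrite subr0; have := d1 j; rewrite ler_norml => /andP[h _]; exact: h.
    by rewrite sumr_const card_ord -[_ *+ 6]mulr_natl; lra.
  have qd : quad (gm y) (y - 0) <= (1 + 36 / 400) * sqd 0 y.
    have zz (z : E) i j : `|z 0 i * z 0 j| <= dotv z z.
      have a := coord_sqd 0 z i; have b := coord_sqd 0 z j.
      move: a b; rewrite !mxE /sqd !subr0 => a b.
      rewrite ler_norml; apply/andP; split.
        have : 0 <= (z 0 i + z 0 j) ^+ 2 by exact: sqr_ge0.
        by nra.
      have : 0 <= (z 0 i - z 0 j) ^+ 2 by exact: sqr_ge0.
      by nra.
    have -> : quad (gm y) (y - 0) = sqd 0 y +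
        \sum_i \sum_j (gm y i j - (i == j)%:R) * ((y - 0) 0 i * (y - 0) 0 j).
      rewrite /quad /sqd /dotv -big_split; apply: eq_bigr => i _ /=.
      rewrite (bigD1 i) //= [in RHS](bigD1 i) //= eqxx -[true%:R]/(1 : R).
      rewrite (eq_bigr (fun j => (gm y i j - (i == j)%:R) * ((y - 0) 0 i * (y - 0) 0 j))).
        by ring.
      by move=> j /negbTE; rewrite eq_sym => ->; rewrite -[false%:R]/(0 : R) !subr0.
    have : \sum_i \sum_j (gm y i j - (i == j)%:R) * ((y - 0) 0 i * (y - 0) 0 j) <=
        \sum_(i < 6) \sum_(j < 6) 400^-1 * sqd 0 y.
      apply: ler_sum => i _; apply: ler_sum => j _; apply: le_trans (ler_norm _) _.
      by rewrite normrM; apply: ler_pM => //; exact: zz.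
    rewrite !sumr_const !card_ord -mulrnA -[_ *+ _]mulr_natl; lra.
  (* Near 0 the matrix [gm] is close to the identity, so its trace is positive; that trace has the
     sign of [\det f]. *)
  have det0 : 0 < \det f.
    rewrite ltNge; apply/negP => dn.
    have : \det f * \sum_i gm y i i >= 0.
      rewrite gf mulr_sumr; apply: sumr_ge0 => i _.
      rewrite gamE mulrA mulfV ?detf0 // mul1r; apply: sumr_ge0 => a _.
      by rewrite -expr2 sqr_ge0.
    have dn' : \det f < 0 by rewrite lt_neqAle dn andbT detf0.
    by rewrite nmulr_rge0 //; lra.
  rewrite (Lop_barrier 1 oV CgV V0 Vy) pmulr_rlt0 // pmulr_rlt0.
    have ss : 0 < sqd 0 y := sqd_gt0 y0.
    by nra.
  apply: mulr_gt0; first by rewrite mulr_gt0 ?ltr0Sn.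
  by apply: exprn_gt0; rewrite invr_gt0 sqd_gt0.
pose w e y := u y + (- e) * barrier 0 1 y.
have bE y : barrier 0 1 y = (sqd 0 y)^-1 by rewrite /barrier expr1.
(* C is relatively closed in V, and a closed annulus within the small ball lies in V, so their
   intersection is closed in the whole space. *)
have closedA k : 0 < k -> closed ([set y | k <= sqd 0 y] `&` [set y | sqd 0 y <= s] `&` C).
  move=> k0.
  have -> : [set y | k <= sqd 0 y] `&` [set y | sqd 0 y <= s] `&` C =
     [set y | k <= sqd 0 y] `&` [set y | sqd 0 y <= s] `&` ~` (V `\` C).
    apply/seteqP; split => y [[/= a b] h]; do 2?split => //=; first by case.
    apply: contrapT => Cy; apply: h; split => //; split; first by have [] := sP y b.
    apply/eqP => y0; move: a; rewrite y0 sqd_self leNgt k0 //.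
  by apply: closedI; [apply: closedI; [exact: sqd_ge_closed|exact: sqd_le_closed]|exact: open_closedC].
(* Up to e / |x|^2, the value at x is dominated by one on the outer sphere. Letting e tend to 0 is
   done below by one suitable choice of e. *)
have step x e : C x -> sqd 0 x <= s -> 0 < e ->
    exists y, [/\ C y, sqd 0 y = s & u x <= u y + e * (sqd 0 x)^-1].
  move=> Cx xs e0; have [Ux x0] := CV x Cx.
  (* Close to 0 the decay gives u |y|^2 <= e / 2, so [w e] is at most - e / (2 |y|^2). It falls
     below [w e x], and the maximum of [w e] avoids a neighbourhood of the singularity. *)
  have [k k0 kP] : exists2 k, 0 < k & forall y, y != 0 -> sqd 0 y <= k -> w e y < w e x.
    have [k1 k10 k1P] := dec (e / 2) (divr_gt0 e0 (ltr0Sn _ _)).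
    pose B := `|w e x| + 1; have B0 : 0 < B by rewrite ltr_wpDl.
    exists (Num.min k1 (e / (2 * B) / 2)); first by rewrite lt_min k10 !divr_gt0 // mulr_gt0.
    move=> y y0; rewrite le_min => /andP[yk yB]; have sy : 0 < sqd 0 y := sqd_gt0 y0.
    have h := k1P y y0 yk.
    have h2 : w e y * sqd 0 y <= - (e / 2).
      rewrite /w mulrDl bE -mulrA mulVf ?lt0r_neq0 // mulr1; lra.
    have h3 : sqd 0 y * (2 * B) < e.
      rewrite -ltr_pdivlMr ?mulr_gt0 //; apply: le_lt_trans yB _.
      by rewrite ltr_pdivrMr // ltr_pMr ?divr_gt0 ?mulr_gt0 // ltr1n.
    have h4 : - B < w e x by have := lerNnormlW (lexx `|w e x|); rewrite /B; lra.
    apply: lt_trans h4; rewrite -(ltr_pM2r sy); apply: le_lt_trans h2 _; lra.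
  pose K := [set y | k <= sqd 0 y] `&` [set y | sqd 0 y <= s] `&` C.
  have cK : compact K by apply: (@sqd_compact 0 s); [exact: closedA|move=> y [[]]].
  have KV : K `<=` V by move=> y [_ /CV].
  have Kx : K x.
    split => //; split => //=; rewrite leNgt; apply/negP => xk.
    by have := kP x x0 (ltW xk); rewrite ltxx.
  have Cb : Ck 2 V (barrier 0 1) by exact: barrier_Ck.
  have Cw : Ck 2 V (w e) by exact: (Ck_add oV Cu (Ck_scale (- e) oV Cb)).
  have [p Kp pmax] := Ck0_max (ex_intro _ x Kx) cK KV (Ck_leq (leq0n 2) Cw).
  have [[/= kp ps] Cp] := Kp; have [Up p0] := CV p Cp.
  have wxp := pmax x Kx.
  have kp' : k < sqd 0 p.
    rewrite lt_neqAle kp andbT; apply/eqP => kpe.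
    by have := kP p p0; rewrite -kpe lexx => /(_ isT); move: wxp; lra.
  exists p; split => //; last first.
    move: wxp; rewrite /w !bE.
    have : 0 <= e * (sqd 0 p)^-1 by rewrite mulr_ge0 ?(ltW e0) // invr_ge0 sqd_ge0.
    by lra.
  apply/eqP; rewrite eq_le ps /= leNgt; apply/negP => ps'.
  pose W := [set y | k < sqd 0 y] `&` [set y | sqd 0 y < s] `&` C.
  have oW : open W by apply: openI => //; apply: openI; [exact: sqd_gt_open|exact: sqd_lt_open].
  have WK : W `<=` K by move=> y [[/= a b] ?]; split => //; split; exact: ltW.
  have WV : W `<=` V by move=> y /WK/KV.
  have CgW i j : Ck 1 W (fun y => gm y i j) := Ck_subset WV (CgV i j).
  have Wp : W p by [].
  have [f fU gf] := ell p Up.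
  have := @Lop_at_max _ gm (w e) W f p oW CgW (Ck_subset WV Cw) Wp fU gf (fun y Wy => pmax y (WK y Wy)).
  rewrite (Lop_add (- e) oW CgW (Ck_subset WV Cu) (Ck_subset WV Cb) Wp).
  rewrite mulNr -mulrN; apply: (subsol_absurd e0 (su p f (CV p Cp) fU gf)).
  by rewrite mulrN oppr_gt0; exact: Lneg.
pose K := [set y | s <= sqd 0 y] `&` [set y | sqd 0 y <= s] `&` C.
have cK : compact K by apply: (@sqd_compact 0 s); [exact: closedA|move=> y [[]]].
have KV : K `<=` V by move=> y [_ /CV].
move=> [x1 Cx1 xs1]; have K0 : K !=set0.
  have [y [Cy ys _]] := step x1 1 Cx1 xs1 ltr01.
  by exists y; split => //; split => /=; rewrite ys.
have [p Kp pmax] := Ck0_max K0 cK KV (Ck_leq (leq0n 2) Cu).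
have [_ Cp] := Kp.
exists p => // x Cx xs; rewrite leNgt; apply/negP => up.
have sx : 0 < sqd 0 x by have [_ /sqd_gt0] := CV x Cx.
(* With this e the error in [step] is half of the supposed gap between [u x] and [u p]. *)
pose e := (u x - u p) * sqd 0 x / 2.
have e0 : 0 < e by rewrite divr_gt0 // mulr_gt0 // subr_gt0.
have [y [Cy ys]] := step x e Cx xs e0.
have Ky : K y by split => //; split => /=; rewrite ys.
have := pmax y Ky.
have -> : e * (sqd 0 x)^-1 = (u x - u p) / 2.
  by rewrite /e mulrAC mulfK // lt0r_neq0.
by lra.
Unshelve. all: by end_near. Qed.

End MaxPrinciple.

(** * Subharmonicity of the norm of a section *)

Section FlatPoint.
Context {R : realType} {Z : Type} (sg : su3 R Z) (A : set (chart R 6 Z)).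
Hypothesis sgS : su3_structure sg A.
Local Notation E := 'rV[R]_6.

(** [Gm] is built from omega and Omega without a frame, so any SU(3)-frame at the point computes it,
    for instance the identity at the centre of SU(3)-coordinates. *)
Lemma Gm_su3_frame c x f : admissible A c -> cdom c x -> su3_frame sg c x f -> Gm sg c x = gam f.
Proof.
move=> cA Ux [fU Hom HO].
have J := Jmx_gram fU HO (is_form_trilin (re_form sgS cA Ux)).
have o : (\matrix_(i, j) omtc (Wc sg c) i j x) = omt f.
  by apply/matrixP => i j; rewrite mxE (omtE fU Hom).
by rewrite /Gm o gam_omt // J mulmxN opprK.
Qed.

Lemma Gm_flat c z : su3_coordinates (A := A) sg c z -> Gm sg c 0 = 1%:M.
Proof.
move=> [cA [[r r0 cE] [_ [fom fOm]]]].
have U0 : cdom c 0 by rewrite cE /= /enorm /dotv big1 ?sqrtr0 // => i _; rewrite mxE mul0r.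
have mx1 k (v : 'I_k -> E) : (fun i => v i *m 1%:M) = v by apply/funext => i; rewrite mulmx1.
rewrite (@Gm_su3_frame c 0 1%:M cA U0); last first.
  by split => [|v|v]; [exact: unitmx1|rewrite mx1|rewrite mx1].
by rewrite /gam det1 invr1 scale1r trmx1 mulmx1.
Qed.

(** The charts of [cone_gauge] are restrictions of the chart of a framing. The transition map is the
    identity, so one frame serves both charts. *)
Lemma Gm_subchart c d x : admissible A c -> admissible A d -> cpar d = cpar c ->
  cdom d `<=` cdom c -> cdom d x -> Gm sg d x = Gm sg c x.
Proof.
move=> cA dA cd dc dx; have cx := dc x dx; have [oc ck _ _] := cA; have [od _ _ _] := dA.
have T k (V : normedModType R) (al : chart R 6 Z -> E -> kform k E V) v : is_dform A al ->
    al d x v = al c x v.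
  move=> [_ _ /(_ d c x v dA cA)]; rewrite /overlap /= cd.
  have cx' : cimg c (cpar c x) by exists x.
  move=> /(_ (conj dx cx')) ->; rewrite /pullf /ctrans cd ck //; congr (al c x _).
  apply/funext => i.
  have e : {in cdom d, (fun y => ccoo c (cpar c y)) =1 id}.
    by move=> y; rewrite inE => /dc; exact: ck.
  by apply: etrans (eq_derive (v i) od e dx) _; exact: derive_id.
have [fu fo fO] := frame_spec sgS cA cx.
have [dom dre dim _] := sgS.
rewrite (Gm_su3_frame cA cx (And3 fu fo fO)); apply: Gm_su3_frame => //; split => // v.
  by rewrite T.
rewrite -fO.
have := T 3%N _ _ (fun i => v i *m frame sg c x) dre.
have := T 3%N _ _ (fun i => v i *m frame sg c x) dim.
rewrite /reform /imform; case: (Om sg d x _) => p q; case: (Om sg c x _) => p' q' /= -> ->.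
by [].
Qed.

Lemma Gm_elliptic c : admissible A c -> elliptic (Gm sg c) (cdom c).
Proof.
move=> cA x Ux; exists (frame sg c x); last exact: (Gm_frame sgS cA Ux).
by have [] := frame_spec sgS cA Ux.
Qed.

End FlatPoint.

Section LopLocal.
Context {R : realType}.
Local Notation E := 'rV[R]_6.

Lemma Lop_eq (gm gm' : E -> 'M[R]_6) (u u' : E -> R) W x : open W -> W x ->
  (forall y, W y -> gm y = gm' y) -> (forall y, W y -> u y = u' y) -> Lop gm u x = Lop gm' u' x.
Proof.
move=> oW Wx gg uu; apply: eq_bigr => i _; apply: (eq_derive _ oW _ Wx) => y; rewrite inE => Wy.
apply: eq_bigr => j _; rewrite gg //; congr (_ * _).
by apply: (eq_derive _ oW _ Wy) => z; rewrite inE; exact: uu.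
Qed.

Lemma Lop_const (gm : E -> 'M[R]_6) (u : E -> R) (M : R) W x : open W -> W x ->
  (forall y, W y -> u y = M) -> Lop gm u x = 0.
Proof.
move=> oW Wx uM; apply: big1 => i _.
apply: etrans (eq_derive _ oW (g := fun=> 0) _ Wx) _; last exact: derive_cst.
move=> y; rewrite inE => Wy; apply: big1 => j _.
have e : 'D_(evec j) u y = 0; last by rewrite e mulr0.
apply: etrans (eq_derive _ oW (g := fun=> M) _ Wy) _; last exact: derive_cst.
by move=> z; rewrite inE; exact: uM.
Qed.

End LopLocal.

Section NormSquared.
Context {R : realType} {m : nat} {G : lieGroup R m} {Z : Type}.
Context {A : set (chart R 6 Z)} {X : set Z} (P : pbundle G A X).
Local Notation E := 'rV[R]_6.
Local Notation V := 'rV[R]_m.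
Variables (sg : su3 R Z) (ip : lie G -> lie G -> R).
Hypothesis sgS : su3_structure sg A.
Hypothesis ipP : Ad_inner_product ip.
Variables (B : gfield P 1) (xi : gfield P 0).
Hypothesis sB : smooth_gfield B.
Hypothesis sxi : adform xi.

Definition lap_identity := forall b x, adm_gauge b -> cdom (gch b) x ->
  Lop (Gm sg (gch b)) (nsq b ip xi) x = 2 * \sum_i \sum_j Gm sg (gch b) x i j *
     ip (dcov B xi b x (fun=> evec i)) (dcov B xi b x (fun=> evec j)).

Lemma nsq_Ck b k : adm_gauge b -> Ck k (cdom (gch b)) (nsq b ip xi).
Proof.
move=> bA; have s := sec_smooth bA sxi.1.
exact: (Ck_bilin (ip_bilinear ipP) (gauge_open bA) (s k) (s k)).
Qed.

Lemma nsq_inv b b' x : adm_gauge b -> adm_gauge b' -> overlap (gch b') (gch b) x ->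
  nsq b' ip xi x = nsq b ip xi (ctrans (gch b') (gch b) x).
Proof.
move=> bA b'A ov; rewrite /nsq /sec; have [_ h] := sxi.
rewrite (h b b' x (fun=> 0) bA b'A ov) /pullf.
have [_ _ _ ->] := ipP; congr (ip (xi b _ _) (xi b _ _)); exact: fun_ord0.
Qed.

Hypothesis lap : lap_identity.

Lemma lap_rows b x f : adm_gauge b -> cdom (gch b) x -> f \in unitmx ->
  Gm sg (gch b) x = gam f -> \det f * Lop (Gm sg (gch b)) (nsq b ip xi) x =
  2 * \sum_a ip (dcov B xi b x (fun=> row a f)) (dcov B xi b x (fun=> row a f)).
Proof.
move=> bA Ux fU gf; rewrite lap // mulrCA; congr (_ * _); rewrite gf.
have [i1 i2] := ip_bilinear ipP.
have bl : bilin (V := R^o) (fun u v => ip (dcov B xi b x (fun=> u)) (dcov B xi b x (fun=> v)) : R^o).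
  split => [v|u]; apply: lin_exp_linear => a p q; rewrite (dcov_lin bA sB sxi.1 _ _ _ Ux).
    exact: i1.
  exact: i2.
exact: (gam_contract fU bl).
Qed.

Lemma subsol_gauge b : adm_gauge b -> subsol (Gm sg (gch b)) (cdom (gch b)) (nsq b ip xi).
Proof.
move=> bA x f Ux fU gf; rewrite lap_rows // mulr_ge0 //; apply: sumr_ge0 => a _.
exact: ip_ge0.
Qed.

(** The operator kills constants, so by [lap_rows] the sum of the squared covariant derivatives
    along the frame vectors is zero. *)
Lemma nsq_const_dcov0 b M W x : adm_gauge b -> open W -> W `<=` cdom (gch b) -> W x ->
  (forall y, W y -> nsq b ip xi y = M) -> forall v, dcov B xi b x v = 0.
Proof.
move=> bA oW WU Wx uM; have Ux := WU x Wx.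
have [f fU gf] := Gm_elliptic sgS (gauge_adm bA) Ux.
have := lap_rows bA Ux fU gf; rewrite (Lop_const _ oW Wx uM) mulr0 => /esym/eqP.
rewrite mulf_eq0 pnatr_eq0 /= psumr_eq0 => [/allP h|a _]; last exact: ip_ge0.
have D a : dcov B xi b x (fun=> row a f) = 0.
  by apply: (ip_eq0 ipP); apply/eqP; apply: h; rewrite mem_index_enum.
have hl : forall a u w, dcov B xi b x (fun=> (a *: u + w) *m f) =
    a *: (dcov B xi b x (fun=> u *m f) : V) + dcov B xi b x (fun=> w *m f).
  by move=> a u w; rewrite -(dcov_lin bA sB sxi.1 _ _ _ Ux) mulmxDl -scalemxAl.
move=> v; rewrite (fun_ord1 v) -[v ord0](mulmxKV fU).
have e := linear_expand hl (v ord0 *m invmx f).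
apply: etrans e _; apply: big1 => j _.
by rewrite /evec -rowE D scaler0.
Qed.

End NormSquared.

(** * Topology of charts and relatively clopen sets *)

Section ChartTopology.
Context {R : realType} {n : nat} {T : topologicalType} (A : set (chart R n T)).
Hypothesis AT : is_manifold A.
Variable c : chart R n T.
Hypothesis cA : admissible A c.

Lemma cpar_preim (V : set T) : open V -> open (cdom c `&` cpar c @^-1` V).
Proof.
move=> oV; have [_ cov top _ _] := AT; have [oc ck _ ad] := cA.
apply: open_local => x [cx Vx].
have [d Ad dx] : (\bigcup_(d in A) cimg d) (cpar c x) by rewrite cov.
have [[oo ss] _] := ad d Ad; have [atl _ _ _ _] := AT; have dA := atl d Ad.
pose Q := cdom d `&` cpar d @^-1` V.
exists (overlap c d `&` ctrans c d @^-1` Q); split.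
- apply: open_preim => //; last by have /top := oV; exact.
  by move=> y oy; exact: (Ck_cont (ss 0%N)).
- by split; [split|have [h1 h2] := adm_ccoo dA dx; split => //=; rewrite /ctrans h2].
move=> y [[cy dy] [_ /= Vy]]; split => //=.
by move: Vy; rewrite /ctrans; have [_ ->] := adm_ccoo dA dy.
Qed.

Lemma cpar_open (W : set 'rV[R]_n) : open W -> W `<=` cdom c -> open (cpar c @` W).
Proof.
move=> oW Wc; have [_ _ top _ _] := AT; have [oc ck _ ad] := cA.
apply/top => d Ad; have [_ [oo ss]] := ad d Ad.
rewrite (_ : _ `&` _ = overlap d c `&` ctrans d c @^-1` W).
  by apply: open_preim => // y oy; exact: (Ck_cont (ss 0%N)).
apply/seteqP; split => y [].
  by move=> dy [x Wx e]; split; [split => //; exists x => //; exact: Wc|rewrite /= /ctrans -e ck //; exact: Wc].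
move=> [dy [x cx e]] /=; rewrite /ctrans -e ck // => Wx; split => //=.
by exists x.
Qed.

(* The segments of a chart ball are connected. *)
Lemma chart_ball_clopen (X : set T) x0 : cimg c `<=` X -> cdom c x0 ->
  exists N : set T, [/\ open N, N (cpar c x0), N `<=` X &
    forall D : set T, D `<=` X -> open D -> open (X `\` D) ->
      forall z z', N z -> N z' -> D z -> D z'].
Proof.
move=> cX cx0; have [oc _ _ _] := cA.
have /nbhs_ballP[e /= e0 eU] := open_nbhs_nbhs (conj oc cx0).
pose Bl := [set x : 'rV[R]_n | `|x0 - x| < e].
have oB : open Bl.
  rewrite (_ : Bl = ball x0 e); first exact: ball_open.
  by rewrite -ball_normE.
have BU : Bl `<=` cdom c by move=> x h; apply: eU; rewrite -ball_normE.
exists (cpar c @` Bl); split; first exact: cpar_open.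
- by exists x0 => //; rewrite /Bl /= subrr normr0.
- by move=> _ [x /BU cx <-]; apply: cX; exists x.
move=> D DX oD oXD _ _ [x Bx <-] [y By <-] Dx.
pose phi (t : R) : 'rV[R]_n := x + t *: (y - x).
have cphi : continuous phi.
  move=> t; apply: (@cvgD _ _ _ _ _ (fun=> x) (fun t => t *: (y - x))); first exact: cvg_cst.
  by apply: (@cvgZ _ _ _ _ _ (fun t : R => t) (fun=> y - x)); [exact: cvg_id|exact: cvg_cst].
have Bphi t : t \in `[0, 1] -> Bl (phi t).
  rewrite in_itv /= => /andP[t0 t1].
  rewrite /Bl /= (_ : x0 - phi t = (1 - t) *: (x0 - x) + t *: (x0 - y)); last first.
    by apply/rowP => i; rewrite !mxE; ring.
  apply: le_lt_trans (ler_normD _ _) _; rewrite !normrZ (ger0_norm t0) ger0_norm ?subr_ge0 //.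
  have /= bx := Bx; have /= by' := By.
  have [->|t00] := eqVneq t 0; first by rewrite subr0 mul1r mul0r addr0.
  have tp : 0 < t by rewrite lt_def t00.
  have : t * `|x0 - y| < t * e by rewrite ltr_pM2l.
  have : (1 - t) * `|x0 - x| <= (1 - t) * e by rewrite ler_wpM2l ?subr_ge0 // ltW.
  lra.
have op Q : open Q -> open [set t | Bl (phi t) /\ Q (cpar c (phi t))].
  move=> oQ; rewrite (_ : [set t | _] = phi @^-1` (Bl `&` (cdom c `&` cpar c @^-1` Q))).
    by apply: open_comp; [move=> t _; exact: cphi|apply: openI => //; exact: cpar_preim].
  by apply/seteqP; split => t /= [a]; [move=> b; do 2!split => //; exact: BU|case].
(* The parameters lying in D are open and closed in [0, 1]; closedness comes from the openness of X
   \ D. *)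
pose Tt := [set t : R | t \in `[0, 1] /\ D (cpar c (phi t))].
have : Tt = [set` `[0, 1]].
  apply: (@segment_connected R 0 1).
  - by exists 0; rewrite /Tt /= in_itv /= lexx ler01 /phi scale0r addr0.
  - exists [set t | Bl (phi t) /\ D (cpar c (phi t))]; first exact: op.
    apply/seteqP; split => t /= [a b]; split => //; last by case: b.
    by split => //; exact: Bphi.
  exists (~` [set t | Bl (phi t) /\ (X `\` D) (cpar c (phi t))]).
    by apply: open_closedC; exact: op.
  apply/seteqP; split => t /= [a b]; split => //; first by move=> [_ []].
  apply: contrapT => nD; apply: b; split; first exact: Bphi.
  by split => //; apply: cX; exists (phi t) => //; apply: BU; exact: Bphi.
move/seteqP => [_ /(_ 1)]; rewrite /= in_itv /= ler01 lexx => /(_ isT)[_].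
by rewrite /phi scale1r addrC subrK.
Qed.

End ChartTopology.

Lemma pgauges_adm_gauge (R : realType) (m : nat) (G : lieGroup R m) (n : nat) (T : Type)
    (A : set (chart R n T)) (X : set T) (P : pbundle G A X) b : pgauges P b -> adm_gauge b.
Proof.
move=> pb; split; first exact: (pgauges_adm pb).
  by move=> x; exact: (pgauges_sec pb).
by move=> b' pb'; split; exact: pgauges_smooth.
Qed.

(** * The maximum over a quasi-component *)

Section Global.
Context {R : realType} {m : nat} {G : lieGroup R m} {Z : topologicalType}.
Context {A : set (chart R 6 Z)} {X : set Z} (P : pbundle G A X).
Local Notation E := 'rV[R]_6.
Hypothesis AZ : is_manifold A.
Hypothesis Zc : compact [set: Z].
Variables (sg : su3 R Z) (ip : lie G -> lie G -> R).
Hypothesis sgS : su3_structure sg A.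
Hypothesis ipP : Ad_inner_product ip.
Variables (B : gfield P 1) (xi : gfield P 0).
Hypothesis sB : smooth_gfield B.
Hypothesis sxi : adform xi.
Hypothesis lap : lap_identity sg ip B xi.

Lemma gauge_at z : X z -> exists b x, [/\ adm_gauge (P := P) b, cdom (gch b) x & cpar (gch b) x = z].
Proof.
move=> /(pgauges_cover P)[b pb [x cx <-]]; exists b, x; split => //.
exact: pgauges_adm_gauge.
Qed.

Lemma gauge_in b : adm_gauge (P := P) b -> cimg (gch b) `<=` X.
Proof. by move=> [_ s _] _ [x cx <-]; rewrite -s //; exact: pproj_in. Qed.

(* |xi|^2 at z, in any gauge around z; [xget] finds a value by [unormE]. *)
Definition unorm (z : Z) : R := xget 0 [set t | exists b x,
  [/\ adm_gauge (P := P) b, cdom (gch b) x, cpar (gch b) x = z & t = nsq b ip xi x]].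

Lemma unormE b x : adm_gauge (P := P) b -> cdom (gch b) x -> unorm (cpar (gch b) x) = nsq b ip xi x.
Proof.
move=> bA cx; rewrite /unorm; set Q := [set t | _].
have : Q (xget 0 Q) by apply: xgetPex; exists (nsq b ip xi x), b, x.
move=> [b' [x' [b'A cx' e ->]]].
have ov : overlap (gch b) (gch b') x by split => //; exists x'.
rewrite (nsq_inv ipP sxi b'A bA ov) /ctrans -e.
by have [[_ ck _ _] _ _] := b'A; rewrite ck.
Qed.

Lemma unorm_open (Q : set R) : open Q -> open [set z | X z /\ Q (unorm z)].
Proof.
move=> oQ; apply: open_local => z [Xz Qz]; have [b [x [bA cx e]]] := gauge_at Xz.
pose W := cdom (gch b) `&` nsq b ip xi @^-1` Q.
have WU : W `<=` cdom (gch b) by move=> y [].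
exists (cpar (gch b) @` W); split.
- apply: (cpar_open AZ (gauge_adm bA)) => //; apply: open_preim => //; first exact: gauge_open.
  by move=> y cy; exact: (Ck_cont (nsq_Ck ipP sxi 0%N bA)).
- by exists x => //; split => //=; rewrite -unormE // e.
move=> _ [y [cy Qy] <-]; split; first by apply: (gauge_in bA); exists y.
by rewrite unormE.
Qed.

Definition clopenX (D : set Z) := [/\ D `<=` X, open D & open (X `\` D)].

(** Near a point outside X, the values on a relatively clopen set are bounded by an attained one.
    [singular_max] supplies this at the singular points. *)
Hypothesis sing : forall s, ~ X s -> forall C, clopenX C ->
  exists N : set Z, [/\ open N, N s & (exists2 z, C z & N z) ->
    exists2 p, C p & forall z, C z -> N z -> unorm z <= unorm p].

Section QuasiComponent.
Variable z0 : Z.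
Hypothesis Xz0 : X z0.

(* The quasi-component of [z0] in [X]; it is open because [X] is locally connected. *)
Definition qcomp : set Z := [set z | X z /\ forall D, clopenX D -> D z0 -> D z].

Lemma chart_nbhd z : X z -> exists N : set Z, [/\ open N, N z, N `<=` X &
    forall D, clopenX D -> forall z1 z2, N z1 -> N z2 -> D z1 -> D z2].
Proof.
move=> Xz; have [b [x [bA cx e]]] := gauge_at Xz.
have [N [oN Nx NX h]] := chart_ball_clopen AZ (gauge_adm bA) (gauge_in bA) cx.
by exists N; split => //; [rewrite -e|move=> D [? ? ?]; exact: h].
Qed.

Lemma qcomp_clopen : clopenX qcomp.
Proof.
split; first by move=> z [].
  apply: open_local => z [Xz h]; have [N [oN Nz NX Nh]] := chart_nbhd Xz.
  exists N; split => // y Ny; split; first exact: NX.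
  by move=> D cD Dz0; apply: (Nh D cD z) => //; exact: h.
apply: open_local => z [Xz nC].
have [D [cD Dz0 Dz]] : exists D, [/\ clopenX D, D z0 & ~ D z].
  apply: contrapT => h; apply: nC; split => // D cD Dz0.
  by apply: contrapT => Dz; apply: h; exists D.
have [_ _ oXD] := cD; exists (X `\` D); split => // y [Xy Dy]; split => //.
by move=> [_ /(_ D cD Dz0)].
Qed.

(** The superlevel sets in the quasi-component generate a filter, which clusters at some p by
    compactness of Z. If p is in X, continuity makes it a maximum point. Otherwise [sing] bounds the
    values near p by that at some q, and every superlevel set meets this neighbourhood. *)
Lemma unorm_max : exists2 p, qcomp p & forall z, qcomp z -> unorm z <= unorm p.
Proof.
have [CX oC oXC] := qcomp_clopen.
pose Fl : set_system Z := filter_from qcomp (fun z => [set y | qcomp y /\ unorm z <= unorm y]).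
have Cz0 : qcomp z0 by split.
have PF : ProperFilter Fl.
  apply: filter_from_proper; last by move=> z Cz; exists z.
  apply: filter_from_filter; first by exists z0.
  move=> z1 z2 C1 C2; have [h|h] := leP (unorm z1) (unorm z2).
    by exists z2 => // y [Cy uy]; split; split => //; exact: le_trans uy.
  by exists z1 => // y [Cy uy]; split; split => //; apply: le_trans uy; exact: ltW.
have [p [_ clp]] := Zc PF filterT.
have clP z N : qcomp z -> open N -> N p -> exists y, [/\ qcomp y, N y & unorm z <= unorm y].
  move=> Cz oN Np.
  have Fz : Fl [set y | qcomp y /\ unorm z <= unorm y] by exists z.
  have [y [[Cy uy] Ny]] := clp _ N Fz (open_nbhs_nbhs (conj oN Np)).
  by exists y.
have [Xp|Xp] := pselect (X p).
  have Cp : qcomp p.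
    apply: contrapT => nC; have [y [Cy [_ nCy] _]] := clP z0 _ Cz0 oXC (conj Xp nC).
    exact: nCy.
  exists p => // z Cz; rewrite leNgt; apply/negP => up.
  have [y [Cy [_ /= uy] uzy]] := clP z _ Cz (unorm_open (open_lt (y := unorm z))) (conj Xp up).
  by move: uzy; rewrite leNgt uy.
have [N [oN Np h]] := sing Xp qcomp_clopen.
have [y [Cy Ny _]] := clP z0 N Cz0 oN Np.
have [q Cq qmax] := h (ex_intro2 _ _ y Cy Ny).
exists q => // z Cz; have [y' [Cy' Ny' uy']] := clP z N Cz oN Np.
exact: le_trans uy' (qmax y' Cy' Ny').
Qed.

(** The set where the maximum is attained is open by [strong_max] and relatively closed by
    continuity, and a quasi-component cannot be split by such a set. *)
Lemma unorm_const : exists M N, [/\ open N, N z0, N `<=` X & forall z, N z -> unorm z = M].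
Proof.
have cC := qcomp_clopen; have [CX oC oXC] := cC.
have [p Cp pmax] := unorm_max; pose M := unorm p.
pose D := [set z | qcomp z /\ unorm z = M].
have oD : open D.
  apply: open_local => z [Cz uz]; have [b [x [bA cx e]]] := gauge_at (CX z Cz).
  have bA' := gauge_adm bA.
  pose U := cdom (gch b) `&` cpar (gch b) @^-1` qcomp.
  have oU : open U by exact: (cpar_preim AZ bA').
  have UU : U `<=` cdom (gch b) by move=> y [].
  have Ux : U x by split => //=; rewrite e.
  have Cg i j : Ck 1 U (fun y => Gm sg (gch b) y i j).
    exact: (Ck_subset UU (Gm_Ck sgS bA' 1%N i j)).
  have ell : elliptic (Gm sg (gch b)) U by move=> y /UU; exact: (Gm_elliptic sgS bA').
  have sub : subsol (Gm sg (gch b)) U (nsq b ip xi).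
    by move=> y f /UU; exact: (subsol_gauge ipP sB sxi lap bA).
  have uM y : U y -> nsq b ip xi y <= M.
    by move=> [cy Cy]; rewrite -unormE //; exact: pmax.
  have ux : nsq b ip xi x = M by rewrite -unormE // e.
  have nM : nbhs x [set y | nsq b ip xi y = M] := strong_max oU Cg ell (Ck_subset UU (nsq_Ck ipP sxi 2 bA)) sub uM Ux ux.
  move: nM; rewrite nbhsE => -[W [oW Wx] WM].
  have WU : W `&` U `<=` cdom (gch b) by move=> y [_ /UU].
  exists (cpar (gch b) @` (W `&` U)); split.
  - by apply: (cpar_open AZ bA') => //; exact: openI.
  - by exists x.
  by move=> _ [y [Wy [cy Cy]] <-]; split => //; rewrite unormE //; exact: WM.
have oCD : open (qcomp `\` D).
  rewrite (_ : qcomp `\` D = qcomp `&` [set z | X z /\ [set t | t != M] (unorm z)]).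
    by apply: openI => //; apply: unorm_open; exact: open_neq.
  apply/seteqP; split => z [Cz]; last by move=> [_ /eqP h]; split => // -[].
  by move=> h; split => //; split; [exact: CX|apply/eqP => uz; apply: h].
(* Otherwise the rest of the quasi-component is relatively clopen and contains [z0], hence contains
   the maximum point p, which lies in [D]. *)
have Dz0 : D z0.
  apply: contrapT => nD.
  have cCD : clopenX (qcomp `\` D).
    split => //; first by move=> z [/CX].
    rewrite (_ : X `\` _ = (X `\` qcomp) `|` D); first exact: openU.
    apply/seteqP; split => z.
      move=> [Xz h]; have [Cz|Cz] := pselect (qcomp z); last by left.
      by right; apply: contrapT => nDz; apply: h.
    by move=> [[Xz Cz]|Dz]; [split => // -[]|split => [|[]//]; case: Dz => /CX].
  have Cz0 : qcomp z0 by split.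
  by have [_ /(_ _ cCD (conj Cz0 nD))[_]] := Cp; apply.
by exists M, D; split => // z [] // /CX.
Qed.

End QuasiComponent.

Lemma dcov_gzero : gzero (dcov B xi).
Proof.
move=> b x v bA cx.
have Xx : X (cpar (gch b) x) by apply: (gauge_in bA); exists x.
have [M [N [oN Nx NX uM]]] := unorm_const Xx.
have oW := cpar_preim AZ (gauge_adm bA) oN.
apply: (nsq_const_dcov0 (M := M) sgS ipP sB sxi lap bA oW).
- by move=> y [].
- by split.
by move=> y [cy Ny]; rewrite -unormE //; exact: uM.
Qed.

End Global.

(** * Behaviour near a singular point *)

Section Singular.
Context {R : realType} {m : nat} {G : lieGroup R m} {Z : topologicalType}.
Context {A : set (chart R 6 Z)} {X : set Z} (P : pbundle G A X).
Local Notation E := 'rV[R]_6.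
Hypothesis AZ : is_manifold A.
Variables (sg : su3 R Z) (ip : lie G -> lie G -> R).
Hypothesis sgS : su3_structure sg A.
Hypothesis ipP : Ad_inner_product ip.
Variables (B : gfield P 1) (xi : gfield P 0).
Hypothesis sB : smooth_gfield B.
Hypothesis sxi : adform xi.
Hypothesis lap : lap_identity sg ip B xi.
Variables (Ps : pbundle G (S5_atlas R) (S5 R)) (Phi : framing Ps P) (s : Z).
Hypothesis Phi_iso : bundle_iso Phi.
Local Notation c := (frch Phi).

Lemma enorm_sqr n (x : 'rV[R]_n) : enorm x ^+ 2 = dotv x x.
Proof. by rewrite /enorm sqr_sqrtr // dotv_ge0. Qed.

Lemma enorm_ge0 n (x : 'rV[R]_n) : 0 <= enorm x.
Proof. exact: sqrtr_ge0. Qed.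

Lemma enorm_gt0 n (x : 'rV[R]_n) : (0 < enorm x) = (x != 0).
Proof. by rewrite sqrtr_gt0 lt_def dotv_ge0 andbT dotv_eq0. Qed.

Lemma radproj_S5 (x : E) : x != 0 -> S5 R (radproj x).
Proof.
move=> x0; have n0 : 0 < enorm x by rewrite enorm_gt0.
rewrite /S5 /= /radproj {1}/enorm dotvZ dotvC dotvZ -enorm_sqr.
rewrite (_ : _ * _ = 1) ?sqrtr1 //; field; exact: lt0r_neq0.
Qed.

Lemma cone_gauge_at (x : E) : cdom c x -> x != 0 -> exists b : gauge R 5 'rV[R]_6 Ps,
  [/\ adm_gauge b, cimg (gch b) (radproj x) & adm_gauge (cone_gauge Phi b)].
Proof.
move=> cx x0; have [b pb bx] := pgauges_cover Ps (radproj_S5 x0).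
have bA := pgauges_adm_gauge pb; exists b; split => //.
by have [_ h] := Phi_iso; exact: h.
Qed.

Lemma tnorm0E (al : kform 0 E (lie G)) w : tnorm ip al = Num.sqrt (ip (al w) (al w)).
Proof.
rewrite /tnorm; congr Num.sqrt.
rewrite (eq_bigr (fun=> ip (al w) (al w))); last by move=> I _; congr (ip (al _) (al _)); exact: fun_ord0.
by rewrite sumr_const card_ffun !card_ord expn0.
Qed.

Variables (As : gfield Ps 1) (mu : R).
Hypothesis mu_gt : -1 < mu.
Hypothesis xi_dec : decays ip As mu (fun b => xi (cone_gauge Phi b)).

(** By the decay, |xi|^2 |y|^2 is at most C^2 |y|^(2 (mu + 1)), and the exponent is positive because
    mu > -1. *)
Lemma unorm_decay d : 0 < d -> exists2 k, 0 < k &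
  forall y, cdom c y -> y != 0 -> sqd 0 y <= k -> unorm ip xi (cpar c y) * sqd 0 y <= d.
Proof.
move=> d0; have [C [delta [delta0 h]]] := xi_dec 0.
have e0 : 0 < mu + 1 by rewrite -[X in _ + X]opprK subr_gt0.
(* Chosen so that C^2 t^2 <= d, the summand 1 covering C = 0; [rho] below then ensures |y|^(mu + 1)
   <= t. *)
pose t := Num.sqrt (d / (C ^+ 2 + 1)).
have C1 : 0 < C ^+ 2 + 1 by rewrite ltr_wpDl ?sqr_ge0.
have t0 : 0 < t by rewrite sqrtr_gt0 divr_gt0.
have t2 : C ^+ 2 * t ^+ 2 <= d.
  rewrite /t sqr_sqrtr; last by apply/ltW/divr_gt0.
  rewrite mulrA ler_pdivrMr //.
  by rewrite mulrC ler_pM2l ?lerDl.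
pose rho := Num.min (delta / 2) (t `^ (mu + 1)^-1).
have rho0 : 0 < rho by rewrite lt_min divr_gt0 // powR_gt0.
exists (rho ^+ 2); first by rewrite exprn_gt0.
move=> y cy y0 yk; have [b [bA bx cA]] := cone_gauge_at cy y0.
have r0 : 0 < enorm y by rewrite enorm_gt0.
have sE : sqd 0 y = enorm y ^+ 2 by rewrite /sqd subr0 enorm_sqr.
have yr : enorm y <= rho by rewrite -(@ler_pXn2r _ 2) ?nnegrE ?(ltW rho0) ?enorm_ge0 // -sE.
have cdy : cdom (gch (cone_gauge Phi b)) y by [].
have := unormE ipP sxi cA cdy => /= ->.
have yd : 0 < enorm y < delta.
  by rewrite r0 (le_lt_trans yr) // gt_min ltr_pdivrMr // ltr_pMr // ltr1n.
have := h b y bA yd bx; rewrite /= (tnorm0E _ (fun=> 0)) subr0 => tn.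
have n0 : 0 <= nsq (cone_gauge Phi b) ip xi y by exact: ip_ge0.
have n2 : nsq (cone_gauge Phi b) ip xi y <= (C * enorm y `^ mu) ^+ 2.
  rewrite -[X in X <= _]sqr_sqrtr //; apply: lerXn2r; rewrite ?nnegrE ?sqrtr_ge0 //.
  by apply: le_trans tn; exact: sqrtr_ge0.
rewrite sE; apply: le_trans (_ : (C * enorm y `^ mu) ^+ 2 * enorm y ^+ 2 <= d).
  by rewrite ler_wpM2r // sqr_ge0.
have -> : (C * enorm y `^ mu) ^+ 2 * enorm y ^+ 2 = C ^+ 2 * (enorm y `^ (mu + 1)) ^+ 2.
  rewrite powRD ?(lt0r_neq0 r0) ?implybT // powRr1 ?(ltW r0) //; ring.
apply: le_trans t2; rewrite ler_wpM2l ?sqr_ge0 //; apply: lerXn2r; rewrite ?nnegrE ?powR_ge0 ?(ltW t0) //.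
have yt : enorm y <= t `^ (mu + 1)^-1 by move: yr; rewrite le_min => /andP[].
have := @ge0_ler_powR R (mu + 1) (ltW e0) (enorm y) (t `^ (mu + 1)^-1).
rewrite !nnegrE enorm_ge0 powR_ge0 => /(_ isT isT yt).
by rewrite -powRrM mulVf ?lt0r_neq0 // powRr1 ?(ltW t0).
Qed.

Hypothesis Phi_coord : su3_coordinates (A := A) sg c s.
Hypothesis Xs : ~ X s.

Lemma singular_max C : clopenX (X := X) C -> exists N : set Z, [/\ open N, N s &
  (exists2 z, C z & N z) ->
    exists2 p, C p & forall z, C z -> N z -> unorm ip xi z <= unorm ip xi p].
Proof.
move=> [CX oC oXC]; have [cA [[r r0 cE] [c0 _]]] := Phi_coord.
have [oU ck _ _] := cA.
have U0 : cdom c 0 by rewrite cE /= /enorm /dotv big1 ?sqrtr0 // => i _; rewrite mxE mul0r.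
pose V := cdom c `&` offc 0; pose u y := unorm ip xi (cpar c y).
have VX y : V y -> X (cpar c y).
  move=> [cy y0]; have [b [bA bx cgA]] := cone_gauge_at cy y0.
  by apply: (gauge_in cgA); exists y.
have loc y : V y -> exists b : gauge R 6 Z P, [/\ adm_gauge b, cdom (gch b) y,
    cdom (gch b) `<=` cdom c, forall z, cdom (gch b) z -> u z = nsq b ip xi z &
    forall z, cdom (gch b) z -> Gm sg (gch b) z = Gm sg c z].
  move=> [cy y0]; have [b [bA bx cgA]] := cone_gauge_at cy y0.
  have sub : cdom (gch (cone_gauge Phi b)) `<=` cdom c by move=> z [].
  exists (cone_gauge Phi b); split => //.
    by move=> z cz; exact: (unormE ipP sxi cgA cz).
  by move=> z cz; exact: (Gm_subchart sgS cA (gauge_adm cgA) erefl sub cz).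
have Cg i j : Ck 1 (cdom c) (fun y => Gm sg c y i j) by exact: (Gm_Ck sgS cA 1%N i j).
have Cu : Ck 2 V u.
  apply: Ck_local => y Vy; have [b [bA yb _ ub _]] := loc y Vy.
  exists (cdom (gch b)); split => //; first exact: gauge_open.
  apply: Ck_eq (nsq_Ck ipP sxi 2 bA); first exact: gauge_open.
  by move=> z; rewrite inE => zb; rewrite ub.
have su : subsol (Gm sg c) V u.
  move=> y f Vy fU gf; have [b [bA yb _ ub gb]] := loc y Vy.
  have -> : Lop (Gm sg c) u y = Lop (Gm sg (gch b)) (nsq b ip xi) y.
    apply: (Lop_eq (gauge_open bA) yb) => z zb; last exact: ub.
    by rewrite gb.
  by apply: (subsol_gauge ipP sB sxi lap bA yb fU); rewrite gb.
pose C' := V `&` cpar c @^-1` C.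
have CE Q : V `&` cpar c @^-1` Q = offc 0 `&` (cdom c `&` cpar c @^-1` Q).
  by rewrite /V setIA [offc 0 `&` cdom c]setIC.
have oC' Q : open Q -> open (V `&` cpar c @^-1` Q).
  move=> oQ; rewrite CE; apply: openI; first exact: offc_open.
  exact: (cpar_preim AZ cA).
have CV : C' `<=` V by move=> y [].
have oVC : open (V `\` C').
  rewrite (_ : V `\` C' = V `&` cpar c @^-1` (X `\` C)); first exact: oC'.
  apply/seteqP; split => y [Vy h]; split => //; first by split; [exact: VX|move=> Cy; apply: h].
  by move=> [_ Cy]; have [_ nC] : (X `\` C) (cpar c y) := h; exact: nC.
have dec d : 0 < d -> exists2 k, 0 < k & forall y, y != 0 -> sqd 0 y <= k -> u y * sqd 0 y <= d.
  move=> d0; have [k k0 kP] := unorm_decay d0.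
  have [k' k'0 k'P] := near_sqd (near_open oU U0).
  exists (Num.min k k'); first by rewrite lt_min k0.
  by move=> y y0; rewrite le_min => /andP[yk yk']; apply: kP => //; exact: k'P.
have [s0 s00 [sU smax]] := sphere_max oU Cg (Gm_elliptic sgS cA) U0 (Gm_flat sgS Phi_coord)
  Cu su dec (oC' C oC) CV oVC.
exists (cpar c @` [set y | sqd 0 y < s0]); split.
- by apply: (cpar_open AZ cA); [exact: sqd_lt_open|move=> y /= h; apply: sU; exact: ltW].
- by exists 0 => //=; rewrite sqd_self.
have NC z : C z -> (cpar c @` [set y | sqd 0 y < s0]) z ->
    exists y, [/\ C' y, sqd 0 y <= s0 & cpar c y = z].
  move=> Cz [y ys e]; exists y; split => //; last exact: ltW.
  split; last by rewrite /= e.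
  split; first by apply: sU; exact: ltW.
  by apply/eqP => y0; apply: Xs; rewrite -c0 -y0 e; exact: CX.
move=> [z Cz Nz]; have [y [Cy ys _]] := NC z Cz Nz.
have [p [_ Cp] pmax] := smax (ex_intro2 _ _ y Cy ys).
exists (cpar c p) => // z' Cz' Nz'.
by have [y' [Cy' ys' <-]] := NC z' Cz' Nz'; exact: pmax.
Qed.

End Singular.

(** * Decay conditions *)

Section EuclideanNorm.
Context {R : realType}.
Local Notation E := 'rV[R]_6.

Lemma is_derive_sqrt (F : normedModType R) (g : F -> R) x v : (forall y, 0 <= g y) -> 0 < g x ->
  {for x, continuous g} -> derivable g x v ->
  is_derive x v (fun y => Num.sqrt (g y)) ('D_v g x * (2 * Num.sqrt (g x))^-1).
Proof.
move=> g0 gx cg dg; have sx : 0 < Num.sqrt (g x) by rewrite sqrtr_gt0.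
have H : (fun h => h^-1 *: (((fun y => Num.sqrt (g y)) \o shift x) (h *: v) - Num.sqrt (g x))) @ 0^'
    --> 'D_v g x * (2 * Num.sqrt (g x))^-1.
  (* Rationalizing the difference quotient of the square root reduces it to that of [g]. *)
  have e : (fun h => h^-1 *: (((fun y => Num.sqrt (g y)) \o shift x) (h *: v) - Num.sqrt (g x))) =
     (fun h => (h^-1 *: ((g \o shift x) (h *: v) - g x)) *
               (Num.sqrt (g (h *: v + x)) + Num.sqrt (g x))^-1).
    apply/funext => h /=; set a := g (h *: v + x); set b := g x.
    rewrite /GRing.scale /= -mulrA; congr (_ * _).
    have s0 : Num.sqrt a + Num.sqrt b != 0.
      by rewrite lt0r_neq0 // ltr_wpDl // sqrtr_ge0.
    apply: (mulIf s0); rewrite mulfVK //.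
    have ea : a = Num.sqrt a ^+ 2 by rewrite sqr_sqrtr // g0.
    have eb : b = Num.sqrt b ^+ 2 by rewrite sqr_sqrtr // g0.
    by rewrite [X in _ = X - _]ea [X in _ = _ - X]eb; ring.
  rewrite e; apply: cvgM; first exact: dg.
  apply: cvgV; first by rewrite mulf_neq0 ?pnatr_eq0 // lt0r_neq0.
  rewrite mulr_natl mulr2n; apply: cvgD; last exact: cvg_cst.
  have Hl : (h *: v + x) @[h --> (0 : R)^'] --> x.
    rewrite -[X in _ --> X]add0r -[X in _ --> X + _](scale0r v).
    by apply: cvgD; [apply: cvgZ; [exact: cvg_within|exact: cvg_cst]|exact: cvg_cst].
  exact: (cvg_comp _ _ (cvg_comp _ _ Hl cg) (@sqrt_continuous R (g x))).
by split; [apply/cvg_ex; eexists; exact: H|exact: cvg_lim H].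
Qed.

Lemma enormE (x : E) : enorm x = Num.sqrt (sqd 0 x).
Proof. by rewrite /enorm /sqd subr0. Qed.

Lemma is_derive_enorm (x v : E) : x != 0 ->
  is_derive x v (@enorm R 6) (dotv x v * (enorm x)^-1).
Proof.
move=> x0; have s0 := sqd_gt0 x0; have D := is_derive_sqd 0 x v.
have H := is_derive_sqrt (sqd_ge0 0) s0 (@sqd_cont R 0 x) (@ex_derive _ _ _ _ _ _ _ D).
rewrite (_ : @enorm R 6 = (fun y => Num.sqrt (sqd 0 y))); last by apply/funext => y; exact: enormE.
rewrite (_ : dotv x v * _ = 'D_v (sqd 0) x * (2 * Num.sqrt (sqd 0 x))^-1) //.
have -> : 'D_v (sqd 0) x = 2 * dotv (x - 0) v by case: D.
by rewrite subr0 -/(enorm x) invfM; field; rewrite sqrtr_eq0 -ltNge.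
Qed.

(** The derivative <x, v> / |x| involves only the norm itself, which drives the induction on k. *)
Lemma Ck_enorm k : Ck k (offc (0 : E)) (@enorm R 6).
Proof.
have oU := @offc_open R 0.
have c0 (x : E) : {for x, continuous (@enorm R 6)}.
  rewrite (_ : @enorm R 6 = (fun y => Num.sqrt (sqd 0 y))); last by apply/funext => y; exact: enormE.
  by apply: (@continuous_comp _ _ _ (sqd 0) Num.sqrt); [exact: sqd_cont|exact: sqrt_continuous].
elim: k => [|k IH]; first by split.
split=> // v; split; first by move=> x x0; have [] := is_derive_enorm v x0.
apply: (@Ck_eq _ _ _ _ _ (fun x : E => dotv x v * (enorm x)^-1)) => //.
  by move=> x; rewrite inE => x0; have [_ ->] := is_derive_enorm v x0.
apply: (Ck_mul oU).
  apply: Ck_sum; first exact: oU.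
  by move=> i _; apply: (Ck_mul oU); [exact: Ck_coord|exact: Ck_cst].
by apply: (Ck_inv oU) => // x x0; rewrite lt0r_neq0 // enorm_gt0.
Qed.

Lemma radproj_Ck k : Ck k (offc (0 : E)) (@radproj R 6).
Proof.
have oU := @offc_open R 0; apply: (Ck_scalev oU).
  by apply: (Ck_inv oU); [move=> x x0; rewrite lt0r_neq0 // enorm_gt0|exact: Ck_enorm].
by apply/(Ck_mxP _ _ oU) => i j; exact: Ck_coord.
Qed.

End EuclideanNorm.

(** * Coordinates of the sphere along radial projection *)

Section Stereographic.
Context {R : realType}.
Local Notation E := 'rV[R]_6.
Variable e : R.
Hypothesis e2 : e * e = 1.

Lemma row5_max (u : 'rV[R]_5) (w : 'rV[R]_1) : (row_mx u w : 'rV[R]_(5 + 1)) 0 ord_max = w 0 0.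
Proof. by rewrite (_ : ord_max = rshift 5 (ord0 : 'I_1)) ?row_mxEr //; apply/val_inj. Qed.

Lemma stereo_den (u : 'rV[R]_5) : 1 - e * cpar (stereo e) u 0 ord_max = 2 / (dotv u u + 1).
Proof.
have t0 : 0 < dotv u u + 1 by rewrite ltr_wpDl // dotv_ge0.
rewrite /= row5_max mxE !mulrA e2 mul1r; field; exact: lt0r_neq0.
Qed.

Lemma dotv_split (p : 'rV[R]_(5 + 1)) :
  dotv p p = dotv (lsubmx p) (lsubmx p) + p 0 ord_max * p 0 ord_max.
Proof.
rewrite /dotv big_split_ord big_ord1; congr (_ + _).
  by apply: eq_bigr => i _; rewrite !mxE.
by congr (p 0 _ * p 0 _); apply/val_inj.
Qed.

Lemma stereo_cimg (p : E) : dotv p p = 1 -> 1 - e * p 0 ord_max != 0 ->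
  cpar (stereo e) (ccoo (stereo e) p) = p.
Proof.
move=> p1 d0; have := dotv_split p; rewrite p1 => ps.
set l := lsubmx _ in ps *; set z := p 0 ord_max in ps d0 *.
have -> : ccoo (stereo e) p = (1 - e * z)^-1 *: l by [].
set u := _ *: l.
have uu : dotv u u = (1 + e * z) / (1 - e * z).
  rewrite /u dotvZ dotvC dotvZ.
  have -> : dotv l l = (1 - e * z) * (1 + e * z).
    have -> : dotv l l = 1 - z * z by rewrite ps addrK.
    transitivity (1 - e * e * (z * z)); last by ring.
    by rewrite e2 mul1r.
  field; exact: d0.
have u1 : dotv u u + 1 = 2 / (1 - e * z) by rewrite uu; field.
have um : dotv u u - 1 = 2 * (e * z) / (1 - e * z) by rewrite uu; field.
have a1 : 2 / (dotv u u + 1) = 1 - e * z by rewrite u1; field; rewrite d0.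
have b1 : e * (dotv u u - 1) / (dotv u u + 1) = z.
  rewrite um u1; transitivity (e * e * z); last by rewrite e2 mul1r.
  by field; rewrite d0.
have -> : cpar (stereo e) u = row_mx ((2 / (dotv u u + 1)) *: u)
            (const_mx (e * (dotv u u - 1) / (dotv u u + 1)) : 'rV[R]_1) by [].
have -> : const_mx (e * (dotv u u - 1) / (dotv u u + 1)) = rsubmx (p : 'rV[R]_(5 + 1)).
  by apply/matrixP => i j; rewrite b1 !mxE /z !ord1; congr (p _ _); apply/val_inj.
rewrite a1 /u scalerA mulfV // scale1r; exact: (@hsubmxK _ 1 5 1 p).
Qed.

End Stereographic.

Section SphereCoordinates.
Context {R : realType}.
Local Notation E := 'rV[R]_6.
Variable c : chart R 5 E.
Hypothesis cA : admissible (S5_atlas R) c.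

Definition cone_dom : set E := [set x | x != 0 /\ cimg c (radproj x)].
Local Notation q := (fun x : E => ccoo c (radproj x)).

(** An admissible chart is related only to the two stereographic ones, so its coordinate is factored
    through one of these, where an explicit formula is available. *)
Lemma sphere_coord_local x : cone_dom x -> exists O : set E,
  [/\ open O, O x, O `<=` cone_dom & forall k, Ck k O q].
Proof.
move=> [x0 cx]; have [oc ck cov ad] := cA; have o0 := @offc_open R 0.
have [d Ad dx] := cov _ cx.
have [e e2 dE] : exists2 e : R, e * e = 1 & d = stereo e.
  by case: Ad => ->; [exists 1; rewrite ?mulr1|exists (-1); rewrite ?mulrNN ?mulr1].
have rC j k : Ck k (offc 0) (fun y : E => radproj y 0 j).
  exact: ((Ck_mxP k _ o0).1 (radproj_Ck k) 0 j).
(* This denominator vanishes exactly where the radial projection is the pole of the stereographic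
   chart. *)
pose den (y : E) := 1 - e * radproj y 0 ord_max.
have denC k : Ck k (offc 0) den.
  apply: (Ck_add o0); first exact: Ck_cst.
  by apply: (Ck_opp o0); apply: (Ck_mul o0); [exact: Ck_cst|exact: rC].
pose Q := offc 0 `&` den @^-1` [set t | t != 0].
have oQ : open Q.
  apply: open_preim => // y y0; exact: (Ck_cont (denC 0%N)).
have Q0 : Q `<=` offc 0 by move=> y [].
have dom1 (y : E) : y != 0 -> dotv (radproj y) (radproj y) = 1.
  by move=> y0; rewrite -enorm_sqr (radproj_S5 y0) expr1n.
pose si (y : E) : 'rV[R]_5 := ccoo d (radproj y).
have siC k : Ck k Q si.
  have -> : si = (fun y => (den y)^-1 *: (lsubmx (radproj y : 'rV[R]_(5 + 1)) : 'rV[R]_5)).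
    by apply/funext => y; rewrite /si dE.
  apply: (Ck_scalev oQ).
    by apply: (Ck_inv oQ); [move=> y []|exact: (Ck_subset Q0)].
  apply/(Ck_mxP _ _ oQ) => i j.
  apply: (Ck_eq oQ _ (Ck_subset Q0 (rC (lshift 1 j) k))).
  by move=> y _; rewrite (ord1 i) [RHS]mxE.
have dsi y : Q y -> cpar d (si y) = radproj y.
  by move=> [y0 h]; rewrite /si dE; apply: (stereo_cimg e2) => //; exact: dom1.
have Qx : Q x.
  split => //; rewrite /= /den; case: dx => u _; rewrite dE => <-.
  rewrite stereo_den // mulf_neq0 ?pnatr_eq0 // invr_eq0 lt0r_neq0 //.
  by rewrite ltr_wpDl // dotv_ge0.
have [_ [oo ss]] := ad d Ad.
exists (Q `&` si @^-1` overlap d c).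
have oO : open (Q `&` si @^-1` overlap d c).
  by apply: open_preim => // y Qy; exact: (Ck_cont (siC 0%N)).
split => //.
- split => //; split; first by rewrite dE.
  by rewrite /= dsi.
- by move=> y [Qy [_ /=]]; rewrite dsi // => h; split => //; exact: (Q0 y Qy).
move=> k.
apply: (@Ck_eq _ _ _ _ _ (fun y => ctrans d c (si y))) => //.
  by move=> y; rewrite inE => -[Qy _]; rewrite /ctrans dsi.
apply: (Ck_comp oO oo _ _ (ss k)); first by move=> y [].
by apply: Ck_subset (siC k) => y [].
Qed.

Lemma cone_dom_open : open cone_dom.
Proof.
apply: open_local => x /sphere_coord_local[N [oN Nx NC _]].
by exists N.
Qed.

Lemma sphere_coord_Ck k : Ck k cone_dom q.
Proof.
apply: Ck_local => x /sphere_coord_local[N [oN Nx _ CN]].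
by exists N.
Qed.

End SphereCoordinates.

(** * Sums of decaying forms *)

Section CovariantDerivatives.
Context {R : realType} {m : nat} (G : lieGroup R m).
Local Notation E := 'rV[R]_6.
Local Notation V := 'rV[R]_m.
Variables (W : set E) (B : E -> kform 1 E (lie G)).
Hypothesis oW : open W.
Definition smooth_form l (al : E -> kform l E (lie G)) :=
  forall v, smooth_on W (fun x => al x v : V).
Hypothesis sB : smooth_form B.

Lemma nabla_smooth l (al : E -> kform l E (lie G)) : smooth_form al -> smooth_form (nabla B al).
Proof.
move=> sal v k; apply: (Ck_add oW).
  exact: (CkD _ (sal _ k.+1)).
exact: (Ck_bilin (brk_bilinear G) oW (sB _ k) (sal _ k)).
Qed.

Lemma nablak_smooth k l (al : E -> kform l E (lie G)) : smooth_form al -> smooth_form (nablak (k := k) B al).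
Proof. by move=> sal; elim: k => [|k IH] //; exact: nabla_smooth. Qed.

Lemma nabla_add l (al be ga : E -> kform l E (lie G)) : smooth_form al -> smooth_form be ->
  (forall x v, W x -> ga x v = (al x v : V) + be x v) ->
  forall x v, W x -> nabla B ga x v = (nabla B al x v : V) + nabla B be x v.
Proof.
move=> sal sbe gE x v Wx; have [_ b2] := brk_bilinear G; rewrite /nabla.
set w := fun j => v (lift ord0 j).
have da : derivable (fun y => al y w : V) x (v ord0) := Ck_der (sal w 1%N) Wx.
have db : derivable (fun y => be y w : V) x (v ord0) := Ck_der (sbe w 1%N) Wx.
have e1 : 'D_(v ord0) (fun y => ga y w : V) x =
    'D_(v ord0) (fun y => al y w : V) x + 'D_(v ord0) (fun y => be y w : V) x.
  apply: etrans (eq_derive (v ord0) oW (g := fun y => (al y w : V) + be y w) _ Wx) _.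
    by move=> y; rewrite inE; exact: gE.
  exact: deriveD.
have e2 : brk G (B x (fun=> v ord0)) (ga x w) =
    (brk G (B x (fun=> v ord0)) (al x w) : V) + brk G (B x (fun=> v ord0)) (be x w).
  have := b2 1 (B x (fun=> v ord0)) (al x w) (be x w).
  by rewrite !scale1r -gE.
by rewrite -[X in _ = _ + X]/(_ + _) [X in X + _]e1 e2 addrACA.
Qed.

Lemma nablak_add k l (al be ga : E -> kform l E (lie G)) : smooth_form al -> smooth_form be ->
  (forall x v, W x -> ga x v = (al x v : V) + be x v) ->
  forall x v, W x -> nablak (k := k) B ga x v = (nablak (k := k) B al x v : V) + nablak (k := k) B be x v.
Proof.
move=> sal sbe gE; elim: k => [|k IH] //.
by apply: nabla_add => //; exact: nablak_smooth.
Qed.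

Variable ip : lie G -> lie G -> R.
Hypothesis ipP : Ad_inner_product ip.

(** From |x + y|^2 <= 2 |x|^2 + 2 |y|^2; the constant 2 is harmless for decay rates and avoids the
    Cauchy-Schwarz inequality. *)
Lemma tnorm_add l (al be ga : kform l E (lie G)) : (forall v, ga v = (al v : V) + be v) ->
  tnorm ip ga <= 2 * (tnorm ip al + tnorm ip be).
Proof.
move=> gE; have [i1 i2] := ip_bilinear ipP.
have s0 (h : kform l E (lie G)) :
    0 <= \sum_(I : {ffun 'I_l -> 'I_6}) ip (h (fun i => evec (I i))) (h (fun i => evec (I i))).
  by apply: sumr_ge0 => I _; exact: ip_ge0.
have ipD (x y : V) : ip (x + y) (x + y) <= 2 * (ip x x + ip y y).
  have a := ip_ge0 ipP (x - y).
  have e1 u : ip (x + u) (x + u) = ip x x + 2 * ip x u + ip u u.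
    have h1 w : ip (x + u) w = ip x w + ip u w.
      by have := i1 1 x u w; rewrite !scale1r.
    have h2 w : ip w (x + u) = ip w x + ip w u.
      by have := i2 1 w x u; rewrite !scale1r.
    by rewrite h1 !h2 (ipC ipP u x); ring.
  have hN w : ip w (- y) = - ip w y := bilinNr (ip_bilinear ipP) w y.
  move: a; rewrite !e1 !hN (ipC ipP (- y)) hN.
  lra.
have h : \sum_(I : {ffun 'I_l -> 'I_6}) ip (ga (fun i => evec (I i))) (ga (fun i => evec (I i))) <=
   2 * (tnorm ip al ^+ 2 + tnorm ip be ^+ 2).
  rewrite /tnorm !sqr_sqrtr // -big_split mulr_sumr; apply: ler_sum => I _ /=.
  by rewrite gE; exact: ipD.
have ta : 0 <= tnorm ip al := sqrtr_ge0 _; have tb : 0 <= tnorm ip be := sqrtr_ge0 _.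
have M0 : 0 <= 2 * (tnorm ip al + tnorm ip be) by rewrite mulr_ge0 // addr_ge0.
apply: le_trans (_ : Num.sqrt ((2 * (tnorm ip al + tnorm ip be)) ^+ 2) <= _).
  apply: ler_wsqrtr; apply: le_trans h _.
  have : 0 <= tnorm ip al * tnorm ip be by rewrite mulr_ge0.
  have := sqr_ge0 (tnorm ip al); have := sqr_ge0 (tnorm ip be).
  nra.
by rewrite sqrtr_sqr ger0_norm.
Qed.

End CovariantDerivatives.

Section ConeDecay.
Context {R : realType} {m : nat} {G : lieGroup R m} {Z : Type}.
Context {A : set (chart R 6 Z)} {X : set Z} (P : pbundle G A X).
Local Notation E := 'rV[R]_6.
Local Notation V := 'rV[R]_m.
Variables (Ps : pbundle G (S5_atlas R) (S5 R)) (Phi : framing Ps P) (As : gfield Ps 1).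
Hypothesis sAs : smooth_gfield As.
Variable ip : lie G -> lie G -> R.
Hypothesis ipP : Ad_inner_product ip.

Lemma pr_conn_smooth b : adm_gauge b -> smooth_form (cone_dom (gch b)) (pr_conn As b).
Proof.
move=> bA v k; have cA : admissible (S5_atlas R) (gch b) by have [] := bA.
have [oc _ _ _] := cA; have oW := cone_dom_open cA.
pose q (x : E) := ccoo (gch b) (radproj x).
have qd x : cone_dom (gch b) x -> cdom (gch b) (q x).
  by move=> [_ cx]; have [] := adm_ccoo cA cx.
have [fAs cAs] := sAs bA.
apply: (@Ck_eq _ _ _ _ _ (fun x => \sum_(j < 5) ('D_(v ord0) q x) 0 j *: (As b (q x) (fun=> evec j) : V))) => //.
  move=> x; rewrite inE => Wx; rewrite /pr_conn /pullf.
  have -> : (fun i => 'D_(v i) q x) = (fun=> 'D_(v ord0) q x) by apply/funext => i; rewrite ord1.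
  have l a u w : As b (q x) (fun=> a *: u + w) =
      a *: (As b (q x) (fun=> u) : V) + As b (q x) (fun=> w).
    exact: is_form1_linear (fAs _ (qd x Wx)).
  exact/esym/(linear_expand l).
apply: (@Ck_sum _ _ _ k _ _ _ xpredT
  (fun j x => ('D_(v ord0) q x) 0 j *: (As b (q x) (fun=> evec j) : V)) oW) => j _.
apply: (Ck_scalev oW).
  exact: ((Ck_mxP k _ oW).1 (CkD (v ord0) (sphere_coord_Ck cA k.+1)) 0 j).
exact: (Ck_comp oW oc qd (sphere_coord_Ck cA k) (cAs (fun=> evec j) k)).
Qed.

Local Notation W b := (cdom (gch (cone_gauge Phi b))).

(** Smoothness is needed to distribute the iterated derivatives over the sum, and it is known only
    over the ball of the framing; hence [r] also limits the radius. *)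
Lemma decays_add mu r l (al be ga : gauge R 5 E Ps -> E -> kform l E (lie G)) :
  0 < r -> cdom (frch Phi) = [set x | enorm x < r] -> bundle_iso Phi ->
  (forall b, adm_gauge b -> smooth_form (W b) (al b)) ->
  (forall b, adm_gauge b -> smooth_form (W b) (be b)) ->
  (forall b x v, adm_gauge b -> W b x -> ga b x v = (al b x v : V) + be b x v) ->
  decays ip As mu al -> decays ip As mu be -> decays ip As mu ga.
Proof.
move=> r0 cE [_ iso] sal sbe gE dal dbe k.
have [C1 [d1 [d10 h1]]] := dal k; have [C2 [d2 [d20 h2]]] := dbe k.
exists (2 * (C1 + C2)), (Num.min r (Num.min d1 d2)); split; first by rewrite !lt_min r0 d10.
move=> b x bA; rewrite !lt_min => /andP[x0 /andP[xr /andP[x1 x2]]] bx.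
have oW : open (W b) by have [[]] := iso b bA.
have Wx : W b x by split => //; [rewrite cE|rewrite -enorm_gt0].
have sB : smooth_form (W b) (pr_conn As b).
  by move=> v j; apply: Ck_subset (pr_conn_smooth bA v j) => y [].
have nE v := nablak_add (k := k) oW sB (sal b bA) (sbe b bA) (fun y w Wy => gE b y w bA Wy) v Wx.
apply: le_trans (tnorm_add ipP (nE)) _.
rewrite -mulrA ler_pM2l // mulrDl.
by apply: lerD; [apply: h1|apply: h2] => //; rewrite x0.
Qed.

End ConeDecay.

Section ZeroSection.
Context {R : realType} {m : nat} {G : lieGroup R m}.
Local Notation V := 'rV[R]_m.

Definition zerog n (T : Type) (A : set (chart R n T)) (X : set T) (P : pbundle G A X) l :
  gfield P l := fun _ _ _ => (0 : V).
Arguments zerog {n T A X} P l.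

Lemma adform_zero n T A X (P : @pbundle R m G n T A X) l : adform (zerog P l).
Proof.
split=> [b bA|b b' x v bA b'A ov]; last by rewrite /zerog /pullf Ad0.
split=> [x _|v k]; last exact: Ck_cst.
by split => // *; rewrite /zerog scaler0 addr0.
Qed.

Lemma nablak_zero (B : 'rV[R]_6 -> kform 1 'rV[R]_6 (lie G)) k l x v :
  nablak (k := k) B (fun _ (_ : 'I_l -> 'rV[R]_6) => (0 : V)) x v = 0.
Proof.
elim: k x v => [|k IH] x v //=; rewrite /nabla IH.
have -> : brk G (B x (fun=> v ord0)) 0 = 0 by exact: (bilin0r (brk_bilinear G)).
rewrite addr0.
rewrite (_ : (fun y => _) = fun=> (0 : V)); first exact: derive_cst.
by apply/funext => y; rewrite IH.
Qed.

Lemma decays_zero (Ps : pbundle G (S5_atlas R) (S5 R)) (As : gfield Ps 1) ip mu l :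
  Ad_inner_product ip ->
  decays ip As mu (fun _ _ (_ : 'I_l -> 'rV[R]_6) => (0 : V)).
Proof.
move=> ipP k; exists 0, 1; split => // b x _ _ _; rewrite mul0r /tnorm big1 ?sqrtr0 // => I _.
rewrite nablak_zero; exact: (bilin0r (ip_bilinear ipP)).
Qed.

Lemma dcov_zero (Z : Type) (A : set (chart R 6 Z)) X (P : pbundle G A X) (B : gfield P 1) b x v :
  dcov B (zerog P 0) b x v = 0.
Proof.
rewrite (fun_ord1 v) dcovE.
have -> : brk G (B b x (fun=> v ord0)) (sec b (zerog P 0) x) = 0.
  exact: (bilin0r (brk_bilinear G)).
by rewrite addr0; exact: derive_cst.
Qed.

End ZeroSection.
Arguments zerog {R m G n T A X} P l.

Section StarCurvature.
Context {R : realType} {m : nat} {G : lieGroup R m} {Z : Type}.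
Context {A : set (chart R 6 Z)} {X : set Z} (P : pbundle G A X).
Variable sg : su3 R Z.
Hypothesis sgS : su3_structure sg A.
Variable B : gfield P 1.
Hypothesis sB : smooth_gfield B.

Lemma starf0 (f : 'M[R]_(5 + 1)) (V : lmodType R) (al : kform 5 'rV[R]_(5 + 1) V) v :
  (forall w, al w = 0) -> starf (k := 5) (l := 1) f al v = 0.
Proof. by move=> a0; rewrite /starf /star0 big1 ?scaler0 // => I _; rewrite a0 scaler0. Qed.

Lemma star_curv_ImOm_eq0 : gzero (star_curv_ImOm sg B) <-> gzero (curv_ImOm sg B).
Proof.
split=> h b x v bA Ux; last by apply: starf0 => w; exact: h.
have cA := gauge_adm bA; have [fU _ _] := frame_spec sgS cA Ux.
have bF := curv_bilin bA sB Ux; have tI := is_form_trilin (im_form sgS cA Ux).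
apply: (Yvec_eq0_wedger23 bF tI) => l; set f := frame sg (gch b) x in fU.
have := h b x (fun=> l *m (f^T *m f)) bA Ux.
rewrite /star_curv_ImOm /curv_ImOm (starf_wedger23 _ fU bF tI).
have -> : l *m (f^T *m f) *m (invmx f *m (invmx f)^T) = l.
  by rewrite !mulmxA mulmxK // -mulmxA trK' // mulmx1.
by move/eqP; rewrite scaler_eq0 (negbTE (detf0 fU)) /= => /eqP.
Qed.

End StarCurvature.

Section SumConnection.
Context {R : realType} {m : nat} {G : lieGroup R m} {n : nat} {T : Type}.
Context {A : set (chart R n T)} {X : set T} (P : pbundle G A X).
Local Notation V := 'rV[R]_m.

Lemma connection_add (B eta : gfield P 1) : connection B -> adform eta -> connection (addg B eta).
Proof.
move=> [sB tB] [se te]; split=> [b bA|b b' x v bA b'A ov].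
  have [fB cB] := sB b bA; have [fe ce] := se b bA.
  have oc : open (cdom (gch b)) by have [[]] := bA.
  split=> [x Ux|v k]; last by apply: (Ck_add oc); [exact: cB|exact: ce].
  have [l1 a1] := fB x Ux; have [l2 a2] := fe x Ux.
  split=> [v i a u w|v i j ij vij]; rewrite /addg; last first.
    by rewrite (a1 v i j ij vij) (a2 v i j ij vij) addr0.
  by rewrite l1 l2 addrACA -scalerDr.
rewrite /addg (tB b b' x v bA b'A ov) (te b b' x v bA b'A ov) /pullf.
by rewrite addrAC -AdD.
Qed.

End SumConnection.

Theorem proposition2p23
  (R : realType)
  (* the compact Lie group G with an Ad-invariant inner product *)
  (m : nat) (G : lieGroup R m) (G_compact : compact [set: G])
  (ip : lie G -> lie G -> R)
  (ip_inner : Ad_inner_product ip)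
  (* the compact manifold Z with its SU(3)-structure *)
  (Z : topologicalType) (AZ : set (chart R 6 Z))
  (Z_manifold : is_manifold AZ) (Z_compact : compact [set: Z])
  (sg : su3 R Z) (sg_su3 : su3_structure sg AZ)
  (d_star_omega : forall c x v, admissible AZ c -> cdom c x ->
     codiff2 sg c (om sg c) x v = 0)
  (w1 : R[i])
  (d_Omega : forall c x v, admissible AZ c -> cdom c x ->
     Complex (dext (reform (Om sg c)) x v) (dext (imform (Om sg c)) x v)
     = w1 * real_complex R (wedgef (V3 := R) *%R (om sg c x) (om sg c x) v))
  (* the singular set and the bundle *)
  (S : set Z) (S_finite : finite_set S)
  (P : pbundle G AZ (~` S))
  (* the rates and the model connections on S^5 *)
  (mu : Z -> R) (mu_range : forall s, S s -> -1 < mu s < 0)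
  (Ps : Z -> pbundle G (S5_atlas R) (S5 R))
  (As : forall s, gfield (Ps s) 1)
  (As_connection : forall s, S s -> connection (As s))
  (theta : S5form 1) (om1 om2 om3 : S5form 2)
  (S5_data : S5_forms theta om1 om2 om3)
  (As_instanton : forall s, S s -> forall b x, adm_gauge b -> cdom (gch b) x ->
     forall v : 'I_4 -> 'rV[R]_5,
       [/\ wedger (curv (As s) b x) (om1 (gch b) x) v = 0,
           wedger (curv (As s) b x) (om2 (gch b) x) v = 0 &
           wedger (curv (As s) b x) (om3 (gch b) x) v = 0])
  (* the conically singular connection A and any set of framings of it *)
  (A : gfield P 1) (A_cs : conically_singular ip sg S mu As A)
  (Phi : forall s, framing (Ps s) P)
  (Phi_framing : forall s, S s -> is_framing ip sg (As s) (mu s) s A (Phi s))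
  (a : gfield P 1) (a_mu : Omega_mu ip S mu As Phi a) :
  let Aa := addg A a in
  let system (xi1 xi2 : gfield P 0) :=
    [/\ Lambda_flat sg Aa,
        gzero (addg (addg (star_curv_ImOm sg Aa) (dcov Aa xi1))
                    (Jpull sg (dcov Aa xi2))) &
        gzero (codcov sg A a)] in
  ([/\ conically_singular ip sg S mu As Aa,
       su3_instanton sg Aa & gzero (codcov sg A a)]
   <->
   exists xi1 xi2 : gfield P 0,
     [/\ Omega_mu ip S mu As Phi xi1, Omega_mu ip S mu As Phi xi2 &
         system xi1 xi2])
  /\
  (forall xi1 xi2 : gfield P 0,
     Omega_mu ip S mu As Phi xi1 -> Omega_mu ip S mu As Phi xi2 ->
     system xi1 xi2 ->
     gzero (dcov Aa xi1) /\ gzero (dcov Aa xi2)).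

Proof.
move=> Aa system.
have [a_ad a_dec] := a_mu; have cAa : connection Aa := connection_add A_cs.1 a_ad.
have sAa : smooth_gfield Aa := cAa.1.
(* The last claim of the theorem, proved first because the backward implication needs it to remove
   the two gradients from the equation. *)
have vanish (xi1 xi2 : gfield P 0) : Omega_mu ip S mu As Phi xi1 -> Omega_mu ip S mu As Phi xi2 ->
    system xi1 xi2 -> gzero (dcov Aa xi1) /\ gzero (dcov Aa xi2).
  move=> [ad1 dec1] [ad2 dec2] [flat sys _].
  have lap xi : xi = xi1 \/ xi = xi2 -> lap_identity sg ip Aa xi.
    move=> xiE b x bA Ux; have cA := gauge_adm bA.
    apply: etrans (lap_nsq bA sg_su3 (fun x v => d_star_omega (gch b) x v cA)
      (fun x v => d_Omega (gch b) x v cA) sAa ad1.1 ad2.1 (fun x => flat b x bA)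
      (fun x v => sys b x v bA) ip_inner Ux xiE) _.
    by congr (_ * _); apply: eq_bigr => i _; apply: eq_bigr => j _; rewrite !dcov_nab.
  have key xi : adform xi -> lap_identity sg ip Aa xi ->
      (forall s, S s -> decays ip (As s) (mu s) (fun b => xi (cone_gauge (Phi s) b))) ->
      gzero (dcov Aa xi).
    move=> ad lapx dec.
    apply: (dcov_gzero Z_manifold Z_compact sg_su3 ip_inner sAa ad lapx) => s nXs C cC.
    have Ss : S s by apply: contrapT.
    have [coord iso _] := Phi_framing s Ss; have /andP[mu1 _] := mu_range s Ss.
    exact: (singular_max Z_manifold sg_su3 ip_inner sAa ad lapx iso mu1 (dec s Ss) coord nXs cC).
  by split; [apply: key (lap _ (or_introl erefl)) dec1|apply: key (lap _ (or_intror erefl)) dec2].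
split; last exact: vanish.
split=> [[_ [flat inst] cod]|[xi1 [xi2 [W1 W2 sys]]]].
  have W0 : Omega_mu ip S mu As Phi (zerog P 0).
    by split; [exact: adform_zero|move=> s Ss; exact: decays_zero].
  (* An instanton solves the system with both sections equal to zero. *)
  exists (zerog P 0), (zerog P 0); split => //; split => //.
  have star0 := (star_curv_ImOm_eq0 sg_su3 sAa).2 inst.
  move=> b x v bA Ux; rewrite /addg /Jpull (star0 b x v bA Ux) !dcov_zero.
  by rewrite !addr0.
have [g1 g2] := vanish xi1 xi2 W1 W2 sys; have [flat eqn cod] := sys.
split=> //; last first.
  split=> //; apply/(star_curv_ImOm_eq0 sg_su3 sAa) => b x v bA Ux.
  have := eqn b x v bA Ux; rewrite /addg /Jpull (g1 b x v bA Ux) (g2 b x _ bA Ux).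
  by rewrite !addr0.
(* The framings of A also serve for A + a: the difference to the model connection changes by [a],
   which decays at the same rate. *)
split=> // s Ss; exists (Phi s); have [coord iso dA] := Phi_framing s Ss.
have [_ [[r r0 cE] _]] := coord.
split=> //; apply: (decays_add (proj1 (As_connection s Ss)) ip_inner r0 cE iso _ _ _ dA (a_dec s Ss)).
- move=> b bA v k; have cgA := iso.2 b bA; have oW := gauge_open cgA.
  have [_ sA] := A_cs.1.1 _ cgA.
  have pS : Ck k (cdom (gch (cone_gauge (Phi s) b))) (fun x => pr_conn (As s) b x v).
    by apply: Ck_subset (pr_conn_smooth (proj1 (As_connection s Ss)) bA v k) => y [].
  exact: (Ck_add oW (sA v k) (Ck_opp oW pS)).
- by move=> b bA v k; have [_ sa] := a_ad.1 _ (iso.2 b bA); exact: sa.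
by move=> b x v bA Wx; rewrite /Aa /addg addrAC.
Qed.
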